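(* Let $\Lambda_\alpha$ be the determinantal point process associated to the weight $\phi_\alpha(z)=|z|^\alpha$, $\alpha>0$ (that is, the determinantal process with kernel $K_{\phi_\alpha}$ and reference measure $\mu_{\phi_\alpha}$). Then $$\mathbb{P}\bigl(\Lambda_\alpha \text{ is separated}\bigr)=\begin{cases}1 & \text{if } \alpha<4/3,\\ 0 & \text{if } \alpha\ge 4/3.\end{cases}$$
   Context: $m$ is Lebesgue measure on $\mathbb{C}$ and $D(z,r)$ is the disk with center $z$ and radius $r$. For a subharmonic weight $\phi$ with doubling Laplacian $\nu=\Delta\phi$ (here $\phi=\phi_\alpha$, with $\Delta|z|^\alpha=\alpha^2|z|^{\alpha-2}$), $\rho(z)=\rho_\phi(z)$ denotes the positive radius such that $\nu(D(z,\rho(z)))=1$. The generalized Fock space $\mathcal{F}_\phi$ is the space of entire functions $f$ with $\|f\|_\phi^2:=\int_{\mathbb{C}}|f|^2\,d\mu_\phi<+\infty$, where $d\mu_\phi(z)=c_\phi e^{-2\phi(z)}\frac{dm(z)}{\rho^2(z)}$ and $c_\phi>0$ is the constant for which $\|1\|_\phi=1$. $\mathcal{F}_\phi$ is a reproducing kernel Hilbert space with kernel $K_\phi(z,\zeta)$ (holomorphic in $z$, antiholomorphic in $\zeta$): $f(z)=\int_{\mathbb{C}}f(\zeta)K_\phi(z,\zeta)\,d\mu_\phi(\zeta)$ for all $f\in\mathcal{F}_\phi$. The determinantal point process $\Lambda_\phi$ with kernel $K_\phi$ and reference measure $\mu_\phi$ is the simple point process in $\mathbb{C}$ such that for any disjoint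 Borel sets $B_1,\dots,B_n\subset\mathbb{C}$, $\mathbb{E}\bigl[\prod_{k=1}^n\#(B_k\cap\Lambda_\phi)\bigr]=\int_{B_1}\cdots\int_{B_n}\det\bigl(K_\phi(z_i,z_j)\bigr)_{1\le i,j\le n}\,d\mu_\phi(z_1)\cdots d\mu_\phi(z_n)$; $\Lambda_\alpha=\Lambda_{\phi_\alpha}$. A sequence $\{\lambda_k\}\subset\mathbb{C}$ is separated if $\inf_{j\ne k}|\lambda_k-\lambda_j|>0$. *)

(* Defs.v *)
From HB Require Import structures.
From mathcomp Require Import all_boot all_order all_algebra.
From mathcomp Require Import complex.
From mathcomp Require Import all_classical all_reals all_analysis.
From mathcomp Require Import measurable_realfun.

Set Implicit Arguments.
Unset Strict Implicit.
Unset Printing Implicit Defensive.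
Import Order.TTheory GRing.Theory Num.Theory.
Import numFieldNormedType.Exports.

Local Open Scope classical_set_scope.
Local Open Scope ring_scope.

(* [integral] takes the supremum over the simple functions below the integrand
   without asking for measurability, and this lower integral is already sigma
   additive in its domain: [density m w], the measure w dm, is a measure for
   every nonnegative w. *)
Section density.
Local Open Scope ereal_scope.
Context d (T : measurableType d) (R : realType).
Variables (m : {measure set T -> \bar R}) (w : T -> R).

Definition density (w0 : forall x, (0 <= w x)%R) (A : set T) : \bar R :=
  \int[m]_(x in A) (w x)%:E.

Hypothesis w0 : forall x, (0 <= w x)%R.
Local Notation dens := (density w0).

Import HBNNSimple.

Let dens_set0 : dens set0 = 0.
Proof. by rewrite /density integral_set0. Qed.

Let dens_ge0 A : 0 <= dens A.
Proof. by apply: integral_ge0 => x _; rewrite lee_fin. Qed.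

Let le_dens (A : set T) (h : {nnsfun T >-> R}) :
  (forall x, (h x <= (w \_ A) x)%R) -> sintegral m h <= dens A.
Proof.
move=> hw; rewrite /density integral_mkcond ge0_integralTE; last first.
  by move=> x; rewrite patchE; case: ifP => // _; rewrite lee_fin.
apply: ereal_sup_ubound; exists h => // x /=.
by have := hw x; rewrite !patchE; case: ifP => _; rewrite lee_fin.
Qed.

Let dens_le (A : set T) (y : \bar R) :
  (forall h : {nnsfun T >-> R}, (forall x, (h x <= (w \_ A) x)%R) ->
    sintegral m h <= y) -> dens A <= y.
Proof.
move=> hy; rewrite /density integral_mkcond ge0_integralTE; last first.
  by move=> x; rewrite patchE; case: ifP => // _; rewrite lee_fin.
apply: ge_ereal_sup => _ [h hw <-]; apply: hy => x.
by have := hw x; rewrite !patchE; case: ifP => _; rewrite lee_fin.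
Qed.

Let densS A B : A `<=` B -> dens A <= dens B.
Proof.
move=> AB; apply: dens_le => h hw; apply: le_dens => x.
apply: (le_trans (hw x)); rewrite !patchE.
case: ifPn => [/set_mem /AB /mem_set ->//|_].
by case: ifP.
Qed.

Let dens_superadditive A B : A `&` B = set0 ->
  dens A + dens B <= dens (A `|` B).
Proof.
move=> AB; have [->|yfin] := eqVneq (dens (A `|` B)) +oo; first by rewrite leey.
have {}yfin : dens (A `|` B) \is a fin_num.
  by rewrite ge0_fin_numE ?lt_neqAle ?yfin ?leey.
have Bfin : dens B \is a fin_num.
  rewrite ge0_fin_numE//; apply: (le_lt_trans (densS (@subsetUr _ A B))).
  by rewrite ltey_eq yfin.
rewrite -leeBrDr//; apply: dens_le => h1 h1w.
rewrite leeBrDl// -leeBrDr; last first.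
  rewrite ge0_fin_numE ?sintegral_ge0//.
  rewrite (le_lt_trans (le_dens h1w))// (le_lt_trans (densS (@subsetUl _ A B)))//.
  by rewrite ltey_eq yfin.
apply: dens_le => h2 h2w; rewrite leeBrDl; last first.
  rewrite ge0_fin_numE ?sintegral_ge0//.
  rewrite (le_lt_trans (le_dens h1w))// (le_lt_trans (densS (@subsetUl _ A B)))//.
  by rewrite ltey_eq yfin.
rewrite -sintegralD; apply: (@le_dens _ (add_nnsfun h1 h2)) => x /=.
have := h1w x; have := h2w x; rewrite !patchE in_setU.
have [xA|_] := boolP (x \in A); have [xB|_] := boolP (x \in B) => //= hB hA.
- have : (A `&` B) x by split; exact: set_mem.
  by rewrite AB.
- by rewrite -[leRHS]addr0 lerD.
- by rewrite -[leRHS]add0r lerD.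
- by rewrite -[leRHS]add0r lerD.
Qed.

Let dens_sigma_additive : semi_sigma_additive dens.
Proof.
move=> F mF tF _; apply: cvg_toP.
  by apply: ereal_nondecreasing_is_cvgn => k n kn; apply: lee_sum_nneg_natr.
apply/eqP; rewrite eq_le; apply/andP; split.
  apply: lime_le.
    by apply: ereal_nondecreasing_is_cvgn => k n kn; apply: lee_sum_nneg_natr.
  apply: nearW => n.
  suff : \sum_(0 <= i < n) dens (F i) <= dens (\big[setU/set0]_(i < n) F i).
    by move/le_trans; apply; apply: densS; exact: bigsetU_bigcup.
  elim: n => [|n ih]; first by rewrite big_geq.
  rewrite big_nat_recr//= big_ord_recr/=.
  apply: le_trans (dens_superadditive _); last first.
    by rewrite (@trivIset_bigsetUI _ xpredT)// => i j _ _; exact: tF.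
  exact: leeD.
apply: dens_le => h hw.
have -> : sintegral m h = \int[m]_(x in \bigcup_i F i) (h x)%:E.
  rewrite -integralT_nnsfun [RHS]integral_mkcond; apply: eq_integral => x _.
  rewrite patchE; case: ifPn => // xF; congr EFin; apply/eqP.
  by have := hw x; rewrite eq_le fun_ge0 patchE (negbTE xF) andbT.
rewrite ge0_integral_bigcup//; last 2 first.
- exact/measurable_EFinP/measurable_funTS.
- by move=> x _; rewrite lee_fin fun_ge0.
apply: lee_nneseries => [i _ _|i _].
  by apply: integral_ge0 => x _; rewrite lee_fin fun_ge0.
rewrite integral_nnsfun// (mrestrict _ (mF i)); apply: le_dens => x.
rewrite -mrestrict !patchE; case: ifPn => // xF.
have := hw x; rewrite patchE mem_set//.
by exists i => //; exact: set_mem.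
Qed.

HB.instance Definition _ := isMeasure.Build _ _ _
  dens dens_set0 dens_ge0 dens_sigma_additive.

End density.

HB.instance Definition _ (R : realType) := isPointed.Build R[i] 0.

(* The Borel sets of C, transported from R x R by z |-> (Re z, Im z). *)
HB.instance Definition _ (R : realType) := Measurable.copy R[i]
  (g_sigma_algebra_preimageType
    (fun z : R[i] => (complex.Re z, complex.Im z))).

Section complex_plane.
Variable R : realType.
Local Notation C := R[i].

Definition complex_of_pair (p : R * R) : C := Complex p.1 p.2.

Let measurable_complex_of_pair : measurable_fun [set: R * R] complex_of_pair.
Proof.
move=> _ A [B mB <-]; rewrite !setTI.
by rewrite (_ : _ @^-1` _ = B)//; apply/seteqP; split => -[x y].
Qed.

HB.instance Definition _ := isMeasurableFun.Build _ _ _ _ complex_of_pair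
  measurable_complex_of_pair.

Definition lebesgueC : set C -> \bar R :=
  pushforward (lebesgue_measure \x lebesgue_measure)%E complex_of_pair.

Let lebesgueC0 : lebesgueC set0 = 0%E.
Proof. exact: measure0. Qed.

Let lebesgueC_ge0 A : (0 <= lebesgueC A)%E.
Proof. exact: measure_ge0. Qed.

Let lebesgueC_sigma_additive : semi_sigma_additive lebesgueC.
Proof. exact: measure_semi_sigma_additive. Qed.

HB.instance Definition _ := isMeasure.Build _ _ _ lebesgueC
  lebesgueC0 lebesgueC_ge0 lebesgueC_sigma_additive.

Definition modulus (z : C) : R := complex.Re `|z|.

Definition disk (z : C) (r : R) : set C := [set w | modulus (w - z) < r].

(* [derivable] takes scalars in C here, so the limit of the difference quotients
   along 1 is the complex derivative. *)
Definition entire (f : C -> C) : Prop :=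
  forall z : C, derivable (f : C^o -> C^o) z 1.

Definition integralC (mu : {measure set C -> \bar R}) (f : C -> C) : C :=
  Complex (\int[mu]_z complex.Re (f z)) (\int[mu]_z complex.Im (f z)).

(* \int_{B_1} ... \int_{B_n} F [:: z_1; ...; z_n] dmu(z_n) ... dmu(z_1) *)
Fixpoint iterated_integral (mu : {measure set C -> \bar R}) (Bs : seq (set C))
    (F : seq C -> \bar R) : \bar R :=
  if Bs is B :: Bs' then
    (\int[mu]_(z in B) iterated_integral mu Bs' (fun zs => F (z :: zs)))%E
  else F [::].

Definition is_separated (L : set C) : Prop :=
  (0 < ereal_inf [set (modulus (p.1 - p.2))%:E |
    p in [set p : C * C | [/\ L p.1, L p.2 & p.1 <> p.2]]])%E.

End complex_plane.

Section fock_space.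
Variable R : realType.
Local Notation C := R[i].
Local Notation m := (@lebesgueC R).

(* nu stands for the Laplacian of the weight phi. *)
Variables (phi : C -> R) (nu : {measure set C -> \bar R}).

Definition rho (z : C) : R := get [set r | 0 < r /\ nu (disk z r) = 1%E].

Definition c_phi : R :=
  get [set c | 0 < c /\
    (\int[m]_z (c * expR (- 2 * phi z) / rho z ^+ 2)%:E = 1)%E].

Definition fock_density (z : C) : R :=
  c_phi * expR (- 2 * phi z) / rho z ^+ 2.

Lemma fock_density_ge0 z : 0 <= fock_density z.
Proof.
rewrite /fock_density divr_ge0 ?sqr_ge0// mulr_ge0 ?expR_ge0//.
by rewrite /c_phi; case: xgetP => [c _ [/ltW]|].
Qed.

Definition mu_phi : set C -> \bar R := density m fock_density_ge0.

HB.instance Definition _ := Measure.on mu_phi.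

Definition fock (f : C -> C) : Prop :=
  entire f /\ (\int[mu_phi]_z (modulus (f z) ^+ 2)%:E < +oo)%E.

(* Membership of the sections in the Fock space makes the kernel unique, by the
   Riesz representation theorem. *)
Definition fock_kernel (K : C -> C -> C) : Prop :=
  [/\ forall zeta, fock (fun z => K z zeta),
      forall z, fock (fun zeta => (K z zeta)^*%C) &
      forall f z, fock f ->
        f z = integralC mu_phi (fun zeta => f zeta * K z zeta)].

End fock_space.

Section determinantal_process.
Context d (Omega : measurableType d) (R : realType) (P : probability Omega R).
Local Notation C := R[i].

(* A simple point process is a random locally finite set of points. *)
Definition simple_point_process (Lambda : Omega -> set C) : Prop :=
  (forall w r, finite_set (Lambda w `&` disk 0 r)) /\
  (forall B : set C, measurable B ->
    measurable_fun [set: Omega]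
      (fun w => counting (B `&` Lambda w) : \bar R)).

(* [kernel_det K zs] is real and nonnegative for a positive semidefinite
   kernel K, so that taking the real part loses nothing. *)
Definition kernel_det (K : C -> C -> C) (zs : seq C) : R :=
  complex.Re (\det (\matrix_(i < size zs, j < size zs) K zs`_i zs`_j)).

Definition determinantal_process (K : C -> C -> C)
    (mu : {measure set C -> \bar R}) (Lambda : Omega -> set C) : Prop :=
  simple_point_process Lambda /\
  forall Bs : seq (set C),
    (forall k, (k < size Bs)%N -> measurable (nth set0 Bs k)) ->
    trivIset [set k | (k < size Bs)%N] (nth set0 Bs) ->
    (\int[P]_w \prod_(B <- Bs) counting (B `&` Lambda w) =
     iterated_integral mu Bs (fun zs => (kernel_det K zs)%:E))%E.

End determinantal_process.

Section power_weight.
Variables (R : realType) (alpha : R).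

Definition phi_alpha (z : R[i]) : R := modulus z `^ alpha.

Lemma laplacian_density_ge0 (z : R[i]) :
  0 <= alpha ^+ 2 * modulus z `^ (alpha - 2).
Proof. by rewrite mulr_ge0 ?sqr_ge0 ?powR_ge0. Qed.

(* The distributional Laplacian of |z|^alpha, for alpha > 0. *)
Definition laplacian_phi_alpha : set R[i] -> \bar R :=
  density (@lebesgueC R) laplacian_density_ge0.

HB.instance Definition _ := Measure.on laplacian_phi_alpha.

Definition mu_alpha : set R[i] -> \bar R :=
  mu_phi phi_alpha laplacian_phi_alpha.

HB.instance Definition _ := Measure.on mu_alpha.

Definition fock_kernel_alpha (K : R[i] -> R[i] -> R[i]) : Prop :=
  fock_kernel phi_alpha laplacian_phi_alpha K.

End power_weight.

(* Main.v *)
Require Import Defs.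
From HB Require Import structures.
From mathcomp Require Import all_boot all_order all_algebra.
From mathcomp Require Import complex finmap.
From mathcomp Require Import all_classical all_reals all_analysis.
From mathcomp Require Import measurable_realfun.
From mathcomp Require Import ring lra zify.
Import Order.TTheory GRing.Theory Num.Theory.
Import numFieldNormedType.Exports.

Set Implicit Arguments.
Unset Strict Implicit.
Unset Printing Implicit Defensive.

Local Open Scope classical_set_scope.
Local Open Scope ring_scope.



(** * Moduli and measurability in the complex plane *)

Section modulus_theory.
Variable R : realType.
Local Notation C := R[i].
Implicit Types z w : C.

Lemma modulusE z :
  modulus z = Num.sqrt (complex.Re z ^+ 2 + complex.Im z ^+ 2).
Proof. by rewrite /modulus normc_def. Qed.

Lemma normr_modulus z : `|z| = (modulus z)%:C%C.
Proof. by rewrite modulusE normc_def. Qed.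

Lemma modulus_sqr z : modulus z ^+ 2 = complex.Re z ^+ 2 + complex.Im z ^+ 2.
Proof. by rewrite modulusE sqr_sqrtr// addr_ge0// sqr_ge0. Qed.

Lemma modulus_ge0 z : 0 <= modulus z.
Proof. by rewrite modulusE sqrtr_ge0. Qed.

Lemma modulusM z w : modulus (z * w) = modulus z * modulus w.
Proof. by apply: complexI; rewrite rmorphM/= -!normr_modulus normrM. Qed.

Lemma modulusD z w : modulus (z + w) <= modulus z + modulus w.
Proof. by rewrite -lecR rmorphD/= -!normr_modulus ler_normD. Qed.

Lemma modulusN z : modulus (- z) = modulus z.
Proof. by apply: complexI; rewrite -!normr_modulus normrN. Qed.

Lemma modulusB z w : modulus (z - w) = modulus (w - z).
Proof. by rewrite -modulusN opprB. Qed.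

Lemma modulus_real (x : R) : modulus x%:C%C = `|x|.
Proof. by rewrite modulusE/= expr0n/= addr0 sqrtr_sqr. Qed.

Lemma modulus0 : modulus (0 : C) = 0.
Proof. by rewrite (modulus_real 0) normr0. Qed.

Lemma modulus1 : modulus (1 : C) = 1.
Proof. by rewrite (modulus_real 1) normr1. Qed.

Lemma modulusX z n : modulus (z ^+ n) = modulus z ^+ n.
Proof. by elim: n => [|n ih]; rewrite ?expr0 ?modulus1// !exprS modulusM ih. Qed.

Lemma modulus_eq0 z : (modulus z == 0) = (z == 0).
Proof. by rewrite -(inj_eq (@complexI R)) -normr_modulus normr_eq0. Qed.

Lemma modulus_gt0 z : (0 < modulus z) = (z != 0).
Proof. by rewrite lt_neqAle modulus_ge0 andbT eq_sym modulus_eq0. Qed.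

Lemma modulusV z : modulus z^-1 = (modulus z)^-1.
Proof.
by apply: complexI; rewrite (fmorphV (real_complex R)) -!normr_modulus normfV.
Qed.

Lemma modulusJ z : modulus z^*%C = modulus z.
Proof. by apply: complexI; rewrite -!normr_modulus normcJ. Qed.

Lemma le_Re_modulus z : `|complex.Re z| <= modulus z.
Proof. by rewrite -lecR -normr_modulus normc_ge_Re. Qed.

Lemma le_Im_modulus z : `|complex.Im z| <= modulus z.
Proof.
rewrite -(ler_pXn2r (ltn0Sn 1)) ?nnegrE ?modulus_ge0//.
by rewrite modulus_sqr real_normK ?num_real// lerDr sqr_ge0.
Qed.

Lemma le_modulus_ReIm z : modulus z <= `|complex.Re z| + `|complex.Im z|.
Proof.
rewrite -(ler_pXn2r (ltn0Sn 1)) ?nnegrE ?modulus_ge0 ?addr_ge0//.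
rewrite modulus_sqr sqrrD !real_normK ?num_real//.
by rewrite -addrA lerD2l lerDr mulrn_wge0// mulr_ge0.
Qed.

Lemma modulus_dist z w : `|modulus z - modulus w| <= modulus (z - w).
Proof.
have h (u v : C) : modulus u - modulus v <= modulus (u - v).
  by rewrite lerBlDr; have := modulusD (u - v) v; rewrite subrK.
by rewrite ler_norml lerNl opprB h modulusB h.
Qed.

Lemma mulJ z : z * z^*%C = (modulus z ^+ 2)%:C%C.
Proof. by rewrite rmorphXn/= -normr_modulus sqr_normc. Qed.

Lemma ReM z w : complex.Re (z * w) =
  complex.Re z * complex.Re w - complex.Im z * complex.Im w.
Proof. by case: z w => [a b] [c e]. Qed.

Lemma ImM z w : complex.Im (z * w) =
  complex.Re z * complex.Im w + complex.Im z * complex.Re w.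
Proof. by case: z w => [a b] [c e]. Qed.

Lemma ReD z w : complex.Re (z + w) = complex.Re z + complex.Re w.
Proof. by case: z w => [a b] [c e]. Qed.

Lemma ImD z w : complex.Im (z + w) = complex.Im z + complex.Im w.
Proof. by case: z w => [a b] [c e]. Qed.

Lemma ReB z w : complex.Re (z - w) = complex.Re z - complex.Re w.
Proof. by case: z w => [a b] [c e]. Qed.

Lemma ImB z w : complex.Im (z - w) = complex.Im z - complex.Im w.
Proof. by case: z w => [a b] [c e]. Qed.

Lemma ReJ z : complex.Re z^*%C = complex.Re z.
Proof. by case: z. Qed.

Lemma ImJ z : complex.Im z^*%C = - complex.Im z.
Proof. by case: z. Qed.

Lemma complex_eqP z w : complex.Re z = complex.Re w ->
  complex.Im z = complex.Im w -> z = w.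
Proof. by case: z w => [a b] [c e] /= -> ->. Qed.

End modulus_theory.

(** Continuity of a real function on the plane, spelled with the real-valued
    modulus: this avoids the complex-valued norm of the topology of the type of
    complex numbers. *)
Definition continuousC (R : realType) (f : R[i] -> R) : Prop :=
  forall z e, 0 < e -> exists2 d, 0 < d &
    forall w, modulus (w - z) < d -> `|f w - f z| < e.

Section plane_measurability.
Variable R : realType.
Local Notation C := R[i].

Lemma measurable_ReIm :
  measurable_fun [set: C] (fun z : C => (complex.Re z, complex.Im z)).
Proof. by move=> _ A mA; exists A. Qed.

Lemma measurable_Re : measurable_fun [set: C] (@complex.Re R).
Proof. exact: (measurableT_comp measurable_fst measurable_ReIm). Qed.

Lemma measurable_Im : measurable_fun [set: C] (@complex.Im R).
Proof. exact: (measurableT_comp measurable_snd measurable_ReIm). Qed.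

Lemma measurable_pair_complex d (T : measurableType d) (f g : T -> R) :
  measurable_fun [set: T] f -> measurable_fun [set: T] g ->
  measurable_fun [set: T] (fun x => Complex (f x) (g x)).
Proof.
move=> mf mg.
apply: (measurableT_comp (f := @complex_of_pair R) (g := fun x => (f x, g x))).
  exact: measurable_funP.
exact/measurable_fun_pair.
Qed.

Definition grid_point (n : nat) (z : C) : C :=
  Complex ((Num.floor (complex.Re z * n.+1%:R))%:~R / n.+1%:R)
    ((Num.floor (complex.Im z * n.+1%:R))%:~R / n.+1%:R).

Lemma grid_point_near n z : modulus (grid_point n z - z) <= 2 * n.+1%:R^-1.
Proof.
have h (x : R) : `|(Num.floor (x * n.+1%:R))%:~R / n.+1%:R - x| <= n.+1%:R^-1.
  have n0 : 0 < n.+1%:R :> R by rewrite ltr0n.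
  have /andP[] := floor_itv (x * n.+1%:R); rewrite intrD => h1 h2.
  have := ltW h2; rewrite -ler_pdivlMr// mulrDl mul1r => h3.
  have : (Num.floor (x * n.+1%:R))%:~R / n.+1%:R <= x by rewrite ler_pdivrMr.
  move: h3; set a := _ / _; set b := _^-1 => h3 h4.
  by rewrite ler_norml; apply/andP; split; lra.
apply: (le_trans (le_modulus_ReIm _)); rewrite mulr_natl mulr2n.
by case: z => x y; apply: lerD; exact: h.
Qed.

Lemma measurable_continuousC (f : C -> R) :
  continuousC f -> measurable_fun [set: C] f.
Proof.
move=> cf; apply: (measurable_fun_cvg (h := fun n z => f (grid_point n z))).
- move=> n _ A mA; rewrite setTI.
  pose cell (ij : int * int) : set C :=
    [set z | [/\ Num.floor (complex.Re z * n.+1%:R) = ij.1,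
      Num.floor (complex.Im z * n.+1%:R) = ij.2 &
      A (f (Complex (ij.1%:~R / n.+1%:R) (ij.2%:~R / n.+1%:R)))]].
  have -> : (fun z => f (grid_point n z)) @^-1` A = \bigcup_ij cell ij.
    apply/seteqP; split => [z zA|z [ij _ [h1 h2 h3]]].
      by exists (Num.floor (complex.Re z * n.+1%:R), Num.floor (complex.Im z * n.+1%:R)).
    by rewrite /preimage/= /grid_point h1 h2.
  apply: countable_bigcupT_measurable; first exact: countableP.
  move=> -[i j].
  have mfl (g : C -> R) (k : int) : measurable_fun [set: C] g ->
      measurable [set z | Num.floor (g z * n.+1%:R) = k].
    move=> mg.
    have -> : [set z | Num.floor (g z * n.+1%:R) = k] =
        [set: C] `&` (fun z => g z * n.+1%:R) @^-1` `[k%:~R, (k + 1)%:~R[.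
      rewrite setTI; apply/seteqP; split => z /=; rewrite in_itv/=.
        by move=> /eqP; rewrite floor_eq.
      by move=> h; apply/eqP; rewrite floor_eq.
    have : measurable_fun [set: C] (fun z => g z * n.+1%:R).
      exact: measurable_funM.
    by apply; [exact: measurableT|exact: measurable_itv].
  have [Af|nAf] := pselect (A (f (Complex (i%:~R / n.+1%:R) (j%:~R / n.+1%:R)))).
    have -> : cell (i, j) =
        [set z | Num.floor (complex.Re z * n.+1%:R) = i] `&`
        [set z | Num.floor (complex.Im z * n.+1%:R) = j].
      by apply/seteqP; split => z /=; [case|case].
    by apply: measurableI; apply: mfl; [exact: measurable_Re|exact: measurable_Im].
  by rewrite (_ : cell _ = set0)//; apply/seteqP; split => z // [].
- move=> z _; apply/cvgrPdist_lt => e e0.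
  have [d d0 hd] := cf z e e0.
  have : \forall n \near \oo, 2 * n.+1%:R^-1 < d.
    have : (2 * n.+1%:R^-1 : R) @[n --> \oo] --> (2 * 0 : R).
      by apply: cvgMr; exact: cvg_harmonic.
    rewrite mulr0 => /cvgrPdist_lt /(_ d d0); apply: filterS => n.
    by rewrite sub0r normrN; apply: le_lt_trans; exact: ler_norm.
  apply: filterS => n hn; rewrite distrC; apply: hd.
  exact: (le_lt_trans (grid_point_near n z)).
Qed.

Lemma continuousC_modulus : continuousC (@modulus R).
Proof.
move=> z e e0; exists e => // w h; exact: le_lt_trans (modulus_dist _ _) h.
Qed.

Lemma measurable_modulus : measurable_fun [set: C] (@modulus R).
Proof. exact: measurable_continuousC continuousC_modulus. Qed.

Lemma measurable_disk (z : C) r : measurable (disk z r).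
Proof.
have c : continuousC (fun w : C => modulus (w - z)).
  move=> w e e0; exists e => // v h; apply: le_lt_trans (modulus_dist _ _) _.
  by rewrite opprB addrA subrK.
have -> : disk z r = [set: C] `&` (fun w : C => modulus (w - z)) @^-1` `]-oo, r[.
  by rewrite setTI; apply/seteqP; split => w /=; rewrite in_itv.
by apply: (measurable_continuousC c); [exact: measurableT|exact: measurable_itv].
Qed.

End plane_measurability.

(** * Invariance of the plane Lebesgue measure *)

Section lebesgue_line.
Variable R : realType.
Local Notation mu := (@lebesgue_measure R).
Local Open Scope ereal_scope.

Lemma ge0_integral_translate (f : R -> \bar R) (a : R) :
  measurable_fun [set: R] f -> (forall x, 0 <= f x) ->
  \int[mu]_x f (x + a)%R = \int[mu]_x f x.
Proof.
move=> mf f0.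
have mT : measurable_fun [set: measurableTypeR R]
    (fun x : measurableTypeR R => (x + a)%R : measurableTypeR R).
  exact: measurable_funD.
rewrite -(@ge0_integral_pushforward _ _ _ _ R _ mT mu setT f)//.
apply: eq_measure_integral => A mA _; apply/esym.
apply: (@lebesgue_measure_unique R (pushforward mu _)) => // _ [[b c]] _ <-.
have E : (fun x : R => x + a)%R @^-1` `]b, c]%classic = `](b - a)%R, (c - a)%R]%classic.
  by apply/seteqP; split => x /=; rewrite !in_itv/= ltrBlDr lerBrDr.
rewrite /pushforward; transitivity (mu `](b - a)%R, (c - a)%R]); last by rewrite -E.
rewrite !lebesgue_measure_itv/= !lte_fin ltrD2r.
by case: ifP => // _; rewrite -!EFinD; congr EFin; lra.
Qed.

Lemma ge0_integral_scale (f : R -> \bar R) (t : R) : (0 < t)%R ->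
  measurable_fun [set: R] f -> (forall x, 0 <= f x) ->
  \int[mu]_x f (t * x)%R = t^-1%:E * \int[mu]_x f x.
Proof.
move=> t0 mf f0.
have mT : measurable_fun [set: measurableTypeR R]
    (fun x : measurableTypeR R => (t * x)%R : measurableTypeR R).
  exact: measurable_funM.
have tV0 : (0 <= t^-1)%R by rewrite invr_ge0 ltW.
rewrite -(@ge0_integral_pushforward _ _ _ _ R _ mT mu setT f)//.
have -> : t^-1%:E * \int[mu]_x f x = \int[mscale (NngNum tV0) mu]_x f x.
  by rewrite (ge0_integral_mscale mu measurableT (NngNum tV0))// => x _.
apply: eq_measure_integral => A mA _.
pose T := fun x : measurableTypeR R => (t * x)%R : measurableTypeR R.
pose T1 : {measure set (measurableTypeR R) -> \bar R} := pushforward mu T.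
pose T2 : {measure set (measurableTypeR R) -> \bar R} := mscale (NngNum (ltW t0)) (T1 mT).
have h1 : mu A = T2 A.
  apply: (@lebesgue_measure_unique R T2) => // _ [[b c]] _ <-.
  have E : (fun x : R => t * x)%R @^-1` `]b, c]%classic =
      `](t^-1 * b)%R, (t^-1 * c)%R]%classic.
    by apply/seteqP; split => x /=; rewrite !in_itv/= ltr_pdivrMl// ler_pdivlMl.
  transitivity (t%:E * mu `](t^-1 * b)%R, (t^-1 * c)%R]); last by rewrite -E.
  rewrite !lebesgue_measure_itv/= !lte_fin ltr_pM2l ?invr_gt0//.
  case: ifP => // _; last by rewrite mule0.
  rewrite -!EFinD -EFinM; congr EFin.
  by rewrite -mulrBr mulrA divff ?mul1r ?gt_eqF.
transitivity (t^-1%:E * T2 A); last by rewrite -h1.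
by rewrite /T2/= /mscale/= muleA -EFinM mulVf ?gt_eqF// mul1e.
Qed.

End lebesgue_line.

Section lebesgue_plane.
Variable R : realType.
Local Notation C := R[i].
Local Notation lam := (@lebesgue_measure R).
Local Notation m := (@lebesgueC R).
Local Open Scope ereal_scope.
Implicit Type F : C -> \bar R.

Lemma measurable_complex_of_pairP :
  measurable_fun [set: R * R] (@complex_of_pair R).
Proof. exact: measurable_funP. Qed.

Lemma measurableC_pair F : measurable_fun [set: C] F ->
  measurable_fun [set: R * R] (fun p => F (complex_of_pair p)).
Proof. by move=> mF; apply: measurableT_comp mF measurable_complex_of_pairP. Qed.

Lemma integral_lebesgueC F : measurable_fun [set: C] F ->
  (forall z, 0 <= F z) ->
  \int[m]_z F z = \int[lam]_x \int[lam]_y F (Complex x y).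
Proof.
move=> mF F0; rewrite /lebesgueC ge0_integral_pushforward//; last first.
  exact: measurable_complex_of_pairP.
by rewrite preimage_setT fubini_tonelli1//=; exact: measurableC_pair.
Qed.

Lemma integral_lebesgueC_swap F : measurable_fun [set: C] F ->
  (forall z, 0 <= F z) ->
  \int[m]_z F z = \int[lam]_y \int[lam]_x F (Complex x y).
Proof.
move=> mF F0; rewrite /lebesgueC ge0_integral_pushforward//; last first.
  exact: measurable_complex_of_pairP.
by rewrite preimage_setT fubini_tonelli2//=; exact: measurableC_pair.
Qed.

Lemma measurable_slice2 F x : measurable_fun [set: C] F ->
  measurable_fun [set: R] (fun y => F (Complex x y)).
Proof.
move=> mF; apply: (measurableT_comp mF).
by apply: (@measurable_pair_complex _ _ _ (cst x) id).
Qed.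

Lemma measurable_slice1 F y : measurable_fun [set: C] F ->
  measurable_fun [set: R] (fun x => F (Complex x y)).
Proof.
move=> mF; apply: (measurableT_comp mF).
by apply: (@measurable_pair_complex _ _ _ id (cst y)).
Qed.

(** Fubini reduces the invariance under shears to translations of the line. *)
Lemma integral_shear_Im F (t : R) : measurable_fun [set: C] F ->
  (forall z, 0 <= F z) ->
  \int[m]_z F (Complex (complex.Re z) (complex.Im z + t * complex.Re z)%R) =
  \int[m]_z F z.
Proof.
move=> mF F0.
have mG : measurable_fun [set: C] (fun z =>
    F (Complex (complex.Re z) (complex.Im z + t * complex.Re z)%R)).
  apply: (measurableT_comp mF); apply: measurable_pair_complex.
    exact: measurable_Re.
  apply: measurable_funD; first exact: measurable_Im.
  by apply: measurable_funM => //; exact: measurable_Re.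
rewrite (integral_lebesgueC mF F0) (integral_lebesgueC mG (fun=> F0 _)).
apply: eq_integral => x _ /=.
rewrite (ge0_integral_translate (f := fun y => F (Complex x y)))//.
exact: measurable_slice2.
Qed.

Lemma integral_shear_Re F (t : R) : measurable_fun [set: C] F ->
  (forall z, 0 <= F z) ->
  \int[m]_z F (Complex (complex.Re z + t * complex.Im z)%R (complex.Im z)) =
  \int[m]_z F z.
Proof.
move=> mF F0.
have mG : measurable_fun [set: C] (fun z =>
    F (Complex (complex.Re z + t * complex.Im z)%R (complex.Im z))).
  apply: (measurableT_comp mF); apply: measurable_pair_complex.
    apply: measurable_funD; first exact: measurable_Re.
    by apply: measurable_funM => //; exact: measurable_Im.
  exact: measurable_Im.
rewrite (integral_lebesgueC_swap mF F0) (integral_lebesgueC_swap mG (fun=> F0 _)).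
apply: eq_integral => y _ /=.
rewrite (ge0_integral_translate (f := fun x => F (Complex x y)))//.
exact: measurable_slice1.
Qed.

Lemma measurable_mulC (a b : C) : measurable_fun [set: C] (fun z => a * z + b)%R.
Proof.
have -> : (fun z : C => a * z + b)%R = (fun z : C => Complex
    ((complex.Re a * complex.Re z - complex.Im a * complex.Im z) + complex.Re b)%R
    ((complex.Re a * complex.Im z + complex.Im a * complex.Re z) + complex.Im b)%R).
  by apply/funext => z; apply: complex_eqP; rewrite /= ?ReD ?ImD ?ReM ?ImM.
have mR := @measurable_Re R; have mI := @measurable_Im R.
by apply: measurable_pair_complex; apply: measurable_funD => //;
  [apply: measurable_funB|apply: measurable_funD]; exact: measurable_funM.
Qed.

Lemma measurable_scaleC (a : C) : measurable_fun [set: C] ( *%R a).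
Proof.
by have := measurable_mulC a 0%R; congr measurable_fun; apply/funext => z;
  rewrite addr0.
Qed.

Lemma measurable_translateC (b : C) : measurable_fun [set: C] (fun z => z + b)%R.
Proof.
by have := measurable_mulC 1%R b; congr measurable_fun; apply/funext => z;
  rewrite mul1r.
Qed.

(** A rotation whose angle is not pi is the product of three shears. *)
Lemma integral_rotation_shears F (l : C) : measurable_fun [set: C] F ->
  (forall z, 0 <= F z) -> modulus l = 1%R -> complex.Re l != (-1)%R ->
  \int[m]_z F (l * z)%R = \int[m]_z F z.
Proof.
move=> mF F0 l1; set c := complex.Re l; set s := complex.Im l => cN1.
have cs : (c ^+ 2 + s ^+ 2 = 1)%R by rewrite -modulus_sqr l1 expr1n.
have c0 : (1 + c != 0)%R.
  by apply: contra cN1 => /eqP h; apply/eqP; lra.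
pose t := (s / (1 + c))%R.
have tc : (t * (1 + c) = s)%R by rewrite /t mulfVK.
have ts : (t * s = 1 - c)%R.
  apply: (mulIf c0); rewrite mulrAC tc; have : (s * s = 1 - c * c)%R by rewrite -!expr2; lra.
  move=> ->; ring.
pose S1 (z : C) := Complex (complex.Re z + (- t) * complex.Im z)%R (complex.Im z).
pose S2 (z : C) := Complex (complex.Re z) (complex.Im z + s * complex.Re z)%R.
have mR := @measurable_Re R; have mI := @measurable_Im R.
have mS1 : measurable_fun [set: C] S1.
  apply: measurable_pair_complex => //.
  by apply: measurable_funD => //; exact: measurable_funM.
have mS2 : measurable_fun [set: C] S2.
  apply: measurable_pair_complex => //.
  by apply: measurable_funD => //; exact: measurable_funM.
transitivity (\int[m]_z F (S1 (S2 (S1 z)))).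
  apply: eq_integral => z _; congr F.
  case: z => x y; apply: complex_eqP; rewrite /= ?ReM ?ImM /= -/c -/s.
    have -> : (x + - t * y + - t * (y + s * (x + - t * y)) =
      x * (1 - t * s) - y * (t * (1 + 1 - t * s)))%R by ring.
    rewrite ts (_ : 1 + 1 - (1 - c) = 1 + c)%R; last ring.
    by rewrite tc; ring.
  have -> : (y + s * (x + - t * y) = y * (1 - t * s) + s * x)%R by ring.
  by rewrite ts; ring.
rewrite (integral_shear_Re (F := fun z => F (S1 (S2 z))))//; last first.
  by apply: (measurableT_comp mF); exact: measurableT_comp.
rewrite (integral_shear_Im (F := fun z => F (S1 z)))//; last first.
  exact: measurableT_comp.
by rewrite (integral_shear_Re (F := F)).
Qed.

Lemma integral_rotation F (l : C) : measurable_fun [set: C] F ->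
  (forall z, 0 <= F z) -> modulus l = 1%R ->
  \int[m]_z F (l * z)%R = \int[m]_z F z.
Proof.
move=> mF F0 l1; have [cN1|] := eqVneq (complex.Re l) (-1)%R; last first.
  exact: integral_rotation_shears.
(* the remaining angle is pi, twice a quarter turn *)
have i1 : modulus ('i%C : C) = 1%R.
  by rewrite modulusE/= expr0n/= expr1n add0r sqrtr1.
have iN1 : complex.Re ('i%C : C) != (-1)%R.
  by rewrite /= eq_sym oppr_eq0 oner_eq0.
have lE : l = ('i%C * 'i%C)%R.
  apply: complex_eqP; first by rewrite cN1/= mulr0 mulr1 sub0r.
  have := modulus_sqr l; rewrite l1 cN1 expr1n sqrrN expr1n.
  move=> h; have /eqP : (complex.Im l ^+ 2 = 0)%R by lra.
  by rewrite sqrf_eq0 => /eqP ->; rewrite /= mulr0 mul0r addr0.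
transitivity (\int[m]_z F ('i%C * ('i%C * z))%R).
  by apply: eq_integral => z _; rewrite lE mulrA.
rewrite (integral_rotation_shears (F := fun z => F ('i%C * z)%R))//; last first.
  by apply: (measurableT_comp mF); exact: measurable_scaleC.
by rewrite integral_rotation_shears.
Qed.

Lemma integral_translateC F (a : C) : measurable_fun [set: C] F ->
  (forall z, 0 <= F z) -> \int[m]_z F (z + a)%R = \int[m]_z F z.
Proof.
move=> mF F0.
pose G (z : C) := F (Complex (complex.Re z) (complex.Im z + complex.Im a)%R).
have mG : measurable_fun [set: C] G.
  apply: (measurableT_comp mF); apply: measurable_pair_complex.
    exact: measurable_Re.
  by apply: measurable_funD => //; exact: measurable_Im.
have G0 z : 0 <= G z by exact: F0.
transitivity (\int[m]_z G z).
  have mFa : measurable_fun [set: C] (fun z => F (z + a)%R).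
    by apply: (measurableT_comp mF); exact: measurable_translateC.
  rewrite (integral_lebesgueC_swap mG G0) (integral_lebesgueC_swap mFa (fun=> F0 _)).
  apply: eq_integral => y _; rewrite /G/=.
  rewrite -(ge0_integral_translate (f := fun x => F (Complex x (y + complex.Im a)%R)) (complex.Re a))//.
    by apply: eq_integral => x _; congr F; case: (a).
  exact: measurable_slice1.
rewrite (integral_lebesgueC mG G0) (integral_lebesgueC mF F0).
apply: eq_integral => x _; rewrite /G/=.
rewrite (ge0_integral_translate (f := fun y => F (Complex x y)))//.
exact: measurable_slice2.
Qed.

Lemma integral_scaleC F (t : R) : (0 < t)%R -> measurable_fun [set: C] F ->
  (forall z, 0 <= F z) ->
  \int[m]_z F (t%:C%C * z)%R = (t ^- 2)%:E * \int[m]_z F z.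
Proof.
move=> t0 mF F0.
have mFt : measurable_fun [set: C] (fun z => F (t%:C%C * z)%R).
  by apply: (measurableT_comp mF); exact: measurable_scaleC.
have tE x y : (t%:C%C * Complex x y = Complex (t * x) (t * y))%R.
  by apply: complex_eqP; rewrite ?ReM ?ImM/= ?mul0r ?subr0 ?addr0.
have mF2 : measurable_fun [set: R] (fun x => \int[lam]_y F (Complex x y)).
  exact: (@measurable_fun_fubini_tonelli_F _ _ _ _ R lam
    (fun p => F (complex_of_pair p)) (measurableC_pair mF) (fun p => F0 _)).
have F20 x : 0 <= \int[lam]_y F (Complex x y) by exact: integral_ge0.
rewrite (integral_lebesgueC mF F0) (integral_lebesgueC mFt (fun=> F0 _)).
transitivity (\int[lam]_x (t^-1%:E * \int[lam]_y F (Complex (t * x)%R y))).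
  apply: eq_integral => x _; under eq_integral do rewrite tE.
  rewrite (ge0_integral_scale (f := fun y => F (Complex (t * x)%R y)))//.
  exact: measurable_slice2.
rewrite (ge0_integral_scale (f := fun x => t^-1%:E * \int[lam]_y F (Complex x y)))//.
- rewrite ge0_integralZl//; first by rewrite muleA -EFinM expr2 invfM.
  by rewrite lee_fin invr_ge0 ltW.
- by apply: emeasurable_funM.
- by move=> x; apply: mule_ge0 => //; rewrite lee_fin invr_ge0 ltW.
Qed.

End lebesgue_plane.

Section disks.
Variable R : realType.
Local Notation C := R[i].
Local Notation m := (@lebesgueC R).
Local Open Scope ereal_scope.

Lemma lebesgueC_rect (a b c e : R) : (a <= b)%R -> (c <= e)%R ->
  m [set z | complex.Re z \in `[a, b] /\ complex.Im z \in `[c, e]] =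
  ((b - a) * (e - c))%:E.
Proof.
move=> ab ce; rewrite /lebesgueC /pushforward.
have -> : @complex_of_pair R @^-1`
    [set z | complex.Re z \in `[a, b] /\ complex.Im z \in `[c, e]] =
    `[a, b]%classic `*` `[c, e]%classic by apply/seteqP; split => -[x y].
rewrite product_measure1E//.
rewrite -[LHS]/(lebesgue_measure `[a, b] * lebesgue_measure `[c, e]).
rewrite !lebesgue_measure_itv/= !lte_fin EFinM.
by congr (_ * _); rewrite lt_neqAle ?ab ?ce andbT; case: eqVneq => //= ->;
  rewrite ?subrr// -EFinB.
Qed.

Definition disk_area : R := fine (m (disk 0%R 1%R)).

Lemma disk_areaE : m (disk 0%R 1%R) = disk_area%:E.
Proof.
rewrite /disk_area fineK// ge0_fin_numE//.
pose Q := [set z : C | complex.Re z \in `[-1, 1]%R /\ complex.Im z \in `[-1, 1]%R].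
have mQ : measurable Q.
  have mI (f : C -> R) : measurable_fun [set: C] f ->
      measurable ([set: C] `&` f @^-1` `[(-1)%R, 1%R]%classic).
    by move=> mf; apply: mf; [exact: measurableT|exact: measurable_itv].
  have := measurableI _ _ (mI _ (@measurable_Re R)) (mI _ (@measurable_Im R)).
  by rewrite !setTI.
apply: (@le_lt_trans _ _ (m Q)).
  apply: le_measure; rewrite ?inE//; first exact: measurable_disk.
  move=> z; rewrite /disk/= subr0 => /ltW z1; rewrite /Q/= !in_itv/= -!ler_norml.
  by split; [exact: le_trans (le_Re_modulus _) _|exact: le_trans (le_Im_modulus _) _].
by rewrite /Q lebesgueC_rect ?ltry//; lra.
Qed.

Lemma disk_area_gt0 : (0 < disk_area)%R.
Proof.
rewrite -lte_fin -disk_areaE.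
pose Q := [set z : C | complex.Re z \in `[0, 1/2]%R /\ complex.Im z \in `[0, 1/3]%R].
have mQ : measurable Q.
  have mI (f : C -> R) (r : R) : measurable_fun [set: C] f ->
      measurable ([set: C] `&` f @^-1` `[0%R, r]%classic).
    by move=> mf; apply: mf; [exact: measurableT|exact: measurable_itv].
  have := measurableI _ _ (mI _ (1/2)%R (@measurable_Re R)) (mI _ (1/3)%R (@measurable_Im R)).
  by rewrite !setTI.
apply: (@lt_le_trans _ _ (m Q)).
  by rewrite /Q lebesgueC_rect ?lte_fin; lra.
apply: le_measure; rewrite ?inE//; first exact: measurable_disk.
move=> z; rewrite /Q/= !in_itv/= => -[/andP[x0 x1] /andP[y0 y1]].
rewrite /disk/= subr0; apply: (le_lt_trans (le_modulus_ReIm _)).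
by rewrite !ger0_norm//; lra.
Qed.

Lemma lebesgueC_disk (z : C) (r : R) : (0 <= r)%R ->
  m (disk z r) = (disk_area * r ^+ 2)%:E.
Proof.
rewrite le_eqVlt => /predU1P[<-|r0].
  rewrite expr0n/= mulr0 (_ : disk z 0%R = set0) ?measure0//.
  by apply/seteqP; split => w //; rewrite /disk/= ltNge modulus_ge0.
have md := @measurable_disk R.
have h (A : set C) : measurable A -> m A = \int[m]_w (\1_A w)%:E.
  by move=> mA; rewrite integral_indic// setIT.
have mI (A : set C) : measurable A ->
    measurable_fun [set: C] (fun w => (\1_A w : R)%:E).
  by move=> mA; apply/measurable_EFinP; exact: measurable_indic.
have I0 (A : set C) w : 0 <= (\1_A w : R)%:E by rewrite lee_fin.
rewrite (h _ (md z r)) -(integral_translateC z (mI _ (md z r)) (I0 _)).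
transitivity (\int[m]_w (\1_(disk 0%R r) w)%:E).
  apply: eq_integral => w _; congr EFin.
  by rewrite !indicE; congr (nat_of_bool _)%:R; apply/idP/idP; rewrite !inE /disk/= addrK subr0.
have := integral_scaleC r0 (mI _ (md 0%R r)) (I0 _).
rewrite -h// (_ : \int[m]_w (\1_(disk 0%R r) (r%:C%C * w)%R)%:E = m (disk 0%R 1%R)).
  rewrite disk_areaE => h1; apply/esym; rewrite mulrC EFinM h1 muleA -EFinM.
  by rewrite divff ?mul1e// expf_neq0// gt_eqF.
rewrite [RHS]h//; apply: eq_integral => w _; congr EFin; rewrite !indicE.
congr (nat_of_bool _)%:R; apply/idP/idP; rewrite !inE /disk/= !subr0 modulusM modulus_real gtr0_norm//.
  by rewrite -[X in (_ < X)%R]mulr1 ltr_pM2l.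
by rewrite -[X in _ -> (_ < X)%R]mulr1 ltr_pM2l.
Qed.

End disks.

(** * Lower integrals and densities *)

Section lower_integral.
Local Open Scope ereal_scope.
Context d (T : measurableType d) (R : realType) (mu : {measure set T -> \bar R}).
Implicit Types (f g : T -> \bar R) (D : set T).

Import HBNNSimple.

(** The integral of a nonnegative function is a supremum over simple functions,
    so it is monotone and homogeneous even without measurability: the
    correlation integrals below can be compared as they stand. *)
Lemma ge0_le_integral_any D f g : (forall x, D x -> 0 <= f x) ->
  (forall x, D x -> f x <= g x) ->
  \int[mu]_(x in D) f x <= \int[mu]_(x in D) g x.
Proof.
move=> f0 fg; rewrite (integral_mkcond D f) (integral_mkcond D g).
have f0' x : 0 <= (f \_ D) x by rewrite patchE; case: ifPn => // /set_mem/f0.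
have fg' x : (f \_ D) x <= (g \_ D) x.
  by rewrite !patchE; case: ifPn => // /set_mem/fg.
rewrite !ge0_integralTE//; last by move=> x; exact: le_trans (fg' x).
apply: le_ereal_sup => _ [h hf <-]; exists h => // x /=.
exact: le_trans (hf x) (fg' x).
Qed.

Lemma ge0_integralZl_any D f (k : R) : (0 <= k)%R ->
  (forall x, D x -> 0 <= f x) ->
  \int[mu]_(x in D) (k%:E * f x) = k%:E * \int[mu]_(x in D) f x.
Proof.
have ub g (c : R) : (0 < c)%R -> (forall x, D x -> 0 <= g x) ->
    c%:E * \int[mu]_(x in D) g x <= \int[mu]_(x in D) (c%:E * g x).
  move=> c0 g0; rewrite -lee_pdivlMl//.
  rewrite (integral_mkcond D g) ge0_integralTE; last first.
    by move=> x; rewrite patchE; case: ifPn => // /set_mem/g0.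
  apply: ge_ereal_sup => _ [h hg <-]; rewrite lee_pdivlMl//.
  rewrite integral_mkcond ge0_integralTE; last first.
    move=> x; rewrite patchE; case: ifPn => // /set_mem xD.
    by apply: mule_ge0; [rewrite lee_fin ltW|exact: g0].
  rewrite -sintegralrM; apply: ereal_sup_ubound.
  exists (scale_nnsfun h (ltW c0)) => // x /=.
  rewrite patchE EFinM; have := hg x; rewrite patchE; case: ifPn => _ h0.
    by apply: lee_wpmul2l => //; rewrite lee_fin ltW.
  have hx : (h x <= 0)%R by rewrite -lee_fin.
  have -> : h x = 0%R by apply/eqP; rewrite eq_le hx fun_ge0.
  by rewrite mule0.
rewrite le_eqVlt => /predU1P[<- f0|k0 f0].
  by rewrite mul0e integral0_eq// => x _; rewrite mul0e.
apply/eqP; rewrite eq_le ub// andbT -lee_pdivrMl//.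
apply: le_trans (ub (fun x => k%:E * f x) k^-1%R _ _) _; first by rewrite invr_gt0.
  by move=> x xD; apply: mule_ge0; [rewrite lee_fin ltW|exact: f0].
apply: ge0_le_integral_any => x xD.
  by do 2 (apply: mule_ge0; first by rewrite lee_fin ?invr_ge0 ltW); exact: f0.
by rewrite muleA -EFinM mulVf ?mul1e// gt_eqF.
Qed.

End lower_integral.

Section integral_density.
Local Open Scope ereal_scope.
Context d (T : measurableType d) (R : realType) (mu : {measure set T -> \bar R}).
Variables (w : T -> R) (w0 : forall x, (0 <= w x)%R).
Hypothesis mw : measurable_fun [set: T] w.
Local Notation dens := (density mu w0).

Import HBNNSimple.

Let integral_density_nnsfun (h : {nnsfun T >-> R}) :
  \int[dens]_x (h x)%:E = \int[mu]_x ((h x)%:E * (w x)%:E).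
Proof.
have mwE : measurable_fun [set: T] (EFin \o w) by exact/measurable_EFinP.
have mh r : measurable (h @^-1` [set r]) by exact: measurable_sfunP.
rewrite integralT_nnsfun sintegralE.
transitivity (\sum_(r \in range h) \int[mu]_x
    (r%:E * ((\1_(h @^-1` [set r]) x)%:E * (w x)%:E))).
  apply: eq_fsbigr => r /set_mem [y _ <-].
  rewrite ge0_integralZl_any; last 2 first.
  - exact: fun_ge0.
  - by move=> x _; rewrite -EFinM lee_fin mulr_ge0.
  congr (_ * _); transitivity (\int[mu]_(x in h @^-1` [set h y]) (w x)%:E) => //.
  rewrite integral_mkcond.
  apply: eq_integral => x _; rewrite patchE indicE.
  by case: ifPn; rewrite ?mul1e ?mul0e.
rewrite -ge0_integral_fsum//; last 2 first.
- by move=> r; apply: emeasurable_funM => //; apply: emeasurable_funM => //;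
    exact/measurable_EFinP/measurable_indic.
- move=> r x _; have [<-|r0] := eqVneq (h x) r.
    by rewrite !mule_ge0 ?lee_fin ?fun_ge0.
  by rewrite indicE memNset ?mul0e ?mule0//= => /eqP; exact/negP.
apply: eq_integral => x _.
rewrite [in RHS]fimfunE -fsumEFin// ge0_mule_fsuml//; last first.
  by move=> r; rewrite -/(_ r) nnfun_muleindic_ge0.
by apply: eq_fsbigr => r _; rewrite muleA EFinM.
Qed.

Lemma ge0_integral_density (f : T -> \bar R) :
  measurable_fun [set: T] f -> (forall x, 0 <= f x) ->
  \int[dens]_x f x = \int[mu]_x (f x * (w x)%:E).
Proof.
move=> mf f0; have mT := @measurableT _ T.
pose f_ := nnsfun_approx mT mf.
have f_cvg x : (EFin \o f_ ^~ x) @ \oo --> f x.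
  by apply: cvg_nnsfun_approx => // y _.
have f_nd x : {homo (fun n => (f_ n x)%:E) : n p / (n <= p)%N >-> n <= p}.
  by move=> n p np; rewrite lee_fin; exact/lefP/nd_nnsfun_approx.
have mf_ n : measurable_fun [set: T] (fun x => (f_ n x)%:E).
  by exact/measurable_EFinP.
have mwE : measurable_fun [set: T] (EFin \o w) by exact/measurable_EFinP.
transitivity (limn (fun n => \int[dens]_x (f_ n x)%:E)).
  rewrite -monotone_convergence//.
  - by apply: eq_integral => x _; apply/esym/cvg_lim => //; exact: f_cvg.
  - by move=> n x _; rewrite lee_fin.
under eq_fun do rewrite integral_density_nnsfun.
rewrite -monotone_convergence//.
- apply: eq_integral => x _; apply/cvg_lim => //.
  have [w0x|wx0] := eqVneq (w x) 0%R.
    rewrite w0x mule0 (_ : (fun _ => _) = cst 0); first exact: cvg_cst.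
    by apply/funext => n; rewrite mule0.
  by apply: cvgeZr => //; exact: f_cvg.
- by move=> n; exact: emeasurable_funM.
- by move=> n x _; rewrite -EFinM lee_fin mulr_ge0.
- by move=> x _ n p np; apply: lee_wpmul2r; [rewrite lee_fin|exact: f_nd].
Qed.

Lemma ge0_integral_density_set (f : T -> \bar R) D : measurable D ->
  measurable_fun [set: T] f -> (forall x, 0 <= f x) ->
  \int[dens]_(x in D) f x = \int[mu]_(x in D) (f x * (w x)%:E).
Proof.
move=> mD mf f0; rewrite [LHS]integral_mkcond [RHS]integral_mkcond.
rewrite ge0_integral_density.
- by apply: eq_integral => x _; rewrite !patchE; case: ifPn => // _; rewrite mul0e.
- by apply/(measurable_restrictT _ _).1 => //; exact: measurable_funTS.
- by move=> x; rewrite patchE; case: ifPn.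
Qed.

End integral_density.

(** * Complex differentiability *)

Section complex_differentiability.
Variable R : realType.
Local Notation C := R[i].
Implicit Types (f g : C -> C) (z l : C).

(** Complex differentiability with real-valued moduli. *)
Definition cdiff f z l : Prop := forall e : R, 0 < e -> exists2 d, 0 < d &
  forall h, modulus h < d -> modulus (f (z + h) - f z - l * h) <= e * modulus h.

Lemma entire_cdiff f : entire f -> forall z, exists l, cdiff f z l.
Proof.
move=> ef z; have /cvg_ex[l /cvgrPdist_lt fl] := ef z.
exists l => e e0; have eC : 0 < e%:C%C :> C by rewrite ltcR.
have /nbhs_ballP[d /= d0 hd] := fl _ eC.
have dE : d = (complex.Re d)%:C%C by rewrite RRe_real// gtr0_real.
exists (complex.Re d); first by rewrite -ltcR -dE.
move=> h hd'; have [->|h0] := eqVneq h 0.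
  by rewrite addr0 subrr mulr0 subr0 modulus0 mulr0.
have := hd h; rewrite /ball/= sub0r normrN => /(_ _ h0).
have -> : `|h| < d by rewrite dE normr_modulus ltcR.
move=> /(_ isT); rewrite normr_modulus ltcR => /ltW.
have m0 : 0 < modulus h by rewrite modulus_gt0.
rewrite -(ler_pM2r m0); apply: le_trans.
have -> : h *: (1 : C^o) = h by exact: mulr1.
rewrite -modulusM -modulusN mulrBl opprB /= (addrC h).
set A := f (z + h) - f z.
by rewrite -[h^-1 *: A]/(h^-1 * A) mulrAC mulVf// mul1r.
Qed.

Lemma cdiff_cst (c : C) z : cdiff (fun=> c) z 0.
Proof. by move=> e e0; exists 1 => // h _; rewrite mul0r !subr0 subrr modulus0 mulr_ge0 ?modulus_ge0// ltW. Qed.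

Lemma cdiff_affine (a b : C) z : cdiff (fun x => a + b * x) z b.
Proof.
move=> e e0; exists 1 => // h _.
rewrite (_ : _ - _ = 0); last by ring.
by rewrite modulus0 mulr_ge0 ?modulus_ge0// ltW.
Qed.

Lemma cdiff_lip f z l : cdiff f z l -> exists2 d, 0 < d &
  forall h, modulus h < d -> modulus (f (z + h) - f z) <= (modulus l + 1) * modulus h.
Proof.
move=> /(_ 1 ltr01)[d d0 hd]; exists d => // h /hd.
rewrite mul1r mulrDl mul1r -modulusM => H.
have := modulusD (f (z + h) - f z - l * h) (l * h); rewrite subrK => K.
by apply: le_trans K _; rewrite addrC lerD2l.
Qed.

Lemma cdiff_continuous f z l : cdiff f z l -> forall e, 0 < e ->
  exists2 d, 0 < d & forall w, modulus (w - z) < d -> modulus (f w - f z) < e.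
Proof.
move=> /cdiff_lip[d d0 hd] e e0.
have L0 : 0 < modulus l + 1 by rewrite ltr_wpDl ?modulus_ge0.
exists (Num.min d (e / (modulus l + 1))); first by rewrite lt_min d0 divr_gt0.
move=> w; rewrite lt_min => /andP[w1 w2].
have := hd _ w1; rewrite (addrC z) subrK => /le_lt_trans; apply.
by rewrite mulrC -ltr_pdivlMr.
Qed.

Lemma cdiff_mul f g z l k : cdiff f z l -> cdiff g z k ->
  cdiff (fun x => f x * g x) z (l * g z + f z * k).
Proof.
move=> fl gk e e0.
pose M := modulus (f z) + modulus (g z) + modulus l + 1.
have f0 := modulus_ge0 (f z); have g0 := modulus_ge0 (g z).
have l0 := modulus_ge0 l.
have M0 : 0 < M by rewrite /M; lra.
have e3 : 0 < e / (3 * M) by rewrite divr_gt0// mulr_gt0.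
have [d1 d10 h1] := fl _ e3; have [d2 d20 h2] := gk _ e3.
have [d3 d30 h3] := cdiff_lip fl.
have [d4 d40 h4] := cdiff_continuous gk e3.
pose e' := Num.min (e / (3 * M)) 1.
have e'0 : 0 < e' by rewrite lt_min e3 ltr01.
exists (Num.min (Num.min d1 d2) (Num.min d3 d4)).
  by rewrite !lt_min d10 d20 d30 d40.
move=> h; rewrite !lt_min => /andP[/andP[k1 k2] /andP[k3 k4]].
have {}h1 := h1 _ k1; have {}h2 := h2 _ k2; have {}h3 := h3 _ k3.
have {h4} := h4 (z + h); rewrite [z + h - z]addrC addKr => /(_ k4)/ltW h4.
rewrite (_ : _ - _ = (f (z + h) - f z) * (g (z + h) - g z) +
  ((f (z + h) - f z - l * h) * g z + f z * (g (z + h) - g z - k * h))); last by ring.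
apply: le_trans (modulusD _ _) _.
have -> : e * modulus h = M * (e / (3 * M) * modulus h) +
    (M * (e / (3 * M) * modulus h) + M * (e / (3 * M) * modulus h)).
  by field; rewrite gt_eqF.
apply: lerD; last apply: le_trans (modulusD _ _) _; last apply: lerD.
- rewrite modulusM mulrCA mulrC; apply: ler_pM; rewrite ?modulus_ge0//.
  by apply: le_trans h3 _; rewrite ler_wpM2r ?modulus_ge0// /M; lra.
- rewrite modulusM mulrC; apply: ler_pM; rewrite ?modulus_ge0//.
  by rewrite /M; lra.
- rewrite modulusM; apply: ler_pM; rewrite ?modulus_ge0//.
  by rewrite /M; lra.
Qed.

Lemma cdiff_comp f g z l k : cdiff g z k -> cdiff f (g z) l ->
  cdiff (f \o g) z (l * k).
Proof.
move=> gk fl e e0.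
pose M := modulus l + (modulus k + 1).
have M0 : 0 < M by rewrite /M ltr_wpDl ?modulus_ge0// ltr_wpDl ?modulus_ge0.
have e2 : 0 < e / (2 * M) by rewrite divr_gt0// mulr_gt0.
have [d1 d10 h1] := gk _ e2; have [d2 d20 h2] := fl _ e2.
have [d3 d30 h3] := cdiff_lip gk; have [d4 d40 h4] := cdiff_continuous gk d20.
exists (Num.min d1 (Num.min d3 d4)); first by rewrite !lt_min d10 d30 d40.
move=> h; rewrite !lt_min => /and3P[k1 k3 k4].
have {}h1 := h1 _ k1; have {}h3 := h3 _ k3.
have {h4} := h4 (z + h); rewrite [z + h - z]addrC addKr => /(_ k4) h4.
have {h2} := h2 _ h4; rewrite (addrC (g z)) subrK => h2.
rewrite (_ : _ - _ = (f (g (z + h)) - f (g z) - l * (g (z + h) - g z)) +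
  l * (g (z + h) - g z - k * h)); last by rewrite /=; ring.
apply: le_trans (modulusD _ _) _; rewrite modulusM.
have -> : e * modulus h = e / (2 * M) * (M * modulus h) + M * (e / (2 * M) * modulus h).
  by field; rewrite gt_eqF.
apply: lerD.
  apply: le_trans h2 _; apply: ler_wpM2l; first exact: ltW.
  by apply: le_trans h3 _; rewrite ler_wpM2r ?modulus_ge0// /M lerDr modulus_ge0.
apply: ler_pM; rewrite ?modulus_ge0// /M lerDl addr_ge0 ?modulus_ge0//.
Qed.

Lemma continuousC_Re f : (forall z, exists l, cdiff f z l) ->
  continuousC (fun z => complex.Re (f z)).
Proof.
move=> df z e e0; have [l dl] := df z; have [d d0 hd] := cdiff_continuous dl e0.
exists d => // w /hd; rewrite -ReB; apply: le_lt_trans; exact: le_Re_modulus.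
Qed.

Lemma continuousC_Im f : (forall z, exists l, cdiff f z l) ->
  continuousC (fun z => complex.Im (f z)).
Proof.
move=> df z e e0; have [l dl] := df z; have [d d0 hd] := cdiff_continuous dl e0.
exists d => // w /hd; rewrite -ImB; apply: le_lt_trans; exact: le_Im_modulus.
Qed.

End complex_differentiability.

Section complex_exponential.
Variable R : realType.
Local Notation C := R[i].
Implicit Types z : C.

Definition expC z : C :=
  Complex (expR (complex.Re z) * cos (complex.Im z))
          (expR (complex.Re z) * sin (complex.Im z)).

Lemma expCD z w : expC (z + w) = expC z * expC w.
Proof.
apply: complex_eqP; rewrite ?ReM ?ImM /expC/= ReD ImD expRD ?cosD ?sinD; ring.
Qed.

Lemma expC0 : expC 0 = 1.
Proof. by rewrite /expC/= expR0 cos0 sin0 mulr1 mulr0. Qed.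

Lemma modulus_expC z : modulus (expC z) = expR (complex.Re z).
Proof.
rewrite modulusE/= !exprMn -mulrDr cos2Dsin2 mulr1 sqrtr_sqr.
by rewrite ger0_norm// expR_ge0.
Qed.

Lemma expC_Im2pi (x y : R) : expC (Complex x (y + 2 * pi)) = expC (Complex x y).
Proof. by rewrite /expC/= mulr_natl cosD2pi sinD2pi. Qed.

Lemma real_derive_eps (f : R -> R) (x l : R) : is_derive x (1 : R) f l ->
  forall e, 0 < e -> exists2 d, 0 < d &
    forall h, `|h| < d -> `|f (x + h) - f x - l * h| <= e * `|h|.
Proof.
move=> [df fl] e e0.
have /cvgrPdist_lt/(_ e e0) : h^-1 *: ((f \o shift x) (h *: 1) - f x) @[h --> 0^'] --> l.
  by rewrite -fl.
move=> /nbhs_ballP[d /= d0 hd]; exists d => // h hd'; have [->|h0] := eqVneq h 0.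
  by rewrite addr0 subrr mulr0 subr0 normr0 mulr0.
have := hd h; rewrite /ball/= sub0r normrN => /(_ hd' h0)/ltW.
have m0 : 0 < `|h| by rewrite normr_gt0.
rewrite -(ler_pM2r m0); apply: le_trans.
have -> : h *: (1 : R^o) = h by exact: mulr1.
rewrite -normrM -normrN mulrBl opprB /= (addrC h).
set A := f (x + h) - f x.
by rewrite -[h^-1 *: A]/(h^-1 * A) mulrAC mulVf// mul1r.
Qed.

Lemma cdiff_expC0 : cdiff expC 0 1.
Proof.
move=> e e0.
have [k k0 [k1 ke]] : exists2 k : R, 0 < k & k <= 1 /\ 7 * k <= e.
  exists (Num.min 1 (e / 7)); first by rewrite lt_min ltr01 divr_gt0.
  split; first by rewrite ge_min lexx.
  by rewrite mulrC -ler_pdivlMr// ge_min lexx orbT.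
have [d1 d10 h1] := @real_derive_eps expR 0 _ (is_derive_expR 0) k k0.
have [d2 d20 h2] := @real_derive_eps cos 0 _ (is_derive_cos 0) k k0.
have [d3 d30 h3] := @real_derive_eps sin 0 _ (is_derive_sin 0) k k0.
exists (Num.min (Num.min d1 (k / 2)) (Num.min d2 d3)).
  by rewrite !lt_min d10 d20 d30 divr_gt0.
move=> [x y]; rewrite !lt_min => /andP[/andP[m1 m4] /andP[m2 m3]].
have xm := le_Re_modulus (Complex x y); have ym := le_Im_modulus (Complex x y).
rewrite /= in xm ym; set m := modulus (Complex x y) in m1 m2 m3 m4 xm ym *.
have := h1 x (le_lt_trans xm m1); rewrite add0r expR0 mul1r => {}h1.
have := h2 y (le_lt_trans ym m2); rewrite add0r cos0 sin0 oppr0 mul0r subr0 => {}h2.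
have := h3 y (le_lt_trans ym m3); rewrite add0r cos0 sin0 mul1r subr0 => {}h3.
have m0 : 0 <= m by exact: modulus_ge0.
have kx : k * `|x| <= k * m by rewrite ler_wpM2l// ltW.
have ky : k * `|y| <= k * m by rewrite ler_wpM2l// ltW.
have km : m <= k / 2 by exact: ltW.
have e1 : `|expR x - 1| <= 2 * m.
  have -> : expR x - 1 = (expR x - 1 - x) + x by ring.
  apply: le_trans (ler_normD _ _) _; have : k * m <= 1 * m by rewrite ler_wpM2r.
  by lra.
have e2 : `|expR x| <= 2.
  have -> : expR x = (expR x - 1) + 1 by ring.
  by apply: le_trans (ler_normD _ _) _; rewrite normr1; lra.
rewrite add0r expC0 mul1r; apply: le_trans (le_modulus_ReIm _) _ => /=.
have -> : expR x * cos y - 1 - x = (expR x - 1 - x) + expR x * (cos y - 1) by ring.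
have -> : expR x * sin y - 0 - y = expR x * (sin y - y) + y * (expR x - 1) by ring.
have t1 : `|expR x * (cos y - 1)| <= 2 * (k * m).
  by rewrite normrM; apply: ler_pM => //; lra.
have t2 : `|expR x * (sin y - y)| <= 2 * (k * m).
  by rewrite normrM; apply: ler_pM => //; lra.
have t3 : `|y * (expR x - 1)| <= m * (2 * m) by rewrite normrM; apply: ler_pM.
have t4 : m * (2 * m) <= m * k by rewrite ler_wpM2l//; lra.
have := ler_normD (expR x - 1 - x) (expR x * (cos y - 1)).
have := ler_normD (expR x * (sin y - y)) (y * (expR x - 1)).
have : 7 * k * m <= e * m by rewrite ler_wpM2r.
have : 0 <= k * m by rewrite mulr_ge0// ltW.
by lra.
Qed.

Lemma cdiff_expC z : cdiff expC z (expC z).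
Proof.
move=> e e0.
have m0 : 0 < modulus (expC z) by rewrite modulus_expC expR_gt0.
have [d d0 hd] := cdiff_expC0 (divr_gt0 e0 m0).
exists d => // h /hd; rewrite add0r expC0 mul1r => H.
have -> : expC (z + h) - expC z - expC z * h = expC z * (expC h - 1 - h).
  by rewrite expCD; ring.
by rewrite modulusM -ler_pdivlMl// mulrA [_^-1 * _]mulrC.
Qed.

Lemma cdiff_affine_exp (a b w : C) z :
  exists l, cdiff (fun x => a + w * expC (b * x)) z l.
Proof.
have h1 := @cdiff_affine R 0 b z.
have h2 := cdiff_comp h1 (@cdiff_expC (0 + b * z)).
have := cdiff_comp h2 (@cdiff_affine R a w _).
have -> : (fun x => a + w * x) \o (expC \o (fun x => 0 + b * x)) =
    (fun x => a + w * expC (b * x)) by apply/funext => x /=; rewrite add0r.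
by move=> h; eexists; exact: h.
Qed.

End complex_exponential.

(** * Goursat's theorem on circles *)

Section segment_integral.
Variable R : realType.
Local Notation lam := (@lebesgue_measure R).
Implicit Types f g : R -> R.

Definition continuousR f : Prop := forall x e, 0 < e -> exists2 d, 0 < d &
  forall y, `|y - x| < d -> `|f y - f x| < e.

Lemma continuousRP f : continuousR f -> continuous f.
Proof.
move=> cf x; apply/cvgrPdist_lt => e e0; have [d d0 hd] := cf x e e0.
apply/nbhs_ballP; exists d => //= y; rewrite /ball/= => xy.
by rewrite distrC; apply: hd; rewrite distrC.
Qed.

Lemma integrable_continuousR f a b : continuousR f ->
  lam.-integrable `[a, b] (EFin \o f).
Proof.
move=> cf; apply: continuous_compact_integrable; first exact: segment_compact.
by apply: continuous_subspaceT; exact: continuousRP.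
Qed.

Lemma continuousRB f g : continuousR f -> continuousR g ->
  continuousR (fun x => f x - g x).
Proof.
move=> cf cg x e e0; have e2 : 0 < e / 2 by rewrite divr_gt0.
have [d1 d10 h1] := cf x _ e2; have [d2 d20 h2] := cg x _ e2.
exists (Num.min d1 d2); first by rewrite lt_min d10.
move=> y; rewrite lt_min => /andP[/h1 k1 /h2 k2].
have -> : f y - g y - (f x - g x) = (f y - f x) - (g y - g x) by ring.
by apply: le_lt_trans (ler_normB _ _) _; lra.
Qed.

Lemma continuousR_cst (c : R) : continuousR (fun=> c).
Proof. by move=> x e e0; exists 1 => // y _; rewrite subrr normr0. Qed.

Definition seg_int (a b : R) f : R := \int[lam]_(x in `[a, b]) f x.

Lemma seg_intB a b f g : continuousR f -> continuousR g ->
  seg_int a b (fun x => f x - g x) = seg_int a b f - seg_int a b g.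
Proof.
by move=> cf cg; rewrite /seg_int RintegralB//; exact: integrable_continuousR.
Qed.

Lemma seg_int_cst a b c : a <= b -> seg_int a b (fun=> c) = c * (b - a).
Proof.
move=> ab; rewrite /seg_int Rintegral_cst//.
rewrite -[fine _]/(fine (lebesgue_measure `[a, b])) lebesgue_measure_itv/= lte_fin.
by move: ab; rewrite le_eqVlt => /predU1P[->|->//]; rewrite ltxx subrr.
Qed.

Lemma seg_int_split a b c f : continuousR f -> a <= c -> c <= b ->
  seg_int a b f = seg_int a c f + seg_int c b f.
Proof.
move=> cf ac cb; have := @Rintegral_itvB R f (BLeft a) (BRight b) c.
move=> /(_ (integrable_continuousR _ _ cf)); rewrite !bnd_simp => /(_ ac cb).
rewrite Rintegral_itv_obnd_cbnd; last first.
  apply: integrableS (integrable_continuousR a b cf) => // x /=.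
  by rewrite !in_itv/= => /andP[/ltW cx ->]; rewrite (le_trans ac cx).
by rewrite /seg_int => <-; rewrite addrC subrK.
Qed.

Lemma seg_int_bound a b f M : continuousR f -> a <= b ->
  (forall x, a <= x <= b -> `|f x| <= M) -> `|seg_int a b f| <= M * (b - a).
Proof.
move=> cf ab fM.
have If := integrable_continuousR a b cf.
have Ic c := integrable_continuousR a b (continuousR_cst c).
rewrite ler_norml -mulNr -!seg_int_cst//; apply/andP; split.
  apply: le_Rintegral => // x /=; rewrite in_itv/= => /fM.
  by rewrite ler_norml => /andP[].
apply: le_Rintegral => // x /=; rewrite in_itv/= => /fM.
by rewrite ler_norml => /andP[].
Qed.

End segment_integral.

Section goursat.
Variable R : realType.
Local Notation C := R[i].
Variable g : C -> C.
Hypothesis dg : forall z, exists l, cdiff g z l.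
Let p x y : R := complex.Re (g (Complex x y)).
Let q x y : R := complex.Im (g (Complex x y)).

Let cont_slices (f : C -> R) : continuousC f ->
  (forall x, continuousR (fun y => f (Complex x y))) /\
  (forall y, continuousR (fun x => f (Complex x y))).
Proof.
move=> cf; split=> u v e e0.
  have [d d0 hd] := cf (Complex u v) e e0; exists d => // y h; apply: hd.
  by apply: le_lt_trans (le_modulus_ReIm _) _; rewrite /= subrr normr0 add0r.
have [d d0 hd] := cf (Complex v u) e e0; exists d => // y h; apply: hd.
by apply: le_lt_trans (le_modulus_ReIm _) _; rewrite /= subrr normr0 addr0.
Qed.

Let cp1 y : continuousR (p^~ y).
Proof. exact: (cont_slices (continuousC_Re dg)).2. Qed.
Let cp2 x : continuousR (p x).
Proof. exact: (cont_slices (continuousC_Re dg)).1. Qed.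
Let cq1 y : continuousR (q^~ y).
Proof. exact: (cont_slices (continuousC_Im dg)).2. Qed.
Let cq2 x : continuousR (q x).
Proof. exact: (cont_slices (continuousC_Im dg)).1. Qed.

(* the imaginary part of the contour integral of g along the boundary of the
   rectangle with lower left corner (a, c) and sides u, v *)
Let Psi (a c u v : R) : R :=
  seg_int a (a + u) (fun x => q x c - q x (c + v)) +
  seg_int c (c + v) (fun y => p (a + u) y - p a y).

Let PsiD a c u v : 0 <= u -> 0 <= v -> Psi a c u v =
  Psi a c (u / 2) (v / 2) + Psi (a + u / 2) c (u / 2) (v / 2) +
  (Psi a (c + v / 2) (u / 2) (v / 2) +
   Psi (a + u / 2) (c + v / 2) (u / 2) (v / 2)).
Proof.
move=> u0 v0; rewrite /Psi.
have hu : a + u / 2 + u / 2 = a + u by field.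
have hv : c + v / 2 + v / 2 = c + v by field.
rewrite !hu !hv !seg_intB//.
have su f : continuousR f -> seg_int a (a + u) f =
    seg_int a (a + u / 2) f + seg_int (a + u / 2) (a + u) f.
  by move=> cf; apply: seg_int_split => //; lra.
have sv f : continuousR f -> seg_int c (c + v) f =
    seg_int c (c + v / 2) f + seg_int (c + v / 2) (c + v) f.
  by move=> cf; apply: seg_int_split => //; lra.
rewrite (su _ (cq1 c)) (su _ (cq1 (c + v))) (sv _ (cp2 (a + u))) (sv _ (cp2 a)).
ring.
Qed.

Let Psi_local z e : 0 < e -> exists2 d, 0 < d & forall a c u v,
  0 <= u < d -> 0 <= v < d -> a <= complex.Re z <= a + u ->
  c <= complex.Im z <= c + v -> `|Psi a c u v| <= 2 * e * (u + v) ^+ 2.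
Proof.
case: z => x y e0 /=; have [[al be] dl] := dg (Complex x y).
have [d d0 hd] := dl _ e0.
exists (d / 2); first by rewrite divr_gt0.
move=> a c u v /andP[u0 ud] /andP[v0 vd] /andP[ax xa] /andP[cy yc].
have err s t : `|s - x| <= u -> `|t - y| <= v ->
  `|p s t - p x y - (al * (s - x) - be * (t - y))| <= e * (u + v) /\
  `|q s t - q x y - (be * (s - x) + al * (t - y))| <= e * (u + v).
  move=> su tv; pose h : C := Complex (s - x) (t - y).
  have hle : modulus h <= u + v.
    by apply: le_trans (le_modulus_ReIm _) _; rewrite lerD.
  have := hd h; move=> /(_ _)/wrap[]; first by apply: le_lt_trans hle _; lra.
  have -> : Complex x y + h = Complex s t.
    by apply: complex_eqP; rewrite ?ReD ?ImD/=; ring.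
  move=> H; have {}H : modulus (g (Complex s t) - g (Complex x y) - Complex al be * h) <= e * (u + v).
    by apply: le_trans H _; rewrite ler_wpM2l// ltW.
  split; apply: le_trans H.
    by apply: le_trans (le_Re_modulus _); rewrite !ReB ReM/= lexx.
  by apply: le_trans (le_Im_modulus _); rewrite !ImB ImM/= addrC [be * _ + _]addrC addrC lexx.
have M1 s : a <= s <= a + u -> `|s - x| <= u.
  by move=> /andP[h1 h2]; rewrite ler_norml; apply/andP; split; lra.
have M2 t : c <= t <= c + v -> `|t - y| <= v.
  by move=> /andP[h1 h2]; rewrite ler_norml; apply/andP; split; lra.
have aau : a <= a + u by lra.
have ccv : c <= c + v by lra.
(* the contour integral of the affine part vanishes *)
have -> : Psi a c u v =
    seg_int a (a + u) (fun s => q s c - q s (c + v) - (- (al * v))) +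
    seg_int c (c + v) (fun t => p (a + u) t - p a t - al * u).
  have cB1 := continuousRB (cq1 c) (cq1 (c + v)).
  have cB2 := continuousRB (cp2 (a + u)) (cp2 a).
  rewrite (seg_intB _ _ cB1 (continuousR_cst _)) (seg_intB _ _ cB2 (continuousR_cst _)).
  by rewrite !seg_int_cst// /Psi; ring.
have ca : a <= a <= a + u by rewrite lexx.
have cau : a <= a + u <= a + u by rewrite lexx andbT.
have cc : c <= c <= c + v by rewrite lexx.
have ccv' : c <= c + v <= c + v by rewrite lexx andbT.
apply: le_trans (ler_normD _ _) _.
have B1 : `|seg_int a (a + u) (fun s => q s c - q s (c + v) - (- (al * v)))| <=
    2 * (e * (u + v)) * (a + u - a).
  apply: seg_int_bound => //.
    by apply: continuousRB (continuousR_cst _); exact: continuousRB.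
  move=> s su; have [_ e1] := err s c (M1 _ su) (M2 _ cc).
  have [_ e2] := err s (c + v) (M1 _ su) (M2 _ ccv').
  rewrite (_ : _ - _ = (q s c - q x y - (be * (s - x) + al * (c - y))) -
    (q s (c + v) - q x y - (be * (s - x) + al * (c + v - y)))); last by ring.
  by apply: le_trans (ler_normB _ _) _; lra.
have B2 : `|seg_int c (c + v) (fun t => p (a + u) t - p a t - al * u)| <=
    2 * (e * (u + v)) * (c + v - c).
  apply: seg_int_bound => //.
    by apply: continuousRB (continuousR_cst _); exact: continuousRB.
  move=> t tv; have [e1 _] := err a t (M1 _ ca) (M2 _ tv).
  have [e2 _] := err (a + u) t (M1 _ cau) (M2 _ tv).
  rewrite (_ : _ - _ = (p (a + u) t - p x y - (al * (a + u - x) - be * (t - y))) -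
    (p a t - p x y - (al * (a - x) - be * (t - y)))); last by ring.
  by apply: le_trans (ler_normB _ _) _; lra.
by apply: le_trans (lerD B1 B2) _; rewrite le_eqVlt; apply/orP; left; apply/eqP; ring.
Qed.

Let Psi_step (s : R * R * (R * R)) : exists t : R * R * (R * R),
  0 <= s.2.1 -> 0 <= s.2.2 ->
  [/\ t.2 = (s.2.1 / 2, s.2.2 / 2),
     t.1.1 = s.1.1 \/ t.1.1 = s.1.1 + s.2.1 / 2,
     t.1.2 = s.1.2 \/ t.1.2 = s.1.2 + s.2.2 / 2 &
     `|Psi s.1.1 s.1.2 s.2.1 s.2.2| <= 4 * `|Psi t.1.1 t.1.2 t.2.1 t.2.2|].
Proof.
case: s => -[a c] [u v] /=.
have [[u0 v0]|h] := pselect (0 <= u /\ 0 <= v); last first.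
  by exists (a, c, (u, v)) => u0 v0; exfalso; exact: h.
have := PsiD a c u0 v0.
set P1 := Psi a c (u / 2) _; set P2 := Psi (a + _) c _ _.
set P3 := Psi a (c + _) _ _; set P4 := Psi (a + _) (c + _) _ _ => E.
have [h1|h1] := leP `|Psi a c u v| (4 * `|P1|).
  by exists (a, c, (u / 2, v / 2)); split; [by []|by left|by left|exact: h1].
have [h2|h2] := leP `|Psi a c u v| (4 * `|P2|).
  by exists (a + u / 2, c, (u / 2, v / 2)); split; [by []|by right|by left|exact: h2].
have [h3|h3] := leP `|Psi a c u v| (4 * `|P3|).
  by exists (a, c + v / 2, (u / 2, v / 2)); split; [by []|by left|by right|exact: h3].
exists (a + u / 2, c + v / 2, (u / 2, v / 2)); split; [by []|by right|by right|].
have := ler_normD (P1 + P2) (P3 + P4); rewrite -E.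
by have := ler_normD P1 P2; have := ler_normD P3 P4; rewrite -/P4; lra.
Qed.

(** Goursat: bisection produces nested rectangles on which the contour integral
    loses at most a factor 4, while differentiability at their common point
    makes it small compared to their area. *)
Let goursat_Psi a c u v : 0 <= u -> 0 <= v -> Psi a c u v = 0.
Proof.
move=> u0 v0; have [step hstep] := choice Psi_step.
pose s n := iter n step (a, c, (u, v)).
have s2 n : (s n).2 = (u / 2 ^+ n, v / 2 ^+ n) /\
    `|Psi a c u v| <= 4 ^+ n * `|Psi (s n).1.1 (s n).1.2 (s n).2.1 (s n).2.2|.
  elim: n => [|n [e1 e2]]; first by rewrite !expr0 !divr1 mul1r.
  have uv k (w : R) : 0 <= w -> 0 <= w / 2 ^+ k.
    by move=> w0; rewrite divr_ge0// exprn_ge0.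
  have := hstep (s n); rewrite e1 /= => /(_ (uv _ _ u0) (uv _ _ v0))[h1 _ _ h2].
  split; first by rewrite h1; congr (_, _); rewrite exprS invfM mulrA mulrAC.
  apply: le_trans e2 _; rewrite e1/= exprS mulrC -mulrA [4 ^+ n * _]mulrC mulrA.
  by rewrite ler_wpM2r ?exprn_ge0.
have hs n : (s n.+1).1.1 = (s n).1.1 \/ (s n.+1).1.1 = (s n).1.1 + u / 2 ^+ n / 2.
  have [e1 _] := s2 n; have := hstep (s n); rewrite e1 /=.
  by case=> //; rewrite divr_ge0// exprn_ge0.
have hs' n : (s n.+1).1.2 = (s n).1.2 \/ (s n.+1).1.2 = (s n).1.2 + v / 2 ^+ n / 2.
  have [e1 _] := s2 n; have := hstep (s n); rewrite e1 /=.
  by case=> //; rewrite divr_ge0// exprn_ge0.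
have nested (b : nat -> R) w : 0 <= w ->
    (forall n, b n.+1 = b n \/ b n.+1 = b n + w / 2 ^+ n / 2) ->
    exists x, forall n, b n <= x <= b n + w / 2 ^+ n.
  move=> w0 hb.
  have w0' n : 0 <= w / 2 ^+ n by rewrite divr_ge0// exprn_ge0.
  have wS n : w / 2 ^+ n.+1 = w / 2 ^+ n / 2 by rewrite exprS invfM mulrA mulrAC.
  have bd n k : b n <= b (n + k)%N /\ b (n + k)%N + w / 2 ^+ (n + k) <= b n + w / 2 ^+ n.
    elim: k => [|k [i1 i2]]; first by rewrite addn0.
    rewrite addnS wS; have := w0' (n + k)%N; move: i2.
    by case: (hb (n + k)%N) => ->; move: (w / _ ^+ (n + k)) => W; lra.
  have ub n : ubound (range b) (b n + w / 2 ^+ n).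
    move=> _ [k _ <-]; have [nk|/ltnW kn] := leqP n k.
      have [_] := bd n (k - n)%N; rewrite subnKC//; have := w0' k; lra.
    have [] := bd k (n - k)%N; rewrite subnKC//; have := w0' n; lra.
  exists (sup (range b)) => n; apply/andP; split.
    by apply: ub_le_sup; [exists (b 0%N + w / 2 ^+ 0)|exists n].
  by apply: ge_sup; [exists (b 0%N), 0%N|].
have [x hx] := nested (fun n => (s n).1.1) u u0 hs.
have [y hy] := nested (fun n => (s n).1.2) v v0 hs'.
have small e : 0 < e -> `|Psi a c u v| <= e * (2 * (u + v) ^+ 2).
  move=> e0; have [d d0 hd] := Psi_local (Complex x y) e0.
  have [n hn] : exists n, u / 2 ^+ n < d /\ v / 2 ^+ n < d.
    have : \forall n \near \oo, (u + v) * 2^-1 ^+ n < d.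
      have : (u + v) * 2^-1 ^+ n @[n --> \oo] --> (u + v) * 0.
        by apply: cvgMr; apply: cvg_expr; rewrite ger0_norm//; lra.
      rewrite mulr0 => /cvgrPdist_lt/(_ d d0); apply: filterS => n.
      by rewrite sub0r normrN; apply: le_lt_trans; exact: ler_norm.
    move=> [n _ /(_ n (leqnn n))] /= hn; exists n.
    have i0 : 0 <= (2^-1 : R) ^+ n by rewrite exprn_ge0// invr_ge0.
    rewrite -!exprVn; split; apply: le_lt_trans hn; rewrite ler_wpM2r//; lra.
  have [e1 e2] := s2 n; rewrite e1/= in e2; apply: le_trans e2 _.
  have w0 (w : R) : 0 <= w -> 0 <= w / 2 ^+ n by move=> w0; rewrite divr_ge0// exprn_ge0.
  have := hd _ _ (u / 2 ^+ n) (v / 2 ^+ n) _ _ (hx n) (hy n).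
  rewrite !w0//= hn.1 hn.2 => /(_ isT isT) H.
  have n4 : 0 < 4 ^+ n :> R by rewrite exprn_gt0.
  apply: le_trans (ler_wpM2l (ltW n4) H) _.
  rewrite -mulrDl expr_div_n -exprM mulnC exprM -[2 ^+ 2]/(2 * 2).
  rewrite (_ : 2 * 2 = 4 :> R); last ring.
  by rewrite le_eqVlt; apply/orP; left; apply/eqP; field; rewrite gt_eqF.
apply/eqP; rewrite -normr_le0; apply/ler_addgt0Pr => e e0; rewrite add0r.
set K := 2 * (u + v) ^+ 2 in small.
have K0 : 0 <= K by rewrite /K mulr_ge0// exprn_ge0// addr_ge0.
have K1 : 0 < K + 1 by lra.
apply: le_trans (small (e / (K + 1)) _) _; first by rewrite divr_gt0.
by rewrite mulrAC ler_pdivrMr// ler_wpM2l ?ltW//; lra.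
Qed.

(** For a function of period v along the imaginary axis the horizontal sides
    cancel, and the integral over a vertical period does not depend on the
    abscissa. *)
Lemma periodic_seg_int a u v : 0 <= u -> 0 <= v ->
  (forall x, g (Complex x v) = g (Complex x 0)) ->
  seg_int 0 v (fun y => complex.Re (g (Complex (a + u) y))) =
  seg_int 0 v (fun y => complex.Re (g (Complex a y))).
Proof.
move=> u0 v0 per; have := goursat_Psi a 0 u0 v0; rewrite /Psi add0r.
have -> : (fun x => q x 0 - q x v) = (fun=> 0).
  by apply/funext => x; rewrite /q per subrr.
rewrite seg_int_cst ?lerDl// mul0r add0r seg_intB// => /eqP.
by rewrite subr_eq0 => /eqP.
Qed.

End goursat.

Section circle_mean.
Variable R : realType.
Local Notation C := R[i].

(** The mean value property on circles: in the logarithmic coordinate the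
    circle around z of radius |w| becomes a vertical segment of length 2 pi,
    which can be moved to minus infinity, that is, to the centre. *)
Lemma circle_mean (f : C -> C) (z w : C) : (forall z, exists l, cdiff f z l) ->
  seg_int 0 (2 * pi) (fun t => complex.Re (f (z + w * expC (Complex 0 t)))) =
  2 * pi * complex.Re (f z).
Proof.
move=> df; pose g x := f (z + w * expC (1 * x)).
have dg x : exists l, cdiff g x l.
  have [k dk] := cdiff_affine_exp z 1 w x; have [l dl] := df (z + w * expC (1 * x)).
  by exists (l * k); exact: (cdiff_comp dk dl).
have per x : g (Complex x (2 * pi)) = g (Complex x 0).
  by rewrite /g !mul1r; have := expC_Im2pi x 0; rewrite add0r => ->.
have pi2 : 0 <= 2 * pi :> R by rewrite mulr_ge0// pi_ge0.
have cont x : continuousR (fun y => complex.Re (g (Complex x y))).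
  move=> y e e0; have [d d0 hd] := continuousC_Re dg (Complex x y) e0.
  exists d => // y' h; apply: hd; apply: le_lt_trans (le_modulus_ReIm _) _.
  by rewrite /= subrr normr0 add0r.
have -> : (fun t => complex.Re (f (z + w * expC (Complex 0 t)))) =
    (fun t => complex.Re (g (Complex 0 t))).
  by apply/funext => t; rewrite /g mul1r.
apply/eqP; rewrite -subr_eq0 -normr_le0; apply/ler_addgt0Pr => e e0; rewrite add0r.
have pi2' : 0 < 2 * pi :> R by rewrite mulr_gt0// pi_gt0.
have e1 : 0 < e / (2 * pi) by rewrite divr_gt0.
have [l dl] := df z; have [d d0 hd] := cdiff_continuous dl e1.
have [u [u0 hu]] : exists u, 0 <= u /\ modulus w * expR (- u) < d.
  exists (modulus w / d); split; first by rewrite divr_ge0 ?modulus_ge0// ltW.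
  rewrite expRN ltr_pdivrMr ?expR_gt0// -ltr_pdivrMl//.
  have := expR_ge1Dx (modulus w / d); rewrite mulrC; lra.
have := @periodic_seg_int _ g dg (- u) u _ u0 pi2 per; rewrite addNr => ->.
have -> : 2 * pi * complex.Re (f z) = seg_int 0 (2 * pi) (fun=> complex.Re (f z)).
  by rewrite seg_int_cst// subr0 mulrC.
rewrite -seg_intB//; last exact: continuousR_cst.
have -> : e = e / (2 * pi) * (2 * pi - 0) by rewrite subr0 divfK// gt_eqF.
apply: seg_int_bound => //; first exact: continuousRB (continuousR_cst _).
move=> y _; rewrite -ReB; apply: le_trans (le_Re_modulus _) _; apply/ltW/hd.
by rewrite mul1r addrC addKr modulusM modulus_expC.
Qed.

End circle_mean.

(** * Mean values of entire functions *)

Section disk_average.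
Variable R : realType.
Local Notation C := R[i].
Local Notation m := (@lebesgueC R).
Local Notation lam := (@lebesgue_measure R).
Local Notation kap := (disk_area R).
Local Open Scope ereal_scope.

Let lebesgueC_sigma_finite : sigma_finite [set: C] m.
Proof.
exists (fun n => disk 0%R n%:R).
  apply/esym/seteqP; split => // z _; exists (Num.truncn (modulus z)).+1 => //.
  by rewrite /disk/= subr0 truncnS_gt.
by move=> n; split; [exact: measurable_disk|rewrite lebesgueC_disk ?ltry].
Qed.

HB.instance Definition _ :=
  @Measure_isSigmaFinite.Build _ _ _ m lebesgueC_sigma_finite.

Lemma integral_disk_cst (z : C) r c : (0 <= r)%R ->
  \int[m]_(w in disk z r) c%:E = (c * (kap * r ^+ 2))%:E.
Proof.
move=> r0; rewrite integral_cst; last exact: measurable_disk.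
by rewrite EFinM; congr (_ * _); exact: lebesgueC_disk.
Qed.

Lemma seg_int_EFin a b (f : R -> R) : continuousR f ->
  \int[lam]_(x in `[a, b]) (f x)%:E = (seg_int a b f)%:E.
Proof.
by move=> cf; rewrite /seg_int fineK//; apply: integrable_fin_num => //;
  exact: integrable_continuousR.
Qed.

Let polar (z w : C) (t : R) : C := (z + w * expC (Complex 0%R t))%R.

Let measurable_polar z : measurable_fun [set: C * R] (fun p => polar z p.1 p.2).
Proof.
have mc : measurable_fun [set: C * R] (fun p : C * R => cos p.2).
  by apply: measurableT_comp => //; apply: continuous_measurable_fun; exact: continuous_cos.
have ms : measurable_fun [set: C * R] (fun p : C * R => sin p.2).
  by apply: measurableT_comp => //; apply: continuous_measurable_fun; exact: continuous_sin.
have mr : measurable_fun [set: C * R] (fun p : C * R => complex.Re p.1).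
  by apply: measurableT_comp => //; exact: measurable_Re.
have mi : measurable_fun [set: C * R] (fun p : C * R => complex.Im p.1).
  by apply: measurableT_comp => //; exact: measurable_Im.
have -> : (fun p => polar z p.1 p.2) = (fun p : C * R => Complex
    (complex.Re z + (complex.Re p.1 * cos p.2 - complex.Im p.1 * sin p.2))%R
    (complex.Im z + (complex.Re p.1 * sin p.2 + complex.Im p.1 * cos p.2))%R).
  apply/funext => -[w t]; apply: complex_eqP.
    by rewrite /polar ReD ReM/= expR0 !mul1r.
  by rewrite /polar ImD ImM/= expR0 !mul1r.
by apply: measurable_pair_complex; apply: measurable_funD => //;
  [apply: measurable_funB|apply: measurable_funD]; exact: measurable_funM.
Qed.

(** Rotation invariance lets one average over all rotations around the centre,
    so that Fubini turns circular means into means over the disk, without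
    polar coordinates. *)
Lemma disk_average (F : C -> R) z s : measurable_fun [set: C] F ->
  (forall w, (0 <= F w)%R) ->
  (2 * pi)%:E * \int[m]_(w in disk z s) (F w)%:E =
  \int[m]_(w in disk 0%R s)
    \int[lam]_(t in `[0%R, (2 * pi)%R]) (F (z + w * expC (Complex 0%R t))%R)%:E.
Proof.
move=> mF F0.
have pi2 : (0 <= 2 * pi :> R)%R by rewrite mulr_ge0// pi_ge0.
pose I : set R := `[0%R, (2 * pi)%R]%classic.
have mI : measurable I by exact: measurable_itv.
pose h (p : C * R) : \bar R :=
  (\1_(disk (0%R : C) s) p.1 * \1_I p.2 * F (polar z p.1 p.2))%:E.
have mh : measurable_fun [set: C * R] h.
  apply/measurable_EFinP; apply: measurable_funM; first apply: measurable_funM.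
  - have mD : measurable_fun [set: C] (\1_(disk (0%R : C) s) : C -> R).
      by apply: measurable_indic; exact: measurable_disk.
    exact: measurableT_comp mD measurable_fst.
  - have mI' : measurable_fun [set: R] (\1_I : R -> R) by exact: measurable_indic.
    exact: measurableT_comp mI' measurable_snd.
  - by apply: (measurableT_comp mF); exact: measurable_polar.
have h0 p : 0 <= h p by rewrite lee_fin !mulr_ge0.
have -> : \int[m]_(w in disk 0%R s) \int[lam]_(t in `[0%R, (2 * pi)%R])
    (F (z + w * expC (Complex 0%R t))%R)%:E = \int[m]_w \int[lam]_t h (w, t).
  rewrite integral_mkcond; apply: eq_integral => w _; rewrite patchE.
  case: ifPn => wD.
    rewrite integral_mkcond; apply: eq_integral => t _; rewrite patchE /h/=.
    by rewrite indicE wD mul1r indicE; case: ifPn; rewrite ?mul1r ?mul0r.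
  apply/esym; apply: integral0_eq => t _.
  by rewrite /h/= indicE (negbTE wD) !mul0r.
transitivity (\int[lam]_t \int[m]_w h (w, t)); last first.
  exact: (esym (@fubini_tonelli _ _ _ _ R m lam h mh h0)).
transitivity (\int[lam]_t ((\1_I t)%:E * \int[m]_(w in disk z s) (F w)%:E)).
  rewrite ge0_integralZr//; last 2 first.
  - exact/measurable_EFinP/measurable_indic.
  - by apply: integral_ge0 => w _; rewrite lee_fin.
  rewrite integral_indic// setIT; congr (_ * _).
  rewrite -[RHS]/(lebesgue_measure `[0%R, (2 * pi)%R]) lebesgue_measure_itv/= lte_fin.
  by move: pi2; rewrite le_eqVlt => /predU1P[<-|->]; rewrite ?ltxx// oppr0 addr0.
apply: eq_integral => t _.
pose G (w : C) : \bar R := (\1_(disk (0%R : C) s) w * F (z + w)%R)%:E.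
have mG : measurable_fun [set: C] G.
  apply/measurable_EFinP; apply: measurable_funM.
    by apply: measurable_indic; exact: measurable_disk.
  apply: (measurableT_comp mF); have := @measurable_translateC R z.
  by congr measurable_fun; apply/funext => w; rewrite addrC.
have G0 w : 0 <= G w by rewrite lee_fin mulr_ge0.
have l1 : modulus (expC (Complex 0%R t)) = 1%R by rewrite modulus_expC expR0.
transitivity ((\1_I t)%:E * \int[m]_w G w).
  congr (_ * _); rewrite integral_mkcond.
  pose H := (fun w => (F w)%:E) \_ (disk z s).
  have mH : measurable_fun [set: C] H.
    apply/(measurable_restrictT _ _).1; first exact: measurable_disk.
    by apply: measurable_funTS; exact/measurable_EFinP.
  have H0 w : 0 <= H w by rewrite /H patchE; case: ifPn => // _; rewrite lee_fin.
  rewrite -/H -(integral_translateC z mH H0).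
  apply: eq_integral => w _; rewrite /H patchE /G indicE addrC.
  have -> : ((z + w)%R \in disk z s) = (w \in disk 0%R s).
    by apply/idP/idP; rewrite !inE /disk/= subr0 addrC addKr.
  by case: ifPn; rewrite ?mul1r ?mul0r.
rewrite -(integral_rotation mG G0 l1) -ge0_integralZl//; last first.
  by apply: (measurableT_comp mG); exact: measurable_scaleC.
apply: eq_integral => w _; rewrite /G/h/= -EFinM; congr EFin.
have -> : \1_(disk (0%R : C) s) (expC (Complex 0%R t) * w)%R = \1_(disk (0%R : C) s) w :> R.
  by rewrite !indicE; congr (nat_of_bool _)%:R; apply/idP/idP;
    rewrite !inE /disk/= !subr0 modulusM l1 mul1r.
by rewrite /polar mulrCA mulrA (mulrC w).
Qed.

End disk_average.

Section local_estimates.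
Variable R : realType.
Local Notation C := R[i].
Local Notation m := (@lebesgueC R).
Local Notation lam := (@lebesgue_measure R).
Local Notation kap := (disk_area R).
Variable f : C -> C.
Hypothesis df : forall z, exists l, cdiff f z l.

Let pi2 : 0 < 2 * pi :> R. Proof. by rewrite mulr_gt0// pi_gt0. Qed.

Let expC_continuous x e : 0 < e -> exists2 d, 0 < d &
  forall y, `|y - x| < d -> modulus (expC (Complex 0 y) - expC (Complex 0 x)) < e :> R.
Proof.
move=> e0; have [d d0 hd] := cdiff_continuous (@cdiff_expC R (Complex 0 x)) e0.
exists d => // y xy; apply: hd; apply: le_lt_trans (le_modulus_ReIm _) _.
by rewrite /= subrr normr0 add0r.
Qed.

Lemma continuousR_circle (F : C -> R) (z w : C) : continuousC F ->
  continuousR (fun t => F (z + w * expC (Complex 0 t))).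
Proof.
move=> cF x e e0; have [d d0 hd] := cF (z + w * expC (Complex 0 x)) e e0.
have M0 : 0 < modulus w + 1 by have := modulus_ge0 w; lra.
have [d' d'0 hd'] := expC_continuous x (divr_gt0 d0 M0).
exists d' => // y /hd' H; apply: hd.
rewrite opprD addrACA subrr add0r -mulrBr modulusM.
apply: (@le_lt_trans _ _ ((modulus w + 1) * modulus (expC (Complex 0 y) - expC (Complex 0 x)))).
  by rewrite ler_wpM2r ?modulus_ge0//; lra.
by rewrite mulrC -ltr_pdivlMr.
Qed.

Let continuousRZ (k : R) (F : R -> R) : continuousR F -> continuousR (fun t => k * F t).
Proof.
move=> cF x e e0; have M0 : 0 < `|k| + 1 by have := normr_ge0 k; lra.
have [d d0 hd] := cF x _ (divr_gt0 e0 M0); exists d => // y /hd.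
rewrite ltr_pdivlMr// -mulrBr normrM; apply: le_lt_trans.
by rewrite mulrC; apply: ler_wpM2l => //; lra.
Qed.

Lemma continuousC_sqr (F : C -> R) : continuousC F -> continuousC (fun z => F z ^+ 2).
Proof.
move=> cF z e e0; set M := `|F z| *+ 2 + 1.
have M0 : 0 < M by rewrite /M mulr2n; have := normr_ge0 (F z); lra.
have k0 : 0 < Num.min 1 (e / M) by rewrite lt_min ltr01 divr_gt0.
have [d d0 hd] := cF z _ k0; exists d => // w /hd; rewrite lt_min => /andP[h1 h2].
rewrite subr_sqr normrM; apply: (@le_lt_trans _ _ (`|F w - F z| * M)).
  apply: ler_wpM2l => //; rewrite /M mulr2n.
  have := ler_normD (F w - F z) (F z + F z); rewrite addrA subrK.
  by have := ler_normD (F z) (F z); lra.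
by rewrite -ltr_pdivlMr.
Qed.

Let sq_mean (g : C -> C) z s : (forall z, exists l, cdiff g z l) -> 0 <= s ->
  ((kap * s ^+ 2 * complex.Re (g z) ^+ 2)%:E <=
   \int[m]_(w in disk z s) (complex.Re (g w) ^+ 2)%:E)%E.
Proof.
move=> dg s0; have cR := continuousC_Re dg.
have cR2 := continuousC_sqr cR.
have e2 : (0 < (2 * pi : R)%:E)%E by rewrite lte_fin.
rewrite -(lee_pmul2l _ e2)//.
have mF : measurable_fun [set: C] (fun w => complex.Re (g w) ^+ 2).
  exact: measurable_continuousC.
rewrite (disk_average z s mF (fun w => sqr_ge0 _)).
apply: (@le_trans _ _ (\int[m]_(w in disk 0%R s) (2 * pi * complex.Re (g z) ^+ 2)%:E)%E).
  rewrite integral_disk_cst//.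
  by rewrite -!EFinM lee_fin le_eqVlt; apply/orP; left; apply/eqP; ring.
apply: ge0_le_integral_any => w wD.
  by rewrite lee_fin mulr_ge0 ?sqr_ge0// ltW.
rewrite (@seg_int_EFin _ _ _ (fun t => complex.Re (g (z + w * expC (Complex 0 t))) ^+ 2)); last first.
  exact: (continuousR_circle (F := fun z => complex.Re (g z) ^+ 2)).
rewrite lee_fin.
set u := complex.Re (g z); set F := fun t => complex.Re (g (z + w * expC (Complex 0 t))).
have cF : continuousR F by exact: (continuousR_circle (F := fun z => complex.Re (g z))).
have IF := integrable_continuousR 0 (2 * pi) cF.
have cF2 : continuousR (fun t => F t ^+ 2).
  exact: (continuousR_circle (F := fun z => complex.Re (g z) ^+ 2)).
have IF2 := integrable_continuousR 0 (2 * pi) cF2.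
have -> : 2 * pi * u ^+ 2 = seg_int 0 (2 * pi) (fun t => 2 * u * F t - u ^+ 2).
  rewrite seg_intB; last 2 first.
  - exact: continuousRZ.
  - exact: continuousR_cst.
  rewrite seg_int_cst ?ltW// subr0 /seg_int RintegralZl//.
  by rewrite -/(seg_int 0 (2 * pi) F) circle_mean// -/u; ring.
apply: le_Rintegral => //.
  by apply/integrable_continuousR/continuousRB; [exact: continuousRZ|exact: continuousR_cst].
move=> t _; have := sqr_ge0 (F t - u); rewrite sqrrB mulrC -mulr_natl; lra.
Qed.

Let df_mul (c : C) z : exists l, cdiff (fun x => c * f x) z l.
Proof.
have [l dl] := df z; eexists; exact: (cdiff_mul (cdiff_cst c z) dl).
Qed.

(** The square of the mean is at most the mean of the square on each circle,
    hence on disks. *)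
Lemma disk_mean_sqr z s : 0 <= s ->
  ((kap * s ^+ 2 * modulus (f z) ^+ 2)%:E <=
   \int[m]_(w in disk z s) (modulus (f w) ^+ 2)%:E)%E.
Proof.
move=> s0; pose g x := (- 'i%C) * f x.
have gI x : complex.Re (g x) = complex.Im (f x).
  by rewrite /g ReM/= oppr0 mul0r sub0r mulN1r opprK.
have dg : forall z, exists l, cdiff g z l by move=> x; exact: df_mul.
have m1 : measurable_fun [set: C] (fun w => (complex.Re (f w) ^+ 2)%:E).
  by apply/measurable_EFinP; apply: measurable_continuousC; exact/continuousC_sqr/continuousC_Re.
have m2 : measurable_fun [set: C] (fun w => (complex.Re (g w) ^+ 2)%:E).
  by apply/measurable_EFinP; apply: measurable_continuousC; exact/continuousC_sqr/continuousC_Re.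
have mD := @measurable_disk R z s.
have -> : (\int[m]_(w in disk z s) (modulus (f w) ^+ 2)%:E =
    \int[m]_(w in disk z s) (complex.Re (f w) ^+ 2)%:E +
    \int[m]_(w in disk z s) (complex.Re (g w) ^+ 2)%:E)%E.
  rewrite -ge0_integralD//; last 4 first.
  - by move=> x _; rewrite lee_fin sqr_ge0.
  - exact: measurable_funTS.
  - by move=> x _; rewrite lee_fin sqr_ge0.
  - exact: measurable_funTS.
  by apply: eq_integral => x _; rewrite -EFinD gI modulus_sqr.
rewrite modulus_sqr mulrDr EFinD; apply: leeD; first exact: sq_mean.
by rewrite -gI; exact: sq_mean.
Qed.

(** Harnack's inequality for the positive harmonic function M + Re (c f): the
    mean over a disk is compared with the mean over a slightly larger disk
    around the other point. *)
Lemma entire_lipschitz z w s M : 0 < s -> modulus (w - z) <= s ->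
  (forall x, modulus (x - z) < 3 * s -> modulus (f x) <= M) ->
  modulus (f w - f z) <= 6 * M * modulus (w - z) / s.
Proof.
move=> s0; set t := modulus (w - z) => ts fM.
have t0 : 0 <= t by exact: modulus_ge0.
have M0 : 0 <= M by apply: le_trans (fM z _); rewrite ?subrr ?modulus0 ?modulus_ge0//; lra.
pose c : C := - (f w - f z)^*%C / (modulus (f w - f z))%:C%C.
have [fwz|fwz] := eqVneq (f w - f z) 0.
  by rewrite fwz modulus0 mulr_ge0 ?invr_ge0 ?(ltW s0)// !mulr_ge0.
have n0 : (modulus (f w - f z)) != 0 by rewrite modulus_eq0.
have c1 : modulus c = 1.
  by rewrite /c modulusM modulusN modulusJ modulusV modulus_real ger0_norm ?modulus_ge0// divff.
pose u x := complex.Re (c * f x).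
have uwz : u z - u w = modulus (f w - f z).
  rewrite /u -ReB -mulrBr -opprB mulrN -mulNr /c !mulNr opprK mulrAC [_^*%C * _]mulrC mulJ.
  by rewrite -(fmorphV (real_complex R)) -rmorphM/= expr2 mulfK.
have um x : modulus (x - z) < 3 * s -> `|u x| <= M.
  by move=> /fM h; apply: le_trans (le_Re_modulus _) _; rewrite modulusM c1 mul1r.
pose F x := Num.max 0 (M + u x).
have cu : continuousC u by apply: continuousC_Re => x; exact: df_mul.
have F0 x : 0 <= F x by rewrite le_max lexx.
have FE x : modulus (x - z) < 3 * s -> F x = M + u x.
  by move=> /um; rewrite ler_norml => /andP[h _]; apply/max_idPr; lra.
have mF : measurable_fun [set: C] F.
  apply: measurable_maxr => //; apply: measurable_funD => //.
  exact: measurable_continuousC.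
have avg x r : 0 <= r -> modulus (x - z) + r <= 3 * s ->
    (\int[m]_(w in disk x r) (F w)%:E = (kap * r ^+ 2 * (M + u x))%:E)%E.
  move=> r0 hr; have e2 : (0 < (2 * pi : R)%:E)%E by rewrite lte_fin.
  suff : ((2 * pi)%:E * \int[m]_(w in disk x r) (F w)%:E =
      (2 * pi)%:E * (kap * r ^+ 2 * (M + u x))%:E)%E.
    by move=> E; apply: le_anti; apply/andP; split; rewrite -(lee_pmul2l _ e2)// E.
  rewrite (disk_average x r mF F0).
  transitivity (\int[m]_(w in disk 0%R r) (2 * pi * (M + u x))%:E)%E; last first.
    rewrite integral_disk_cst//.
    by rewrite -!EFinM; congr EFin; ring.
  apply: eq_integral => y /set_mem; rewrite /disk/= subr0 => yr.
  have yin t' : modulus (x + y * expC (Complex 0 t') - z) < 3 * s.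
    apply: lt_le_trans hr; rewrite addrAC; apply: le_lt_trans (modulusD _ _) _.
    by rewrite ltrD2l modulusM modulus_expC expR0 mulr1.
  transitivity (\int[lam]_(t in `[0%R, (2 * pi)%R])
      (M + u (x + y * expC (Complex 0%R t)))%:E)%E.
    by apply: eq_integral => t' _; rewrite FE.
  rewrite (@seg_int_EFin _ _ _ (fun t => M + u (x + y * expC (Complex 0 t)))); last first.
    apply: (continuousR_circle (F := fun y => M + u y)) => v e e0.
    by have [d d0 hd] := cu v e e0; exists d => // v' /hd; rewrite opprD addrACA subrr add0r.
  congr EFin; transitivity (seg_int 0 (2 * pi) (fun t => u (x + y * expC (Complex 0 t)) - (- M))).
    by congr seg_int; apply/funext => t'; rewrite opprK addrC.
  rewrite seg_intB; last 2 first.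
  - exact: continuousR_circle.
  - exact: continuousR_cst.
  rewrite seg_int_cst ?ltW// subr0 (circle_mean (f := fun x => c * f x)); first by rewrite /u; ring.
  by move=> v; exact: df_mul.
have wz : modulus (z - w) = t by rewrite modulusB.
have st0 : 0 <= s + t by rewrite addr_ge0// ltW.
have A1 := avg z s (ltW s0); rewrite subrr modulus0 add0r in A1.
have A2 := avg w (s + t) st0.
have K0 := disk_area_gt0 R.
have : kap * s ^+ 2 * (M + u z) <= kap * (s + t) ^+ 2 * (M + u w).
  rewrite -lee_fin -A1 -?A2; last 2 first.
  - by rewrite -/t; lra.
  - by lra.
  apply: ge0_subset_integral; try exact: measurable_disk.
  - exact/measurable_EFinP/measurable_funTS.
  - by move=> x _; rewrite lee_fin.
  move=> x; rewrite /disk/= => xz.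
  rewrite (_ : x - w = (x - z) + (z - w)); last by ring.
  by apply: le_lt_trans (modulusD _ _) _; rewrite wz ltrD2r.
move=> H'; have H : s ^+ 2 * (M + u z) <= (s + t) ^+ 2 * (M + u w).
  by move: H'; rewrite -!(mulrA kap) ler_pM2l.
have uw : M + u w <= 2 * M.
  have /um : modulus (w - z) < 3 * s by rewrite -/t; lra.
  by rewrite ler_norml => /andP[_]; lra.
have uw0 : 0 <= M + u w by rewrite -FE// -/t; lra.
rewrite -uwz ler_pdivlMr// -(ler_pM2r s0).
have -> : (u z - u w) * s * s = s ^+ 2 * (M + u z) - s ^+ 2 * (M + u w) by ring.
apply: (@le_trans _ _ (((s + t) ^+ 2 - s ^+ 2) * (M + u w))); first by rewrite mulrBl; lra.
have -> : (s + t) ^+ 2 - s ^+ 2 = t * (2 * s + t) by ring.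
apply: (@le_trans _ _ (t * (3 * s) * (2 * M))); last by rewrite le_eqVlt; apply/orP; left; apply/eqP; ring.
by apply: ler_pM => //; [rewrite mulr_ge0//; lra|rewrite ler_wpM2l//; lra].
Qed.

End local_estimates.

(** * Positive definite kernels *)

Section psd_kernels.
Variables (R : realType) (T : Type).
Local Notation C := R[i].
Implicit Types (K L : T -> T -> C) (x y a : T).

Definition quad_form K (s : seq (C * T)) : C :=
  \sum_(u <- s) \sum_(v <- s) u.1 * K u.2 v.2 * v.1^*%C.

Definition psd K : Prop := (forall x y, K y x = (K x y)^*%C) /\
  forall s, 0 <= complex.Re (quad_form K s).

Lemma Re_sum (I : Type) (s : seq I) (F : I -> C) :
  complex.Re (\sum_(i <- s) F i) = \sum_(i <- s) complex.Re (F i).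
Proof. by elim/big_ind2: _ => // x1 x2 y1 y2 <- <-; rewrite ReD. Qed.

Lemma conjc_sum (I : Type) (s : seq I) (F : I -> C) :
  (\sum_(i <- s) F i)^*%C = \sum_(i <- s) (F i)^*%C.
Proof. exact: rmorph_sum. Qed.

Lemma psd_diag K x : psd K -> K x x = (complex.Re (K x x))%:C%C.
Proof.
move=> [h _]; apply: complex_eqP => //=; have := h x x.
by move=> /(congr1 (@complex.Im R)); rewrite ImJ; lra.
Qed.

Lemma psd_diag_ge0 K x : psd K -> 0 <= complex.Re (K x x).
Proof.
move=> [_ /(_ [:: (1, x)])]; by rewrite /quad_form !big_seq1 rmorph1 mulr1 mul1r.
Qed.

Lemma quad_form2 K (c d : C) x y : psd K ->
  complex.Re (quad_form K [:: (c, x); (d, y)]) =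
  modulus c ^+ 2 * complex.Re (K x x) + modulus d ^+ 2 * complex.Re (K y y) +
  2 * complex.Re (c * K x y * d^*%C).
Proof.
move=> pK; rewrite /quad_form !big_cons !big_nil !addr0/= !ReD.
rewrite (pK.1 x y).
have e z u : psd K -> complex.Re (z * K u u * z^*%C) = modulus z ^+ 2 * complex.Re (K u u).
  by move=> _; rewrite (psd_diag u pK) mulrAC mulJ ReM/= mul0r subr0.
rewrite !e//; have -> : complex.Re (d * (K x y)^*%C * c^*%C) = complex.Re (c * K x y * d^*%C).
  rewrite -[LHS]ReJ !rmorphM/= !conjcK; congr complex.Re; ring.
ring.
Qed.

Lemma psd_CauchySchwarz K x y : psd K ->
  modulus (K x y) ^+ 2 <= complex.Re (K x x) * complex.Re (K y y).
Proof.
move=> pK; have k1 := psd_diag_ge0 x pK; have k2 := psd_diag_ge0 y pK.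
have rr (k : R) : complex.Re (k%:C%C * K x y * (- K x y)^*%C) = - (k * modulus (K x y) ^+ 2).
  rewrite -mulrA rmorphN mulrN mulJ -rmorphN -rmorphM/= ; ring.
have rr' (k : R) : complex.Re (- K x y * K x y * (k%:C%C)^*%C) = complex.Re (- K x y * K x y * (k%:C%C)).
  by rewrite conjc_real.
have H := pK.2 [:: ((complex.Re (K y y))%:C%C, x); (- K x y, y)].
rewrite quad_form2// modulus_real modulusN rr real_normK ?num_real// in H.
have H' := pK.2 [:: (- (K x y)^*%C, x); ((complex.Re (K x x))%:C%C, y)].
rewrite quad_form2// modulus_real modulusN modulusJ real_normK ?num_real// conjc_real in H'.
have rr2 (k : R) : complex.Re (- (K x y)^*%C * K x y * k%:C%C) = - (k * modulus (K x y) ^+ 2).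
  rewrite mulNr [_^*%C * _]mulrC mulJ -rmorphN -rmorphM/=; ring.
rewrite rr2 in H'.
have H0 := pK.2 [:: (1, x); (- K x y, y)].
rewrite quad_form2// modulus1 modulusN (rr 1) in H0.
move: k1 k2 H H' H0; set k := complex.Re (K x x); set l := complex.Re (K y y).
set r := modulus (K x y) ^+ 2 => k0 l0 H H' H0.
have r0 : 0 <= r by exact: sqr_ge0.
have [l1|l1] := ltP 0 l.
  have : 0 <= l * (k * l - r) by lra.
  by rewrite pmulr_rge0//; lra.
have [k1|k1] := ltP 0 k.
  have : 0 <= k * (k * l - r) by lra.
  by rewrite pmulr_rge0//; lra.
have e1 : k = 0 by lra.
have e2 : l = 0 by lra.
by rewrite e1 e2 in H0 *; lra.
Qed.

Definition schur K a x y : C := K x y - K x a * K a y / K a a.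

Lemma psd_schur K a : psd K -> psd (schur K a).
Proof.
move=> pK; split=> [x y|s].
  rewrite /schur rmorphB rmorphM rmorphM fmorphV/= -(pK.1 x y) -(pK.1 x a) -(pK.1 a y) -(pK.1 a a).
  by rewrite [K y a * _]mulrC.
pose S := \sum_(u <- s) u.1 * K u.2 a.
have SJ : S^*%C = \sum_(u <- s) K a u.2 * u.1^*%C.
  rewrite conjc_sum; apply: eq_bigr => u _; rewrite rmorphM/= mulrC; congr (_ * _).
  by rewrite -(pK.1 u.2 a).
have Q : quad_form (schur K a) s = quad_form K s - S * S^*%C / K a a.
  rewrite /quad_form SJ /S mulr_suml mulr_suml -sumrB; apply: eq_bigr => u _.
  rewrite mulr_sumr mulr_suml -sumrB; apply: eq_bigr => v _.
  by rewrite /schur; ring.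
have kr : (K a a)^*%C = K a a by rewrite -(pK.1 a a).
have := pK.2 ((- (S / K a a), a) :: s); suff -> : quad_form K ((- (S / K a a), a) :: s) =
  quad_form (schur K a) s by [].
rewrite Q /quad_form big_cons !big_cons/=.
have -> : \sum_(v <- s) - (S / K a a) * K a v.2 * v.1^*%C = - (S / K a a) * S^*%C.
  by rewrite SJ mulr_sumr; apply: eq_bigr => v _; rewrite mulrA.
have -> : \sum_(u <- s) \sum_(v <- (- (S / K a a), a) :: s) u.1 * K u.2 v.2 * v.1^*%C =
   S * (- (S / K a a))^*%C + \sum_(u <- s) \sum_(v <- s) u.1 * K u.2 v.2 * v.1^*%C.
  move: (- (S / K a a)) => b; rewrite /S mulr_suml -big_split/=.
  by apply: eq_bigr => u _; rewrite big_cons.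
rewrite rmorphN rmorphM fmorphV/= kr.
have [k0|k0] := eqVneq (K a a) 0; first by rewrite k0 invr0; ring.
by field.
Qed.

Lemma psd_eq0 K a x : psd K -> K a a = 0 -> K a x = 0.
Proof.
move=> pK k0; have := psd_CauchySchwarz a x pK; rewrite k0/= mul0r => h.
apply/eqP; rewrite -modulus_eq0 -sqrf_eq0 eq_le h sqr_ge0//.
Qed.

End psd_kernels.

Section kernel_determinants.
Variable R : realType.
Local Notation C := R[i].
Implicit Types (K L : C -> C -> C) (zs : seq C).

Lemma kernel_det_nil K : kernel_det K [::] = 1.
Proof. by rewrite /kernel_det det_mx00. Qed.

(** Schur complement with respect to the first point. *)
Lemma kernel_det_cons K a zs : psd K ->
  kernel_det K (a :: zs) = complex.Re (K a a) * kernel_det (schur K a) zs.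
Proof.
move=> pK; rewrite /kernel_det; set n := size zs.
pose M : 'M[C]_(1 + n) := \matrix_(i, j) K (nth 0 (a :: zs) i) (nth 0 (a :: zs) j).
pose D : 'M[C]_n := \matrix_(i, j) schur K a (nth 0 zs i) (nth 0 zs j).
suff h : \det M = K a a * \det D.
  rewrite -[X in complex.Re X = _]/(\det M) h (psd_diag a pK) ReM/= mul0r subr0.
  by congr (_ * _).
have [k0|k0] := eqVneq (K a a) 0.
  rewrite k0 mul0r (expand_det_row _ ord0) big1// => j _.
  have -> : M ord0 j = 0 by rewrite mxE; exact: psd_eq0.
  by rewrite mul0r.
pose c : 'M[C]_(n, 1) := \matrix_(i, j) K (nth 0 zs i) a.
pose r : 'M[C]_(1, n) := \matrix_(i, j) K a (nth 0 zs j).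
pose B : 'M[C]_n := \matrix_(i, j) K (nth 0 zs i) (nth 0 zs j).
have ME : M = block_mx (K a a)%:M r c B.
  apply/matrixP => i j.
  case: (split_ordP i) => i' ->; case: (split_ordP j) => j' ->;
    by rewrite ?block_mxEul ?block_mxEur ?block_mxEdl ?block_mxEdr !mxE/= ?ord1.
pose L : 'M[C]_(1 + n) := block_mx 1%:M 0 (- (K a a)^-1 *: c) 1%:M.
have detL : \det L = 1 by rewrite det_lblock !det1 mulr1.
rewrite -[LHS]mul1r -detL -det_mulmx ME mulmx_block !mul1mx !mul0mx !addr0.
have -> : - (K a a)^-1 *: c *m (K a a)%:M + c = 0.
  by rewrite mul_mx_scalar scalerA mulrN mulfV// scaleN1r addNr.
rewrite det_ublock det_scalar1; congr (_ * \det _).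
apply/matrixP => i j; rewrite !mxE big_ord1 !mxE /schur; ring.
Qed.

Lemma kernel_det1 K a : psd K -> kernel_det K [:: a] = complex.Re (K a a).
Proof. by move=> pK; rewrite kernel_det_cons// kernel_det_nil mulr1. Qed.

Lemma kernel_det2 K a b : psd K -> kernel_det K [:: a; b] =
  complex.Re (K a a) * complex.Re (K b b) - modulus (K a b) ^+ 2.
Proof.
move=> pK; rewrite kernel_det_cons// kernel_det1; last exact: psd_schur.
rewrite /schur (pK.1 a b) ReB [_^*%C * _]mulrC mulJ (psd_diag a pK).
rewrite -(fmorphV (real_complex R)) -rmorphM/= mulrBr.
have [k0|k0] := eqVneq (complex.Re (K a a)) 0; last by rewrite mulrCA mulfV// mulr1.
have := psd_CauchySchwarz a b pK; rewrite k0 !mul0r => h.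
by have := sqr_ge0 (modulus (K a b)); lra.
Qed.

Lemma kernel_det_ge0 K zs : psd K -> 0 <= kernel_det K zs.
Proof.
elim: zs K => [|a zs ih] K pK; first by rewrite kernel_det_nil.
rewrite kernel_det_cons// mulr_ge0//; first exact: psd_diag_ge0.
by apply: ih; exact: psd_schur.
Qed.

Lemma psdD K L : psd K -> psd L -> psd (fun x y => K x y + L x y).
Proof.
move=> pK pL; split=> [x y|s]; first by rewrite rmorphD/= -(pK.1 x y) -(pL.1 x y).
have -> : quad_form (fun x y => K x y + L x y) s = quad_form K s + quad_form L s.
  rewrite /quad_form -big_split; apply: eq_bigr => u _ /=.
  by rewrite -big_split; apply: eq_bigr => v _ /=; ring.
by rewrite ReD addr_ge0// (pK.2, pL.2).
Qed.

Let superadditive_real (k l k' l' r r' t : R) : 0 <= r -> 0 <= r' -> 0 <= t ->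
  t <= r + r' -> r ^+ 2 <= k * l -> r' ^+ 2 <= k' * l' ->
  0 <= k -> 0 <= l -> 0 <= k' -> 0 <= l' ->
  k * l - r ^+ 2 <= (k + k') * (l + l') - t ^+ 2.
Proof.
move=> r0 r'0 t0 tr c1 c2 k0 l0 k'0 l'0.
have t2 : t ^+ 2 <= (r + r') ^+ 2 by rewrite ler_pXn2r ?nnegrE ?addr_ge0.
(* arithmetic-geometric mean inequality *)
have rr : 2 * (r * r') <= k * l' + k' * l.
  rewrite -(ler_pXn2r (ltn0Sn 1)) ?nnegrE ?mulr_ge0 ?addr_ge0 ?mulr_ge0//.
  have rk : r ^+ 2 * r' ^+ 2 <= (k * l') * (k' * l).
    have -> : (k * l') * (k' * l) = (k * l) * (k' * l') by ring.
    by apply: ler_pM; rewrite ?sqr_ge0.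
  apply: (@le_trans _ _ (4 * ((k * l') * (k' * l)))).
    have -> : (2 * (r * r')) ^+ 2 = 4 * (r ^+ 2 * r' ^+ 2) by ring.
    by rewrite ler_wpM2l.
  rewrite -subr_ge0 (_ : _ - _ = (k * l' - k' * l) ^+ 2) ?sqr_ge0//; ring.
have e1 : (k + k') * (l + l') = k * l + (k * l' + k' * l) + k' * l' by ring.
have e2 : (r + r') ^+ 2 = r ^+ 2 + 2 * (r * r') + r' ^+ 2 by ring.
rewrite e2 in t2; rewrite e1; clear -t2 rr c2.
move: (k * l) (k * l' + k' * l) (k' * l') (r * r') (t ^+ 2) (r ^+ 2) (r' ^+ 2) t2 rr c2.
by move=> *; lra.
Qed.

Lemma kernel_det2_mono K L a b : psd K -> psd L ->
  kernel_det K [:: a; b] <= kernel_det (fun x y => K x y + L x y) [:: a; b].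
Proof.
move=> pK pL; rewrite !kernel_det2//; last exact: psdD.
rewrite !ReD.
have c1 := psd_CauchySchwarz a b pK; have c2 := psd_CauchySchwarz a b pL.
have := psd_diag_ge0 a pK; have := psd_diag_ge0 b pK.
have := psd_diag_ge0 a pL; have := psd_diag_ge0 b pL.
have := modulusD (K a b) (L a b); move: c1 c2.
have := modulus_ge0 (K a b); have := modulus_ge0 (L a b); have := modulus_ge0 (K a b + L a b).
move=> t0 r'0 r0 c1 c2 tr k0 l0 k'0 l'0.
exact: (superadditive_real r0 r'0 t0 tr c1 c2).
Qed.

Lemma psd_rank1 K a : psd K -> psd (fun x y => K x a * K a y / K a a).
Proof.
move=> pK; have kr := psd_diag a pK; split=> [x y|s].
  by rewrite !rmorphM fmorphV/= -(pK.1 x a) -(pK.1 a y) -(pK.1 a a) [K y a * _]mulrC.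
pose S := \sum_(u <- s) u.1 * K u.2 a.
have SJ : S^*%C = \sum_(u <- s) K a u.2 * u.1^*%C.
  rewrite conjc_sum; apply: eq_bigr => u _; rewrite rmorphM/= mulrC; congr (_ * _).
  by rewrite -(pK.1 u.2 a).
have -> : quad_form (fun x y => K x a * K a y / K a a) s = S * S^*%C / K a a.
  rewrite /quad_form SJ /S !mulr_suml; apply: eq_bigr => u _.
  rewrite mulr_sumr mulr_suml; apply: eq_bigr => v _; ring.
rewrite mulJ kr -(fmorphV (real_complex R)) -rmorphM/=.
by rewrite divr_ge0 ?sqr_ge0//; exact: psd_diag_ge0.
Qed.

Lemma kernel_det_schur_le K a zs : psd K -> (size zs <= 2)%N ->
  kernel_det (schur K a) zs <= kernel_det K zs.
Proof.
move=> pK; have pS := psd_schur a pK; case: zs => [|b [|c [|//]]] _.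
- by rewrite !kernel_det_nil.
- rewrite !kernel_det1// /schur ReB lerBlDr lerDl.
  rewrite (pK.1 a b) [_^*%C * _]mulrC mulJ (psd_diag a pK).
  rewrite -(fmorphV (real_complex R)) -rmorphM/=.
  by rewrite divr_ge0 ?sqr_ge0//; exact: psd_diag_ge0.
- have := kernel_det2_mono b c pS (psd_rank1 a pK).
  suff -> : (fun x y => schur K a x y + K x a * K a y / K a a) = K by [].
  by apply/funext => x; apply/funext => y; rewrite /schur subrK.
Qed.

(** Fischer's inequality, which expresses the negative correlation of a
    determinantal process. *)
Lemma fischer K xs ys : psd K -> (size ys <= 2)%N ->
  kernel_det K (xs ++ ys) <= kernel_det K xs * kernel_det K ys.
Proof.
move=> pK ys2; elim: xs K pK => [|a xs ih] K pK.
  by rewrite kernel_det_nil mul1r.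
rewrite !kernel_det_cons// -mulrA ler_wpM2l ?psd_diag_ge0//.
have pS := psd_schur a pK; apply: (le_trans (ih _ pS)).
by rewrite ler_wpM2l ?kernel_det_ge0// kernel_det_schur_le.
Qed.

End kernel_determinants.

(** * Inner products of entire functions *)

Section entire_functions.
Variable R : realType.
Local Notation C := R[i].
Implicit Types f g : C -> C.

Lemma cdiff_entire f : (forall z, exists l, cdiff f z l) -> entire f.
Proof.
move=> df z; have [l fl] := df z; apply/cvg_ex; exists l; apply/cvgrPdist_lt => e e0.
have eE : e = (complex.Re e)%:C%C by rewrite RRe_real// gtr0_real.
have e2 : 0 < complex.Re e / 2 by rewrite divr_gt0// -ltcR -eE.
have [d d0 hd] := fl _ e2.
apply/nbhs_ballP; exists d%:C%C => /=; first by rewrite ltcR.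
move=> h; rewrite /ball/= sub0r normrN normr_modulus ltcR => hd' h0.
have -> : h *: (1 : C^o) = h by exact: mulr1.
rewrite normr_modulus eE ltcR.
have m0 : 0 < modulus h by rewrite modulus_gt0.
rewrite -(ltr_pM2r m0) -modulusM -modulusN mulrBl opprB /= (addrC h).
set A := f (z + h) - f z.
rewrite -[h^-1 *: A]/(h^-1 * A) mulrAC mulVf// mul1r.
by apply: le_lt_trans (hd _ hd') _; rewrite ltr_pM2r//; move: e2; lra.
Qed.

Lemma cdiff_add f g z l k : cdiff f z l -> cdiff g z k ->
  cdiff (fun x => f x + g x) z (l + k).
Proof.
move=> fl gk e e0; have e2 : 0 < e / 2 by rewrite divr_gt0.
have [d1 d10 h1] := fl _ e2; have [d2 d20 h2] := gk _ e2.
exists (Num.min d1 d2); first by rewrite lt_min d10.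
move=> h; rewrite lt_min => /andP[/h1 k1 /h2 k2].
rewrite (_ : _ - _ = (f (z + h) - f z - l * h) + (g (z + h) - g z - k * h)); last by ring.
by apply: le_trans (modulusD _ _) _; lra.
Qed.

Lemma entire_lin (a : C) f g : entire f -> entire g ->
  entire (fun x => a * f x + g x).
Proof.
move=> /entire_cdiff ef /entire_cdiff eg; apply: cdiff_entire => z.
have [l fl] := ef z; have [k gk] := eg z; eexists.
exact: (cdiff_add (cdiff_mul (cdiff_cst a z) fl) gk).
Qed.

Lemma entire_cst (c : C) : entire (fun=> c).
Proof. by apply: cdiff_entire => z; exists 0; exact: cdiff_cst. Qed.

Lemma entireM f g : entire f -> entire g -> entire (fun x => f x * g x).
Proof.
move=> /entire_cdiff ef /entire_cdiff eg; apply: cdiff_entire => z.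
have [l fl] := ef z; have [k gk] := eg z; eexists; exact: (cdiff_mul fl gk).
Qed.

Lemma entireX n : entire (fun x : C => x ^+ n).
Proof.
elim: n => [|n ih]; first exact: entire_cst.
have -> : (fun x : C => x ^+ n.+1) = (fun x => x * x ^+ n).
  by apply/funext => x; rewrite exprS.
apply: entireM ih; apply: cdiff_entire => z; exists 1.
by have := @cdiff_affine R 0 1 z; congr cdiff; apply/funext => x; rewrite add0r mul1r.
Qed.

Lemma measurable_entire_Re f : entire f ->
  measurable_fun [set: C] (fun z => complex.Re (f z)).
Proof. by move=> /entire_cdiff df; exact/measurable_continuousC/continuousC_Re. Qed.

Lemma measurable_entire_Im f : entire f ->
  measurable_fun [set: C] (fun z => complex.Im (f z)).
Proof. by move=> /entire_cdiff df; exact/measurable_continuousC/continuousC_Im. Qed.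

Lemma measurable_entire_sqr f : entire f ->
  measurable_fun [set: C] (fun z => modulus (f z) ^+ 2).
Proof.
move=> ef; have -> : (fun z => modulus (f z) ^+ 2) =
    (fun z => complex.Re (f z) ^+ 2 + complex.Im (f z) ^+ 2).
  by apply/funext => z; rewrite modulus_sqr.
by apply: measurable_funD; apply: measurable_funX;
  [exact: measurable_entire_Re|exact: measurable_entire_Im].
Qed.

End entire_functions.

Section complex_integral.
Variable R : realType.
Local Notation C := R[i].
Variable mu : {measure set C -> \bar R}.
Implicit Types f g : C -> C.

Definition integrableC f : Prop :=
  mu.-integrable setT (fun z => (complex.Re (f z))%:E) /\
  mu.-integrable setT (fun z => (complex.Im (f z))%:E).

Lemma integralCE f : integralC mu f =
  Complex (\int[mu]_z complex.Re (f z)) (\int[mu]_z complex.Im (f z)).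
Proof. by []. Qed.

Let int_lin (a b : R) (u v : C -> R) :
  mu.-integrable setT (EFin \o u) -> mu.-integrable setT (EFin \o v) ->
  mu.-integrable setT (fun z => (a * u z + b * v z)%:E) /\
  \int[mu]_z (a * u z + b * v z) = a * \int[mu]_z u z + b * \int[mu]_z v z.
Proof.
move=> iu iv.
have iau : mu.-integrable setT (EFin \o (fun z => a * u z)).
  by have := integrableZl measurableT a iu; apply: eq_integrable.
have ibv : mu.-integrable setT (EFin \o (fun z => b * v z)).
  by have := integrableZl measurableT b iv; apply: eq_integrable.
split; first by have := integrableD measurableT iau ibv; apply: eq_integrable.
by rewrite RintegralD// !RintegralZl.
Qed.

Lemma integralC_lin (a : C) f g : integrableC f -> integrableC g ->
  integrableC (fun z => a * f z + g z) /\
  integralC mu (fun z => a * f z + g z) = a * integralC mu f + integralC mu g.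
Proof.
case: a => a b [f1 f2] [g1 g2].
have [h1 e1] := int_lin a (- b) f1 f2.
have [h2 e2] := int_lin 1 1 h1 g1.
have [k1 E1] := int_lin a b f2 f1.
have [k2 E2] := int_lin 1 1 k1 g2.
have RE : (fun z => complex.Re (Complex a b * f z + g z)) =
    (fun z => 1 * (a * complex.Re (f z) + - b * complex.Im (f z)) + 1 * complex.Re (g z)).
  by apply/funext => z; rewrite ReD ReM/=; ring.
have IE : (fun z => complex.Im (Complex a b * f z + g z)) =
    (fun z => 1 * (a * complex.Im (f z) + b * complex.Re (f z)) + 1 * complex.Im (g z)).
  by apply/funext => z; rewrite ImD ImM/=; ring.
split.
  split; first by rewrite (_ : (fun z => _) = EFin \o (fun z => complex.Re (Complex a b * f z + g z)))// RE.
  by rewrite (_ : (fun z => _) = EFin \o (fun z => complex.Im (Complex a b * f z + g z)))// IE.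
rewrite !integralCE RE IE e2 E2 e1 E1; apply: complex_eqP.
  by rewrite ReD ReM/=; ring.
by rewrite ImD ImM/=; ring.
Qed.

Lemma integralC_conj f : integrableC f ->
  integralC mu (fun z => (f z)^*%C) = (integralC mu f)^*%C.
Proof.
move=> [f1 f2]; have [_ e] := int_lin (-1) 0 f2 f2.
rewrite !integralCE; apply: complex_eqP => /=.
  by apply: eq_Rintegral => z _; rewrite ReJ.
have -> : (fun z => complex.Im (f z)^*%C) = (fun z => -1 * complex.Im (f z) + 0 * complex.Im (f z)).
  by apply/funext => z; rewrite ImJ; ring.
by rewrite e; ring.
Qed.

End complex_integral.

Section fock_inner_product.
Variable R : realType.
Local Notation C := R[i].
Variable mu : {measure set C -> \bar R}.
Implicit Types f g h : C -> C.

Definition sqr_integrable f : Prop :=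
  entire f /\ (\int[mu]_z (modulus (f z) ^+ 2)%:E < +oo)%E.

Definition inner f g : C := integralC mu (fun z => f z * (g z)^*%C).

Definition sqr_norm f : R := fine (\int[mu]_z (modulus (f z) ^+ 2)%:E).

Let integrable_sqr f : sqr_integrable f ->
  mu.-integrable setT (fun z => (modulus (f z) ^+ 2)%:E).
Proof.
move=> [ef fy]; apply/integrableP; split.
  by apply/measurable_EFinP; exact: measurable_entire_sqr.
by under eq_integral do rewrite gee0_abs ?lee_fin ?sqr_ge0//.
Qed.

Let le_prod_sqr f g z :
  modulus (f z * (g z)^*%C) <= modulus (f z) ^+ 2 + modulus (g z) ^+ 2.
Proof.
rewrite modulusM modulusJ; have := sqr_ge0 (modulus (f z) - modulus (g z)).
have := sqr_ge0 (modulus (f z)); have := sqr_ge0 (modulus (g z)).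
rewrite sqrrB -mulr_natl; move: (modulus (f z) ^+ 2) (modulus (g z) ^+ 2).
by move: (modulus (f z) * modulus (g z)) => *; lra.
Qed.

Lemma integrableC_prod f g : sqr_integrable f -> sqr_integrable g ->
  integrableC mu (fun z => f z * (g z)^*%C).
Proof.
move=> Lf Lg; have I2 := integrableD measurableT (integrable_sqr Lf) (integrable_sqr Lg).
have fR := measurable_entire_Re Lf.1; have fI := measurable_entire_Im Lf.1.
have gR := measurable_entire_Re Lg.1; have gI := measurable_entire_Im Lg.1.
split; apply: le_integrable I2 => //.
- apply/measurable_EFinP.
  have -> : (fun z => complex.Re (f z * (g z)^*%C)) = (fun z =>
      complex.Re (f z) * complex.Re (g z) + complex.Im (f z) * complex.Im (g z)).
    by apply/funext => z; rewrite ReM ReJ ImJ mulrN opprK.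
  by apply: measurable_funD; exact: measurable_funM.
- move=> z _; rewrite /= lee_fin [leRHS]ger0_norm ?addr_ge0 ?sqr_ge0//.
  by apply: le_trans (le_prod_sqr f g z); exact: le_Re_modulus.
- apply/measurable_EFinP.
  have -> : (fun z => complex.Im (f z * (g z)^*%C)) = (fun z =>
      complex.Im (f z) * complex.Re (g z) - complex.Re (f z) * complex.Im (g z)).
    by apply/funext => z; rewrite ImM ReJ ImJ mulrN addrC.
  by apply: measurable_funB; exact: measurable_funM.
- move=> z _; rewrite /= lee_fin [leRHS]ger0_norm ?addr_ge0 ?sqr_ge0//.
  by apply: le_trans (le_prod_sqr f g z); exact: le_Im_modulus.
Qed.

Lemma sqr_integrable_lin (a : C) f g : sqr_integrable f -> sqr_integrable g ->
  sqr_integrable (fun z => a * f z + g z).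
Proof.
move=> Lf Lg; split; first exact: entire_lin Lf.1 Lg.1.
have I1 := integrableZl measurableT (2 * modulus a ^+ 2) (integrable_sqr Lf).
have I2 := integrableZl measurableT 2 (integrable_sqr Lg).
have /integrableP[_ I] := integrableD measurableT I1 I2.
apply: le_lt_trans I; apply: ge0_le_integral_any => z _; first by rewrite lee_fin sqr_ge0.
have p1 : 0 <= 2 * modulus a ^+ 2 * modulus (f z) ^+ 2.
  by apply: mulr_ge0; [apply: mulr_ge0 => //|]; exact: sqr_ge0.
have p2 : 0 <= 2 * modulus (g z) ^+ 2 by apply: mulr_ge0 => //; exact: sqr_ge0.
rewrite /= lee_fin ger0_norm; last exact: addr_ge0.
have h : modulus (a * f z + g z) <= modulus a * modulus (f z) + modulus (g z).
  by rewrite -modulusM modulusD.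
apply: (@le_trans _ _ ((modulus a * modulus (f z) + modulus (g z)) ^+ 2)).
  have a0 := modulus_ge0 a; have f0 := modulus_ge0 (f z).
  have g0 := modulus_ge0 (g z); have l0 := modulus_ge0 (a * f z + g z).
  have s0 : 0 <= modulus a * modulus (f z) + modulus (g z) by rewrite addr_ge0// mulr_ge0.
  by rewrite ler_pXn2r.
move: (modulus a) (modulus (f z)) (modulus (g z)) => p q r.
rewrite -subr_ge0 (_ : _ - _ = (p * q - r) ^+ 2) ?sqr_ge0//; ring.
Qed.

Lemma inner_conj f g : sqr_integrable f -> sqr_integrable g ->
  inner g f = (inner f g)^*%C.
Proof.
move=> Lf Lg; rewrite /inner -integralC_conj; last exact: integrableC_prod.
by congr integralC; apply/funext => z; rewrite rmorphM/= conjcK mulrC.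
Qed.

Lemma inner_linl (a : C) f g h : sqr_integrable f -> sqr_integrable g ->
  sqr_integrable h ->
  inner (fun z => a * f z + g z) h = a * inner f h + inner g h.
Proof.
move=> Lf Lg Lh; rewrite /inner.
have [_ <-] := integralC_lin a (integrableC_prod Lf Lh) (integrableC_prod Lg Lh).
by congr integralC; apply/funext => z; rewrite mulrDl mulrA.
Qed.

Lemma inner_linr (a : C) f g h : sqr_integrable f -> sqr_integrable g ->
  sqr_integrable h ->
  inner h (fun z => a * f z + g z) = a^*%C * inner h f + inner h g.
Proof.
move=> Lf Lg Lh; have L := sqr_integrable_lin a Lf Lg.
rewrite (inner_conj L Lh) (inner_conj Lf Lh) (inner_conj Lg Lh) inner_linl//.
by rewrite rmorphD rmorphM.
Qed.

Lemma innerE f : sqr_integrable f -> inner f f = (sqr_norm f)%:C%C.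
Proof.
move=> Lf; rewrite /inner integralCE; apply: complex_eqP => /=.
  by congr fine; apply: eq_integral => z _; rewrite mulJ.
have -> : (fun z => complex.Im (f z * (f z)^*%C)) = (fun=> 0).
  by apply/funext => z; rewrite mulJ.
by rewrite Rintegral_cst// mul0r.
Qed.

Lemma sqr_norm_ge0 f : 0 <= sqr_norm f.
Proof. by rewrite fine_ge0// integral_ge0// => z _; rewrite lee_fin sqr_ge0. Qed.

Lemma sqr_norm_EFin f : sqr_integrable f ->
  (sqr_norm f)%:E = (\int[mu]_z (modulus (f z) ^+ 2)%:E)%E.
Proof.
move=> [_ fy]; rewrite fineK// ge0_fin_numE//.
by apply: integral_ge0 => z _; rewrite lee_fin sqr_ge0.
Qed.

End fock_inner_product.

(** * Reproducing kernels *)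

Section reproducing_kernel.
Variable R : realType.
Local Notation C := R[i].
Variables (phi : C -> R) (nu : {measure set C -> \bar R}) (K : C -> C -> C).
Hypothesis kerK : fock_kernel phi nu K.
Local Notation mu := (mu_phi phi nu : {measure set C -> \bar R}).
Local Notation F := (sqr_integrable mu).
Local Notation ip := (inner mu).
Implicit Types (f h : C -> C) (x y z w : C).

Let sec z : C -> C := fun w => (K z w)^*%C.

Let F_sec z : F (sec z). Proof. by have [_ + _] := kerK; exact. Qed.

Let reproducing f z : F f -> f z = ip f (sec z).
Proof.
move=> Ff; have [_ _ r] := kerK; rewrite (r f z Ff) /inner.
by congr integralC; apply/funext => w; rewrite /sec conjcK.
Qed.

Let hermK x y : K y x = (K x y)^*%C.
Proof.
have e : sec x y = (sec y x)^*%C.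
  rewrite (reproducing y (F_sec x)) (reproducing x (F_sec y)).
  by rewrite -inner_conj.
by move: e; rewrite /sec conjcK => ->.
Qed.

(* the linear combination of sections with norm the quadratic form of K *)
Let comb (s : seq (C * C)) : C -> C := fun z => \sum_(v <- s) v.1^*%C * sec v.2 z.

Let F0 : F (fun=> 0).
Proof.
split; first exact: entire_cst.
rewrite integral0_eq ?ltry// => z _; by rewrite modulus0 expr0n.
Qed.

Let F_comb s : F (comb s).
Proof.
elim: s => [|u s ih].
  by rewrite (_ : comb [::] = (fun=> 0))//; apply/funext => z; rewrite /comb big_nil.
rewrite (_ : comb (u :: s) = (fun z => u.1^*%C * sec u.2 z + comb s z)).
  exact: sqr_integrable_lin.
by apply/funext => z; rewrite /comb big_cons.
Qed.

Let inner_comb h s : F h -> ip h (comb s) = \sum_(v <- s) v.1 * h v.2.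
Proof.
move=> Fh; elim: s => [|u s ih].
  rewrite big_nil /inner integralCE (_ : comb [::] = (fun=> 0)); last first.
    by apply/funext => z; rewrite /comb big_nil.
  have e z : h z * (0 : C)^*%C = 0 by rewrite rmorph0 mulr0.
  have -> : (fun z => complex.Re (h z * (0 : C)^*%C)) = (fun=> 0).
    by apply/funext => z; rewrite e.
  have -> : (fun z => complex.Im (h z * (0 : C)^*%C)) = (fun=> 0).
    by apply/funext => z; rewrite e.
  by rewrite Rintegral_cst// mul0r.
rewrite big_cons -ih (_ : comb (u :: s) = (fun z => u.1^*%C * sec u.2 z + comb s z)).
  by rewrite inner_linr// conjcK -reproducing.
by apply/funext => z; rewrite /comb big_cons.
Qed.

Let quad_form_norm s : quad_form K s = (sqr_norm mu (comb s))%:C%C.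
Proof.
rewrite -innerE// inner_comb// /quad_form; apply: eq_bigr => u _.
rewrite /comb mulr_sumr; apply: eq_bigr => v _.
by rewrite /sec -(hermK v.2) ; ring.
Qed.

Lemma psd_fock_kernel : psd K.
Proof.
split; first exact: hermK.
by move=> s; rewrite quad_form_norm/=; exact: sqr_norm_ge0.
Qed.

(** Point evaluation bounds give bounds of the kernel on the diagonal. *)
Lemma kernel_diag_le z B : 0 <= B ->
  (forall f, F f -> modulus (f z) ^+ 2 <= B * sqr_norm mu f) ->
  complex.Re (K z z) <= B.
Proof.
move=> B0 /(_ _ (F_sec z)); have kz := psd_diag z psd_fock_kernel.
have k0 := psd_diag_ge0 z psd_fock_kernel.
have -> : sqr_norm mu (sec z) = complex.Re (K z z).
  have := innerE (F_sec z); rewrite -reproducing// /sec kz conjc_real.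
  by move=> /complexI ->.
rewrite /sec kz conjc_real modulus_real real_normK ?num_real//=.
have [->//|k1] := eqVneq (complex.Re (K z z)) 0.
have {}k0 : 0 < complex.Re (K z z) by rewrite lt_neqAle eq_sym k1.
by rewrite expr2 ler_pM2r.
Qed.

(** The Schur complement of K at z is the kernel of the functions that vanish
    at z, so that bounds for these bound the determinant. *)
Lemma kernel_det2_le z w B D : 0 <= B -> 0 <= D ->
  (forall f, F f -> modulus (f z) ^+ 2 <= B * sqr_norm mu f) ->
  (forall f, F f -> f z = 0 -> modulus (f w) ^+ 2 <= D * sqr_norm mu f) ->
  kernel_det K [:: z; w] <= B * D.
Proof.
move=> B0 D0 hB hD; have pK := psd_fock_kernel.
rewrite kernel_det_cons// kernel_det1; last exact: psd_schur.
have k0 := psd_diag_ge0 z pK.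
have [kz|kz] := eqVneq (K z z) 0; first by rewrite kz/= mul0r mulr_ge0.
apply: ler_pM => //; [exact: psd_diag_ge0 (psd_schur z pK)|exact: kernel_diag_le|].
pose c := - K w z / K z z.
pose f := comb [:: (1, w); (c, z)].
have kr : (K z z)^*%C = K z z by rewrite -hermK.
have fE x : f x = (K w x)^*%C - (K w z)^*%C / K z z * (K z x)^*%C.
  transitivity ((1 : C)^*%C * (K w x)^*%C + (c^*%C * (K z x)^*%C + 0)).
    by rewrite /f /comb !big_cons big_nil.
  by rewrite rmorph1 mul1r addr0 /c rmorphM rmorphN fmorphV/= kr !mulNr.
have fz : f z = 0 by rewrite fE kr divfK// subrr.
have fw : f w = schur K z w w.
  by rewrite fE /schur -(hermK w w) -(hermK z w) -(hermK w z); ring.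
have nf : (sqr_norm mu f)%:C%C = schur K z w w.
  rewrite -innerE; last exact: F_comb.
  by rewrite inner_comb ?big_cons ?big_nil/= ?fz ?mulr0 ?addr0 ?mul1r//; exact: F_comb.
have := hD _ (F_comb _) fz; rewrite -/f.
have s0 := psd_diag_ge0 w (psd_schur z pK); move: s0.
rewrite fw -nf modulus_real/= => s0.
rewrite real_normK ?num_real//.
have [->//|n1] := eqVneq (sqr_norm mu f) 0.
have n0 : 0 < sqr_norm mu f by rewrite lt_neqAle eq_sym n1.
by rewrite expr2 ler_pM2r.
Qed.

(** Bessel's inequality: removing finitely many orthonormal functions from the
    kernel leaves a positive kernel. *)
Lemma psd_bessel (e : nat -> C -> C) (r : seq nat) : uniq r ->
  (forall n, F (e n)) -> (forall n, sqr_norm mu (e n) = 1) ->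
  (forall n k, n != k -> ip (e n) (e k) = 0) ->
  psd (fun x y => K x y - \sum_(n <- r) e n x * (e n y)^*%C).
Proof.
move=> ur Fe e1 e0; split=> [x y|s].
  rewrite rmorphB/= -hermK conjc_sum; congr (_ - _).
  by apply: eq_bigr => n _; rewrite rmorphM/= conjcK mulrC.
pose f := comb s; have Ff : F f := F_comb s.
pose c n := ip f (e n).
pose p := fun (q : seq nat) z => \sum_(n <- q) c n * e n z.
have Fp q : F (p q).
  elim: q => [|n q ih].
    by rewrite (_ : p [::] = (fun=> 0))//; apply/funext => z; rewrite /p big_nil.
  rewrite (_ : p (n :: q) = (fun z => c n * e n z + p q z)); first exact: sqr_integrable_lin.
  by apply/funext => z; rewrite /p big_cons.
have inner0 h : F h -> ip h (fun=> 0) = 0.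
  move=> Fh; have := inner_comb [::] Fh; rewrite big_nil (_ : comb [::] = (fun=> 0))//.
  by apply/funext => z; rewrite /comb big_nil.
have ip_p h q : F h -> ip h (p q) = \sum_(n <- q) (c n)^*%C * ip h (e n).
  move=> Fh; elim: q => [|n q ih].
    by rewrite big_nil (_ : p [::] = (fun=> 0)) ?inner0//; apply/funext => z; rewrite /p big_nil.
  rewrite big_cons -ih (_ : p (n :: q) = (fun z => c n * e n z + p q z)); first by rewrite inner_linr.
  by apply/funext => z; rewrite /p big_cons.
have cJ n : ip (e n) f = (c n)^*%C by rewrite inner_conj.
have ee n : ip (e n) (e n) = 1 by rewrite innerE// e1.
have pe n q : uniq q -> n \notin q -> ip (p q) (e n) = 0.
  move=> uq nq; rewrite inner_conj// ip_p// big_seq big1 ?rmorph0// => k kq.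
  by rewrite e0 ?mulr0//; apply: contraNneq nq => ->.
have pe1 n q : uniq q -> n \in q -> ip (e n) (p q) = (c n)^*%C.
  move=> uq nq; rewrite ip_p// (bigD1_seq n)//= ee mulr1 big1 ?addr0// => k kn.
  by rewrite e0 ?mulr0// eq_sym.
have pp : ip (p r) (p r) = \sum_(n <- r) (c n)^*%C * c n.
  rewrite ip_p// big_seq [RHS]big_seq; apply: eq_bigr => n nr.
  by rewrite inner_conj// pe1// conjcK.
have fp : ip f (p r) = \sum_(n <- r) (c n)^*%C * c n by rewrite ip_p.
have ppr : (\sum_(n <- r) (c n)^*%C * c n)^*%C = \sum_(n <- r) (c n)^*%C * c n.
  have conjJ (u : C) : (u^*%C * u)^*%C = u^*%C * u by rewrite rmorphM/= conjcK mulrC.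
  by rewrite conjc_sum; apply: eq_bigr => n _.
pose h z := -1 * p r z + f z.
have Fh : F h by exact: sqr_integrable_lin.
have := sqr_norm_ge0 mu h; have -> : sqr_norm mu h = complex.Re (ip h h) by rewrite innerE.
have -> : ip h h = ip f f - \sum_(n <- r) (c n)^*%C * c n.
  rewrite {2}/h inner_linr// /h !inner_linl// pp (inner_conj Ff (Fp r)) fp ppr.
  by rewrite rmorphN rmorph1; ring.
suff -> : ip f f - \sum_(n <- r) (c n)^*%C * c n =
  quad_form (fun x y => K x y - \sum_(n <- r) e n x * (e n y)^*%C) s by [].
have -> : ip f f = quad_form K s by rewrite quad_form_norm innerE.
have -> : \sum_(n <- r) (c n)^*%C * c n =
    \sum_(n <- r) quad_form (fun x y => e n x * (e n y)^*%C) s.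
  apply: eq_bigr => n _.
  have cE : (c n)^*%C = \sum_(u <- s) u.1 * e n u.2 by rewrite -cJ inner_comb.
  have -> : (c n)^*%C * c n = (\sum_(u <- s) u.1 * e n u.2) *
      (\sum_(u <- s) (e n u.2)^*%C * u.1^*%C).
    rewrite -cE; congr (_ * _).
    rewrite -[LHS]conjcK cE conjc_sum; apply: eq_bigr => u _.
    by rewrite rmorphM/= mulrC.
  rewrite /quad_form mulr_suml; apply: eq_bigr => u _.
  by rewrite mulr_sumr; apply: eq_bigr => v _; ring.
rewrite /quad_form [X in _ - X]exchange_big/= -sumrB; apply: eq_bigr => u _.
rewrite [X in _ - X]exchange_big/= -sumrB; apply: eq_bigr => v _.
by rewrite -mulr_suml -mulr_sumr; ring.
Qed.

End reproducing_kernel.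

(** * Integrals of powers of the modulus *)

Section radial_powers.
Variable R : realType.
Local Notation C := R[i].
Local Notation m := (@lebesgueC R).
Local Notation kap := (disk_area R).

Definition annulus (a b : R) : set C := [set w | a <= modulus w < b].

Definition pow_int (p : R) (E : set C) : \bar R :=
  (\int[m]_(w in E) (modulus w `^ p)%:E)%E.

Lemma measurable_modulus_pow p : measurable_fun [set: C] (fun w => modulus w `^ p).
Proof. exact: (measurableT_comp (measurable_powR p) (@measurable_modulus R)). Qed.

Lemma measurable_annulus a b : measurable (annulus a b).
Proof.
have -> : annulus a b = [set: C] `&` (@modulus R) @^-1` `[a, b[.
  by rewrite setTI; apply/seteqP; split => w /=; rewrite /annulus/= in_itv.
by apply: measurable_modulus; [exact: measurableT|exact: measurable_itv].
Qed.

Lemma annulus0 b : annulus 0 b = disk 0 b.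
Proof.
by apply/seteqP; split => w; rewrite /annulus/disk/= subr0 modulus_ge0.
Qed.

Lemma lebesgueC_annulus a b : 0 <= a -> a <= b ->
  (m (annulus a b) = (kap * (b ^+ 2 - a ^+ 2))%:E)%E.
Proof.
move=> a0 ab; have b0 := le_trans a0 ab.
have E : (m (disk 0%R b) = m (disk 0%R a) + m (annulus a b))%E.
  rewrite -measureU; [|exact: measurable_disk|exact: measurable_annulus|].
    congr (m _); apply/seteqP; split => w; rewrite /annulus/disk/= subr0.
      by move=> wb; have [|aw] := ltP (modulus w) a; [left|right; apply/andP; split].
    by case=> [wa|/andP[]//]; exact: lt_le_trans ab.
  apply/seteqP; split => w //; rewrite /annulus/disk/= subr0 => -[wa /andP[aw _]].
  by move: wa; rewrite ltNge aw.
move: E; rewrite !lebesgueC_disk// => E.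
have fin : m (annulus a b) \is a fin_num.
  rewrite ge0_fin_numE//; apply: (@le_lt_trans _ _ (m (disk 0%R b))).
    apply: le_measure; rewrite ?inE; [exact: measurable_annulus|exact: measurable_disk|].
    by move=> w; rewrite /annulus/disk/= subr0 => /andP[].
  by rewrite lebesgueC_disk ?ltry.
move: E; rewrite -(fineK fin) -EFinD => -[E']; congr EFin.
by rewrite mulrBr E'; ring.
Qed.

Lemma pow_int_ge0 p E : (0 <= pow_int p E)%E.
Proof. by apply: integral_ge0 => w _; rewrite lee_fin powR_ge0. Qed.

Lemma pow_int_scale p t a b : 0 < t ->
  (pow_int p (annulus (t * a) (t * b)) = (t `^ (p + 2))%:E * pow_int p (annulus a b))%E.
Proof.
move=> t0; pose F (w : C) : \bar R := (((fun w => (modulus w `^ p)%:E) \_ (annulus (t * a) (t * b))) w).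
have mF : measurable_fun [set: C] F.
  apply/(measurable_restrictT _ _).1; first exact: measurable_annulus.
  by apply: measurable_funTS; apply/measurable_EFinP; exact: measurable_modulus_pow.
have F0 w : (0 <= F w)%E by rewrite /F patchE; case: ifPn => // _; rewrite lee_fin powR_ge0.
have e1 : pow_int p (annulus (t * a) (t * b)) = (\int[m]_w F w)%E.
  by rewrite /pow_int integral_mkcond.
have e2 : ((t `^ p)%:E * pow_int p (annulus a b) = \int[m]_w F (t%:C%C * w)%R)%E.
  transitivity (\int[m]_(w in annulus a b) ((t `^ p)%:E * (modulus w `^ p)%:E))%E.
    by apply/esym; apply: ge0_integralZl_any; [exact: powR_ge0|move=> w _; rewrite lee_fin powR_ge0].
  rewrite integral_mkcond; apply: eq_integral => w _; rewrite /F !patchE.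
  have -> : ((t%:C%C * w)%R \in annulus (t * a) (t * b)) = (w \in annulus a b).
    by apply/idP/idP; rewrite !inE /annulus/= modulusM modulus_real gtr0_norm// ler_pM2l// ltr_pM2l.
  by case: ifPn => // _; rewrite -EFinM modulusM modulus_real gtr0_norm// powRM ?modulus_ge0// ltW.
move: e2; rewrite (integral_scaleC t0 mF F0) -e1 => e2.
have t2 : t `^ (p + 2) = t `^ p * t ^+ 2.
  rewrite powRD ?powR_mulrn ?(ltW t0)//; by apply/implyP => _; rewrite gt_eqF.
rewrite t2 [_ `^ p * _]mulrC EFinM -muleA e2 muleA -EFinM divff ?mul1e//.
by rewrite expf_neq0// gt_eqF.
Qed.

Lemma pow_int_setU p E1 E2 : measurable E1 -> measurable E2 -> [disjoint E1 & E2] ->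
  pow_int p (E1 `|` E2) = (pow_int p E1 + pow_int p E2)%E.
Proof.
move=> m1 m2 d12; rewrite /pow_int ge0_integral_setU//.
  by apply: measurable_funTS; apply/measurable_EFinP; exact: measurable_modulus_pow.
by move=> w _; rewrite lee_fin powR_ge0.
Qed.

Lemma pow_int_annulus_split p a b c : a <= b -> b <= c ->
  pow_int p (annulus a c) = (pow_int p (annulus a b) + pow_int p (annulus b c))%E.
Proof.
move=> ab bc; rewrite -pow_int_setU; try exact: measurable_annulus.
  congr pow_int; apply/seteqP; split => w; rewrite /annulus/=.
    by move=> /andP[aw wc]; have [wb|bw] := ltP (modulus w) b; [left|right]; apply/andP; split.
  case=> /andP[h1 h2]; first by rewrite h1 (lt_le_trans h2 bc).
  by rewrite (le_trans ab h1).
apply/disj_setPS => w [] /=; rewrite /annulus/= => /andP[_ wb] /andP[bw _].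
by move: wb; rewrite ltNge bw.
Qed.

Lemma pow_int_annulus_le p a b M : 0 <= a -> a <= b ->
  (forall x, a <= x < b -> x `^ p <= M) ->
  (pow_int p (annulus a b) <= (M * (kap * (b ^+ 2 - a ^+ 2)))%:E)%E.
Proof.
move=> a0 ab hM.
apply: (@le_trans _ _ (\int[m]_(w in annulus a b) M%:E)%E).
  apply: ge0_le_integral_any => w wab; rewrite lee_fin ?powR_ge0//; exact: hM.
rewrite integral_cst; last exact: measurable_annulus.
by rewrite EFinM; rewrite -[X in (_ * X <= _)%E]/(m (annulus a b)) lebesgueC_annulus.
Qed.

Let half_expRN1 : expR (-1) <= 1 / 2 :> R.
Proof.
rewrite expRN -[1 / 2]/(1 * 2^-1) mul1r lef_pV2 ?posrE ?expR_gt0//.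
by have := @expR_ge1Dx R 1; lra.
Qed.

(** The scaling argument: P <= e^-1 P + a / p gives a decay in 1 / p. *)
Lemma pow_int_inner p : 0 <= p ->
  (pow_int p (disk 0%R 1%R) <= (4 * kap / (p + 2))%:E)%E.
Proof.
move=> p0; have K0 := disk_area_gt0 R; have p2 : 0 < p + 2 by lra.
pose q := expR (- (p + 2)^-1).
have q1 : q <= 1 by rewrite /q expR_le1 oppr_le0 invr_ge0 ltW.
have q0 : 0 < q by exact: expR_gt0.
have qp : q `^ (p + 2) = expR (-1) by rewrite /q -expRM mulNr mulVf ?gt_eqF.
have le1 a : 0 <= a -> forall x, a <= x < 1 -> x `^ p <= 1.
  move=> a0 x /andP[ax x1]; have x0 := le_trans a0 ax.
  by have := ge0_ler_powR p0 x0 ler01 (ltW x1); rewrite powR1.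
have P1 := pow_int_annulus_le (lexx 0) ler01 (le1 0 (lexx 0)).
have fin : pow_int p (annulus 0 1) \is a fin_num.
  by rewrite ge0_fin_numE ?pow_int_ge0//; apply: le_lt_trans P1 _; rewrite ltry.
have E := pow_int_annulus_split p (ltW q0) q1.
have S := pow_int_scale p 0 1 q0; rewrite mulr0 mulr1 qp in S.
have P2 := pow_int_annulus_le (ltW q0) q1 (le1 q (ltW q0)).
rewrite S -(fineK fin) in E.
rewrite -annulus0 -(fineK fin) lee_fin; set P := fine _ in E *.
have P0 : 0 <= P by apply: fine_ge0; exact: pow_int_ge0.
have : (P%:E <= (expR (-1) * P)%:E + (1 * (kap * (1 ^+ 2 - q ^+ 2)))%:E)%E.
  by rewrite [leLHS]E EFinM leeD2l.
rewrite -EFinD lee_fin => H.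
have q2 : 1 - q ^+ 2 <= 2 / (p + 2).
  rewrite /q -expRM_natl.
  by have := @expR_ge1Dx R (2%:R * - (p + 2)^-1); rewrite mulrN; lra.
have h1 : expR (-1) * P <= 1 / 2 * P by rewrite ler_wpM2r.
have h2 : kap * (1 - q ^+ 2) <= kap * (2 / (p + 2)) by rewrite ler_wpM2l// ltW.
rewrite expr1n in H; have -> : 4 * kap / (p + 2) = 2 * (kap * (2 / (p + 2))) by field; lra.
lra.
Qed.

Lemma pow_int_nondecreasing p (E : nat -> set C) B :
  (forall n, measurable (E n)) -> nondecreasing_seq E ->
  (forall n, (pow_int p (E n) <= B)%E) -> (pow_int p (\bigcup_n E n) <= B)%E.
Proof.
move=> mE ndE hB; have H : pow_int p (E n) @[n --> \oo] --> pow_int p (\bigcup_n E n).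
  apply: ge0_nondecreasing_set_cvg_integral => //.
    by move=> n; apply: measurable_funTS; apply/measurable_EFinP; exact: measurable_modulus_pow.
  by move=> n w _; rewrite lee_fin powR_ge0.
rewrite -(cvg_lim _ H)//; apply: lime_le; first by apply/cvg_ex; exists (pow_int p (\bigcup_n E n)).
exact: nearW.
Qed.

Lemma pow_int_outer k : 4 <= k ->
  (pow_int (- 2 - k) [set w | (1 <= modulus w)%R] <= (8 * kap / k)%:E)%E.
Proof.
move=> k4; have K0 := disk_area_gt0 R; have k0 : 0 < k by lra.
set p := - 2 - k; pose Q := expR (k^-1).
have kV : 0 < k^-1 <= 1 / 4.
  rewrite invr_gt0 k0/= -[1 / 4]/(1 * 4^-1) mul1r lef_pV2 ?posrE//; lra.
have Q0 : 0 < Q by exact: expR_gt0.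
have Q1 : 1 < Q by rewrite /Q expR_gt1; case/andP: kV.
have Qp : Q `^ (p + 2) = expR (-1).
  by rewrite /Q -expRM /p (_ : - 2 - k + 2 = - k); [rewrite mulrN mulVf ?gt_eqF|ring].
have le1 b : forall x, 1 <= x < b -> x `^ p <= 1.
  move=> x /andP[x1 _]; have := ler_powR x1 (_ : p <= 0); rewrite powRr0; apply.
  by rewrite /p; lra.
have H1 := pow_int_annulus_le ler01 (ltW Q1) (le1 Q).
have Q2 : 1 * (kap * (Q ^+ 2 - 1 ^+ 2)) <= 4 * kap / k.
  rewrite mul1r expr1n /Q -expRM_natl -[4 * kap / k]/(4 * kap * k^-1).
  move: kV => /andP[kV0 kV4]; set x := k^-1 in kV0 kV4 *.
  have := @expR_ge1Dx R (- (2%:R * x)); rewrite expRN.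
  set y := expR _ => h; have y0 : 0 < y by exact: expR_gt0.
  have : (1 - 2 * x) * y <= 1.
    by rewrite -ler_pdivlMr// mul1r; apply: le_trans h; rewrite mulr_natl; lra.
  move=> h2; have : y - 1 <= 4 * x by nra.
  by move=> h3; rewrite (_ : 4 * kap * x = kap * (4 * x)); [rewrite ler_wpM2l// ltW|ring].
pose E n := annulus 1 (Q ^+ n).
have Qn n : 1 <= Q ^+ n by rewrite exprn_ege1// ltW.
have -> : [set w : C | 1 <= modulus w] = \bigcup_n E n.
  apply/seteqP; split => w /=; last by case=> n _ /andP[].
  move=> w1; have [n hn] : exists n, modulus w < Q ^+ n.
    exists (Num.truncn (modulus w * k)).+1; rewrite /Q -expRM_natl.
    apply: lt_le_trans (expR_ge1Dx _).
    have := truncnS_gt (modulus w * k); rewrite -ltr_pdivlMr// => h.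
    by apply: lt_le_trans h _; rewrite lerDr.
  by exists n => //; rewrite /E/annulus/= w1.
apply: pow_int_nondecreasing.
- by move=> n; exact: measurable_annulus.
- apply/nondecreasing_seqP => n; apply/subsetPset => w; rewrite /E/annulus/= => /andP[-> h]/=.
  by apply: lt_le_trans h _; rewrite exprS ler_peMl ?exprn_ge0// ltW.
elim=> [|n ih].
  rewrite /E expr0 (_ : annulus 1 1 = set0); last first.
    by apply/seteqP; split => w //; rewrite /annulus/= => /andP[/le_lt_trans h/h]; rewrite ltxx.
  by rewrite /pow_int integral_set0 lee_fin divr_ge0 ?(ltW k0)// mulr_ge0 ?(ltW K0).
rewrite /E (@pow_int_annulus_split _ _ Q); [|exact: ltW|by rewrite exprS ler_peMr// ltW].
have := pow_int_scale p 1 (Q ^+ n) Q0; rewrite mulr1 -exprS Qp => ->.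
have -> : (8 * kap / k)%:E = ((4 * kap / k)%:E + (1 / 2)%:E * (8 * kap / k)%:E)%E.
  by rewrite -EFinM -EFinD; congr EFin; field; lra.
apply: leeD; first by apply: le_trans H1 _; rewrite lee_fin.
by apply: lee_pmul => //; rewrite ?lee_fin ?expR_ge0 ?pow_int_ge0 ?half_expRN1.
Qed.

Lemma pow_int_disk_fin p : - 2 < p -> (pow_int p (disk 0%R 1%R) < +oo)%E.
Proof.
move=> p2; have K0 := disk_area_gt0 R.
have [p0|p0] := leP 0 p; first by apply: le_lt_trans (pow_int_inner p0) _; rewrite ltry.
pose h : R := 2^-1; have h0 : 0 < h by rewrite invr_gt0.
have h1 : h < 1 by rewrite invf_lt1// ltr1n.
have hp : h `^ (p + 2) < 1.
  rewrite /h -powR_inv1// -powRrM mulN1r.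
  have : (2 : R) `^ (p + 2) > 1.
    have := gt0_ltr_powR (_ : 0 < p + 2) (_ : (1 : R) \in Num.nneg) (_ : (2 : R) \in Num.nneg).
    rewrite powR1; apply; rewrite ?nnegrE//; lra.
  by rewrite powRN => h3; rewrite invf_lt1//; lra.
have hp0 : 0 <= h `^ (p + 2) by exact: powR_ge0.
pose E n := annulus (h ^+ n) 1.
have hn n : 0 < h ^+ n <= 1 by rewrite exprn_gt0//= exprn_ile1// ltW.
have -> : pow_int p (disk 0%R 1%R) = pow_int p (\bigcup_n E n).
  rewrite /pow_int integral_mkcond [RHS]integral_mkcond; apply: eq_integral => w _.
  rewrite !patchE; case: ifPn => [|/negP wD].
    rewrite inE /disk/= subr0 => w1; case: ifPn => // /negP wE.
    have [w0|w0] := eqVneq w 0; first by rewrite w0 modulus0 powR0// lt_eqF.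
    exfalso; apply: wE; rewrite inE; have m0 : 0 < modulus w by rewrite modulus_gt0.
    have [n hn'] : exists n, h ^+ n <= modulus w.
      exists (Num.truncn (modulus w)^-1).+1.
      have := truncnS_gt ((modulus w)^-1); set n := (Num.truncn _).+1 => hn'.
      rewrite /h exprVn -[leRHS]invrK lef_pV2 ?posrE ?exprn_gt0 ?invr_gt0//.
      apply: (le_trans (ltW hn')); rewrite -natrX ler_nat ltnW//; exact: ltn_expl.
    by exists n => //; rewrite /E/annulus/= hn'.
  case: ifPn => //; rewrite inE => -[n _]; rewrite /E/annulus/= => /andP[_ w1].
  by exfalso; apply: wD; rewrite inE /disk/= subr0.
pose c := h `^ p * (kap * (1 ^+ 2 - h ^+ 2)).
have H1 : (pow_int p (annulus h 1) <= c%:E)%E.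
  apply: pow_int_annulus_le => //; [exact: ltW|exact: ltW|].
  move=> x /andP[hx _]; have x0 : 0 < x by exact: lt_le_trans hx.
  have q0 : 0 <= - p by rewrite oppr_ge0 ltW.
  rewrite -[p]opprK; move: (- p) q0 => q q0.
  rewrite !powRN lef_pV2 ?posrE ?powR_gt0//.
  exact: (ge0_ler_powR q0 (ltW h0) (ltW x0) hx).
have c0 : 0 <= c by rewrite -lee_fin (le_trans (pow_int_ge0 _ _) H1).
apply: (@le_lt_trans _ _ (c / (1 - h `^ (p + 2)))%:E); last by rewrite ltry.
have d0 : 0 < 1 - h `^ (p + 2) by lra.
apply: pow_int_nondecreasing.
- by move=> n; exact: measurable_annulus.
- apply/nondecreasing_seqP => n; apply/subsetPset => w; rewrite /E/annulus/= => /andP[hw ->].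
  rewrite andbT; apply: le_trans hw; rewrite exprS ler_piMl ?exprn_ge0 ?ltW//.
elim=> [|n ih].
  rewrite /E expr0 (_ : annulus 1 1 = set0); last first.
    by apply/seteqP; split => w //; rewrite /annulus/= => /andP[/le_lt_trans h2/h2]; rewrite ltxx.
  by rewrite /pow_int integral_set0 lee_fin divr_ge0// ltW.
have /andP[hn0 hn1] := hn n.
rewrite /E (@pow_int_annulus_split _ _ h); [|by rewrite exprS ler_piMr// ltW|exact: ltW].
have := pow_int_scale p (h ^+ n) 1 h0; rewrite mulr1 -exprS => ->.
have -> : (c / (1 - h `^ (p + 2)))%:E =
    ((h `^ (p + 2))%:E * (c / (1 - h `^ (p + 2)))%:E + c%:E)%E.
  by rewrite -EFinM -EFinD; congr EFin; field; lra.
by apply: leeD => //; apply: lee_pmul => //; rewrite ?lee_fin ?pow_int_ge0.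
Qed.

End radial_powers.

(** * The radius rho *)

Section powers.
Variable R : realType.

Lemma powR_comparable (p a b : R) : 0 < b -> b / 2 <= a -> a <= 2 * b ->
  a `^ p <= 2 `^ `|p| * b `^ p.
Proof.
move=> b0 ba ab; have a0 : 0 < a by lra.
have ln2 : 0 <= ln 2 :> R by apply: ln_ge0; lra.
have e (x : R) : 0 < x -> x `^ p = expR (p * ln x) by move=> x0; rewrite /powR gt_eqF.
have e2 : 2 `^ `|p| = expR (`|p| * ln 2) :> R by rewrite /powR gt_eqF.
rewrite !e// e2 -expRD ler_expR.
have h : `|ln a - ln b| <= ln 2.
  rewrite -ln_div ?posrE// ler_norml; apply/andP; split; last first.
    by rewrite ler_ln ?posrE ?divr_gt0// ler_pdivrMr.
  rewrite -lnV ?posrE// ler_ln ?posrE ?divr_gt0 ?invr_gt0// ler_pdivlMr//.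
  by rewrite mulrC.
have : p * (ln a - ln b) <= `|p| * ln 2.
  by apply: le_trans (ler_norm _) _; rewrite normrM ler_wpM2l.
by rewrite mulrBr; lra.
Qed.

End powers.

Section laplacian.
Variables (R : realType) (alpha : R).
Hypothesis alpha0 : 0 < alpha.
Local Notation C := R[i].
Local Notation m := (@lebesgueC R).
Local Notation kap := (disk_area R).
Local Notation nu := (laplacian_phi_alpha alpha : {measure set C -> \bar R}).

Lemma laplacianE E : nu E = ((alpha ^+ 2)%:E * pow_int (alpha - 2) E)%E.
Proof.
rewrite -ge0_integralZl_any ?sqr_ge0//.
by move=> w _; rewrite lee_fin powR_ge0.
Qed.

Let n1 : R := fine (nu (disk 0 1)).

Let nu1_fin : nu (disk 0 1) = n1%:E.
Proof.
rewrite fineK// ge0_fin_numE// laplacianE.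
apply: lte_mul_pinfty => //; first by rewrite lee_fin sqr_ge0.
by apply: pow_int_disk_fin; rewrite ltrBrDr addrC subrr.
Qed.

Lemma laplacian_disk0 t : 0 < t -> nu (disk 0 t) = (t `^ alpha * n1)%:E.
Proof.
move=> t0; rewrite EFinM -nu1_fin !laplacianE -!annulus0.
have := @pow_int_scale R (alpha - 2) t 0 1 t0; rewrite mulr0 mulr1 => ->.
by rewrite (_ : alpha - 2 + 2 = alpha); [rewrite muleCA|ring].
Qed.

Let K2 : R := 2 `^ `|alpha - 2|.

Let K2_gt0 : 0 < K2. Proof. exact: powR_gt0. Qed.

Let disk_comparable (z w : C) s : s <= modulus z / 2 -> disk z s w ->
  modulus z / 2 <= modulus w <= 2 * modulus z.
Proof.
rewrite /disk/= => sz wz; have := modulus_dist w z; rewrite ler_norml => /andP[h1 h2].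
have z0 := modulus_ge0 z; by apply/andP; split; lra.
Qed.

Lemma laplacian_disk_le (z : C) s : 0 < s -> s <= modulus z / 2 ->
  (nu (disk z s) <= (alpha ^+ 2 * K2 * kap * (modulus z `^ (alpha - 2) * s ^+ 2))%:E)%E.
Proof.
move=> s0 sz; have z0 : 0 < modulus z by lra.
rewrite laplacianE; have -> : (alpha ^+ 2 * K2 * kap * (modulus z `^ (alpha - 2) * s ^+ 2))%:E =
   ((alpha ^+ 2)%:E * (K2 * modulus z `^ (alpha - 2) * (kap * s ^+ 2))%:E)%E.
  by rewrite -EFinM; congr EFin; ring.
apply: lee_wpmul2l; first by rewrite lee_fin sqr_ge0.
rewrite -(integral_disk_cst z _ (ltW s0)); apply: ge0_le_integral_any => w wD.
  by rewrite lee_fin powR_ge0.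
have /andP[h1 h2] := disk_comparable sz wD.
by rewrite lee_fin; exact: powR_comparable.
Qed.

Lemma laplacian_disk_ge (z : C) s : 0 < s -> s <= modulus z / 2 ->
  ((alpha ^+ 2 / K2 * kap * (modulus z `^ (alpha - 2) * s ^+ 2))%:E <= nu (disk z s))%E.
Proof.
move=> s0 sz; have z0 : 0 < modulus z by lra.
rewrite laplacianE; have -> : (alpha ^+ 2 / K2 * kap * (modulus z `^ (alpha - 2) * s ^+ 2))%:E =
   ((alpha ^+ 2)%:E * (modulus z `^ (alpha - 2) / K2 * (kap * s ^+ 2))%:E)%E.
  by rewrite -EFinM; congr EFin; ring.
apply: lee_wpmul2l; first by rewrite lee_fin sqr_ge0.
rewrite -(integral_disk_cst z _ (ltW s0)); apply: ge0_le_integral_any => w wD.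
  by rewrite lee_fin divr_ge0 ?powR_ge0.
have /andP[h1 h2] := disk_comparable sz wD.
rewrite lee_fin ler_pdivrMr// mulrC; apply: powR_comparable; lra.
Qed.

Let n1_gt0 : 0 < n1.
Proof.
rewrite -lte_fin -nu1_fin; pose z : C := (2^-1)%:C%C.
have mz : modulus z = 2^-1 by rewrite modulus_real ger0_norm.
have s0 : (0 : R) < 4^-1 by rewrite invr_gt0.
have sz : 4^-1 <= modulus z / 2 by rewrite mz; lra.
apply: (@lt_le_trans _ _ (nu (disk z 4^-1))).
  apply: lt_le_trans (laplacian_disk_ge s0 sz).
  rewrite lte_fin mz !mulr_gt0 ?invr_gt0 ?disk_area_gt0 ?exprn_gt0 ?powR_gt0//.
apply: le_measure; rewrite ?inE; try exact: measurable_disk.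
move=> w; rewrite /disk/= subr0 => h; have := modulusD (w - z) z; rewrite subrK mz; lra.
Qed.

Lemma laplacian_disk_fin z r : (nu (disk z r) < +oo)%E.
Proof.
pose t := modulus z + `|r| + 1.
have t0 : 0 < t by rewrite /t; have := modulus_ge0 z; have := normr_ge0 r; lra.
apply: (@le_lt_trans _ _ (nu (disk 0 t))); last by rewrite laplacian_disk0// ltry.
apply: le_measure; rewrite ?inE; try exact: measurable_disk.
move=> w; rewrite /disk/= subr0 => h; have := modulusD (w - z) z; rewrite subrK /t.
by have := ler_norm r; lra.
Qed.

Lemma le_laplacian_disk z w r s : modulus (z - w) + r <= s ->
  (nu (disk z r) <= nu (disk w s))%E.
Proof.
move=> h; apply: le_measure; rewrite ?inE; try exact: measurable_disk.
move=> x; rewrite /disk/= => xz.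
by have := modulusD (x - z) (z - w); rewrite addrA subrK; lra.
Qed.

Let circle_null z r : 0 <= r -> nu [set w | modulus (w - z) = r] = 0%E.
Proof.
move=> r0; pose S := [set w : C | modulus (w - z) = r].
have mf : measurable_fun [set: C] (fun w : C => modulus (w - z)).
  exact: (measurableT_comp (@measurable_modulus R) (@measurable_translateC R (- z))).
have mS : measurable S.
  rewrite (_ : S = [set: C] `&` (fun w : C => modulus (w - z)) @^-1` [set r]); last by rewrite setTI.
  by apply: mf; [exact: measurableT|exact: measurable_set1].
have S0 : m S = 0%E.
  apply/eqP; rewrite eq_le measure_ge0 andbT; apply/lee_addgt0Pr => e e0; rewrite add0e.
  have K0 := disk_area_gt0 R.
  pose t := Num.min 1 (e / (kap * (2 * r + 1))).
  have M0 : 0 < kap * (2 * r + 1) by rewrite mulr_gt0//; lra.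
  have t0 : 0 < t by rewrite lt_min ltr01 divr_gt0.
  have E : (m (disk z r) + m S <= m (disk z (r + t)))%E.
    rewrite -measureU//; [|exact: measurable_disk|].
      apply: le_measure; rewrite ?inE; [apply: measurableU => //; exact: measurable_disk|exact: measurable_disk|].
      by move=> w; rewrite /disk /S/= => -[|->]; lra.
    by apply/seteqP; split => w //; rewrite /disk /S/= => -[h1 h2]; move: h1; rewrite h2 ltxx.
  have rt0 : 0 <= r + t by rewrite addr_ge0// ltW.
  rewrite (lebesgueC_disk z r0) (lebesgueC_disk z rt0) in E.
  have fS : m S \is a fin_num.
    rewrite ge0_fin_numE//; apply: (@le_lt_trans _ _ (kap * (r + t) ^+ 2)%:E); last by rewrite ltry.
    by apply: le_trans E; rewrite leeDr// lee_fin mulr_ge0 ?sqr_ge0 ?(ltW K0).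
  move: E; rewrite -(fineK fS) -EFinD !lee_fin => E.
  have t1 : t <= 1 by rewrite /t ge_min lexx.
  have t2 : t * (kap * (2 * r + 1)) <= e by rewrite -ler_pdivlMr// /t ge_min lexx orbT.
  have : kap * (r + t) ^+ 2 - kap * r ^+ 2 <= t * (kap * (2 * r + 1)).
    rewrite (_ : _ - _ = t * (kap * (2 * r + t))); last by ring.
    by rewrite ler_wpM2l ?(ltW t0)// ler_wpM2l ?(ltW K0)//; lra.
  lra.
rewrite laplacianE /pow_int null_set_integral ?mule0//.
- exact/measurable_EFinP/measurable_funTS/measurable_modulus_pow.
Qed.

Lemma rho_exists z : exists r, 0 < r /\ nu (disk z r) = 1%E.
Proof.
pose S := [set r | 0 <= r /\ (nu (disk z r) <= 1)%E].
have S0 : S 0.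
  split => //; rewrite (_ : disk z 0 = set0) ?measure0//.
  by apply/seteqP; split => w //; rewrite /disk/= ltNge modulus_ge0.
pose R1 := modulus z + (2 / n1) `^ alpha^-1.
have p0 : 0 < (2 / n1) `^ alpha^-1 by apply: powR_gt0; rewrite divr_gt0.
have uS : ubound S R1.
  move=> r [r0 hr]; rewrite leNgt; apply/negP => h.
  have := @le_laplacian_disk 0 z ((2 / n1) `^ alpha^-1) r.
  rewrite sub0r modulusN => /(_ (ltW h)) h2.
  have := le_trans h2 hr; rewrite laplacian_disk0// -powRrM mulVf ?gt_eqF// powRr1; last first.
    by rewrite divr_ge0// ltW.
  by rewrite divfK ?gt_eqF// lee_fin; lra.
have hS : has_sup S by split; [exists 0|exists R1].
pose r := sup S; have r0 : 0 <= r by apply: ub_le_sup => //; exists R1.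
have le1 : (nu (disk z r) <= 1)%E.
  pose D n := disk z (r - n.+1%:R^-1).
  have -> : disk z r = \bigcup_n D n.
    apply/seteqP; split => w; rewrite /disk/=; last first.
      by move=> [n _]; rewrite /D/disk/= => h; apply: lt_le_trans h _; rewrite gerBl.
    move=> h; pose n := Num.truncn (r - modulus (w - z))^-1.
    exists n => //; rewrite /D/disk/= ltrBrDr -ltrBrDl.
    have d0 : 0 < r - modulus (w - z) by rewrite subr_gt0.
    rewrite -[ltRHS]invrK ltf_pV2 ?posrE ?invr_gt0 ?ltr0n//.
    exact: truncnS_gt.
  have H : (nu \o D) n @[n --> \oo] --> nu (\bigcup_n D n).
    apply: nondecreasing_cvg_mu => [n| |]; first exact: measurable_disk.
      by apply: bigcup_measurable => n _; exact: measurable_disk.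
    apply/nondecreasing_seqP => n; apply/subsetPset => w; rewrite /D/disk/= => h.
    by apply: lt_le_trans h _; rewrite lerB// lef_pV2 ?posrE ?ltr0n// ler_nat.
  rewrite -(cvg_lim _ H)//; apply: lime_le; first by apply/cvg_ex; exists (nu (\bigcup_n D n)).
  apply: nearW => n /=; have n0 : 0 < n.+1%:R^-1 :> R by rewrite invr_gt0.
  have [s [s0 sS] hs] := sup_adherent n0 hS.
  apply: le_trans sS; apply: le_laplacian_disk; rewrite subrr modulus0 add0r.
  exact: ltW hs.
have ge1 : (1 <= nu (disk z r))%E.
  pose D n := disk z (r + n.+1%:R^-1).
  have gt1 n : (1 <= nu (D n))%E.
    rewrite leNgt; apply/negP => h.
    have /(ub_le_sup (ex_intro _ R1 uS)) : S (r + n.+1%:R^-1).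
      by split; [rewrite addr_ge0// invr_ge0|exact: ltW].
    by rewrite -/r leNgt ltrDl invr_gt0 ltr0n.
  have -> : nu (disk z r) = nu (\bigcap_n D n).
    have -> : \bigcap_n D n = disk z r `|` [set w | modulus (w - z) = r].
      apply/seteqP; split => w.
        move=> h; have : modulus (w - z) <= r.
          apply/ler_addgt0Pr => e e0; pose n := Num.truncn e^-1.
          have := h n I; rewrite /D/disk/= => /ltW h1; apply: le_trans h1 _; rewrite lerD2l.
          rewrite -[leRHS]invrK lef_pV2 ?posrE ?invr_gt0 ?ltr0n//; exact: (ltW (truncnS_gt _)).
        by rewrite le_eqVlt => /predU1P[h1|h1]; [right|left].
      move=> h n _; rewrite /D/disk/=; have n0 : 0 < n.+1%:R^-1 :> R by rewrite invr_gt0.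
      by case: h => /= [h|->]; [apply: lt_trans h _|]; rewrite ltrDl.
    rewrite measureU0//; first exact: measurable_disk.
      have mf : measurable_fun [set: C] (fun w : C => modulus (w - z)).
        exact: (measurableT_comp (@measurable_modulus R) (@measurable_translateC R (- z))).
      rewrite (_ : [set w | _] = [set: C] `&` (fun w : C => modulus (w - z)) @^-1` [set r]); last by rewrite setTI.
      by apply: mf; [exact: measurableT|exact: measurable_set1].
    exact: circle_null.
  have H : (nu \o D) n @[n --> \oo] --> nu (\bigcap_n D n).
    apply: nonincreasing_cvg_mu => [|n| |]; first exact: laplacian_disk_fin.
    - exact: measurable_disk.
    - by apply: bigcap_measurableType => n _; exact: measurable_disk.
    - apply/nonincreasing_seqP => n; apply/subsetPset => w; rewrite /D/disk/= => h.
      by apply: lt_le_trans h _; rewrite lerD2l lef_pV2 ?posrE ?ltr0n// ler_nat.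
  rewrite -(cvg_lim _ H)//; apply: lime_ge; first by apply/cvg_ex; exists (nu (\bigcap_n D n)).
  exact: nearW.
exists r; split; last by apply/eqP; rewrite eq_le le1 ge1.
rewrite lt_neqAle r0 andbT; apply/eqP => re; move: ge1; rewrite -re.
rewrite (_ : disk z 0 = set0) ?measure0//; last first.
  by apply/seteqP; split => w //; rewrite /disk/= ltNge modulus_ge0.
by rewrite lee_fin; lra.
Qed.

Local Notation rho := (rho nu).

Lemma rhoP z : 0 < rho z /\ nu (disk z (rho z)) = 1%E.
Proof. exact: (@getPex _ [set r | 0 < r /\ nu (disk z r) = 1%E] (rho_exists z)). Qed.

Lemma rho_gt0 z : 0 < rho z. Proof. by have [] := rhoP z. Qed.

Lemma rho_ge z s : (nu (disk z s) < 1)%E -> s <= rho z.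
Proof.
move=> h; rewrite leNgt; apply/negP => rs; have [_ r1] := rhoP z.
have := @le_laplacian_disk z z (rho z) s; rewrite subrr modulus0 add0r => /(_ (ltW rs)).
by rewrite r1 leNgt h.
Qed.

Lemma rho_le z s : (1 < nu (disk z s))%E -> rho z <= s.
Proof.
move=> h; rewrite leNgt; apply/negP => rs; have [_ r1] := rhoP z.
have := @le_laplacian_disk z z s (rho z); rewrite subrr modulus0 add0r => /(_ (ltW rs)).
by rewrite r1 leNgt h.
Qed.

End laplacian.

(** * The size of the radius rho *)

Lemma small_parameter (R : realType) (alpha M b : R) : 0 < alpha -> 0 < M -> 0 < b -> exists a, [/\ 0 < a,
  a <= 1 / 4, 6 * a <= b, M * a ^+ 2 <= 1 / 2 & M * (2 * a) `^ alpha <= 1 / 2].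
Proof.
move=> alpha0 M0 b0.
pose d := (2^-1 / M) `^ alpha^-1; have d0 : 0 < d by apply: powR_gt0; rewrite divr_gt0 ?invr_gt0.
have dM : M * d `^ alpha = 2^-1.
  rewrite /d -powRrM mulVf ?gt_eqF// powRr1 ?divr_ge0 ?invr_ge0 ?(ltW M0)//.
  by rewrite mulrC divfK ?gt_eqF.
have [e [e0 e1 e2]] : exists e, [/\ 0 < e, M * e <= 2^-1 & e <= 1].
  exists (Num.min 1 (2^-1 / M)); split; last by rewrite ge_min lexx.
    by rewrite lt_min ltr01 divr_gt0 ?invr_gt0.
  by rewrite mulrC -ler_pdivlMr// ge_min lexx orbT.
pose a := Num.min (Num.min (1 / 4) (b / 6)) (Num.min e (d / 2)).
have [h1 h2 h3 h4] : [/\ a <= 1 / 4, a <= b / 6, a <= e & a <= d / 2].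
  have ha1 : a <= Num.min (1 / 4) (b / 6) by rewrite /a ge_min lexx.
  have ha2 : a <= Num.min e (d / 2) by rewrite /a ge_min lexx orbT.
  by move: ha1 ha2; rewrite !(le_min a) => /andP[u1 u2] /andP[u3 u4].
have a0 : 0 < a by rewrite /a !lt_min e0 !divr_gt0.
move: a a0 h1 h2 h3 h4 => a a0 h1 h2 h3 h4.
exists a; split => //.
- by rewrite mulrC -ler_pdivlMr.
- rewrite -[1 / 2]/(1 * 2^-1) mul1r; apply: le_trans e1; rewrite ler_wpM2l ?(ltW M0)//.
  apply: le_trans h3; rewrite expr2 ler_piMl ?(ltW a0)//.
  by apply: le_trans h1 _; rewrite ler_pdivrMr// mul1r ler1n.
- rewrite -[1 / 2]/(1 * 2^-1) mul1r -dM ler_wpM2l ?(ltW M0)//.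
  apply: ge0_ler_powR; rewrite ?nnegrE ?(ltW alpha0) ?(ltW d0) ?mulr_ge0 ?(ltW a0)//.
  by rewrite mulrC -ler_pdivlMr.
Qed.

Lemma rho_regimes (R : realType) (alpha c a b x : R) :
  let T := 2 `^ `|alpha - 2| in 0 < alpha ->
  0 < c * T -> 0 < a -> a <= 1 / 4 -> 6 * a <= b ->
  c * T * a ^+ 2 <= 1 / 2 -> c * T * (2 * a) `^ alpha <= 1 / 2 -> 0 <= x ->
  let s := a * (1 + x) `^ (1 - alpha / 2) in
  (x < 2 * s -> x + s <= b) /\
  (2 * s <= x -> c * (x `^ (alpha - 2) * s ^+ 2) <= 1 / 2).
Proof.
move=> T alpha0 cT a0 a4 ab ac ad x0 s.
have T1 : 1 <= T.
  by have := ler_powR (_ : 1 <= 2 :> R) (normr_ge0 (alpha - 2)); rewrite powRr0; apply; rewrite ler1n.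
have c0 : 0 < c by move: cT; rewrite pmulr_lgt0// (lt_le_trans ltr01 T1).
have x1 : 0 < 1 + x by rewrite ltr_wpDr.
have x1' : 1 <= 1 + x by rewrite lerDl.
have s0 : 0 < s by rewrite mulr_gt0// powR_gt0.
have al1 : 1 - alpha / 2 <= 1 by rewrite gerBl divr_ge0// ltW.
have sx : s <= a * (1 + x).
  by rewrite /s ler_pM2l// -[leRHS]powRr1 ?(ltW x1)// ler_powR.
have sa : 2 <= alpha -> s <= a.
  move=> al; rewrite /s -[leRHS]mulr1 ler_pM2l// -[leRHS](powRr0 (1 + x)) ler_powR//.
  by rewrite subr_le0 ler_pdivlMr// mul1r.
have small : x <= 1 -> s <= 2 * a.
  move=> xle1; apply: le_trans sx _; rewrite mulrC ler_pM2r//.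
  by clear -xle1; lra.
have s2 : s ^+ 2 = a ^+ 2 * (1 + x) `^ (2 - alpha).
  rewrite /s exprMn; congr (_ * _); rewrite -powR_mulrn ?powR_ge0// -powRrM.
  by congr (_ `^ _); field.
split=> xs.
  have s2a : s <= 2 * a.
    have : s <= a * (1 + 2 * s).
      by apply: le_trans sx _; rewrite ler_pM2l// lerD2l ltW.
    have : a * s <= 1 / 4 * s by rewrite ler_pM2r.
    by rewrite mulrDr mulr1 [a * (2 * s)]mulrCA; move: (a * s) => as_ k1 k2; clear -k1 k2; lra.
  by clear -s2a ab xs; lra.
have xp : 0 < x by apply: lt_le_trans xs; rewrite mulr_gt0.
have P0 : 0 <= x `^ (alpha - 2) by exact: powR_ge0.
have [x1''|x1''] := leP 1 x.
  have h : (1 + x) `^ (2 - alpha) <= T * x `^ (2 - alpha).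
    rewrite /T distrC; apply: powR_comparable => //; first by clear -x0; lra.
    by clear -x1''; lra.
  have e1 : x `^ (alpha - 2) * x `^ (2 - alpha) = 1.
    rewrite -powRD ?(gt_eqF xp) ?implybT//.
    by rewrite (_ : alpha - 2 + (2 - alpha) = 0) ?powRr0//; ring.
  apply: le_trans ac; rewrite -mulrA ler_pM2l// s2 mulrCA [leRHS]mulrC ler_pM2l ?exprn_gt0//.
  apply: le_trans (ler_wpM2l P0 h) _.
  by rewrite mulrCA e1 mulr1.
have {}small := small (ltW x1'').
have [al|al] := leP 2 alpha.
  apply: le_trans ac; rewrite -mulrA ler_pM2l//.
  apply: ler_pM => //; first exact: sqr_ge0.
    apply: le_trans T1; have := ge0_ler_powR (_ : 0 <= alpha - 2) x0 ler01 (ltW x1'').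
    by rewrite powR1; apply; rewrite subr_ge0.
  by rewrite ler_pXn2r ?nnegrE ?(ltW s0) ?(ltW a0)//; exact: sa.
apply: le_trans ad; rewrite -mulrA ler_pM2l//.
have q0 : 0 <= 2 - alpha by rewrite subr_ge0 ltW.
have ts0 : 0 < 2 * s by rewrite mulr_gt0.
have zs' : x `^ (alpha - 2) <= (2 * s) `^ (alpha - 2).
  rewrite -[alpha - 2]opprB !powRN lef_pV2 ?posrE ?powR_gt0//.
  by apply: ge0_ler_powR; rewrite ?nnegrE// ltW.
have e : (2 * s) `^ (alpha - 2) * s ^+ 2 = 2 `^ (alpha - 2) * s `^ alpha.
  rewrite powRM ?(ltW s0)// -mulrA -powR_mulrn ?(ltW s0)// -powRD ?(gt_eqF s0) ?implybT//.
  by congr (_ * _ `^ _); ring.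
apply: (@le_trans _ _ ((2 * s) `^ (alpha - 2) * s ^+ 2)); first by rewrite ler_wpM2r ?sqr_ge0.
rewrite e; apply: ler_pM; rewrite ?powR_ge0//.
  by apply: ler_powR; [rewrite ler1n|exact: ler_norm].
by apply: ge0_ler_powR; rewrite ?nnegrE ?(ltW alpha0) ?(ltW s0)// mulr_ge0 ?(ltW a0).
Qed.

Section rho_regularity.
Variables (R : realType) (alpha : R).
Hypothesis alpha0 : 0 < alpha.
Local Notation C := R[i].
Local Notation m := (@lebesgueC R).
Local Notation kap := (disk_area R).
Local Notation nu := (laplacian_phi_alpha alpha : {measure set C -> \bar R}).
Local Notation rho := (rho nu).

Let laplacian_disk_gt0 z s : 0 < s -> (0 < nu (disk z s))%E.
Proof.
move=> s0.
have [c cs cz] : exists2 c : C, c != 0 & modulus (c - z) <= s / 2.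
  have [z0|z0] := eqVneq z 0; last by exists z; rewrite ?subrr ?modulus0 ?divr_ge0 ?ltW.
  exists (s / 2)%:C%C; rewrite ?z0 ?subr0 ?modulus_real ?ger0_norm ?divr_ge0 ?(ltW s0)//.
  by rewrite -modulus_eq0 modulus_real ger0_norm ?divr_ge0 ?(ltW s0)// gt_eqF// divr_gt0.
have c0 : 0 < modulus c by rewrite modulus_gt0.
pose t := Num.min (s / 2) (modulus c / 2).
have t0 : 0 < t by rewrite lt_min !divr_gt0.
apply: (@lt_le_trans _ _ (nu (disk c t))).
  have tc : t <= modulus c / 2 by rewrite /t ge_min lexx orbT.
  apply: lt_le_trans (laplacian_disk_ge alpha t0 tc).
  rewrite lte_fin; repeat (apply: mulr_gt0; rewrite ?invr_gt0 ?exprn_gt0 ?powR_gt0 ?disk_area_gt0//).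
apply: le_laplacian_disk.
have : t <= s / 2 by rewrite /t ge_min lexx.
by lra.
Qed.

Let laplacian_disk_mono z r s : 0 <= r -> r < s ->
  (nu (disk z r) < nu (disk z s))%E.
Proof.
move=> r0 rs; pose q : C := z + ((r + s) / 2)%:C%C.
have d0 : 0 < (s - r) / 2 by rewrite divr_gt0// subr_gt0.
have mq : modulus (q - z) = (r + s) / 2.
  by rewrite /q addrC addKr modulus_real ger0_norm// divr_ge0//; lra.
have D0 : disk z r `&` disk q ((s - r) / 2) = set0.
  apply/seteqP; split => w //; rewrite /disk/= => -[h1 h2].
  have := modulusD (q - w) (w - z); rewrite addrA subrK mq.
  by rewrite (modulusB q w); lra.
apply: (@lt_le_trans _ _ (nu (disk z r) + nu (disk q ((s - r) / 2)))%E).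
  have f1 : nu (disk z r) \is a fin_num.
    by rewrite ge0_fin_numE//; exact: laplacian_disk_fin.
  by rewrite -[ltLHS]adde0 lteD2lE//; exact: laplacian_disk_gt0.
rewrite -measureU//; try exact: measurable_disk.
apply: le_measure; rewrite ?inE; try exact: measurable_disk.
  by apply: measurableU; exact: measurable_disk.
move=> w; rewrite /disk/= => -[h|h]; first by lra.
by have := modulusD (w - q) (q - z); rewrite addrA subrK mq; lra.
Qed.

Lemma rho_lip z w : rho w <= rho z + modulus (z - w).
Proof.
rewrite leNgt; apply/negP => h.
have [rz1 rz] := rhoP alpha0 z; have [rw1 rw] := rhoP alpha0 w.
have m0 := modulus_ge0 (z - w).
have := @laplacian_disk_mono w _ _ _ h; rewrite rw => /(_ (addr_ge0 (ltW rz1) m0)).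
rewrite ltNge => /negP; apply.
by rewrite -rz; apply: le_laplacian_disk; rewrite addrC.
Qed.

Lemma continuousC_rho : continuousC rho.
Proof.
move=> z e e0; exists e => // w h; apply: le_lt_trans h.
have := rho_lip z w; have := rho_lip w z; rewrite (modulusB z w).
move: (rho w) (rho z) (modulus _) => p q r h1 h2.
by rewrite ler_norml; apply/andP; split; lra.
Qed.

Lemma measurable_rho : measurable_fun [set: C] rho.
Proof. exact: measurable_continuousC continuousC_rho. Qed.

Lemma rho_rotation (l z : C) : modulus l = 1 -> rho (l * z) = rho z.
Proof.
move=> l1; rewrite /rho; congr get; apply/seteqP; split => r /= [r0].
all: suff -> : nu (disk (l * z) r) = nu (disk z r) by [].
all: rewrite !(laplacianE alpha); congr (_ * _)%E; rewrite /pow_int [LHS]integral_mkcond [RHS]integral_mkcond.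
all: rewrite -[LHS](integral_rotation _ _ l1); last first.
all: try by move=> w; rewrite patchE; case: ifPn => // _; rewrite lee_fin powR_ge0.
all: try (apply/(measurable_restrictT _ _).1; [exact: measurable_disk|];
    by apply: measurable_funTS; apply/measurable_EFinP; exact: measurable_modulus_pow).
all: apply: eq_integral => w _; rewrite !patchE modulusM l1 mul1r.
all: suff -> : ((l * w)%R \in disk (l * z) r) = (w \in disk z r) by [].
all: by apply/idP/idP; rewrite !inE /disk/= -mulrBr modulusM l1 mul1r.
Qed.

Lemma rho_lower : exists2 a, 0 < a & forall z, a * (1 + modulus z) `^ (1 - alpha / 2) <= rho z.
Proof.
have n10 : 0 < fine (nu (disk 0 1)).
  apply: fine_gt0; rewrite laplacian_disk_fin// andbT; exact: laplacian_disk_gt0.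
have K0 := disk_area_gt0 R.
pose n1 := fine (nu (disk 0 1)).
have K2 : 0 < 2 `^ `|alpha - 2| :> R by exact: powR_gt0.
pose c2 := alpha ^+ 2 * 2 `^ `|alpha - 2| * kap.
have c20 : 0 < c2 by rewrite !mulr_gt0 ?exprn_gt0.
(* a is small enough for the three regimes below *)
pose b := (2^-1 / n1) `^ alpha^-1.
have b0 : 0 < b by apply: powR_gt0; rewrite divr_gt0 ?invr_gt0.
have bn : b `^ alpha * n1 = 2^-1.
  rewrite /b -powRrM mulVf ?gt_eqF// powRr1 ?divfK ?gt_eqF// divr_ge0 ?invr_ge0 ?ltW//.
have M0 : 0 < c2 * 2 `^ `|alpha - 2| by rewrite mulr_gt0.
have [a [a0 a4 ab ac ad]] := small_parameter alpha0 M0 b0.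
exists a => // z; set s := _ * _.
have z0 := modulus_ge0 z.
have s0 : 0 < s by rewrite mulr_gt0// powR_gt0// ltr_wpDr.
have [h1 h2] := rho_regimes alpha0 M0 a0 a4 ab ac ad z0.
apply: rho_ge => //; have [/h1 sb|zs] := ltP (modulus z) (2 * s).
  apply: (@le_lt_trans _ _ (nu (disk 0 b))).
    by apply: le_laplacian_disk; rewrite subr0.
  by rewrite laplacian_disk0// -/n1 bn lte_fin invf_lt1// ltr1n.
apply: (@le_lt_trans _ _ (1 / 2)%:E); last by rewrite lte_fin ltr_pdivrMr// mul1r ltr1n.
have sz : s <= modulus z / 2 by rewrite ler_pdivlMr// mulrC.
by apply: le_trans (laplacian_disk_le alpha s0 sz) _; rewrite lee_fin -/c2 h2.
Qed.

Lemma rho_upper : exists A R0, [/\ 0 < A, 1 <= R0 &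
  forall z, R0 <= modulus z -> rho z <= A * modulus z `^ (1 - alpha / 2)].
Proof.
have K0 := disk_area_gt0 R.
have K2 : 0 < 2 `^ `|alpha - 2| :> R by exact: powR_gt0.
pose c1 := alpha ^+ 2 / 2 `^ `|alpha - 2| * kap.
have c10 : 0 < c1 by rewrite mulr_gt0// divr_gt0// exprn_gt0.
pose A := 1 + 2 / c1.
have A1 : 1 < A by rewrite /A ltrDl divr_gt0.
have cA : 1 < c1 * A ^+ 2.
  have h : c1 * A = c1 + 2 by rewrite /A; field; rewrite gt_eqF.
  by rewrite expr2 mulrA h; nra.
pose R0 := (2 * A) `^ (2 / alpha).
exists A, (1 + R0); split; [by lra|by rewrite lerDl powR_ge0|].
move=> z zR; have R00 : 0 <= R0 by exact: powR_ge0.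
have z1 : 1 <= modulus z by lra.
have zp : 0 < modulus z by lra.
have sz : A * modulus z `^ (1 - alpha / 2) <= modulus z / 2.
  have a2 : 0 < alpha / 2 by rewrite divr_gt0.
  rewrite powRD; last by rewrite (gt_eqF zp) implybT.
  rewrite powRr1 ?(ltW zp)// powRN mulrCA ler_pM2l//.
  rewrite ler_pdivrMr ?powR_gt0// mulrC ler_pdivlMr// mulrC.
  have : (2 * A) <= modulus z `^ (alpha / 2); last by [].
  have -> : 2 * A = R0 `^ (alpha / 2).
    rewrite /R0 -powRrM (_ : 2 / alpha * (alpha / 2) = 1) ?powRr1//; [lra|field; lra].
  by apply: ge0_ler_powR; rewrite ?nnegrE ?(ltW a2) ?(ltW zp)//; lra.
have s0 : 0 < A * modulus z `^ (1 - alpha / 2) by rewrite mulr_gt0 ?powR_gt0//; lra.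
apply: rho_le => //; apply: lt_le_trans (laplacian_disk_ge alpha s0 sz).
rewrite -/c1 lte_fin exprMn -[(_ `^ (1 - _)) ^+ 2]powR_mulrn ?powR_ge0// -powRrM [X in c1 * X]mulrCA -powRD.
  by rewrite (_ : alpha - 2 + (1 - alpha / 2) * 2%:R = 0); [rewrite powRr0 mulr1|field].
by rewrite (gt_eqF zp) implybT.
Qed.

End rho_regularity.

(** * Mass of the monomials *)

Lemma expR_tangent_lower (R : realType) (d s : R) : 0 <= d -> d <= 1 ->
  d / 2 * `|s| - d ^+ 2 <= expR s - 1 - s.
Proof.
move=> d0 d1; have [s0|s0] := leP 0 s.
  have h1 : expR d * (1 + (s - d)) <= expR s.
    have -> : expR s = expR d * expR (s - d) by rewrite -expRD; congr expR; ring.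
    by rewrite ler_pM2l ?expR_gt0// expR_ge1Dx.
  have h2 := expR_ge1Dx d; rewrite ger0_norm//.
  have h3 : (expR d - 1 - d) * (1 - d + s) >= 0.
    by apply: mulr_ge0; [lra|lra].
  by nra.
have h1 : expR (- d) * (1 + (s + d)) <= expR s.
  have -> : expR s = expR (- d) * expR (s + d) by rewrite -expRD; congr expR; ring.
  by rewrite ler_pM2l ?expR_gt0// expR_ge1Dx.
have h2 := expR_ge1Dx (- d); have e0 := expR_gt0 (- d).
have h3 : expR (- d) * (1 + d) <= 1.
  apply: (@le_trans _ _ (expR (- d) * expR d)); last by rewrite -expRD addNr expR0.
  by rewrite ler_pM2l// expR_ge1Dx.
rewrite ltr0_norm//; move: (expR (- d)) (expR s) h1 h2 h3 e0 => u v h1 h2 h3 e0.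
have h4 : d / 2 <= 1 - u by nra.
have h5 : 0 <= (- s) * (1 - u - d / 2) by apply: mulr_ge0; lra.
nra.
Qed.

Lemma exponent_bound (R : realType) (alpha L N n t : R) : 0 < alpha -> 0 <= L ->
  (2 * L + 2) / alpha <= N -> `|n - alpha * N ^+ 2| <= L * N ->
  2 * n * t - 2 * N ^+ 2 * (expR (alpha * t) - 1) <=
  2 * ((2 * L + 2) / alpha) ^+ 2 - 2 * N * `|t|.
Proof.
move=> al0 L0; set M := (2 * L + 2) / alpha => MN nN.
have M0 : 0 < M by rewrite divr_gt0//; lra.
have N0 : 0 < N by lra.
have MaE : M * alpha = 2 * L + 2 by rewrite /M divfK// gt_eqF.
have d0 : 0 <= M / N by rewrite divr_ge0// ltW.
have d1 : M / N <= 1 by rewrite ler_pdivrMr// mul1r.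
have H := expR_tangent_lower (alpha * t) d0 d1.
have H2 : N * M * alpha * `|t| - 2 * M ^+ 2 <= 2 * N ^+ 2 * (expR (alpha * t) - 1 - alpha * t).
  have N2 : 0 <= 2 * N ^+ 2 by rewrite mulr_ge0 ?sqr_ge0.
  apply: le_trans (ler_wpM2l N2 H); rewrite normrM (ger0_norm (ltW al0)).
  by rewrite le_eqVlt; apply/orP; left; apply/eqP; field; rewrite gt_eqF.
have H3 : (n - alpha * N ^+ 2) * t <= L * N * `|t|.
  by apply: le_trans (ler_norm _) _; rewrite normrM ler_wpM2r.
have -> : 2 * n * t - 2 * N ^+ 2 * (expR (alpha * t) - 1) =
    2 * ((n - alpha * N ^+ 2) * t) - 2 * N ^+ 2 * (expR (alpha * t) - 1 - alpha * t) by ring.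
have H4 : N * M * alpha * `|t| = (2 * L + 2) * (N * `|t|) by rewrite -MaE; ring.
rewrite H4 in H2; have -> : 2 * N * `|t| = 2 * (N * `|t|) by ring.
rewrite -[L * N * _]mulrA in H3.
have H5 : (2 * L + 2) * (N * `|t|) = 2 * (L * (N * `|t|)) + 2 * (N * `|t|) by ring.
rewrite H5 in H2; move: (L * (N * `|t|)) (N * `|t|) (M ^+ 2) H2 H3 => A B D.
move: (_ * t) (2 * N ^+ 2 * _) => E G H2 H3; clear -H2 H3; lra.
Qed.

Section peak.
Variables (R : realType) (alpha : R).
Hypothesis alpha0 : 0 < alpha.
Local Notation C := R[i].
Local Notation m := (@lebesgueC R).
Local Notation kap := (disk_area R).
Local Notation nu := (laplacian_phi_alpha alpha : {measure set C -> \bar R}).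
Local Notation rho := (rho nu).

Definition monomial_density (n : nat) (w : C) : R :=
  modulus w ^+ (2 * n) * expR (- 2 * modulus w `^ alpha) / rho w ^+ 2.

Lemma monomial_density_ge0 n w : 0 <= monomial_density n w.
Proof. by rewrite divr_ge0 ?sqr_ge0// mulr_ge0 ?expR_ge0// exprn_ge0// modulus_ge0. Qed.

Lemma measurable_rho_sqrV : measurable_fun [set: C] (fun w => (rho w ^+ 2)^-1).
Proof.
have -> : (fun w => (rho w ^+ 2)^-1) = (fun w => (rho w) `^ (- 2%:R)).
  by apply/funext => w; rewrite powR_invn// ltW// rho_gt0.
exact: (measurableT_comp (measurable_powR _) (measurable_rho alpha0)).
Qed.

Lemma measurable_exp_weight :
  measurable_fun [set: C] (fun w : C => expR (- 2 * modulus w `^ alpha)).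
Proof.
apply: measurableT_comp; first exact: measurable_expR.
by apply: measurable_funM => //; exact: measurable_modulus_pow.
Qed.

Lemma measurable_monomial_density n : measurable_fun [set: C] (monomial_density n).
Proof.
apply: measurable_funM measurable_rho_sqrV; apply: measurable_funM measurable_exp_weight.
by apply: measurable_funX; exact: measurable_modulus.
Qed.

Let rhoV_le : exists2 b, 0 < b & forall w, (rho w ^+ 2)^-1 <= b * (1 + modulus w) `^ (alpha - 2).
Proof.
have [a a0 ha] := rho_lower alpha0; exists (a ^- 2); first by rewrite invr_gt0 exprn_gt0.
move=> w; have w1 : 0 < 1 + modulus w by rewrite ltr_wpDr ?modulus_ge0.
have r0 := rho_gt0 alpha0 w.
have h : (a * (1 + modulus w) `^ (1 - alpha / 2)) ^+ 2 <= rho w ^+ 2.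
  by rewrite ler_pXn2r ?nnegrE ?(ltW r0)// mulr_ge0 ?powR_ge0 ?(ltW a0).
rewrite -lef_pV2 ?posrE ?exprn_gt0 ?mulr_gt0 ?powR_gt0// in h.
apply: le_trans h _; rewrite exprMn invfM -[(_ `^ _) ^+ 2]powR_mulrn ?powR_ge0// -powRrM -powRN.
by rewrite (_ : - ((1 - alpha / 2) * 2%:R) = alpha - 2)//; field.
Qed.

Let weight_le (r y : R) : 1 <= r -> 0 < y ->
  (1 + r * y) `^ (alpha - 2) <= 2 `^ `|alpha - 2| * r `^ (alpha - 2) *
    (if y < 1 then y `^ (- 2) else y `^ (alpha - 2)).
Proof.
move=> r1 y0; have r0 : 0 < r by exact: lt_le_trans r1.
have ry0 : 0 < r * y by exact: mulr_gt0.
have T1 : 1 <= 2 `^ `|alpha - 2| :> R.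
  by have := ler_powR (_ : 1 <= 2 :> R) (normr_ge0 (alpha - 2)); rewrite powRr0; apply; rewrite ler1n.
have T0 := lt_le_trans ltr01 T1.
case: ifPn => y1; last first.
  rewrite -leNgt in y1; rewrite -mulrA -powRM ?(ltW r0) ?(ltW y0)//.
  have ry1 : 1 <= r * y by rewrite -[1]mulr1 ler_pM.
  apply: powR_comparable => //.
    by rewrite ler_pdivrMr// mulrDl mul1r -lerBlDr; apply: (@le_trans _ _ 0); rewrite ?ler0n// subr_le0 ler_peMr ?(ltW ry0)// ler1n.
  by rewrite mulr_natl mulr2n lerD2r.
have y2 : 1 <= y `^ (- 2).
  have y2' : y `^ 2 <= 1.
    have := ge0_ler_powR (ler0n R 2) (ltW y0 : y \in Num.nneg) ler01 (ltW y1).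
    by rewrite powR1.
  by rewrite powRN invf_ge1// powR_gt0.
have [al|al] := leP 2 alpha.
  have a2 : 0 <= alpha - 2 by rewrite subr_ge0.
  rewrite (ger0_norm a2) -powRM ?(ltW r0)// -[leLHS]mulr1.
  apply: ler_pM => //; first exact: powR_ge0.
  apply: ge0_ler_powR => //; rewrite ?nnegrE ?addr_ge0 ?(ltW ry0) ?mulr_ge0 ?(ltW r0)//.
  have -> : 2 * r = r + r by ring.
  by rewrite lerD// -[leRHS]mulr1 ler_pM2l// ltW.
have a2 : 0 <= 2 - alpha by rewrite subr_ge0 ltW.
apply: (@le_trans _ _ ((r * y) `^ (alpha - 2))).
  rewrite -[alpha - 2]opprB !powRN lef_pV2 ?posrE ?powR_gt0 ?addr_gt0//.
  by apply: ge0_ler_powR => //; rewrite ?nnegrE ?lerDr ?addr_ge0 ?(ltW ry0).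
rewrite powRM ?(ltW r0) ?(ltW y0)//; apply: ler_pM; rewrite ?powR_ge0//.
  by rewrite ler_peMl ?powR_ge0.
by apply: ger_powR; rewrite ?y0 ?(ltW y1)// lerBrDr addrC subrr ltW.
Qed.

(** Near its peak radius r the n-th monomial density decays at least like
    exp (- 2 N |ln (|w| / r)|), where N = r^(alpha / 2): its mass is that of an
    annulus of relative width 1 / N. *)
Lemma monomial_mass_le (L : R) : 0 <= L -> exists B r1, [/\ 0 < B, 1 <= r1 &
  forall (n : nat) r, r1 <= r -> `|n%:R - alpha * r `^ alpha| <= L * r `^ (alpha / 2) ->
  (\int[m]_w (monomial_density n w)%:E <=
   (B * r `^ (alpha / 2) * (r ^+ (2 * n) * expR (- 2 * r `^ alpha)))%:E)%E].
Proof.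
move=> L0; have [b b0 hb] := rhoV_le.
have K0 := disk_area_gt0 R.
pose M := (2 * L + 2) / alpha.
have M0 : 0 < M by rewrite divr_gt0// ltr_wpDl// mulr_ge0.
pose T := 2 `^ `|alpha - 2| : R; have T0 : 0 < T by exact: powR_gt0.
pose B := b * expR (2 * M ^+ 2) * T * (10 * kap).
have B0 : 0 < B by rewrite !mulr_gt0 ?expR_gt0.
pose N1 := M + alpha + 4 + L.
have N10 : 1 <= N1 by rewrite /N1; have := alpha0; lra.
pose r1 := N1 `^ (2 / alpha).
have r11 : 1 <= r1.
  apply: (@le_trans _ _ (N1 `^ 0)); first by rewrite powRr0.
  by apply: ler_powR => //; rewrite divr_ge0 ?(ltW alpha0).
exists B, r1; split => // n r hr hn.
have r1' : 1 <= r by exact: le_trans hr.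
have r0 : 0 < r by exact: lt_le_trans r1'.
pose N := r `^ (alpha / 2).
have a2 : 0 < alpha / 2 by rewrite divr_gt0.
have NN1 : N1 <= N.
  have -> : N1 = r1 `^ (alpha / 2).
    rewrite /r1 -powRrM (_ : 2 / alpha * (alpha / 2) = 1) ?powRr1//.
      exact: le_trans N10.
    by field; rewrite gt_eqF.
  by apply: ge0_ler_powR; rewrite ?nnegrE ?(ltW a2) ?(ltW r0)// (le_trans ler01).
have [NM Na N4 N0] : [/\ M <= N, N <= 2 * N - alpha, 4 <= N & 0 < N].
  by move: NN1; rewrite /N1; split; lra.
have N2 : N ^+ 2 = r `^ alpha.
  rewrite -powR_mulrn ?powR_ge0// -powRrM.
  by rewrite (_ : alpha / 2 * 2%:R = alpha)// divfK// gt_eqF.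
have n1 : (0 < n)%N.
  rewrite lt0n; apply/eqP => n0; move: hn; rewrite n0 sub0r normrN ger0_norm ?mulr_ge0 ?powR_ge0 ?(ltW alpha0)//.
  rewrite -N2 expr2 mulrA ler_pM2r// => h.
  have : alpha * M <= alpha * N by rewrite ler_pM2l.
  have -> : alpha * M = 2 * L + 2 by rewrite /M mulrCA divff ?mulr1// gt_eqF.
  by move: L0 h; move: (alpha * N) => aN; lra.
pose P := r ^+ (2 * n) * expR (- 2 * r `^ alpha).
have P0 : 0 < P by rewrite mulr_gt0 ?expR_gt0// exprn_gt0.
have [D [D0 DE]] : exists D, 0 < D /\ D = b * expR (2 * M ^+ 2) * T * r `^ (alpha - 2) * P.
  eexists; split; last by [].
  apply: mulr_gt0 => //; apply: mulr_gt0; last exact: powR_gt0.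
  by apply: mulr_gt0 => //; apply: mulr_gt0 => //; exact: expR_gt0.
pose k := 2 * N - alpha.
have k4 : 4 <= k by exact: le_trans Na.
(* pointwise bound at r w *)
have bound (w : C) : monomial_density n (r%:C%C * w)%R <=
    D * (if modulus w < 1 then modulus w `^ (2 * N - 2) else modulus w `^ (- 2 - k)).
  have [->|w0] := eqVneq w 0.
    rewrite /monomial_density mulr0 modulus0 expr0n muln_eq0/= (gtn_eqF n1) !mul0r.
    by rewrite mulr_ge0 ?(ltW D0)//; case: ifP => _; exact: powR_ge0.
  have y0 : 0 < modulus w by rewrite modulus_gt0.
  set y := modulus w in y0 *.
  rewrite /monomial_density modulusM modulus_real ger0_norm ?(ltW r0)// -/y.
  have h1 : (r * y) ^+ (2 * n) * expR (- 2 * (r * y) `^ alpha) <=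
      P * (expR (2 * M ^+ 2) * expR (- (2 * N * `|ln y|))).
    have yE : y = expR (ln y) by rewrite lnK// posrE.
    have -> : (r * y) ^+ (2 * n) * expR (- 2 * (r * y) `^ alpha) = P *
        expR (2 * n%:R * ln y - 2 * N ^+ 2 * (expR (alpha * ln y) - 1)).
      rewrite /P exprMn {1}yE -expRM_natl powRM ?(ltW r0) ?(ltW y0)// -N2.
      have -> : y `^ alpha = expR (alpha * ln y) by rewrite /powR gt_eqF.
      have q (A x u v w' : R) : x + u = v + w' -> A * expR x * expR u = A * expR v * expR w'.
        by move=> h; rewrite -!mulrA -!expRD h.
      by apply: q; rewrite natrM; ring.
    rewrite ler_pM2l// -expRD ler_expR.
    by apply: exponent_bound => //; rewrite N2.
  have h2 : (rho (r%:C%C * w) ^+ 2)^-1 <= b * (T * r `^ (alpha - 2) *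
      (if y < 1 then y `^ (- 2) else y `^ (alpha - 2))).
    apply: (le_trans (hb _)); rewrite ler_pM2l// modulusM modulus_real ger0_norm ?(ltW r0)//.
    exact: weight_le.
  have h3 : expR (- (2 * N * `|ln y|)) * (if y < 1 then y `^ (- 2) else y `^ (alpha - 2)) =
      (if y < 1 then y `^ (2 * N - 2) else y `^ (- 2 - k)).
    case: ifPn => y1.
      rewrite ltr0_norm ?ln_lt0 ?y0// mulrN opprK.
      have -> : expR (2 * N * ln y) = y `^ (2 * N) by rewrite /powR gt_eqF.
      by rewrite -powRD// (gt_eqF y0) implybT.
    rewrite -leNgt in y1; rewrite ger0_norm ?ln_ge0//.
    have -> : expR (- (2 * N * ln y)) = y `^ (- (2 * N)) by rewrite /powR gt_eqF// mulNr.
    rewrite -powRD ?(gt_eqF y0) ?implybT//; congr (_ `^ _); rewrite /k; ring.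
  have l1 : 0 <= (r * y) ^+ (2 * n) * expR (- 2 * (r * y) `^ alpha).
    by rewrite mulr_ge0 ?expR_ge0// exprn_ge0// mulr_ge0// ltW.
  have l2 : 0 <= (rho (r%:C%C * w) ^+ 2)^-1 by rewrite invr_ge0 sqr_ge0.
  apply: le_trans (ler_pM l1 l2 h1 h2) _.
  rewrite -h3 DE le_eqVlt; apply/orP; left; apply/eqP; ring.
have mF : measurable_fun [set: C] (fun w => (monomial_density n w)%:E).
  by apply/measurable_EFinP; exact: measurable_monomial_density.
have F0 w : (0 <= (monomial_density n w)%:E)%E by rewrite lee_fin monomial_density_ge0.
have S := integral_scaleC r0 mF F0.
have mS : measurable_fun [set: C] (fun w => (monomial_density n (r%:C%C * w)%R)%:E).
  by apply: (measurableT_comp mF); exact: measurable_scaleC.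
have in_le : (\int[m]_(w in disk 0%R 1%R) (monomial_density n (r%:C%C * w)%R)%:E <=
    (D * (4 * kap / (2 * N)))%:E)%E.
  apply: (@le_trans _ _ (\int[m]_(w in disk 0%R 1%R) (D%:E * (modulus w `^ (2 * N - 2))%:E))%E).
    apply: ge0_le_integral_any => w; rewrite /disk/= subr0 => w1.
      by rewrite lee_fin monomial_density_ge0.
    by rewrite -EFinM lee_fin; have := bound w; rewrite w1.
  rewrite ge0_integralZl_any ?(ltW D0)//; last by move=> w _; rewrite lee_fin powR_ge0.
  rewrite (EFinM D); apply: lee_wpmul2l; first by rewrite lee_fin ltW.
  have p0 : 0 <= 2 * N - 2 by move: N4; clear; lra.
  by have := pow_int_inner p0; rewrite subrK.
have out_le : (\int[m]_(w in [set w : C | (1 <= modulus w)%R]) (monomial_density n (r%:C%C * w)%R)%:E <=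
    (D * (8 * kap / k))%:E)%E.
  apply: (@le_trans _ _ (\int[m]_(w in [set w : C | (1 <= modulus w)%R]) (D%:E * (modulus w `^ (- 2 - k))%:E))%E).
    apply: ge0_le_integral_any => w /= w1; first by rewrite lee_fin monomial_density_ge0.
    by rewrite -EFinM lee_fin; have := bound w; rewrite ltNge w1.
  rewrite ge0_integralZl_any ?(ltW D0)//; last by move=> w _; rewrite lee_fin powR_ge0.
  rewrite (EFinM D); apply: lee_wpmul2l; first by rewrite lee_fin ltW.
  exact: pow_int_outer.
have tot : (\int[m]_w (monomial_density n (r%:C%C * w)%R)%:E <=
    (D * (10 * kap / N))%:E)%E.
  have -> : [set: C] = disk 0%R 1%R `|` [set w : C | (1 <= modulus w)%R].
    apply/seteqP; split => // w _; rewrite /disk/= subr0.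
    by have [h|h] := ltP (modulus w) 1; [left|right].
  have mo : measurable [set w : C | (1 <= modulus w)%R].
    rewrite (_ : [set w | _] = ~` disk 0%R 1%R); first by apply: measurableC; exact: measurable_disk.
    by apply/seteqP; split => w; rewrite /disk/= subr0 leNgt => /negP.
  rewrite (ge0_integral_setU m (measurable_disk _ _) mo); last 3 first.
  - exact: measurable_funTS.
  - by move=> w _; exact: F0.
  - apply/disj_setPS => w []; rewrite /disk/= subr0 => h1 h2.
    by move: h1; rewrite ltNge h2.
  apply: le_trans (leeD in_le out_le) _; rewrite -EFinD lee_fin -mulrDr ler_pM2l//.
  have kN : 8 * kap / k <= 8 * kap / N.
    rewrite ler_pM2l ?mulr_gt0// lef_pV2 ?posrE//; first exact: lt_le_trans Na.
  apply: le_trans (lerD (lexx _) kN) _; rewrite le_eqVlt; apply/orP; left; apply/eqP.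
  by field; rewrite gt_eqF.
have r2 : 0 < r ^+ 2 by rewrite exprn_gt0.
have E1 : (\int[m]_w (monomial_density n w)%:E =
    (r ^+ 2)%:E * \int[m]_w (monomial_density n (r%:C%C * w)%R)%:E)%E.
  by rewrite S muleA -EFinM divff ?mul1e// gt_eqF.
rewrite E1; apply: le_trans (lee_wpmul2l _ tot) _; first by rewrite lee_fin ltW.
rewrite -EFinM lee_fin /B DE -/P -/N le_eqVlt; apply/orP; left; apply/eqP.
have rr : r ^+ 2 * r `^ (alpha - 2) = N ^+ 2.
  rewrite N2 -powR_mulrn ?(ltW r0)// -powRD ?(gt_eqF r0) ?implybT//; congr (_ `^ _); ring.
transitivity (b * expR (2 * M ^+ 2) * T * (10 * kap) * P * (r ^+ 2 * r `^ (alpha - 2)) / N).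
  by ring.
by rewrite rr; field; rewrite gt_eqF.
Qed.

End peak.

(** * The orthonormal basis of monomials *)

Section fock_space_alpha.
Variables (R : realType) (alpha : R).
Hypothesis alpha0 : 0 < alpha.
Local Notation C := R[i].
Local Notation m := (@lebesgueC R).
Local Notation kap := (disk_area R).
Local Notation nu := (laplacian_phi_alpha alpha : {measure set C -> \bar R}).
Local Notation rho := (rho nu).
Local Notation phi := (phi_alpha alpha).
Local Notation mu := (mu_phi phi nu : {measure set C -> \bar R}).

Definition monomial_mass n : \bar R := (\int[m]_w (monomial_density alpha n w)%:E)%E.

Lemma rho_sqrV_bounded : exists b, forall w, modulus w < 1 -> (rho w ^+ 2)^-1 <= b.
Proof.
have [a a0 ha] := rho_lower alpha0.
pose t := a * 2 `^ (- `|1 - alpha / 2|); have t0 : 0 < t by rewrite mulr_gt0 ?powR_gt0.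
exists (t ^- 2) => w w1; have w0 := modulus_ge0 w; have r0 := rho_gt0 alpha0 w.
rewrite lef_pV2 ?posrE ?exprn_gt0// ler_pXn2r ?nnegrE ?(ltW t0) ?(ltW r0)//.
apply: le_trans (ha w); rewrite /t ler_pM2l//.
have z1 : 0 < 1 + modulus w by rewrite ltr_wpDr.
have := @powR_comparable R (1 - alpha / 2) 1 (1 + modulus w) z1.
rewrite powR1 => h; have : 1 <= 2 `^ `|1 - alpha / 2| * (1 + modulus w) `^ (1 - alpha / 2).
  by apply: h; move: w0 w1; move: (modulus w) => x *; lra.
by rewrite powRN mulrC -ler_pdivrMr ?powR_gt0// mul1r.
Qed.

Lemma monomial_mass_fin n : (monomial_mass n < +oo)%E.
Proof.
have [B [r1 [B0 r11 hB]]] := monomial_mass_le alpha0 ler01.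
have [b hb] := rho_sqrV_bounded.
(* a later monomial for which the peak estimate applies *)
have [k [nk kfin]] : exists k, (n <= k)%N /\ (monomial_mass k < +oo)%E.
  pose s := Num.max r1 ((n%:R / alpha) `^ alpha^-1).
  pose k := (Num.truncn (alpha * s `^ alpha)).+1.
  have s1 : r1 <= s by rewrite le_max lexx.
  have s0 : 0 < s by apply: lt_le_trans s1; exact: lt_le_trans r11.
  have ns : n%:R <= alpha * s `^ alpha.
    rewrite mulrC -ler_pdivrMr//.
    have -> : n%:R / alpha = ((n%:R / alpha) `^ alpha^-1) `^ alpha.
      by rewrite -powRrM mulVf ?gt_eqF// powRr1// divr_ge0// ltW.
    apply: ge0_ler_powR; rewrite ?nnegrE ?powR_ge0 ?(ltW s0) ?(ltW alpha0)//.
    by rewrite le_max lexx orbT.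
  have /andP[k1 k2] : (k.-1)%:R <= alpha * s `^ alpha < k%:R.
    by rewrite /k/= truncn_itv// mulr_ge0 ?powR_ge0// ltW.
  exists k; split.
    by rewrite -(ler_nat R) ltW// (le_lt_trans ns).
  apply: le_lt_trans (hB k s s1 _) _; last by rewrite ltry.
  have : 1 <= s `^ (alpha / 2).
    apply: (@le_trans _ _ (s `^ 0)); first by rewrite powRr0.
    by apply: ler_powR; [exact: le_trans s1|rewrite divr_ge0// ltW].
  rewrite mul1r; apply: le_trans.
  have kE : k%:R = (k.-1)%:R + 1 :> R by rewrite /k/= -natr1.
  rewrite ger0_norm; first by rewrite kE; move: k1; clear; lra.
  by rewrite subr_ge0 ltW.
have mD j : measurable_fun [set: C] (fun w => (monomial_density alpha j w)%:E).
  by apply/measurable_EFinP; exact: measurable_monomial_density.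
have le w : monomial_density alpha n w <=
    \1_(disk (0 : C) 1) w * b + monomial_density alpha k w.
  rewrite indicE; have [w1|w1] := ltP (modulus w) 1.
    have -> : (w \in disk 0 1) = true by apply/mem_set; rewrite /disk/= subr0.
    rewrite mul1r -[leLHS]addr0 lerD ?monomial_density_ge0//.
    rewrite -[leRHS]mul1r /monomial_density ler_pM ?invr_ge0 ?sqr_ge0 ?hb//.
      by rewrite mulr_ge0 ?expR_ge0// exprn_ge0// modulus_ge0.
    rewrite mulr_ile1 ?expR_ge0 ?exprn_ge0 ?modulus_ge0//.
      by rewrite exprn_ile1 ?modulus_ge0// ltW.
    by rewrite -expR0 ler_expR mulNr oppr_le0 mulr_ge0// powR_ge0.
  have -> : (w \in disk 0 1) = false.
    by apply: memNset => /=; rewrite /disk/= subr0; apply/negP; rewrite -leNgt.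
  rewrite mul0r add0r /monomial_density ler_wpM2r ?invr_ge0 ?sqr_ge0//.
  by rewrite ler_wpM2r ?expR_ge0// ler_weXn2l// leq_mul2l nk orbT.
have b0 : 0 <= b.
  by apply: le_trans (hb 0 _); rewrite ?invr_ge0 ?sqr_ge0// modulus0.
apply: (@le_lt_trans _ _ (\int[m]_w ((\1_(disk (0 : C) 1) w * b)%:E +
    (monomial_density alpha k w)%:E))%E).
  apply: ge0_le_integral_any => w _; first by rewrite lee_fin monomial_density_ge0.
  by rewrite -EFinD lee_fin le.
have mI : measurable_fun [set: C] (fun w => (\1_(disk (0 : C) 1) w * b)%:E).
  apply/measurable_EFinP; apply: measurable_funM => //.
  by apply: measurable_indic; exact: measurable_disk.
rewrite (ge0_integralD _ _ _ mI _ (mD k))//; last 2 first.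
- by move=> w _; rewrite lee_fin mulr_ge0.
- by move=> w _; rewrite lee_fin monomial_density_ge0.
rewrite lte_add_pinfty//.
have -> : (\int[m]_w (\1_(disk (0 : C) 1) w * b)%:E = \int[m]_(w in disk 0%R 1%R) b%:E)%E.
  rewrite [RHS]integral_mkcond; apply: eq_integral => w _.
  by rewrite patchE indicE; case: ifP; rewrite ?mul1r ?mul0r.
by rewrite integral_disk_cst// ltry.
Qed.

Lemma monomial_mass_gt0 n : (0 < monomial_mass n)%E.
Proof.
pose z : C := (3 / 2 : R)%:C%C; pose b : R := expR (- 2 * 2 `^ alpha) / (rho 0 + 2) ^+ 2.
have K0 := disk_area_gt0 R; have r0 := rho_gt0 alpha0 0.
have b0 : 0 < b by rewrite divr_gt0 ?expR_gt0// exprn_gt0// addr_gt0.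
have zb w : disk z (1 / 2) w -> 1 <= modulus w <= 2.
  rewrite /disk/= => h; have zE : modulus z = 3 / 2 by rewrite modulus_real ger0_norm//; lra.
  have := modulusD (w - z) z; have := modulusD (z - w) w.
  rewrite !subrK zE (modulusB z w); move: h; move: (modulus _) (modulus _) => x y *; lra.
apply: (@lt_le_trans _ _ (\int[m]_(w in disk z (1 / 2)) b%:E)%E).
  have h0 : 0 < 1 / 2 :> R by rewrite divr_gt0.
  by rewrite (integral_disk_cst _ _ (ltW h0)) lte_fin mulr_gt0// mulr_gt0// exprn_gt0.
rewrite /monomial_mass integral_mkcond; apply: ge0_le_integral_any => w _.
  by rewrite patchE; case: ifP; rewrite ?lexx// lee_fin ltW.
rewrite patchE; case: ifPn => [/set_mem/zb/andP[w1 w2]|_]; rewrite lee_fin ?monomial_density_ge0//.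
have rw := rho_gt0 alpha0 w.
rewrite /monomial_density ler_pM ?expR_ge0 ?invr_ge0 ?sqr_ge0//.
  rewrite -[leLHS]mul1r ler_pM ?expR_ge0//; first by rewrite exprn_ege1.
  rewrite ler_expR !mulNr lerN2 ler_pM2l//.
  by apply: ge0_ler_powR; rewrite ?nnegrE ?modulus_ge0 ?(ltW alpha0).
rewrite lef_pV2 ?posrE ?exprn_gt0 ?addr_gt0// ler_pXn2r ?nnegrE ?(ltW rw) ?addr_ge0 ?(ltW r0)//.
apply: le_trans (rho_lip alpha0 0 w) _; rewrite lerD2l modulusB subr0//.
Qed.

Definition monomial_norm n : R := c_phi phi nu * fine (monomial_mass n).

Lemma monomial_massE n : (fine (monomial_mass n))%:E = monomial_mass n.
Proof. by rewrite fineK// ge0_fin_numE ?monomial_mass_fin// ltW// monomial_mass_gt0. Qed.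

Lemma c_phi_gt0 : 0 < c_phi phi nu.
Proof.
suff : exists c, 0 < c /\
    (\int[m]_z (c * expR (- 2 * phi z) / rho z ^+ 2)%:E = 1)%E by move=> /getPex[].
have m0 : 0 < fine (monomial_mass 0) by rewrite -lte_fin monomial_massE monomial_mass_gt0.
exists (fine (monomial_mass 0))^-1; split; first by rewrite invr_gt0.
have -> : (\int[m]_z ((fine (monomial_mass 0))^-1 * expR (- 2 * phi z) / rho z ^+ 2)%:E =
    \int[m]_z ((fine (monomial_mass 0))^-1%:E * (monomial_density alpha 0 z)%:E))%E.
  by apply: eq_integral => z _; rewrite -EFinM /monomial_density muln0 expr0 mul1r mulrA.
rewrite ge0_integralZl_any ?invr_ge0 ?(ltW m0)//; last first.
  by move=> z _; rewrite lee_fin monomial_density_ge0.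
by rewrite -[X in (_ * X)%E]/(monomial_mass 0) -monomial_massE -EFinM mulVf// gt_eqF.
Qed.

Lemma monomial_norm_gt0 n : 0 < monomial_norm n.
Proof. by rewrite mulr_gt0 ?c_phi_gt0// -lte_fin monomial_massE monomial_mass_gt0. Qed.

Lemma fock_densityE z : fock_density phi nu z = c_phi phi nu * monomial_density alpha 0 z.
Proof. by rewrite /fock_density/monomial_density muln0 expr0 mul1r mulrA. Qed.

Lemma measurable_fock_density : measurable_fun [set: C] (fock_density phi nu).
Proof.
have -> : fock_density phi nu = (fun z => c_phi phi nu * monomial_density alpha 0 z).
  by apply/funext => z; exact: fock_densityE.
by apply: measurable_funM => //; exact: measurable_monomial_density.
Qed.

Lemma integral_fock (F : C -> R) : measurable_fun [set: C] F -> (forall z, 0 <= F z) ->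
  (\int[mu]_z (F z)%:E = \int[m]_z (F z * fock_density phi nu z)%:E)%E.
Proof.
move=> mF F0; rewrite /mu_phi (@ge0_integral_density _ _ _ m (fock_density phi nu))//.
- exact: measurable_fock_density.
- exact/measurable_EFinP.
Qed.

Lemma integral_fock_set (F : C -> R) D : measurable D -> measurable_fun [set: C] F ->
  (forall z, 0 <= F z) ->
  (\int[mu]_(z in D) (F z)%:E = \int[m]_(z in D) (F z * fock_density phi nu z)%:E)%E.
Proof.
move=> mD mF F0; rewrite /mu_phi (@ge0_integral_density_set _ _ _ m (fock_density phi nu))//.
- exact: measurable_fock_density.
- exact/measurable_EFinP.
Qed.

Let mono n : C -> C := fun z => z ^+ n.

Lemma sqr_integrable_mono n : sqr_integrable mu (mono n) /\ sqr_norm mu (mono n) = monomial_norm n.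
Proof.
have e : (\int[mu]_z (modulus (mono n z) ^+ 2)%:E = (monomial_norm n)%:E)%E.
  rewrite integral_fock; last 2 first.
  - by apply: measurable_entire_sqr; exact: entireX.
  - by move=> z; exact: sqr_ge0.
  rewrite EFinM monomial_massE -ge0_integralZl_any ?(ltW c_phi_gt0)//; last first.
    by move=> w _; rewrite lee_fin monomial_density_ge0.
  apply: eq_integral => z _; rewrite -EFinM; congr EFin.
  by rewrite modulusX -exprM mulnC fock_densityE /monomial_density muln0 expr0 mul1r; ring.
split; last by rewrite /sqr_norm e.
by split; [exact: entireX|rewrite e ltry].
Qed.

Lemma sqr_norm_rotation (f : C -> C) (l : C) : modulus l = 1 -> entire f ->
  sqr_norm mu (fun z => f (l * z)) = sqr_norm mu f.
Proof.
move=> l1 ef; congr fine; pose G z : \bar R := (modulus (f z) ^+ 2 * fock_density phi nu z)%:E.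
have mf := measurable_entire_sqr ef.
have mfl : measurable_fun [set: C] (fun z => modulus (f (l * z)) ^+ 2).
  exact: (measurableT_comp mf (measurable_scaleC l)).
rewrite (integral_fock mfl) ?(integral_fock mf); try by move=> z; exact: sqr_ge0.
have mG : measurable_fun [set: C] G.
  by apply/measurable_EFinP; apply: measurable_funM mf _; exact: measurable_fock_density.
have G0 z : (0 <= G z)%E by rewrite lee_fin mulr_ge0 ?sqr_ge0 ?fock_density_ge0.
rewrite -[RHS](integral_rotation mG G0 l1).
have dl z : fock_density phi nu (l * z) = fock_density phi nu z.
  by rewrite /fock_density (rho_rotation alpha z l1) /phi_alpha modulusM l1 mul1r.
by apply: eq_integral => z _; rewrite /G dl.
Qed.

Lemma exists_rotation j : (0 < j)%N -> exists2 l : C, modulus l = 1 & l ^+ j = -1.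
Proof.
move=> j0; exists (expC (Complex 0 (pi / j%:R))); first by rewrite modulus_expC/= expR0.
have h k : expC (Complex 0 (pi / j%:R)) ^+ k = expC (Complex 0 (pi / j%:R * k%:R)) :> C.
  elim: k => [|k ih]; first by rewrite expr0 mulr0 [RHS]expC0.
  by rewrite exprS ih -expCD; congr expC; apply: complex_eqP => /=; rewrite ?addr0// -natr1; ring.
rewrite h divfK ?pnatr_eq0 -?lt0n//.
by apply: complex_eqP; rewrite /= ?expR0 ?cospi ?sinpi ?mulr0 ?oppr0 ?mul1r.
Qed.

Lemma inner_mono_lt n k : (k < n)%N -> inner mu (mono n) (mono k) = 0.
Proof.
move=> kn; have [Fn _] := sqr_integrable_mono n; have [Fk _] := sqr_integrable_mono k.
have [|l l1 lj] := @exists_rotation (n - k); first by rewrite subn_gt0.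
have rot (a : C) : sqr_norm mu (fun z => a * mono n z + mono k z) =
    sqr_norm mu (fun z => (- a) * mono n z + mono k z).
  have Fa : entire (fun z => a * mono n z + mono k z) by apply: entire_lin; exact: entireX.
  rewrite -[LHS](sqr_norm_rotation l1 Fa).
  congr fine; apply: eq_integral => z _; congr (EFin (_ ^+ 2)).
  have lk : modulus (l ^+ k) = 1 by rewrite modulusX l1 expr1n.
  rewrite -[RHS]mul1r -[in RHS]lk -modulusM; congr modulus.
  by rewrite /mono !exprMn -{1}(subnK (ltnW kn)) exprD lj; ring.
have key (a : C) : a * inner mu (mono n) (mono k) + a^*%C * (inner mu (mono n) (mono k))^*%C = 0.
  have E b : inner mu (fun z => b * mono n z + mono k z) (fun z => b * mono n z + mono k z) =
     b * b^*%C * inner mu (mono n) (mono n) + (b * inner mu (mono n) (mono k) +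
       b^*%C * (inner mu (mono n) (mono k))^*%C) + inner mu (mono k) (mono k).
    have Fb := sqr_integrable_lin b Fn Fk.
    rewrite inner_linl// !inner_linr// (inner_conj Fn Fk); ring.
  have N b : (sqr_norm mu (fun z => b * mono n z + mono k z))%:C%C =
      inner mu (fun z => b * mono n z + mono k z) (fun z => b * mono n z + mono k z).
    by rewrite innerE//; exact: sqr_integrable_lin.
  have := congr1 (real_complex R) (rot a); rewrite !N !E.
  have -> : (- a)^*%C = - a^*%C by exact: rmorphN.
  move: (inner _ _ _) (inner _ _ _) (inner _ _ _) (a^*%C) => X Y Z W.
  move: (Y^*%C) => V e.
  have e2 : (a * Y + W * V) *+ 2 = 0.
    rewrite mulr2n; apply/eqP; rewrite addr_eq0; apply/eqP; move: e.
    move/(congr1 (fun t => t - a * W * Z - X)) => e.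
    transitivity (a * W * Z + (a * Y + W * V) + X - a * W * Z - X); first by ring.
    by rewrite e; ring.
  by move/eqP: e2; rewrite mulrn_eq0 => /eqP.
move: key; case: (inner _ _ _) => x y key; apply: complex_eqP => /=.
  have := congr1 (@complex.Re R) (key 1); rewrite ReD !ReM/=; lra.
have := congr1 (@complex.Re R) (key (Complex 0 1)); rewrite ReD !ReM/=; lra.
Qed.

Lemma orthonormal_monomials : exists e : nat -> C -> C,
  [/\ forall n, sqr_integrable mu (e n), forall n, sqr_norm mu (e n) = 1,
   forall n k, n != k -> inner mu (e n) (e k) = 0 &
   forall n z, e n z = (Num.sqrt (monomial_norm n))^-1%:C%C * z ^+ n].
Proof.
pose c n : C := (Num.sqrt (monomial_norm n))^-1%:C%C.
have F0 : sqr_integrable mu (fun=> 0).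
  split; first exact: entire_cst.
  have -> : (\int[mu]_z (modulus 0 ^+ 2)%:E = \int[mu]_z 0)%E.
    by apply: eq_integral => z _; rewrite modulus0 expr0n.
  by rewrite integral0.
have eE n : (fun z => c n * z ^+ n) = (fun z => c n * mono n z + 0).
  by apply/funext => z; rewrite addr0.
have z0 f : inner mu f (fun=> 0) = 0.
  rewrite /inner; have -> : (fun z => f z * (0 : C)^*%C) = (fun=> 0).
    by apply/funext => z; rewrite rmorph0 mulr0.
  by apply: complex_eqP; rewrite /= /Rintegral integral0.
have inz n : inner mu (fun=> 0) (mono n) = 0.
  by rewrite (inner_conj (sqr_integrable_mono n).1 F0) z0 rmorph0.
have FE n : sqr_integrable mu (fun z => c n * mono n z + 0).
  by apply: sqr_integrable_lin => //; exact: (sqr_integrable_mono n).1.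
have innE n k : inner mu (fun z => c n * mono n z + 0) (fun z => c k * mono k z + 0) =
    c n * (c k)^*%C * inner mu (mono n) (mono k).
  have [Fn _] := sqr_integrable_mono n; have [Fk _] := sqr_integrable_mono k.
  by rewrite inner_linl// !inner_linr// !z0 inz; ring.
exists (fun n z => c n * z ^+ n); split => // n.
- by rewrite eE.
- rewrite eE; apply: complexI; rewrite -innerE// innE.
  have [Fn Nn] := sqr_integrable_mono n; rewrite innerE// Nn.
  rewrite /c conjc_real -!rmorphM/=; congr (_%:C%C).
  have n0 := monomial_norm_gt0 n; rewrite -invfM -expr2 sqr_sqrtr ?(ltW n0)//.
  by rewrite mulVf// gt_eqF.
move=> k nk; rewrite !eE innE; suff -> : inner mu (mono n) (mono k) = 0 by rewrite mulr0.
have [kn|nk'|/eqP] := ltngtP n k; last by rewrite (negbTE nk).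
- rewrite (inner_conj (sqr_integrable_mono k).1 (sqr_integrable_mono n).1).
  by rewrite inner_mono_lt// rmorph0.
- exact: inner_mono_lt.
Qed.

End fock_space_alpha.

(** * Pointwise bounds in the Fock space *)

Lemma powR_taylor (R : realType) (alpha x : R) : 0 < alpha -> `|x| <= 1 / 2 ->
  alpha * `|x| <= 1 / 2 ->
  `|(1 + x) `^ (alpha / 2) - 1 - alpha / 2 * x| <= (alpha + 2 * alpha ^+ 2) * x ^+ 2.
Proof.
move=> a0 xh ax; have /andP[x1 x2] : - (1 / 2) <= x <= 1 / 2 by rewrite -ler_norml.
have p1 : 0 < 1 + x by lra.
rewrite /powR gt_eqF//; set y := ln (1 + x).
have y1 : y <= x by apply: le_ln1Dx; lra.
have y2 : x - 2 * x ^+ 2 <= y.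
  have h : - y <= - (x / (1 + x)).
    rewrite -lnV ?posrE//; have e : (1 + x)^-1 = 1 + - (x / (1 + x)) by field; rewrite gt_eqF.
    rewrite [in leLHS]e.
    by apply: le_ln1Dx; rewrite ltrN2 ltr_pdivrMr//; lra.
  have : x - 2 * x ^+ 2 <= x / (1 + x).
    rewrite ler_pdivlMr//.
    have := mulr_ge0 (sqr_ge0 x) (_ : 0 <= 2 * x + 1); have : 0 <= 2 * x + 1 by lra.
    by move=> -> /(_ isT); rewrite expr2; nra.
  by move: h; move: (x / (1 + x)) => t; lra.
have ny : `|y| <= 2 * `|x|.
  have sx : x ^+ 2 <= `|x| / 2.
    by rewrite -[x ^+ 2]ger0_norm ?sqr_ge0// normrX expr2 ler_wpM2l//; lra.
  by move: sx y1 y2; case: (ger0P x) => x0; case: (ger0P y) => y0; lra.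
set s := alpha / 2 * y.
have ns : `|s| <= alpha * `|x|.
  rewrite /s normrM gtr0_norm; last by rewrite divr_gt0.
  apply: le_trans (ler_wpM2l _ ny) _; first by rewrite divr_ge0// ltW.
  by rewrite mulrA divfK ?pnatr_eq0.
have /andP[s1 s2] : - (1 / 2) <= s <= 1 / 2 by rewrite -ler_norml (le_trans ns).
have e1 : 1 + s <= expR s by exact: expR_ge1Dx.
have e2 : expR s <= 1 + s + 2 * s ^+ 2.
  have h : 1 - s <= (expR s)^-1 by rewrite -expRN; exact: expR_ge1Dx.
  have q : 0 < 1 - s by lra.
  apply: (@le_trans _ _ (1 - s)^-1).
    by rewrite -[expR s]invrK lef_pV2 ?posrE ?invr_gt0 ?expR_gt0.
  rewrite -[leLHS]mul1r ler_pdivrMr//.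
  have := mulr_ge0 (sqr_ge0 s) (_ : 0 <= 1 - 2 * s); have : 0 <= 1 - 2 * s by lra.
  by move=> -> /(_ isT); rewrite expr2; nra.
have ss : s ^+ 2 <= alpha ^+ 2 * x ^+ 2.
  rewrite -[s ^+ 2]ger0_norm ?sqr_ge0// normrX -[x ^+ 2]ger0_norm ?sqr_ge0// normrX.
  by rewrite -exprMn ler_pXn2r ?nnegrE// mulr_ge0// ltW.
have b1 : alpha / 2 * x - alpha * x ^+ 2 <= s.
  rewrite /s; have := ler_wpM2l (_ : 0 <= alpha / 2) y2; have : 0 <= alpha / 2 by rewrite divr_ge0// ltW.
  by move=> -> /(_ isT); rewrite mulrBr !mulrA divfK ?pnatr_eq0.
have b2 : s <= alpha / 2 * x by rewrite /s ler_wpM2l// divr_ge0// ltW.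
have ax2 : 0 <= alpha * x ^+ 2 by rewrite mulr_ge0 ?sqr_ge0// ltW.
have aax2 : 0 <= alpha ^+ 2 * x ^+ 2 by rewrite mulr_ge0 ?sqr_ge0.
rewrite mulrDl -(mulrA 2) ler_norml.
move: ax2 aax2 b1 b2 ss e1 e2; move: (alpha * x ^+ 2) (alpha ^+ 2 * x ^+ 2) (alpha / 2 * x) (expR s) (s ^+ 2).
by clear => *; apply/andP; split; lra.
Qed.

Lemma weight_taylor_scaled (R : realType) (alpha p r v u : R) :
  0 < alpha -> 0 < p -> 0 < r -> 0 <= u ->
  `|v| <= r * u -> 6 * (1 + alpha) * u <= r -> p * u ^+ 2 <= r ^+ 2 ->
  `|p * (1 + (2 * v + u ^+ 2) / r ^+ 2) `^ (alpha / 2) - p - alpha * (p / r ^+ 2) * v| <=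
    9 * (alpha + 2 * alpha ^+ 2) + alpha / 2.
Proof.
move=> a0 p0 r0 u0 vr ur pu; set x := (2 * v + u ^+ 2) / r ^+ 2.
have r2 : 0 < r ^+ 2 by rewrite exprn_gt0.
have au : 0 <= alpha * u by rewrite mulr_ge0// ltW.
have u3r : 6 * u <= r by move: ur au; rewrite !mulrDr mulrDl mulr1 -mulrA; lra.
have nx : `|x| <= 3 * u / r.
  rewrite /x normrM normfV (gtr0_norm r2) ler_pdivrMr//.
  have -> : 3 * u / r * r ^+ 2 = 3 * (r * u) by field; rewrite gt_eqF.
  apply: le_trans (ler_normD _ _) _; rewrite normrM ger0_norm// [X in _ + X]ger0_norm ?sqr_ge0//.
  have : u ^+ 2 <= r * u by rewrite expr2 ler_wpM2r//; lra.
  by move: vr; lra.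
have nx1 : `|x| <= 1 / 2.
  by apply: le_trans nx _; rewrite ler_pdivrMr//; lra.
have nx2 : alpha * `|x| <= 1 / 2.
  apply: le_trans (ler_wpM2l (ltW a0) nx) _; rewrite mulrA ler_pdivrMr//.
  by move: ur u0; rewrite !mulrDr mulrDl mulr1 -mulrA mulrCA; lra.
have := powR_taylor a0 nx1 nx2.
have pxx : p * x ^+ 2 <= 9.
  apply: (@le_trans _ _ (p * (3 * u / r) ^+ 2)).
    rewrite ler_pM2l// -[x ^+ 2]ger0_norm ?sqr_ge0// normrX.
    by rewrite ler_pXn2r ?nnegrE// divr_ge0 ?mulr_ge0// ltW.
  have -> : p * (3 * u / r) ^+ 2 = 9 * (p * u ^+ 2) / r ^+ 2 by field; rewrite gt_eqF.
  by rewrite ler_pdivrMr// ler_pM2l.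
set q := (1 + x) `^ _ => h.
have -> : p * q - p - alpha * (p / r ^+ 2) * v =
    p * (q - 1 - alpha / 2 * x) + alpha / 2 * (p * u ^+ 2 / r ^+ 2).
  by rewrite /x; field; rewrite gt_eqF.
apply: le_trans (ler_normD _ _) _; rewrite lerD//.
  rewrite normrM gtr0_norm//; apply: le_trans (ler_wpM2l (ltW p0) h) _.
  rewrite mulrCA mulrC ler_wpM2r//.
  by rewrite addr_ge0 ?mulr_ge0 ?sqr_ge0// ltW.
have ph : p * u ^+ 2 / r ^+ 2 <= 1 by rewrite ler_pdivrMr// mul1r.
have ph0 : 0 <= p * u ^+ 2 / r ^+ 2 by rewrite divr_ge0 ?mulr_ge0 ?sqr_ge0// ltW.
rewrite ger0_norm; last by rewrite mulr_ge0// divr_ge0// ltW.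
by rewrite -[leRHS]mulr1 ler_wpM2l// divr_ge0// ltW.
Qed.

Section pointwise_bounds.
Variables (R : realType) (alpha : R).
Hypothesis alpha0 : 0 < alpha.
Local Notation C := R[i].
Local Notation m := (@lebesgueC R).
Local Notation kap := (disk_area R).
Local Notation nu := (laplacian_phi_alpha alpha : {measure set C -> \bar R}).
Local Notation rho := (rho nu).
Local Notation phi := (phi_alpha alpha).
Local Notation mu := (mu_phi phi nu : {measure set C -> \bar R}).

Definition weight_slope (z : C) : C := (alpha * modulus z `^ (alpha - 2))%:C%C * z^*%C.

Definition weight_radius : R := (6 * (1 + alpha))^-1.
Local Notation kp := weight_radius.

Lemma weight_radius_gt0 : 0 < kp.
Proof. by rewrite invr_gt0 mulr_gt0// addr_gt0. Qed.

Lemma weight_radius_le : kp <= 1 / 6.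
Proof.
rewrite /weight_radius invfM -[leRHS]mulrC ler_pM2l ?invr_gt0//.
by rewrite invf_le1 ?addr_gt0// lerDl ltW.
Qed.

Lemma powR_le_modulus (r : R) : 1 <= r -> r `^ (1 - alpha / 2) <= r.
Proof.
move=> r1; rewrite -[leRHS]powRr1 ?(le_trans ler01)//.
by apply: ler_powR => //; rewrite gerDl oppr_le0 divr_ge0// ltW.
Qed.

Lemma scale_sqr (r : R) : 0 < r -> r `^ (alpha - 2) * (r `^ (1 - alpha / 2)) ^+ 2 = 1.
Proof.
move=> r0; rewrite -powR_mulrn ?powR_ge0// -powRrM -powRD; last first.
  by rewrite (gt_eqF r0) implybT.
by rewrite (_ : _ + _ = 0) ?powRr0//; field.
Qed.

Lemma near_comparable (z w : C) : 1 <= modulus z ->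
  modulus (w - z) <= kp * modulus z `^ (1 - alpha / 2) ->
  modulus z / 2 <= modulus w /\ modulus w <= 2 * modulus z.
Proof.
move=> z1 wz; have h := powR_le_modulus z1.
have wz6 : modulus (w - z) <= 1 / 6 * modulus z.
  apply: le_trans wz _; apply: ler_pM => //; first exact: ltW weight_radius_gt0.
  - exact: powR_ge0.
  - exact: weight_radius_le.
have := modulusD (w - z) z; have := modulusD (z - w) w.
rewrite !subrK (modulusB z w); move: wz6 z1; move: (modulus _) (modulus _) (modulus _) => a b c.
by clear => *; split; lra.
Qed.

Lemma weight_taylor : exists2 A, 0 < A & forall z w, 1 <= modulus z ->
  modulus (w - z) <= kp * modulus z `^ (1 - alpha / 2) ->
  `|phi w - phi z - complex.Re (weight_slope z * (w - z))| <= A.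
Proof.
exists (9 * (alpha + 2 * alpha ^+ 2) + alpha / 2).
  by rewrite addr_gt0 ?divr_gt0// mulr_gt0// addr_gt0// mulr_gt0// exprn_gt0.
move=> z w z1 wz; have z0 : 0 < modulus z by lra.
set r := modulus z in z0 z1 wz *; set h := w - z in wz *; set u := modulus h in wz *.
pose v := complex.Re (z^*%C * h).
have u0 : 0 <= u by exact: modulus_ge0.
have Tr := powR_le_modulus z1; have TT := scale_sqr z0.
have K0 : 0 < 6 * (1 + alpha) by rewrite mulr_gt0// addr_gt0.
have wz' : 6 * (1 + alpha) * u <= r `^ (1 - alpha / 2).
  by rewrite mulrC -ler_pdivlMr// mulrC.
have p0 : 0 < r `^ alpha by rewrite powR_gt0.
have pE : r `^ (alpha - 2) = r `^ alpha / r ^+ 2.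
  by rewrite powRB ?(gt_eqF z0) ?implybT// powR_mulrn// ltW.
have r2 : 0 < r ^+ 2 by rewrite exprn_gt0.
have -> : complex.Re (weight_slope z * h) = alpha * (r `^ alpha / r ^+ 2) * v.
  by rewrite /weight_slope -/r pE -mulrA ReM /= mul0r subr0.
have -> : phi w = r `^ alpha * (1 + (2 * v + u ^+ 2) / r ^+ 2) `^ (alpha / 2).
  have -> : r `^ alpha = (r ^+ 2) `^ (alpha / 2).
    by rewrite -powR_mulrn ?(ltW z0)// -powRrM mulrCA divff ?mulr1// pnatr_eq0.
  have wE : modulus w ^+ 2 = r ^+ 2 * (1 + (2 * v + u ^+ 2) / r ^+ 2).
    rewrite mulrDr mulr1 mulrCA divff ?gt_eqF// mulr1 /r /u /v !modulus_sqr ReM ReJ ImJ.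
    by rewrite /h ReB ImB; ring.
  have q0 : 0 <= 1 + (2 * v + u ^+ 2) / r ^+ 2.
    by rewrite -(pmulr_rge0 _ r2) -wE sqr_ge0.
  rewrite -powRM ?sqr_ge0// -wE /phi_alpha -powR_mulrn ?modulus_ge0// -powRrM.
  by rewrite mulrCA divff ?mulr1// pnatr_eq0.
rewrite /phi_alpha -/r; apply: weight_taylor_scaled => //.
- by apply: le_trans (le_Re_modulus _) _; rewrite modulusM modulusJ.
- exact: le_trans wz' Tr.
have uT : u <= r `^ (1 - alpha / 2).
  apply: le_trans wz' => //; rewrite -[leLHS]mul1r ler_wpM2r//; move: alpha0; clear; lra.
have : r `^ (alpha - 2) * u ^+ 2 <= 1.
  by rewrite -[leRHS]TT ler_pM2l ?powR_gt0// ler_pXn2r ?nnegrE ?powR_ge0.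
by rewrite pE mulrAC ler_pdivrMr// mul1r.
Qed.

Let twist (f : C -> C) z : C -> C := fun x => f x * expC (- weight_slope z * (x - z)).

Let twist_cdiff f z : entire f -> forall x, exists l, cdiff (twist f z) x l.
Proof.
move=> /entire_cdiff df x; have [l fl] := df x.
have [k gk] := @cdiff_affine_exp R 0 (- weight_slope z) (expC (weight_slope z * z)) x.
have -> : twist f z = (fun x => f x * (0 + expC (weight_slope z * z) * expC (- weight_slope z * x))).
  apply/funext => y; rewrite /twist add0r -expCD; congr (_ * expC _); ring.
by eexists; exact: (cdiff_mul fl gk).
Qed.

Let twist_sqr f z x : modulus (twist f z x) ^+ 2 =
  modulus (f x) ^+ 2 * expR (- 2 * complex.Re (weight_slope z * (x - z))).
Proof.
have e : complex.Re (- weight_slope z * (x - z)) = - complex.Re (weight_slope z * (x - z)).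
  by rewrite mulNr; exact: raddfN.
rewrite modulusM exprMn modulus_expC -expRM_natl e; congr (_ * expR _); ring.
Qed.

Lemma fock_point_le : exists B r1, [/\ 0 < B, 1 <= r1 & forall f z,
  sqr_integrable mu f -> r1 <= modulus z ->
  modulus (f z) ^+ 2 <= B * expR (2 * phi z) * sqr_norm mu f].
Proof.
have [A A0 hA] := weight_taylor; have [Q [R0 [Q0 R01 hQ]]] := rho_upper alpha0.
have c0 := c_phi_gt0 alpha0; have K0 := disk_area_gt0 R; have k0 := weight_radius_gt0.
pose Q' := Q * 2 `^ `|1 - alpha / 2|; have Q'0 : 0 < Q' by rewrite mulr_gt0 ?powR_gt0.
pose B := expR (2 * A) * Q' ^+ 2 / (c_phi phi nu) / (kap * kp ^+ 2).
exists B, (2 * R0); split.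
- by rewrite !divr_gt0 ?mulr_gt0 ?expR_gt0 ?exprn_gt0.
- by move: R01; lra.
move=> f z Ff rz; have z1 : 1 <= modulus z by move: R01 rz; lra.
have z0 : 0 < modulus z by lra.
pose T := modulus z `^ (1 - alpha / 2); have T0 : 0 < T by exact: powR_gt0.
pose s := kp * T; have s0 : 0 < s by rewrite mulr_gt0.
pose b := Q' ^+ 2 * T ^+ 2 / c_phi phi nu * expR (2 * phi z + 2 * A).
have b0 : 0 < b by rewrite mulr_gt0 ?expR_gt0// divr_gt0// mulr_gt0 ?exprn_gt0.
have step w : disk z s w -> modulus (twist f z w) ^+ 2 <=
    b * (modulus (f w) ^+ 2 * fock_density phi nu w).
  move=> ws; have wz : modulus (w - z) <= kp * modulus z `^ (1 - alpha / 2) by exact: ltW.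
  have [w1 w2] := near_comparable z1 wz; have := hA z w z1 wz; rewrite ler_norml => /andP[h1 h2].
  have rw := rho_gt0 alpha0 w.
  have rT : rho w <= Q' * T.
    apply: le_trans (hQ w _) _; first by move: rz w1; lra.
    by rewrite /Q' -mulrA ler_pM2l//; exact: powR_comparable.
  rewrite twist_sqr mulrCA ler_wpM2l ?sqr_ge0// /fock_density.
  have -> : b * (c_phi phi nu * expR (-2 * phi w) / rho w ^+ 2) =
      ((Q' * T) ^+ 2 / rho w ^+ 2) * expR (2 * phi z + 2 * A + -2 * phi w).
    by rewrite expRD /b; field; rewrite !gt_eqF.
  rewrite -[leLHS]mul1r ler_pM ?expR_ge0//.
    by rewrite ler_pdivlMr ?exprn_gt0// mul1r ler_pXn2r ?nnegrE ?(ltW rw)// mulr_ge0 ?ltW.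
  rewrite ler_expR; move: h1 h2; move: (phi w) (phi z) (complex.Re _) => x y t; lra.
have := @disk_mean_sqr R (twist f z) (twist_cdiff z Ff.1) z s (ltW s0).
have tz : modulus (twist f z z) ^+ 2 = modulus (f z) ^+ 2.
  by rewrite twist_sqr subrr mulr0 mulr0 expR0 mulr1.
rewrite tz => h.
have : ((kap * s ^+ 2 * modulus (f z) ^+ 2)%:E <= (b * sqr_norm mu f)%:E)%E.
  apply: le_trans h _; rewrite EFinM sqr_norm_EFin//.
  rewrite integral_fock//; first last.
  - by move=> x; exact: sqr_ge0.
  - exact: measurable_entire_sqr Ff.1.
  rewrite -ge0_integralZl_any ?(ltW b0)//; last first.
    by move=> x _; rewrite lee_fin mulr_ge0 ?sqr_ge0 ?fock_density_ge0.
  rewrite [leLHS]integral_mkcond; apply: ge0_le_integral_any => x _; rewrite patchE.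
    by case: ifP => // _; rewrite lee_fin sqr_ge0.
  case: ifPn => [/set_mem xs|_]; first by rewrite -EFinM lee_fin; exact: step.
  rewrite -EFinM lee_fin mulr_ge0 ?(ltW b0)//.
  by rewrite mulr_ge0 ?fock_density_ge0// sqr_ge0.
rewrite lee_fin => hh; have ks : 0 < kap * s ^+ 2 by rewrite mulr_gt0 ?exprn_gt0.
rewrite -(ler_pM2l ks); apply: le_trans hh _; rewrite le_eqVlt; apply/orP; left; apply/eqP.
rewrite /b /B /s expRD; field.
by rewrite !gt_eqF.
Qed.

Lemma fock_zero_le : exists D r1 del, [/\ 0 < D, 1 <= r1, 0 < del & forall f z w,
  sqr_integrable mu f -> r1 <= modulus z -> f z = 0 ->
  modulus (w - z) <= del * modulus z `^ (1 - alpha / 2) ->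
  modulus (f w) ^+ 2 <= D * modulus (w - z) ^+ 2 * modulus z `^ (alpha - 2) *
    expR (2 * phi w) * sqr_norm mu f].
Proof.
have [A A0 hA] := weight_taylor; have [B [R0 [B0 R01 hB]]] := fock_point_le.
have k0 := weight_radius_gt0.
exists (36 * B * expR (4 * A) / (kp / 3) ^+ 2), (2 * R0), (kp / 3); split.
- by rewrite divr_gt0 ?exprn_gt0 ?mulr_gt0 ?divr_gt0 ?expR_gt0.
- by move: R01; lra.
- by rewrite divr_gt0.
move=> f z w Ff rz fz wz; have z1 : 1 <= modulus z by move: R01 rz; lra.
have z0 : 0 < modulus z by lra.
have TT := scale_sqr z0; set T := _ `^ (1 - _) in TT wz.
have T0 : 0 < T by exact: powR_gt0.
pose s := kp / 3 * T; have s0 : 0 < s by rewrite mulr_gt0 ?divr_gt0.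
have s3 : 3 * s = kp * T by rewrite /s; field.
pose N := sqr_norm mu f; have N0 : 0 <= N by exact: sqr_norm_ge0.
pose M := Num.sqrt (B * expR (2 * phi z + 2 * A) * N).
have q0 : 0 <= B * expR (2 * phi z + 2 * A) * N by rewrite !mulr_ge0 ?expR_ge0// ltW.
have M0 : 0 <= M by exact: sqrtr_ge0.
have bound x : modulus (x - z) < 3 * s -> modulus (twist f z x) <= M.
  rewrite s3 => xs; have [x1 x2] := near_comparable z1 (ltW xs).
  have := hA z x z1 (ltW xs); rewrite ler_norml => /andP[h1 h2].
  rewrite -(@ler_pXn2r _ 2%N)// ?nnegrE ?modulus_ge0// sqr_sqrtr// twist_sqr.
  apply: (@le_trans _ _ (B * expR (2 * phi x) * N *
    expR (- 2 * complex.Re (weight_slope z * (x - z))))).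
    by rewrite ler_wpM2r ?expR_ge0//; apply: hB => //; move: rz x1; lra.
  rewrite mulrAC ler_wpM2r// -mulrA ler_pM2l// -expRD ler_expR.
  move: h1 h2; move: (phi x) (phi z) (complex.Re _) => a b t; lra.
have ws : modulus (w - z) <= s by [].
have := entire_lipschitz (twist_cdiff z Ff.1) s0 ws bound.
have -> : twist f z z = 0 by rewrite /twist fz mul0r.
rewrite subr0 => h.
have ws' : modulus (w - z) <= kp * T.
  by apply: le_trans ws _; rewrite -s3; move: s0; clear; lra.
have := hA z w z1 ws'; rewrite ler_norml => /andP[h1 h2].
set H := complex.Re _ in h1 h2.
have -> : modulus (f w) ^+ 2 = modulus (twist f z w) ^+ 2 * expR (2 * H).
  by rewrite twist_sqr -/H -mulrA -expRD mulNr addNr expR0 mulr1.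
have sq : modulus (twist f z w) ^+ 2 <= (6 * M * modulus (w - z) / s) ^+ 2.
  by rewrite ler_pXn2r ?nnegrE ?modulus_ge0// divr_ge0 ?(ltW s0)// !mulr_ge0// modulus_ge0.
apply: le_trans (ler_wpM2r (expR_ge0 _) sq) _.
have eH : expR (2 * H) <= expR (2 * phi w - 2 * phi z + 2 * A).
  by rewrite ler_expR; move: h1 h2; move: (phi w) (phi z) H => a b t; lra.
apply: le_trans (ler_wpM2l (sqr_ge0 _) eH) _.
rewrite le_eqVlt; apply/orP; left; apply/eqP.
have -> : modulus z `^ (alpha - 2) = T ^- 2.
  by apply: (mulIf (_ : T ^+ 2 != 0)); rewrite ?TT ?mulVf// gt_eqF// exprn_gt0.
rewrite !exprMn sqr_sqrtr// exprVn /s -/N.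
have -> : expR (2 * phi w - 2 * phi z + 2 * A) =
    expR (2 * phi w) * (expR (2 * phi z))^-1 * expR (2 * A) by rewrite !expRD expRN.
have -> : expR (2 * phi z + 2 * A) = expR (2 * phi z) * expR (2 * A) by rewrite expRD.
have -> : expR (4 * A) = expR (2 * A) * expR (2 * A) by rewrite -expRD; congr expR; ring.
field.
by rewrite !gt_eqF ?expR_gt0.
Qed.

End pointwise_bounds.

(** * A lower bound for the two-point determinant *)

Section complex_lower_bounds.
Variable R : realType.
Local Notation C := R[i].

Lemma modulus_sum_sub (I : Type) (s : seq I) (F : I -> C) :
  modulus (\sum_(i <- s) F i) <= \sum_(i <- s) modulus (F i).
Proof.
elim: s => [|i s ih]; first by rewrite !big_nil modulus0.
by rewrite !big_cons (le_trans (modulusD _ _))// lerD2l.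
Qed.

Lemma modulus_expr_sub1 (u : C) j : j%:R * modulus (u - 1) <= 1 / 4 ->
  modulus (u ^+ j - 1) <= 2 * (j%:R * modulus (u - 1)).
Proof.
have d0 := modulus_ge0 (u - 1); elim: j => [|j ih] h.
  by rewrite expr0 subrr modulus0 mul0r mulr0.
have hj : j%:R * modulus (u - 1) <= 1 / 4.
  by apply: le_trans h; rewrite ler_wpM2r// ler_nat.
have -> : u ^+ j.+1 - 1 = (u - 1) * (u ^+ j - 1) + (u ^+ j - 1) + (u - 1) by rewrite exprS; ring.
apply: le_trans (modulusD _ _) _; apply: le_trans (lerD (modulusD _ _) (lexx _)) _.
rewrite modulusM -natr1 mulrDl mul1r.
have := ih hj; move: h; rewrite -natr1 mulrDl mul1r.
have p0 : 0 <= j%:R * modulus (u - 1) by rewrite mulr_ge0.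
move: p0 d0; move: (j%:R * _) => p; move: (modulus (u - 1)) => d; move: (modulus (_ - 1)) => e p0 d0 h hh.
have : d * e <= d * (1 / 2) by rewrite ler_wpM2l//; move: hh h d0; clear; lra.
move: hh h d0; clear; lra.
Qed.

Lemma modulus_expr_sub1_ge (u : C) j : j%:R * modulus (u - 1) <= 1 / 4 ->
  j%:R * modulus (u - 1) / 2 <= modulus (u ^+ j - 1).
Proof.
move=> h; have d0 := modulus_ge0 (u - 1); rewrite subrX1 modulusM -mulrA mulrCA ler_wpM2l//.
have -> : \sum_(i < j) u ^+ i = j%:R + \sum_(i < j) (u ^+ i - 1).
  by rewrite big_split/= sumrN sumr_const card_ord addrCA subrr addr0.
have : modulus (\sum_(i < j) (u ^+ i - 1)) <= j%:R / 2.
  apply: le_trans (modulus_sum_sub _ _) _.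
  rewrite -[j in leRHS]card_ord mulr_natl -sumr_const; apply: ler_sum => i _.
  have hi : i%:R * modulus (u - 1) <= 1 / 4.
    by apply: le_trans h; rewrite ler_wpM2r// ler_nat ltnW.
  by apply: le_trans (modulus_expr_sub1 hi) _; move: hi; clear; lra.
set S := \sum_(i < j) _ => hS.
have := modulusD (j%:R + S) (- S); rewrite addrK modulusN.
have -> : modulus (j%:R : C) = j%:R by rewrite -[j%:R : C](rmorph_nat (real_complex R)) modulus_real ger0_norm.
by move: hS; clear; lra.
Qed.

Lemma modulus_sqrB (x y : C) : modulus (x - y) ^+ 2 =
  modulus x ^+ 2 + modulus y ^+ 2 - 2 * complex.Re (x * y^*%C).
Proof. by rewrite !modulus_sqr ReB ImB ReM ReJ ImJ; ring. Qed.

Lemma modulus_sqrD (x y : C) : modulus (x + y) ^+ 2 =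
  modulus x ^+ 2 + modulus y ^+ 2 + 2 * complex.Re (x * y^*%C).
Proof. by rewrite !modulus_sqr ReD ImD ReM ReJ ImJ; ring. Qed.

Lemma sum_sqr_minors (s t : seq nat) (a b : nat -> C) :
  \sum_(n <- s) \sum_(k <- t) modulus (a n * b k - a k * b n) ^+ 2 =
  (\sum_(n <- s) modulus (a n) ^+ 2) * (\sum_(k <- t) modulus (b k) ^+ 2) +
  (\sum_(k <- t) modulus (a k) ^+ 2) * (\sum_(n <- s) modulus (b n) ^+ 2) -
  2 * complex.Re ((\sum_(n <- s) a n * (b n)^*%C) * (\sum_(k <- t) a k * (b k)^*%C)^*%C).
Proof.
rewrite conjc_sum [X in _ - 2 * complex.Re X]big_distrlr/= Re_sum [X in _ - X]mulr_sumr.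
rewrite [X in _ + X - _]mulrC !big_distrlr/= -big_split/= -sumrB; apply: eq_bigr => n _.
rewrite Re_sum mulr_sumr -big_split/= -sumrB; apply: eq_bigr => k _.
have J x y : (x * y)^*%C = x^*%C * y^*%C :> C by exact: rmorphM.
rewrite modulus_sqrB !modulusM !exprMn; congr (_ + _ - 2 * complex.Re _).
  by rewrite [RHS]mulrC.
by rewrite !J conjcK; ring.
Qed.

Definition sum_kernel (e : nat -> C -> C) (s : seq nat) (x y : C) : C :=
  \sum_(n <- s) e n x * (e n y)^*%C.

Lemma psd_sum_kernel e s : psd (sum_kernel e s).
Proof.
split=> [x y|q].
  by rewrite /sum_kernel conjc_sum; apply: eq_bigr => n _; rewrite rmorphM/= conjcK mulrC.
have -> : quad_form (sum_kernel e s) q =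
    \sum_(n <- s) (\sum_(u <- q) u.1 * e n u.2) * (\sum_(u <- q) u.1 * e n u.2)^*%C.
  rewrite /quad_form /sum_kernel.
  under eq_bigr => u _ do under eq_bigr => v _ do rewrite mulr_sumr mulr_suml.
  under eq_bigr => u _ do rewrite exchange_big/=.
  rewrite exchange_big/=; apply: eq_bigr => n _.
  rewrite conjc_sum big_distrlr/=; apply: eq_bigr => u _; apply: eq_bigr => v _.
  by rewrite rmorphM/=; ring.
by rewrite Re_sum; apply: sumr_ge0 => n _; rewrite mulJ/= sqr_ge0.
Qed.

(** Of the minors in Lagrange's identity for the Gram determinant, those with
    one index in each of two disjoint windows are kept. *)
Lemma kernel_det2_sum_kernel_ge e (s t : seq nat) x y :
  \sum_(n <- s) \sum_(k <- t) modulus (e n x * e k y - e k x * e n y) ^+ 2 <=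
  kernel_det (sum_kernel e (s ++ t)) [:: x; y].
Proof.
have diag r v : complex.Re (sum_kernel e r v v) = \sum_(n <- r) modulus (e n v) ^+ 2.
  by rewrite Re_sum; apply: eq_bigr => n _; rewrite mulJ.
have hs := kernel_det_ge0 [:: x; y] (psd_sum_kernel e s).
have ht := kernel_det_ge0 [:: x; y] (psd_sum_kernel e t).
move: hs ht; rewrite !kernel_det2; try exact: psd_sum_kernel.
rewrite (sum_sqr_minors s t (e ^~ x) (e ^~ y)) !diag.
have -> : sum_kernel e (s ++ t) x y = sum_kernel e s x y + sum_kernel e t x y.
  by rewrite /sum_kernel big_cat.
rewrite modulus_sqrD !big_cat/= /sum_kernel.
move: (complex.Re _) (\sum_(n <- s) modulus (e n x) ^+ 2) (\sum_(n <- t) modulus (e n x) ^+ 2) => p a b.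
move: (\sum_(n <- s) modulus (e n y) ^+ 2) (\sum_(n <- t) modulus (e n y) ^+ 2) => c d.
move: (_ ^+ 2) (_ ^+ 2) => g h.
rewrite !mulrDl !mulrDr; move: (a * c) (b * d) (a * d) (b * c) => *; lra.
Qed.

End complex_lower_bounds.

Lemma window_real (R : realType) (x N : R) : 0 <= x -> 1 <= N ->
  exists n0 M : nat, [/\ N / 2 <= M%:R, M%:R <= N &
    forall n, (n0 <= n < n0 + 3 * M)%N -> `|n%:R - x| <= 4 * N].
Proof.
move=> x0 N1; exists (Num.truncn x).+1, (Num.truncn N).
have /andP[x1 x2] := truncn_itv x0; have /andP[M1 M2] := truncn_itv (le_trans ler01 N1).
have M3 : 1 <= (Num.truncn N)%:R :> R.
  rewrite ler1n -ltnS -(ltr_nat R); apply: le_lt_trans N1 M2.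
split=> //; first by move: M2; rewrite -natr1; move: M3; clear; lra.
move=> n /andP[n1 n2]; move: n1 n2; rewrite -(ler_nat R) -(ltr_nat R) natrD natrM.
move: x1 x2 M1; rewrite -natr1; move: (_%:R) (_%:R) (_%:R) => a b c.
move=> h1 h2 h3 h4 h5; rewrite ger0_norm; move: h1 h2 h3 h4 h5 N1; clear; lra.
Qed.

Section kernel_lower_bound.
Variables (R : realType) (alpha : R).
Hypothesis alpha0 : 0 < alpha.
Local Notation C := R[i].
Local Notation nu := (laplacian_phi_alpha alpha : {measure set C -> \bar R}).
Local Notation phi := (phi_alpha alpha).
Local Notation mu := (mu_phi phi nu : {measure set C -> \bar R}).
Local Notation kp := (weight_radius alpha).

(** The normalized monomials whose degree lies within O(|z|^(alpha/2)) of
    alpha |z|^alpha peak at z. *)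
Lemma monomial_peak (L : R) : 0 <= L -> exists B r1, [/\ 0 < B, 1 <= r1 &
  forall (n : nat) z, r1 <= modulus z ->
    `|n%:R - alpha * modulus z `^ alpha| <= L * modulus z `^ (alpha / 2) ->
    expR (2 * phi z) <=
      B * modulus z `^ (alpha / 2) * (modulus z ^+ (2 * n) / monomial_norm alpha n)].
Proof.
move=> L0; have [B [r1 [B0 r11 hB]]] := monomial_mass_le alpha0 L0.
have c0 := c_phi_gt0 alpha0.
exists (c_phi phi nu * B), r1; split; rewrite ?mulr_gt0//.
move=> n z rz hn; have := hB n _ rz hn.
rewrite -[X in (X <= _)%E]/(monomial_mass alpha n) -(monomial_massE alpha0) lee_fin => h.
have N0 := monomial_norm_gt0 alpha0 n.
rewrite mulrA ler_pdivlMr// /monomial_norm.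
apply: le_trans (ler_wpM2l (expR_ge0 _) (ler_wpM2l (ltW c0) h)) _.
rewrite le_eqVlt; apply/orP; left; apply/eqP.
rewrite /phi_alpha mulNr expRN; field.
by rewrite gt_eqF ?expR_gt0.
Qed.

Lemma sum_kernel_minor (e : nat -> C -> C) (z w : C) n k : (n <= k)%N -> z != 0 ->
  (forall j x, e j x = (Num.sqrt (monomial_norm alpha j))^-1%:C%C * x ^+ j) ->
  modulus (e n z * e k w - e k z * e n w) ^+ 2 =
  (modulus w ^+ (2 * n) / monomial_norm alpha n) *
  (modulus z ^+ (2 * k) / monomial_norm alpha k) *
  modulus ((w / z) ^+ (k - n) - 1) ^+ 2.
Proof.
move=> nk z0 eE; set u := w / z.
have wE : w = u * z by rewrite /u divfK.
have -> : e n z * e k w - e k z * e n w = e n w * e k z * (u ^+ (k - n) - 1).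
  have pk x : x ^+ k = x ^+ (k - n) * x ^+ n :> C by rewrite -exprD subnK.
  by rewrite !eE wE !exprMn !pk; ring.
have me j x : modulus (e j x) ^+ 2 = modulus x ^+ (2 * j) / monomial_norm alpha j.
  rewrite eE modulusM modulus_real modulusX exprMn real_normK ?num_real//.
  by rewrite exprVn sqr_sqrtr ?(ltW (monomial_norm_gt0 alpha0 j))// -exprM mulnC mulrC.
by rewrite modulusM modulusM !exprMn !me.
Qed.

Lemma kernel_det2_ge (K : C -> C -> C) : fock_kernel phi nu K ->
  exists c r1 del, [/\ 0 < c, 1 <= r1, 0 < del & forall z w, r1 <= modulus z ->
    modulus (w - z) <= del * modulus z `^ (1 - alpha / 2) ->
    c * modulus (w - z) ^+ 2 * modulus z `^ (alpha - 2) * expR (2 * phi z + 2 * phi w) <=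
    kernel_det K [:: z; w]].
Proof.
move=> kerK; have [e [Fe e1 e0 eE]] := orthonormal_monomials alpha0.
have [A A0 hA] := weight_taylor alpha0; have k0 := weight_radius_gt0 alpha0.
have [Th [Th0 hTh]] : exists Th : R, 0 < Th /\ forall a b : R, 0 < b -> b / 2 <= a -> a <= 2 * b ->
    a `^ (alpha / 2) <= Th * b `^ (alpha / 2).
  exists (2 `^ `|alpha / 2|); split=> [|a b b0 h1 h2]; first exact: powR_gt0.
  exact: powR_comparable.
pose L := (4 + alpha * (A + alpha)) * Th.
have L0 : 0 <= L by rewrite mulr_ge0 ?(ltW Th0)// addr_ge0// mulr_ge0 ?addr_ge0// ltW.
have L40 : 0 <= 4 :> R by [].
have [B1 [s1 [B10 s11 hB1]]] := monomial_peak L40.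
have [B2 [s2 [B20 s21 hB2]]] := monomial_peak L0.
pose del := Num.min kp (1 / 12).
have del0 : 0 < del by rewrite lt_min k0 divr_gt0.
exists (64 * (B1 * B2 * Th))^-1, (s1 + 2 * s2), del; split=> //.
- by rewrite invr_gt0 !mulr_gt0.
- by move: s11 s21; clear; lra.
move=> z w rz wz.
have z1 : 1 <= modulus z by move: s11 s21 rz; clear; lra.
have z0 : 0 < modulus z by apply: lt_le_trans z1.
have wz' : modulus (w - z) <= kp * modulus z `^ (1 - alpha / 2).
  by apply: le_trans wz _; rewrite ler_wpM2r ?powR_ge0// ge_min lexx.
have [w1 w2] := near_comparable alpha0 z1 wz'.
have w0 : 0 < modulus w by move: w1 z0; clear; lra.
have := hA z w z1 wz'; set r := modulus z in rz z1 z0 wz wz' w1 w2 *.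
pose N := r `^ (alpha / 2); have N0 : 0 < N by exact: powR_gt0.
have N1 : 1 <= N.
  by rewrite -(powRr0 r); apply: ler_powR => //; rewrite divr_ge0// ltW.
have N2 : r `^ alpha = N ^+ 2.
  by rewrite /N -powR_mulrn ?powR_ge0// -powRrM divfK// pnatr_eq0.
have rN : r `^ (1 - alpha / 2) = r / N.
  by rewrite powRB ?(gt_eqF z0) ?implybT// powRr1// ltW.
have rA : r `^ (alpha - 2) = N ^+ 2 / r ^+ 2.
  by rewrite powRB ?(gt_eqF z0) ?implybT// N2 powR_mulrn// ltW.
rewrite rA; rewrite rN in wz.
set d := modulus (w - z) in wz *; have d0 : 0 <= d by exact: modulus_ge0.
move=> hT.
have dN : d * N <= del * r by rewrite -ler_pdivlMr// -mulrA.
have slope : `|complex.Re (weight_slope alpha z * (w - z))| <= alpha * N.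
  apply: le_trans (le_Re_modulus _) _; rewrite !modulusM modulusJ modulus_real -/d -/r.
  rewrite ger0_norm ?mulr_ge0 ?powR_ge0 ?(ltW alpha0)// rA.
  have -> : alpha * (N ^+ 2 / r ^+ 2) * r * d = alpha * N * (d * N / r) by field; rewrite gt_eqF.
  rewrite -[leRHS]mulr1 ler_wpM2l ?mulr_ge0 ?(ltW alpha0) ?(ltW N0)//.
  rewrite ler_pdivrMr// (le_trans dN)// ler_wpM2r ?(ltW z0)//.
  by rewrite ge_min; apply/orP; right; lra.
have phiwz : `|phi w - phi z| <= (A + alpha) * N.
  have -> : phi w - phi z = (phi w - phi z - complex.Re (weight_slope alpha z * (w - z))) +
    complex.Re (weight_slope alpha z * (w - z)) by rewrite subrK.
  apply: le_trans (ler_normD _ _) _; rewrite mulrDl lerD//; apply: le_trans hT _.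
  by rewrite ler_peMr// ltW.
have NwT : N <= Th * modulus w `^ (alpha / 2) by apply: hTh => //; move: w1 w2; clear; lra.
have NwT' : modulus w `^ (alpha / 2) <= Th * N by exact: hTh.
have ar0 : 0 <= alpha * r `^ alpha by rewrite mulr_ge0 ?powR_ge0// ltW.
have [n0 [M [M1 M2 hM]]] := window_real ar0 N1.
pose s := index_iota n0 (n0 + M); pose t := index_iota (n0 + 2 * M) (n0 + 3 * M).
pose d' := d / r; have d'0 : 0 <= d' by rewrite divr_ge0// ltW.
have uE : modulus (w / z - 1) = d'.
  have -> : w / z - 1 = (w - z) / z by field; rewrite -modulus_gt0.
  by rewrite modulusM modulusV.
pose T := expR (2 * phi z + 2 * phi w) * d' ^+ 2 / (16 * (B1 * B2 * Th)).
have term n k : n \in s -> k \in t ->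
    T <= modulus (e n z * e k w - e k z * e n w) ^+ 2.
  rewrite !mem_index_iota => /andP[n1 n2] /andP[k1 k2].
  have hn : `|n%:R - alpha * r `^ alpha| <= 4 * N by apply: hM; move: n1 n2; clear; lia.
  have hk : `|k%:R - alpha * r `^ alpha| <= 4 * N by apply: hM; move: k1 k2; clear; lia.
  have hnw : `|n%:R - alpha * modulus w `^ alpha| <= L * modulus w `^ (alpha / 2).
    rewrite /L -mulrA; apply: le_trans (ler_wpM2l _ NwT); last first.
      by rewrite addr_ge0// mulr_ge0 ?addr_ge0// ltW.
    have -> : n%:R - alpha * modulus w `^ alpha =
      (n%:R - alpha * r `^ alpha) - alpha * (phi w - phi z) by rewrite /phi_alpha -/r; ring.
    apply: le_trans (ler_normB _ _) _; rewrite mulrDl lerD// normrM gtr0_norm// -mulrA.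
    by rewrite ler_pM2l.
  have p1 := hB1 k z _ hk; have p2 := hB2 n w _ hnw.
  have {}p1 : expR (2 * phi z) <= B1 * N * (r ^+ (2 * k) / monomial_norm alpha k).
    by apply: p1; move: rz s11 s21; rewrite /r; clear; lra.
  have {p2} : expR (2 * phi w) <=
      B2 * modulus w `^ (alpha / 2) * (modulus w ^+ (2 * n) / monomial_norm alpha n).
    by apply: p2; move: rz w1 s11 s21; clear; lra.
  set q := _ / monomial_norm alpha n; have q0 : 0 <= q.
    by rewrite divr_ge0 ?exprn_ge0 ?modulus_ge0// ltW// monomial_norm_gt0.
  move=> p2; have {}p2 : expR (2 * phi w) <= B2 * (Th * N) * q.
    by apply: le_trans p2 _; rewrite ler_wpM2r// ler_wpM2l// ltW.
  rewrite (sum_kernel_minor w _ _ eE); last 2 first.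
  - by move: n2 k1; clear; lia.
  - by rewrite -modulus_gt0.
  rewrite -/q -/r; set q' := _ / monomial_norm alpha k in p1 *.
  have q'0 : 0 <= q' by rewrite divr_ge0 ?exprn_ge0 ?(ltW z0)// ltW// monomial_norm_gt0.
  have j1 : M%:R <= (k - n)%:R :> R by rewrite ler_nat; move: n2 k1; clear; lia.
  have j2 : (k - n)%:R <= 3 * M%:R :> R by rewrite -natrM ler_nat; move: n1 k2; clear; lia.
  have hu : (N * d' / 4) ^+ 2 <= modulus ((w / z) ^+ (k - n) - 1) ^+ 2.
    rewrite ler_pXn2r ?nnegrE ?modulus_ge0//; last by rewrite divr_ge0// mulr_ge0// ltW.
    have small : (k - n)%:R * modulus (w / z - 1) <= 1 / 4.
      rewrite uE; apply: (@le_trans _ _ (3 * N * d')).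
        by rewrite ler_wpM2r//; move: j2 M2; clear; lra.
      rewrite /d' mulrA ler_pdivrMr//.
      have : del * r <= 1 / 12 * r.
        by rewrite ler_wpM2r ?(ltW z0)// ge_min lexx orbT.
      have -> : 3 * N * d = 3 * (d * N) by ring.
      by move: dN; move: (d * N) (del * r); clear; move=> a b; lra.
    apply: le_trans (modulus_expr_sub1_ge small); rewrite uE.
    have : N * d' / 2 <= M%:R * d' by rewrite mulrAC ler_wpM2r.
    have : M%:R * d' <= (k - n)%:R * d' by rewrite ler_wpM2r.
    by move: (N * d') (_ * d') (_ * d'); clear; move=> a b c; lra.
  apply: (@le_trans _ _ (q * q' * (N * d' / 4) ^+ 2)); last first.
    by rewrite ler_wpM2l// mulr_ge0.
  rewrite /T expRD ler_pdivrMr ?mulr_gt0//.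
  apply: (@le_trans _ _ ((B1 * N * q') * (B2 * (Th * N) * q) * d' ^+ 2)).
    by rewrite ler_wpM2r ?sqr_ge0// ler_pM ?expR_ge0.
  by rewrite le_eqVlt; apply/orP; left; apply/eqP; field.
have Bp : 0 < 16 * (B1 * B2 * Th) by rewrite !mulr_gt0.
have T0 : 0 <= T by rewrite divr_ge0 ?(ltW Bp)// mulr_ge0 ?expR_ge0// sqr_ge0.
have sum_ge : (N / 2) ^+ 2 * T <= \sum_(n <- s) \sum_(k <- t)
    modulus (e n z * e k w - e k z * e n w) ^+ 2.
  have hs (q : seq nat) (F : nat -> R) x : size q = M -> (forall n, n \in q -> x <= F n) ->
      M%:R * x <= \sum_(n <- q) F n.
    move=> <-; elim: q => [|n q ih] h; first by rewrite big_nil mul0r.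
    rewrite big_cons/= -natr1 mulrDl mul1r addrC lerD ?h ?mem_head// ih// => k kq.
    by apply: h; rewrite in_cons kq orbT.
  apply: (@le_trans _ _ (M%:R * (M%:R * T))).
    rewrite mulrA ler_wpM2r// -expr2 ler_pXn2r ?nnegrE// divr_ge0// ltW//.
  apply: (hs); first by rewrite size_iota addKn.
  move=> n ns; apply: hs; first by rewrite size_iota; clear; lia.
  by move=> k kt; exact: term.
have pL := psd_sum_kernel e (s ++ t).
have ust : uniq (s ++ t).
  rewrite cat_uniq !iota_uniq andbT/=; apply/hasPn => k; rewrite !mem_index_iota => /andP[k1 _].
  by apply/negP => /andP[_]; move: k1; clear; lia.
have pKL : psd (fun x y => K x y - sum_kernel e (s ++ t) x y).
  exact: (psd_bessel kerK ust Fe e1 e0).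
have := kernel_det2_mono z w pL pKL.
have -> : (fun x y => sum_kernel e (s ++ t) x y + (K x y - sum_kernel e (s ++ t) x y)) = K.
  by apply/funext => x; apply/funext => y; rewrite addrC subrK.
apply: le_trans; apply: le_trans (kernel_det2_sum_kernel_ge e s t z w).
apply: le_trans sum_ge; rewrite le_eqVlt; apply/orP; left; apply/eqP.
rewrite /T /d'; field.
by rewrite !gt_eqF.
Qed.

End kernel_lower_bound.

(** * One-point and two-point moments *)

Section moments.
Variables (R : realType) (alpha : R).
Hypothesis alpha0 : 0 < alpha.
Local Notation C := R[i].
Local Notation m := (@lebesgueC R).
Local Notation nu := (laplacian_phi_alpha alpha : {measure set C -> \bar R}).
Local Notation rho := (rho nu).
Local Notation phi := (phi_alpha alpha).
Local Notation mu := (mu_phi phi nu : {measure set C -> \bar R}).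
Variable K : C -> C -> C.
Hypothesis kerK : fock_kernel phi nu K.
Local Notation moment Bs := (iterated_integral mu Bs (fun zs => (kernel_det K zs)%:E)).

Lemma kernel_diag_alpha_le : exists B r1, [/\ 0 < B, 1 <= r1 & forall z,
  r1 <= modulus z -> complex.Re (K z z) <= B * expR (2 * phi z)].
Proof.
have [B [r1 [B0 r11 hB]]] := fock_point_le alpha0.
exists B, r1; split=> // z rz; apply: (kernel_diag_le kerK).
  by rewrite mulr_ge0 ?expR_ge0// ltW.
by move=> f Ff; exact: hB.
Qed.

Lemma kernel_det2_alpha_le : exists D r1 del, [/\ 0 < D, 1 <= r1, 0 < del & forall z w,
  r1 <= modulus z -> modulus (w - z) <= del * modulus z `^ (1 - alpha / 2) ->
  kernel_det K [:: z; w] <=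
    D * modulus (w - z) ^+ 2 * modulus z `^ (alpha - 2) * expR (2 * phi z + 2 * phi w)].
Proof.
have [B [r1 [B0 r11 hB]]] := fock_point_le alpha0.
have [D [r2 [del [D0 r21 del0 hD]]]] := fock_zero_le alpha0.
exists (B * D), (r1 + r2), del; split; rewrite ?mulr_gt0//.
  by move: r11 r21; lra.
move=> z w rz wz.
apply: (@le_trans _ _ ((B * expR (2 * phi z)) *
   (D * modulus (w - z) ^+ 2 * modulus z `^ (alpha - 2) * expR (2 * phi w)))); last first.
  by rewrite le_eqVlt; apply/orP; left; apply/eqP; rewrite expRD; ring.
apply: (kernel_det2_le kerK).
- by rewrite mulr_ge0 ?expR_ge0// ltW.
- by rewrite !mulr_ge0 ?expR_ge0 ?powR_ge0 ?exprn_ge0 ?modulus_ge0// ltW.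
- by move=> f Ff; apply: hB => //; move: rz r11 r21; lra.
- by move=> f Ff fz; apply: hD => //; move: rz r11 r21; lra.
Qed.

Definition ring_region (r : R) : set C := [set z | r / 2 <= modulus z <= 2 * r].

Lemma weight_mass_eq B : measurable B ->
  (\int[mu]_(z in B) (expR (2 * phi z))%:E =
   \int[m]_(z in B) (c_phi phi nu * (rho z ^+ 2)^-1)%:E)%E.
Proof.
have mE : measurable_fun [set: C] (fun z => expR (2 * phi z)).
  apply: measurableT_comp; first exact: measurable_expR.
  by apply: measurable_funM => //; exact: measurable_modulus_pow.
move=> mB; rewrite (integral_fock_set alpha0 mB mE); last by move=> z; exact: expR_ge0.
apply: eq_integral => z _; congr EFin.
by rewrite /fock_density mulNr expRN; field; rewrite !gt_eqF ?expR_gt0// rho_gt0.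
Qed.

(** On the ring the density of exp(2 phi) mu is comparable to r^(alpha-2). *)
Lemma weight_mass_bounds : exists c1 c2 r1, [/\ 0 < c1, 0 < c2, 1 <= r1 & forall r B,
  r1 <= r -> measurable B -> B `<=` ring_region r ->
  ((c1 * r `^ (alpha - 2))%:E * m B <= \int[mu]_(z in B) (expR (2 * phi z))%:E)%E /\
  (\int[mu]_(z in B) (expR (2 * phi z))%:E <= (c2 * r `^ (alpha - 2))%:E * m B)%E].
Proof.
have [a a0 ha] := rho_lower alpha0; have [Q [R0 [Q0 R01 hQ]]] := rho_upper alpha0.
have c0 := c_phi_gt0 alpha0.
pose p := 1 - alpha / 2; pose k : R := 2 `^ `|p|; have k0 : 0 < k by exact: powR_gt0.
have [D [D0 DE]] : exists D, 0 < D /\ D = a / k / k by exists (a / k / k); rewrite !divr_gt0.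
have [E [E0 EE]] : exists E, 0 < E /\ E = Q * k by exists (Q * k); rewrite mulr_gt0.
exists (c_phi phi nu / E ^+ 2), (c_phi phi nu / D ^+ 2), (2 * R0); split.
- by rewrite divr_gt0// exprn_gt0.
- by rewrite divr_gt0// exprn_gt0.
- by move: R01; lra.
move=> r B rr mB Br; have r0 : 0 < r by move: rr R01; lra.
have r1 : 1 <= r by move: rr R01; lra.
have T0 : 0 < r `^ p by exact: powR_gt0.
have qE : r `^ (alpha - 2) = (r `^ p) ^- 2.
  apply: (mulIf (_ : (r `^ p) ^+ 2 != 0)); first by rewrite gt_eqF// exprn_gt0.
  by rewrite mulVf ?scale_sqr// gt_eqF// exprn_gt0.
have up z : B z -> rho z <= E * r `^ p.
  move=> /Br/andP[z1 z2]; apply: le_trans (hQ z _) _; first by move: z1 rr; lra.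
  by rewrite EE -mulrA ler_pM2l//; exact: powR_comparable.
have lo z : B z -> D * r `^ p <= rho z.
  move=> /Br/andP[z1 z2]; apply: le_trans (ha z).
  rewrite DE -!mulrA ler_pM2l// mulrA -invfM mulrC ler_pdivrMr ?mulr_gt0//.
  have h1 : r `^ p <= k * modulus z `^ p.
    apply: powR_comparable; move: z1 z2 r0; lra.
  have h2 : modulus z `^ p <= k * (1 + modulus z) `^ p.
    apply: powR_comparable; move: z1 z2 r1; lra.
  apply: le_trans h1 _; rewrite [leRHS]mulrC -mulrA ler_pM2l//.
rewrite weight_mass_eq// -!(integral_cst m mB); split; apply: ge0_le_integral_any => z Bz.
- by rewrite lee_fin mulr_ge0 ?powR_ge0// divr_ge0 ?sqr_ge0// ltW.
- rewrite lee_fin qE -mulrA -invfM -exprMn ler_pM2l// lef_pV2 ?posrE ?exprn_gt0 ?rho_gt0//; last first.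
    by rewrite mulr_gt0.
  by rewrite ler_pXn2r ?nnegrE ?(ltW (rho_gt0 alpha0 z)) ?up// mulr_ge0// ltW.
- by rewrite lee_fin mulr_ge0 ?invr_ge0 ?sqr_ge0// ltW.
- rewrite lee_fin qE -mulrA -invfM -exprMn ler_pM2l// lef_pV2 ?posrE ?exprn_gt0 ?rho_gt0//; last first.
    by rewrite mulr_gt0.
  by rewrite ler_pXn2r ?nnegrE ?(ltW (rho_gt0 alpha0 z)) ?lo// mulr_ge0 ?ltW.
Qed.

Lemma moment1_le : exists c r1, [/\ 0 < c, 1 <= r1 & forall r B v, r1 <= r ->
  measurable B -> B `<=` ring_region r -> m B = v%:E ->
  (moment [:: B] <= (c * r `^ (alpha - 2) * v)%:E)%E].
Proof.
have [c1 [c2 [r1 [c10 c20 r11 hw]]]] := weight_mass_bounds.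
have [b [r2 [b0 r21 hb]]] := kernel_diag_alpha_le; have pK := psd_fock_kernel kerK.
exists (b * c2), (r1 + 2 * r2); split; rewrite ?mulr_gt0//.
  by move: r11 r21; lra.
move=> r B v rr mB Br vB; have [|_ h2] := hw r B _ mB Br; first by move: rr r21; lra.
apply: (@le_trans _ _ (b%:E * \int[mu]_(z in B) (expR (2 * phi z))%:E)%E); last first.
  have -> : b * c2 * r `^ (alpha - 2) * v = b * (c2 * r `^ (alpha - 2) * v) by ring.
  rewrite EFinM; apply: lee_wpmul2l; first by rewrite lee_fin ltW.
  by rewrite EFinM -vB.
rewrite -ge0_integralZl_any ?(ltW b0)//.
apply: ge0_le_integral_any => z /Br/andP[z1 z2] /=; first by rewrite lee_fin kernel_det_ge0.
rewrite kernel_det1// -EFinM lee_fin hb//; move: z1 rr r11; lra.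
Qed.

Let moment2_weights B B' (k : R) : 0 <= k ->
  (\int[mu]_(w in B') (expR (2 * phi w))%:E < +oo)%E ->
  (\int[mu]_(z in B) \int[mu]_(w in B') (k * expR (2 * phi z + 2 * phi w))%:E =
   k%:E * (\int[mu]_(z in B) (expR (2 * phi z))%:E * \int[mu]_(w in B') (expR (2 * phi w))%:E))%E.
Proof.
move=> k0 Ify; have e0 (x : R) : (0 <= (expR x)%:E)%E by rewrite lee_fin expR_ge0.
have I0 : (0 <= \int[mu]_(w in B') (expR (2 * phi w))%:E)%E by apply: integral_ge0.
have [I II] : exists I, (\int[mu]_(w in B') (expR (2 * phi w))%:E)%E = I%:E.
  by exists (fine (\int[mu]_(w in B') (expR (2 * phi w))%:E)%E); rewrite fineK// ge0_fin_numE.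
transitivity (\int[mu]_(z in B) ((k * I)%:E * (expR (2 * phi z))%:E))%E.
  apply: eq_integral => z _.
  transitivity ((k * expR (2 * phi z))%:E * \int[mu]_(w in B') (expR (2 * phi w))%:E)%E.
    have ke : 0 <= k * expR (2 * phi z) by rewrite mulr_ge0 ?expR_ge0.
    rewrite -(ge0_integralZl_any mu ke)//.
    by apply: eq_integral => w _; rewrite -EFinM expRD mulrA.
  by rewrite II -!EFinM mulrAC.
have I0' : 0 <= I by rewrite -lee_fin -II.
rewrite ge0_integralZl_any ?mulr_ge0// II EFinM -muleA; congr (_ * _)%E; exact: muleC.
Qed.

Let divM_le (e k a b : R) : 0 < e -> 0 < k -> a <= k * b -> e / k * a <= e * b.
Proof.
by move=> e0 k0 h; rewrite -mulrA ler_pM2l// mulrC ler_pdivrMr// mulrC.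
Qed.

Let ring_powR (p r x : R) : 0 < r -> r / 2 <= x <= 2 * r ->
  r `^ p <= 2 `^ `|p| * x `^ p /\ x `^ p <= 2 `^ `|p| * r `^ p.
Proof.
move=> r0 /andP[x1 x2]; split; apply: powR_comparable; move: x1 x2 r0; lra.
Qed.

Lemma moment2_le : exists c r1 del, [/\ 0 < c, 1 <= r1, 0 < del & forall r t B B' v v',
  r1 <= r -> t <= del * r `^ (1 - alpha / 2) ->
  measurable B -> measurable B' -> B `<=` ring_region r -> B' `<=` ring_region r ->
  m B = v%:E -> m B' = v'%:E -> (forall z w, B z -> B' w -> modulus (w - z) <= t) ->
  (moment [:: B; B'] <= (c * t ^+ 2 * (r `^ (alpha - 2)) ^+ 3 * v * v')%:E)%E].
Proof.
have [c1 [c2 [r1 [c10 c20 r11 hw]]]] := weight_mass_bounds.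
have [D [r2 [del [D0 r21 del0 hD]]]] := kernel_det2_alpha_le; have pK := psd_fock_kernel kerK.
have [k [k0 hk]] : exists k : R, 0 < k /\ k = 2 `^ `|1 - alpha / 2|
  by exists (2 `^ `|1 - alpha / 2|); rewrite powR_gt0.
have [l [l0 hl]] : exists l : R, 0 < l /\ l = 2 `^ `|alpha - 2|
  by exists (2 `^ `|alpha - 2|); rewrite powR_gt0.
exists (D * l * c2 ^+ 2), (r1 + 2 * r2), (del / k); split.
- by rewrite !mulr_gt0// exprn_gt0.
- by move: r11 r21; lra.
- by rewrite divr_gt0.
move=> r t B B' v v' rr tr mB mB' Br B'r vB vB' ht.
have r0 : 0 < r by move: rr r11 r21; lra.
have rr1 : r1 <= r by move: rr r21; lra.
have [_ h1] := hw r B rr1 mB Br; have [_ h2] := hw r B' rr1 mB' B'r.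
rewrite vB -EFinM in h1; rewrite vB' -EFinM in h2.
set q := r `^ (alpha - 2) in h1 h2 *; have q0 : 0 < q by exact: powR_gt0.
have s0 : 0 <= D * l * t ^+ 2 * q by rewrite mulr_ge0 ?(ltW q0)// mulr_ge0 ?sqr_ge0// mulr_ge0// ltW.
apply: (@le_trans _ _ (\int[mu]_(z in B) \int[mu]_(w in B')
    (D * l * t ^+ 2 * q * expR (2 * phi z + 2 * phi w))%:E)%E).
  apply: ge0_le_integral_any => z Bz.
    by apply: integral_ge0 => w _; rewrite lee_fin kernel_det_ge0.
  apply: ge0_le_integral_any => w Bw; first by rewrite lee_fin kernel_det_ge0.
  rewrite lee_fin /=; have wz := ht _ _ Bz Bw; have Rz := Br _ Bz.
  have [p1 _] := ring_powR (1 - alpha / 2) r0 Rz; have [_ p2] := ring_powR (alpha - 2) r0 Rz.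
  rewrite -hk in p1; rewrite -hl -/q in p2; have /andP[z1 z2] := Rz.
  apply: le_trans (hD z w _ _) _; first by move: z1 rr r11; lra.
    apply: le_trans wz _; apply: le_trans tr _.
    exact: divM_le.
  rewrite ler_wpM2r ?expR_ge0//.
  have -> : D * l * t ^+ 2 * q = D * t ^+ 2 * (l * q) by ring.
  have w0 := modulus_ge0 (w - z).
  rewrite ler_pM ?powR_ge0//; first by rewrite mulr_ge0 ?sqr_ge0// ltW.
  by rewrite ler_pM2l// ler_pXn2r ?nnegrE// (le_trans w0).
rewrite moment2_weights//; last exact: le_lt_trans h2 (ltry _).
have -> : D * l * c2 ^+ 2 * t ^+ 2 * q ^+ 3 * v * v' =
    (D * l * t ^+ 2 * q) * ((c2 * q * v) * (c2 * q * v')) by ring.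
rewrite [leRHS]EFinM; apply: lee_wpmul2l; first by rewrite lee_fin.
have e0 (x : R) : (0 <= (expR x)%:E)%E by rewrite lee_fin expR_ge0.
by rewrite [leRHS]EFinM; apply: lee_pmul => //; apply: integral_ge0.
Qed.

Lemma moment2_ge : exists c r1 del, [/\ 0 < c, 1 <= r1, 0 < del & forall r t B B' v v',
  r1 <= r -> 0 <= t ->
  measurable B -> measurable B' -> B `<=` ring_region r -> B' `<=` ring_region r ->
  m B = v%:E -> m B' = v'%:E ->
  (forall z w, B z -> B' w -> t <= modulus (w - z) <= del * r `^ (1 - alpha / 2)) ->
  ((c * t ^+ 2 * (r `^ (alpha - 2)) ^+ 3 * v * v')%:E <= moment [:: B; B'])%E].
Proof.
have [c1 [c2 [r1 [c10 c20 r11 hw]]]] := weight_mass_bounds.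
have [D [r2 [del [D0 r21 del0 hD]]]] := kernel_det2_ge alpha0 kerK.
have [k [k0 hk]] : exists k : R, 0 < k /\ k = 2 `^ `|1 - alpha / 2|
  by exists (2 `^ `|1 - alpha / 2|); rewrite powR_gt0.
have [l [l0 hl]] : exists l : R, 0 < l /\ l = 2 `^ `|alpha - 2|
  by exists (2 `^ `|alpha - 2|); rewrite powR_gt0.
exists (D / l * c1 ^+ 2), (r1 + 2 * r2), (del / k); split.
- by rewrite mulr_gt0 ?exprn_gt0// divr_gt0.
- by move: r11 r21; lra.
- by rewrite divr_gt0.
move=> r t B B' v v' rr t0 mB mB' Br B'r vB vB' ht.
have r0 : 0 < r by move: rr r11 r21; lra.
have rr1 : r1 <= r by move: rr r21; lra.
have [h1 _] := hw r B rr1 mB Br; have [h2 b2] := hw r B' rr1 mB' B'r.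
rewrite vB -EFinM in h1; rewrite vB' -EFinM in h2; rewrite vB' -EFinM in b2.
have v0 : 0 <= v by rewrite -lee_fin -vB measure_ge0.
have v'0 : 0 <= v' by rewrite -lee_fin -vB' measure_ge0.
set q := r `^ (alpha - 2) in h1 h2 b2 *; have q0 : 0 < q by exact: powR_gt0.
have s0 : 0 <= D / l * t ^+ 2 * q 
  by rewrite mulr_ge0 ?(ltW q0)// mulr_ge0 ?sqr_ge0// divr_ge0// ltW.
apply: (@le_trans _ _ (\int[mu]_(z in B) \int[mu]_(w in B')
    (D / l * t ^+ 2 * q * expR (2 * phi z + 2 * phi w))%:E)%E).
  rewrite moment2_weights//; last exact: le_lt_trans b2 (ltry _).
  have -> : D / l * c1 ^+ 2 * t ^+ 2 * q ^+ 3 * v * v' =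
      (D / l * t ^+ 2 * q) * ((c1 * q * v) * (c1 * q * v')) by ring.
  rewrite [leLHS]EFinM; apply: lee_wpmul2l; first by rewrite lee_fin.
  have cv x : 0 <= x -> (0 <= (c1 * q * x)%:E)%E by move=> x0; rewrite lee_fin !mulr_ge0// ltW.
  by rewrite [leLHS]EFinM; apply: lee_pmul => //; exact: cv.
apply: ge0_le_integral_any => z Bz.
  by apply: integral_ge0 => w _; rewrite lee_fin mulr_ge0 ?expR_ge0.
apply: ge0_le_integral_any => w Bw; first by rewrite lee_fin mulr_ge0 ?expR_ge0.
rewrite lee_fin /=; have /andP[tw wz] := ht _ _ Bz Bw; have Rz := Br _ Bz.
have [p1 _] := ring_powR (1 - alpha / 2) r0 Rz; have [p2 _] := ring_powR (alpha - 2) r0 Rz.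
rewrite -hk in p1; rewrite -hl -/q in p2; have /andP[z1 z2] := Rz.
apply: le_trans (hD z w _ _); last 2 first.
- by move: z1 rr r11; lra.
- apply: le_trans wz _.
  exact: divM_le.
rewrite ler_wpM2r ?expR_ge0//.
have -> : D / l * t ^+ 2 * q = D * t ^+ 2 * (q / l) by ring.
have D00 := ltW D0; have w0 := modulus_ge0 (w - z).
apply: ler_pM; first by rewrite mulr_ge0 ?sqr_ge0.
- by rewrite divr_ge0// ltW.
- by rewrite ler_pM2l// ler_pXn2r ?nnegrE.
- by rewrite ler_pdivrMr// mulrC.
Qed.

End moments.

(** * Moments of counts and negative correlation *)

Section iterated_integrals.
Variables (R : realType) (mu : {measure set R[i] -> \bar R}).
Local Notation C := R[i].
Local Notation iter := (iterated_integral mu).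
Implicit Types (F G : seq C -> \bar R) (Bs : seq (set C)).
Local Open Scope ereal_scope.

Lemma iterated_integral_ge0 Bs F : (forall zs, 0 <= F zs) -> 0 <= iter Bs F.
Proof.
by elim: Bs F => [|B Bs ih] F F0 //=; apply: integral_ge0 => z _; exact: ih.
Qed.

Lemma le_iterated_integral Bs F G : (forall zs, 0 <= F zs) ->
  (forall zs, size zs = size Bs -> F zs <= G zs) -> iter Bs F <= iter Bs G.
Proof.
elim: Bs F G => [|B Bs ih] F G F0 FG /=; first exact: FG.
apply: ge0_le_integral_any => z _; first exact: iterated_integral_ge0.
by apply: ih => // zs szs; apply: FG; rewrite /= szs.
Qed.

Lemma iterated_integralZl Bs F (k : R) : (0 <= k)%R -> (forall zs, 0 <= F zs) ->
  iter Bs (fun zs => k%:E * F zs) = k%:E * iter Bs F.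
Proof.
move=> k0; elim: Bs F => [|B Bs ih] F F0 //=.
rewrite -ge0_integralZl_any//; first by apply: eq_integral => z _; exact: ih.
by move=> z _; exact: iterated_integral_ge0.
Qed.

Lemma iterated_integral_cat Bs Bs' F :
  iter (Bs ++ Bs') F = iter Bs (fun xs => iter Bs' (fun ys => F (xs ++ ys))).
Proof. by elim: Bs F => [|B Bs ih] F //=; apply: eq_integral => z _; exact: ih. Qed.

Variable K : C -> C -> C.
Hypothesis pK : psd K.
Local Notation moment Bs := (iter Bs (fun zs => (kernel_det K zs)%:E)).

Lemma moment_ge0 Bs : 0 <= moment Bs.
Proof. by apply: iterated_integral_ge0 => zs; rewrite lee_fin kernel_det_ge0. Qed.

(** Fischer's inequality makes a determinantal process negatively correlated. *)
Lemma moment_cat_le Bs Bs' : (size Bs' <= 2)%N -> moment Bs' < +oo ->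
  moment (Bs ++ Bs') <= moment Bs * moment Bs'.
Proof.
move=> s2 fin; rewrite iterated_integral_cat.
have [I IE] : exists I, moment Bs' = I%:E.
  by exists (fine (moment Bs')); rewrite fineK// ge0_fin_numE// moment_ge0.
have I0 : (0 <= I)%R by rewrite -lee_fin -IE moment_ge0.
have d0 zs : 0 <= (kernel_det K zs)%:E by rewrite lee_fin kernel_det_ge0.
rewrite IE muleC -iterated_integralZl//; apply: le_iterated_integral => xs.
  by apply: iterated_integral_ge0 => ys.
move=> _; rewrite muleC -IE -iterated_integralZl//; last exact: kernel_det_ge0.
apply: le_iterated_integral => // ys sys; rewrite -EFinM lee_fin.
by apply: fischer; rewrite ?sys.
Qed.

End iterated_integrals.

Section counts.
Context d (Omega : measurableType d) (R : realType) (P : probability Omega R).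
Local Notation C := R[i].
Variables (Lambda : Omega -> set C) (K : C -> C -> C) (mu : {measure set C -> \bar R}).
Hypothesis dpp : determinantal_process P K mu Lambda.
Local Notation moment Bs := (iterated_integral mu Bs (fun zs => (kernel_det K zs)%:E)).

Definition bounded_borel (B : set C) : Prop :=
  measurable B /\ exists r, B `<=` disk 0 r.

Fixpoint disjoint_borel (Bs : seq (set C)) : Prop :=
  if Bs is B :: Bs' then
    [/\ bounded_borel B, foldr (fun B' p => B `&` B' = set0 /\ p) True Bs' &
        disjoint_borel Bs']
  else True.

Definition num (B : set C) (w : Omega) : nat := #|` fset_set (B `&` Lambda w)|%fset.

Lemma bounded_borel_finite B w : bounded_borel B -> finite_set (B `&` Lambda w).
Proof.
move=> [_ [r Br]]; apply: sub_finite_set (dpp.1.1 w r) => z [Bz Lz].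
by split=> //; exact: Br.
Qed.

Lemma countingE B w : bounded_borel B -> counting (B `&` Lambda w) = (num B w)%:R%:E :> \bar R.
Proof. by move=> bB; rewrite /counting asboolT//; exact: bounded_borel_finite. Qed.

Lemma measurable_num B : bounded_borel B ->
  measurable_fun [set: Omega] (fun w => (num B w)%:R : R).
Proof.
move=> bB; apply/measurable_EFinP; have := dpp.1.2 B bB.1.
by congr measurable_fun; apply/funext => w; exact: countingE.
Qed.

Let disjoint_borel_nth Bs k : disjoint_borel Bs -> (k < size Bs)%N ->
  bounded_borel (nth set0 Bs k).
Proof. by elim: Bs k => [//|B Bs ih] [|k] [? _ /ih]; [|exact]. Qed.

Let disjoint_borel_trivIset Bs : disjoint_borel Bs ->
  trivIset [set k | (k < size Bs)%N] (nth set0 Bs).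
Proof.
elim: Bs => [_ i j //|B Bs ih] [_ h /ih {}ih].
have h0 k : (k < size Bs)%N -> B `&` nth set0 Bs k = set0.
  by move: h; elim: Bs {ih} k => [//|B' Bs ih] [|k] /= [? ?] //; exact: ih.
move=> [|i] [|j] //= si sj; first by rewrite h0// => -[z].
  by rewrite setIC h0// => -[z].
by move=> /ih ->.
Qed.

Lemma expectation_counts Bs : disjoint_borel Bs ->
  (\int[P]_w (\prod_(B <- Bs) (num B w)%:R)%:E = moment Bs)%E.
Proof.
move=> dB; rewrite -dpp.2; last 2 first.
- by move=> k /(disjoint_borel_nth dB)[].
- exact: disjoint_borel_trivIset.
apply: eq_integral => w _; elim: Bs dB => [|B Bs ih] dB; first by rewrite !big_nil.
by case: dB => bB _ /ih e; rewrite !big_cons EFinM e countingE.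
Qed.

End counts.

(** * Fine partitions *)

Lemma measurable_floor_eq d (T : measurableType d) (R : realType) (g : T -> R) (c : R) (k : int) :
  measurable_fun [set: T] g -> measurable [set z | Num.floor (g z * c) = k].
Proof.
move=> mg; have -> : [set z | Num.floor (g z * c) = k] =
    [set: T] `&` (fun z => g z * c) @^-1` `[k%:~R, (k + 1)%:~R[.
  rewrite setTI; apply/seteqP; split => z /=; rewrite in_itv/=.
    by move=> /eqP; rewrite floor_eq.
  by move=> h; apply/eqP; rewrite floor_eq.
have : measurable_fun [set: T] (fun z => g z * c) by exact: measurable_funM.
by apply; [exact: measurableT|exact: measurable_itv].
Qed.

Lemma fatou_bound d (T : measurableType d) (R : realType) (mu : {measure set T -> \bar R})
    (F : nat -> T -> \bar R) (G : T -> \bar R) (c : \bar R) :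
  (forall n, measurable_fun [set: T] (F n)) -> (forall n x, (0 <= F n x)%E) ->
  (forall x, (0 <= G x)%E) ->
  (forall x, exists n0, forall n, (n0 <= n)%N -> (G x <= F n x)%E) ->
  (forall n, (\int[mu]_x F n x <= c)%E) -> (\int[mu]_x G x <= c)%E.
Proof.
move=> mF F0 G0 GF Fc; apply: (@le_trans _ _ (\int[mu]_x limn_einf (F ^~ x))%E).
  apply: ge0_le_integral_any => x _ //; have [n0 h] := GF x.
  rewrite limn_einf_lim; apply: lime_ge; first exact: is_cvg_einfs.
  exists n0 => // n /= n0n; apply: le_ereal_inf_tmp => _ [k /= nk <-].
  by apply: h; exact: leq_trans nk.
apply: le_trans (fatou mu measurableT mF (fun n x _ => F0 n x)) _.
rewrite limn_einf_lim; apply: lime_le; first exact: is_cvg_einfs.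
apply: nearW => n; apply: le_trans (Fc n).
by apply: ereal_inf_lbound; exists n => /=.
Qed.

Section partitions.
Variable R : realType.
Local Notation C := R[i].

Definition grid_cell (W n : nat) (p : 'I_(2 * W * n.+1).+1 * 'I_(2 * W * n.+1).+1) : set C :=
  [set z | Num.floor (complex.Re z * n.+1%:R) = p.1%:Z - (W * n.+1)%:Z /\
           Num.floor (complex.Im z * n.+1%:R) = p.2%:Z - (W * n.+1)%:Z].

Lemma measurable_grid_cell W n p : measurable (@grid_cell W n p).
Proof.
have -> : @grid_cell W n p =
    [set z | Num.floor (complex.Re z * n.+1%:R) = p.1%:Z - (W * n.+1)%:Z] `&`
    [set z | Num.floor (complex.Im z * n.+1%:R) = p.2%:Z - (W * n.+1)%:Z] by [].
by apply: measurableI; apply: measurable_floor_eq; [exact: measurable_Re|exact: measurable_Im].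
Qed.

Lemma grid_index (W n : nat) (x : R) : `|x| <= W%:R ->
  exists i : 'I_(2 * W * n.+1).+1, Num.floor (x * n.+1%:R) = i%:Z - (W * n.+1)%:Z.
Proof.
rewrite ler_norml => /andP[x1 x2]; have n0 : 0 < n.+1%:R :> R by rewrite ltr0n.
have h1 : - (W * n.+1)%:Z <= Num.floor (x * n.+1%:R).
  rewrite floor_ge_int_tmp.
  by rewrite mulrNz -pmulrn natrM -mulNr ler_pM2r.
have h2 : Num.floor (x * n.+1%:R) <= (W * n.+1)%:Z.
  rewrite -ltzD1 floor_lt_int.
  rewrite intrD -pmulrn natrM; apply: (@le_lt_trans _ _ (W%:R * n.+1%:R)).
    by rewrite ler_pM2r.
  by rewrite ltrDl.
pose k := absz (Num.floor (x * n.+1%:R) + (W * n.+1)%:Z).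
have kE : k%:Z = Num.floor (x * n.+1%:R) + (W * n.+1)%:Z.
  by rewrite /k gez0_abs//; move: h1; lia.
have kb : (k < (2 * W * n.+1).+1)%N by move: kE h2; lia.
by exists (Ordinal kb); rewrite kE addrK.
Qed.

Lemma floor_separates (x y : R) : x != y -> exists n0, forall n, (n0 <= n)%N ->
  Num.floor (x * n.+1%:R) <> Num.floor (y * n.+1%:R).
Proof.
move=> xy; have d0 : 0 < `|x - y| by rewrite normr_gt0 subr_eq0.
exists (Num.truncn `|x - y|^-1) => n hn e.
have n0 : 0 < n.+1%:R :> R by rewrite ltr0n.
have : `|x - y| * n.+1%:R < 1.
  rewrite -[n.+1%:R]gtr0_norm// -normrM mulrBl ltr_norml.
  have h (t : R) : (Num.floor t)%:~R <= t < (Num.floor t)%:~R + 1.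
    by have := floor_itv t; rewrite intrD.
  have := h (x * n.+1%:R); have := h (y * n.+1%:R); rewrite e.
  move: ((Num.floor (y * n.+1%:R))%:~R) => a; move: (x * n.+1%:R) => b.
  by move: (y * n.+1%:R) => c /andP[? ?] /andP[? ?]; apply/andP; split; lra.
rewrite mulrC -ltr_pdivlMr// mul1r ltNge => /negP; apply.
have i0 : 0 <= `|x - y|^-1 by rewrite invr_ge0.
have /andP[_ h] := truncn_itv i0.
by apply: ltW; apply: lt_le_trans h _; rewrite ler_nat.
Qed.

(** Partitions of a bounded set that separate the points in the limit. *)
Lemma fine_partition (B : set C) : bounded_borel B ->
  exists (I : nat -> finType) (b : forall n, I n -> set C),
  [/\ forall n i, bounded_borel (b n i) /\ b n i `<=` B,
      forall n i j, i != j -> b n i `&` b n j = set0,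
      forall n z, B z -> exists i, b n i z &
      forall x y, x != y -> exists n0, forall n, (n0 <= n)%N -> forall i,
        b n i x -> b n i y -> False].
Proof.
move=> [mB [r Br]]; pose W := (Num.truncn `|r|).+1.
exists (fun n => 'I_(2 * W * n.+1).+1 * 'I_(2 * W * n.+1).+1)%type.
exists (fun n p => B `&` @grid_cell W n p); split.
- move=> n p; split; last by move=> z [].
  split; first by apply: measurableI => //; exact: measurable_grid_cell.
  by exists r => z [/Br].
- move=> n [i1 i2] [j1 j2]; apply: contra_neqP => /eqP/set0P[z [[_ [/= a1 a2]] [_ [/= b1 b2]]]].
  move: a1 a2; rewrite b1 b2 => a1 a2; congr (_, _); apply: val_inj => /=; lia.
- move=> n z Bz; have zW : modulus z <= W%:R.
    have := Br z Bz; rewrite /disk/= subr0 => zr.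
    have /andP[_ h] := truncn_itv (normr_ge0 r).
    by apply: ltW; apply: lt_trans h; apply: lt_le_trans zr (ler_norm r).
  have [i hi] := @grid_index W n _ (le_trans (le_Re_modulus z) zW).
  have [j hj] := @grid_index W n _ (le_trans (le_Im_modulus z) zW).
  by exists (i, j).
- move=> x y xy.
  have [re|re] := eqVneq (complex.Re x) (complex.Re y).
    have im : complex.Im x != complex.Im y.
      by apply: contra_neq xy => im; exact: complex_eqP.
    have [n0 h] := floor_separates im; exists n0 => n /h hn i [_ [_ a]] [_ [_ b]].
    by apply: hn; rewrite a b.
  have [n0 h] := floor_separates re; exists n0 => n /h hn i [_ [a _]] [_ [b _]].
  by apply: hn; rewrite a b.
Qed.

End partitions.

Section moments_of_counts.
Context d (Omega : measurableType d) (R : realType) (P : probability Omega R).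
Local Notation C := R[i].
Variables (Lambda : Omega -> set C) (K : C -> C -> C) (mu : {measure set C -> \bar R}).
Hypothesis dpp : determinantal_process P K mu Lambda.
Hypothesis pK : psd K.
Local Notation moment Bs := (iterated_integral mu Bs (fun zs => (kernel_det K zs)%:E)).
Local Notation N := (num Lambda).

Let numR B w : R := (N B w)%:R.

Lemma num_count B b w : bounded_borel B -> b `<=` B ->
  N b w = count (fun x => x \in b) (enum_fset (fset_set (B `&` Lambda w))).
Proof.
move=> bB sb; have fB := bounded_borel_finite dpp w bB.
have fb : finite_set (b `&` Lambda w).
  by apply: sub_finite_set fB => z [bz Lz]; split=> //; exact: sb.
rewrite /num -size_filter; apply: perm_size; apply: uniq_perm.
- exact: fset_uniq.
- by rewrite filter_uniq// fset_uniq.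
move=> x; rewrite mem_filter [LHS](in_fset_set fb).
have -> : (x \in enum_fset (fset_set (B `&` Lambda w))) = (x \in B `&` Lambda w).
  exact: (in_fset_set fB).
apply/idP/andP => [/set_mem[bx Lx]|[/set_mem bx /set_mem[_ Lx]]].
  by split; apply/mem_set => //; split=> //; exact: sb.
by apply/mem_set.
Qed.

Lemma num_partition B (I : finType) (b : I -> set C) w : bounded_borel B ->
  (forall i, b i `<=` B) -> (forall i j, i != j -> b i `&` b j = set0) ->
  (forall z, B z -> exists i, b i z) -> N B w = \sum_i N (b i) w.
Proof.
move=> bB sb tb cb; rewrite (num_count w bB (@subset_refl _ B)).
under eq_bigr => i _ do rewrite (num_count w bB (sb i)) -sum1_count big_mkcond/=.
rewrite exchange_big/= -sum1_count big_mkcond/=; apply: eq_bigr => x _.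
have [xB|xB] := boolP (x \in B); last first.
  rewrite big1// => i _; case: ifPn => // /set_mem /sb /mem_set.
  by rewrite (negbTE xB).
have [i bi] := cb _ (set_mem xB).
rewrite (bigD1 i)//= mem_set// big1 ?addn0// => j ji; case: ifPn => // /set_mem bj.
have : (b j `&` b i) x by [].
by rewrite tb.
Qed.

Lemma num_le1 (B : set C) (I : nat -> finType) (b : forall n, I n -> set C) w :
  bounded_borel B -> (forall n i, b n i `<=` B) ->
  (forall x y, x != y -> exists n0, forall n, (n0 <= n)%N -> forall i,
        b n i x -> b n i y -> False) ->
  exists n0, forall n, (n0 <= n)%N -> forall i, (N (b n i) w <= 1)%N.
Proof.
move=> bB sb sep; set s := enum_fset (fset_set (B `&` Lambda w)).
have : forall p : C * C, exists k, p.1 != p.2 ->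
    forall n, (k <= n)%N -> forall i, b n i p.1 -> b n i p.2 -> False.
  move=> [x y].
  have [->|/sep[n0 h]] := eqVneq x y; first by exists 0%N => /eqP.
  by exists n0.
move=> /choice[f hf].
exists (\max_(x <- s) \max_(y <- s) f (x, y)) => n hn i.
rewrite (num_count w bB (sb n i)) -/s -size_filter.
have : uniq [seq x <- s | x \in b n i] by rewrite filter_uniq// fset_uniq.
case E : [seq x <- s | x \in b n i] => [|x [|y l]] //= /andP[]; rewrite in_cons negb_or => /andP[xy _] _.
have : x \in [seq x <- s | x \in b n i] by rewrite E mem_head.
have : y \in [seq x <- s | x \in b n i] by rewrite E !in_cons eqxx orbT.
rewrite !mem_filter => /andP[/set_mem yb ys] /andP[/set_mem xb xs].
exfalso; apply: (hf (x, y) xy n _ i) => //; apply: leq_trans hn.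
apply: leq_trans (leq_bigmax_seq (F := fun x => \max_(y <- s) f (x, y)) x xs isT).
exact: (leq_bigmax_seq (F := fun y => f (x, y)) y ys isT).
Qed.

End moments_of_counts.

(** * Second moments of counts *)

Section pair_sums.
Variable R : realType.

Lemma le_sum_pairs (J : finType) (Q : pred (J * J)) (u v : J -> \bar R) :
  (forall j, 0 <= u j)%E -> (forall j, 0 <= v j)%E ->
  (\sum_(p | Q p) u p.1 * v p.2 <= (\sum_j u j) * (\sum_j v j))%E.
Proof.
move=> u0 v0.
have -> : ((\sum_j u j) * (\sum_j v j) = \sum_i \sum_j u i * v j)%E.
  by rewrite ge0_sume_distrl//; apply: eq_bigr => i _; rewrite ge0_sume_distrr.
rewrite pair_big/= big_mkcond/=; apply: lee_sum => p _.
by case: ifP => // _; exact: mule_ge0.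
Qed.

Definition pair_sum (I : finType) (x : I -> nat) : nat :=
  \sum_(p : I * I | p.1 != p.2) x p.1 * x p.2.

Lemma sqr_sum_bits (I : finType) (x : I -> nat) : (forall i, x i <= 1)%N ->
  ((\sum_i x i) ^ 2 = \sum_i x i + pair_sum x)%N.
Proof.
move=> x1; rewrite -mulnn big_distrlr/= /pair_sum.
have -> : \sum_(p : I * I | p.1 != p.2) x p.1 * x p.2 = \sum_i \sum_(j | i != j) x i * x j.
  by rewrite pair_big_dep; exact: eq_bigl.
rewrite -big_split/=; apply: eq_bigr => i _; rewrite (bigD1 i)//=; congr addn.
  by have := x1 i; case: (x i) => [|[|]].
by apply: eq_bigl => j; rewrite eq_sym.
Qed.

End pair_sums.

Section second_moments.
Context d (Omega : measurableType d) (R : realType) (P : probability Omega R).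
Local Notation C := R[i].
Variables (Lambda : Omega -> set C) (K : C -> C -> C) (mu : {measure set C -> \bar R}).
Hypothesis dpp : determinantal_process P K mu Lambda.
Hypothesis pK : psd K.
Local Notation moment Bs := (iterated_integral mu Bs (fun zs => (kernel_det K zs)%:E)).
Local Notation N := (num Lambda).

Definition expectation_nat (f : Omega -> nat) : \bar R := (\int[P]_w ((f w)%:R)%:E)%E.
Local Notation Ex := expectation_nat.

Let mnum (f : Omega -> nat) := measurable_fun [set: Omega] (fun w => (f w)%:R : R).

Let mnumM f g : mnum f -> mnum g -> mnum (fun w => f w * g w)%N.
Proof.
move=> mf mg; rewrite /mnum; have -> : (fun w => (f w * g w)%:R : R) = (fun w => (f w)%:R * (g w)%:R).
  by apply/funext => w; rewrite natrM.
exact: measurable_funM.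
Qed.

Let mnumD f g : mnum f -> mnum g -> mnum (fun w => f w + g w)%N.
Proof.
move=> mf mg; rewrite /mnum; have -> : (fun w => (f w + g w)%:R : R) = (fun w => (f w)%:R + (g w)%:R).
  by apply/funext => w; rewrite natrD.
exact: measurable_funD.
Qed.

Let mnum_sum (I : Type) (s : seq I) (Q : pred I) (f : I -> Omega -> nat) :
  (forall i, mnum (f i)) -> mnum (fun w => \sum_(i <- s | Q i) f i w)%N.
Proof.
move=> mf; elim: s => [|i s ih].
  by rewrite /mnum; under eq_fun do rewrite big_nil; exact: measurable_cst.
rewrite /mnum; under eq_fun do rewrite big_cons.
by case: (Q i) => //; exact: mnumD.
Qed.

Let mN B : bounded_borel B -> mnum (N B).
Proof. by move=> bB; exact: (measurable_num dpp bB). Qed.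

Let Ex_ge0 f : (0 <= Ex f)%E.
Proof. by apply: integral_ge0 => w _; rewrite lee_fin. Qed.

Let le_Ex f g : (forall w, f w <= g w)%N -> (Ex f <= Ex g)%E.
Proof.
by move=> fg; apply: ge0_le_integral_any => w _; rewrite lee_fin// ler_nat.
Qed.

Let Ex_sum (I : Type) (s : seq I) (Q : pred I) (f : I -> Omega -> nat) :
  (forall i, mnum (f i)) ->
  (Ex (fun w => \sum_(i <- s | Q i) f i w)%N = \sum_(i <- s | Q i) Ex (f i))%E.
Proof.
move=> mf; elim: s => [|i s ih].
  by rewrite big_nil /Ex; under eq_integral => w _ do rewrite big_nil; rewrite integral0.
rewrite [RHS]big_cons; case Qi : (Q i); last first.
  by rewrite -ih; apply: eq_integral => w _; rewrite big_cons Qi.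
rewrite -ih.
transitivity (\int[P]_w (((f i w)%:R : R)%:E + ((\sum_(j <- s | Q j) f j w)%N%:R : R)%:E))%E.
  by apply: eq_integral => w _; rewrite big_cons Qi natrD EFinD.
apply: ge0_integralD => //; try by move=> w _; rewrite lee_fin.
- by apply/measurable_EFinP; exact: mf.
- by apply/measurable_EFinP; exact: mnum_sum.
Qed.

Let Ex_moment Bs : disjoint_borel Bs -> (Ex (fun w => \prod_(B <- Bs) N B w)%N = moment Bs)%E.
Proof.
move=> dB; rewrite -(expectation_counts dpp dB).
by apply: eq_integral => w _; rewrite natr_prod.
Qed.

Let Ex1 B : bounded_borel B -> (Ex (N B) = moment [:: B])%E.
Proof.
by move=> bB; rewrite -Ex_moment//; apply: eq_integral => w _; rewrite big_seq1.
Qed.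

Let Ex2 B B' : disjoint_borel [:: B; B'] -> (Ex (fun w => N B w * N B' w)%N = moment [:: B; B'])%E.
Proof.
move=> h; rewrite -Ex_moment//; apply: eq_integral => w _.
by rewrite !big_cons big_nil muln1.
Qed.

Let Ex3 A B B' : disjoint_borel [:: A; B; B'] ->
  (Ex (fun w => N A w * N B w * N B' w)%N = moment [:: A; B; B'])%E.
Proof.
move=> h; rewrite -Ex_moment//; apply: eq_integral => w _.
by rewrite !big_cons big_nil muln1 !mulnA.
Qed.

Let Ex4 A A' B B' : disjoint_borel [:: A; A'; B; B'] ->
  (Ex (fun w => N A w * N A' w * (N B w * N B' w))%N = moment [:: A; A'; B; B'])%E.
Proof.
move=> h; rewrite -Ex_moment//; apply: eq_integral => w _.
by rewrite !big_cons big_nil muln1 !mulnA.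
Qed.

Definition partition_of (B : set C) (I : finType) (b : I -> set C) : Prop :=
  [/\ forall i, bounded_borel (b i) /\ b i `<=` B,
      forall i j, i != j -> b i `&` b j = set0 &
      forall z, B z -> exists i, b i z].

Let sum_N B (I : finType) (b : I -> set C) w : bounded_borel B -> partition_of B b ->
  (\sum_i N (b i) w)%N = N B w.
Proof. by move=> bB [h1 h2 h3]; rewrite -(num_partition dpp w bB _ h2 h3)// => i; have [] := h1 i. Qed.

Let le_N B b w : bounded_borel B -> b `<=` B -> (N b w <= N B w)%N.
Proof.
move=> bB sb; rewrite (num_count dpp w bB sb) (num_count dpp w bB (@subset_refl _ B)).
by apply: sub_count => x /set_mem /sb /mem_set.
Qed.

Let disj_sub (A B A' B' : set C) : A `<=` A' -> B `<=` B' -> A' `&` B' = set0 -> A `&` B = set0.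
Proof. by move=> h1 h2 h3; apply/seteqP; split => // z [/h1 a /h2 b]; have : (A' `&` B') z by []; rewrite h3. Qed.

Let mpair B (I : finType) (b : I -> set C) : partition_of B b ->
  mnum (fun w => pair_sum (fun i => N (b i) w)).
Proof.
by move=> [h _ _]; apply: mnum_sum => p; apply: mnumM; apply: mN; [case: (h p.1)|case: (h p.2)].
Qed.

Let pair_times_le B B' (I : finType) (b : I -> set C) : disjoint_borel [:: B; B'] ->
  partition_of B b -> (moment [:: B; B'] < +oo)%E ->
  (Ex (fun w => pair_sum (fun i => N (b i) w) * N B' w)%N <=
   moment [:: B] * moment [:: B; B'])%E.
Proof.
move=> dB pb fin; have [bB [BB' _] [bB' _ _]] := dB; have [h1 h2 h3] := pb.
have b1 i := (h1 i).1; have s1 i := (h1 i).2.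
have d2 i : disjoint_borel [:: b i; B'].
  split; [exact: b1|split=> //; exact: disj_sub (s1 i) (@subset_refl _ _) BB'|by []].
have d3 i j : i != j -> disjoint_borel [:: b i; b j; B'].
  move=> ij; split; [exact: b1| |exact: d2].
  split; [exact: h2|split=> //; exact: disj_sub (s1 i) (@subset_refl _ _) BB'].
have fin2 : forall k, (moment [:: b k; B'] < +oo)%E.
  move=> k; apply: le_lt_trans fin; rewrite -(Ex2 (d2 k)) -(Ex2 dB); apply: le_Ex => w.
  by rewrite leq_mul2r (le_N w bB (s1 k)) orbT.
have -> : (Ex (fun w => pair_sum (fun i => N (b i) w) * N B' w)%N =
   \sum_(p : I * I | p.1 != p.2) moment [:: b p.1; b p.2; B'])%E.
  transitivity (Ex (fun w => \sum_(p : I * I | p.1 != p.2) N (b p.1) w * N (b p.2) w * N B' w)%N).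
    by apply: eq_integral => w _; rewrite /pair_sum big_distrl.
  rewrite Ex_sum; last by move=> p; do !apply: mnumM; exact: mN.
  by apply: eq_bigr => p hp; rewrite Ex3//; exact: d3.
have -> : (moment [:: B] = \sum_i moment [:: b i])%E.
  rewrite -Ex1//; transitivity (Ex (fun w => \sum_i N (b i) w)%N).
    by apply: eq_integral => w _; rewrite (sum_N w bB pb).
  by rewrite Ex_sum => [|i]; [apply: eq_bigr => i _; exact: Ex1|exact: mN].
have -> : (moment [:: B; B'] = \sum_i moment [:: b i; B'])%E.
  rewrite -Ex2//; transitivity (Ex (fun w => \sum_i N (b i) w * N B' w)%N).
    by apply: eq_integral => w _; rewrite -(sum_N w bB pb) big_distrl.
  by rewrite Ex_sum => [|i]; [apply: eq_bigr => i _; exact: Ex2|apply: mnumM; exact: mN].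
apply: le_trans (le_sum_pairs _ _ _); try by move=> i; exact: moment_ge0.
apply: lee_sum => p _; exact: (@moment_cat_le _ mu _ pK [:: b p.1]).
Qed.

Let pair_pair_le B B' (I I' : finType) (b : I -> set C) (b' : I' -> set C) :
  disjoint_borel [:: B; B'] -> partition_of B b -> partition_of B' b' ->
  (moment [:: B; B'] < +oo)%E ->
  (Ex (fun w => pair_sum (fun i => N (b i) w) * pair_sum (fun k => N (b' k) w))%N <=
   moment [:: B; B'] * moment [:: B; B'])%E.
Proof.
move=> dB pb pb' fin; have [bB [BB' _] [bB' _ _]] := dB; have [h1 h2 h3] := pb.
have [h1' h2' h3'] := pb'.
have b1 i := (h1 i).1; have s1 i := (h1 i).2.
have b1' i := (h1' i).1; have s1' i := (h1' i).2.
have dd i k : b i `&` b' k = set0 by exact: disj_sub BB'.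
have d2 i k : disjoint_borel [:: b i; b' k] by split; [exact: b1|split|split; [exact: b1'| |]].
have d4 i j k l : i != j -> k != l -> disjoint_borel [:: b i; b' k; b j; b' l].
  move=> ij kl; split; [exact: b1|split; [exact: dd|split; [exact: h2|by split; [exact: dd|]]]|].
  split; [exact: b1'| |exact: d2].
  split; [by rewrite setIC; exact: dd|split; [exact: h2'|by []]].
have fin2 : forall i k, (moment [:: b i; b' k] < +oo)%E.
  move=> i k; apply: le_lt_trans fin; rewrite -(Ex2 (d2 i k)) -(Ex2 dB); apply: le_Ex => w.
  by apply: leq_mul; exact: le_N.
pose M i k := moment [:: b i; b' k].
have M0 i k : (0 <= M i k)%E by exact: moment_ge0.
pose S i := (\sum_k M i k)%E.
have S0 i : (0 <= S i)%E by exact: sume_ge0.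
have -> : (moment [:: B; B'] = \sum_i S i)%E.
  rewrite -Ex2//; transitivity (Ex (fun w => \sum_i \sum_k N (b i) w * N (b' k) w)%N).
    by apply: eq_integral => w _; rewrite -(sum_N w bB pb) -(sum_N w bB' pb') big_distrlr.
  rewrite Ex_sum => [|i]; last by apply: mnum_sum => k; apply: mnumM; exact: mN.
  apply: eq_bigr => i _; rewrite Ex_sum => [|k]; last by apply: mnumM; exact: mN.
  by apply: eq_bigr => k _; exact: Ex2.
apply: le_trans (le_sum_pairs (fun p => p.1 != p.2) S0 S0).
have -> : (Ex (fun w => pair_sum (fun i => N (b i) w) * pair_sum (fun k => N (b' k) w))%N =
   \sum_(p : I * I | p.1 != p.2) \sum_(q : I' * I' | q.1 != q.2)
     moment [:: b p.1; b' q.1; b p.2; b' q.2])%E.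
  transitivity (Ex (fun w => \sum_(p : I * I | p.1 != p.2) \sum_(q : I' * I' | q.1 != q.2)
      N (b p.1) w * N (b' q.1) w * (N (b p.2) w * N (b' q.2) w))%N).
    apply: eq_integral => w _; rewrite /pair_sum big_distrlr/=; congr (_%:R%:E).
    by apply: eq_bigr => p _; apply: eq_bigr => q _; rewrite mulnACA.
  have mq p q : mnum (fun w => N (b p.1) w * N (b' q.1) w * (N (b p.2) w * N (b' q.2) w))%N.
    by do !apply: mnumM; exact: mN.
  rewrite Ex_sum => [|p]; last by apply: mnum_sum => q; exact: mq.
  apply: eq_bigr => p hp; rewrite Ex_sum => [|q]; last exact: mq.
  by apply: eq_bigr => q hq; rewrite Ex4//; exact: d4.
apply: lee_sum => p _.
apply: le_trans (le_sum_pairs (fun q => q.1 != q.2) (M0 p.1) (M0 p.2)).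
apply: lee_sum => q _; exact: (@moment_cat_le _ mu _ pK [:: b p.1; b' q.1] [:: b p.2; b' q.2] isT (fin2 _ _)).
Qed.

Let partition_of_fine B (I : nat -> finType) (b : forall n, I n -> set C) n :
  (forall n i, bounded_borel (b n i) /\ b n i `<=` B) ->
  (forall n i j, i != j -> b n i `&` b n j = set0) ->
  (forall n z, B z -> exists i, b n i z) -> partition_of B (b n).
Proof. by move=> h1 h2 h3; split; [exact: h1|exact: h2|exact: h3]. Qed.

(** Splitting B and B' into cells with at most one point, the square of the
    product of the counts only involves products of counts of distinct cells. *)
Lemma second_moment_le B B' a a' e : disjoint_borel [:: B; B'] ->
  (moment [:: B] <= a%:E)%E -> (moment [:: B'] <= a'%:E)%E -> moment [:: B; B'] = e%:E ->
  (Ex (fun w => (N B w * N B' w) ^ 2)%N <= (e * (1 + a + a' + e))%:E)%E.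
Proof.
move=> dB ha ha' he; have [bB [BB' _] [bB' _ _]] := dB.
have dB' : disjoint_borel [:: B'; B] by split=> //; split=> //; rewrite setIC.
have e0 : 0 <= e by rewrite -lee_fin -he moment_ge0.
have he' : moment [:: B'; B] = e%:E.
  by rewrite -he -!Ex2//; apply: eq_integral => w _; rewrite mulnC.
have [I [b [h1 h2 h3 h4]]] := fine_partition bB.
have [I' [b' [h1' h2' h3' h4']]] := fine_partition bB'.
have pb n := partition_of_fine n h1 h2 h3; have pb' n := partition_of_fine n h1' h2' h3'.
pose Q n w := pair_sum (fun i => N (b n i) w).
pose Q' n w := pair_sum (fun i => N (b' n i) w).
pose F n w := (N B w * N B' w + (Q n w * N B' w + (Q' n w * N B w + Q n w * Q' n w)))%N.
have mQ n : mnum (Q n) by exact: mpair.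
have mQ' n : mnum (Q' n) by exact: mpair.
apply: (@fatou_bound _ _ _ P (fun n w => ((F n w)%:R : R)%:E)).
- move=> n; apply/measurable_EFinP.
  by do !apply: mnumD; apply: mnumM => //; exact: mN.
- by move=> n w; rewrite lee_fin.
- by move=> w; rewrite lee_fin.
- move=> w.
  have [n1 hn1] := num_le1 dpp w bB (fun n i => (h1 n i).2) h4.
  have [n2 hn2] := num_le1 dpp w bB' (fun n i => (h1' n i).2) h4'.
  exists (maxn n1 n2) => n; rewrite geq_max => /andP[/hn1 u1 /hn2 u2].
  rewrite lee_fin ler_nat expnMn -(sum_N w bB (pb n)) -(sum_N w bB' (pb' n)).
  rewrite !sqr_sum_bits// /F -(sum_N w bB (pb n)) -(sum_N w bB' (pb' n)) /Q /Q'.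
  by rewrite mulnDl !mulnDr -!addnA leq_add2l addnCA leq_add2l mulnC.
move=> n.
have fe (f g : Omega -> nat) : mnum f -> mnum g -> (Ex (fun w => f w + g w)%N = Ex f + Ex g)%E.
  move=> mf mg; rewrite -ge0_integralD//; try by move=> w _; rewrite lee_fin.
  - by apply: eq_integral => w _; rewrite natrD EFinD.
  - exact/measurable_EFinP.
  - exact/measurable_EFinP.
have mNN : mnum (fun w => N B w * N B' w)%N by apply: mnumM; exact: mN.
have m1 : mnum (fun w => Q n w * N B' w)%N by apply: mnumM => //; exact: mN.
have m2 : mnum (fun w => Q' n w * N B w)%N by apply: mnumM => //; exact: mN.
have m3 : mnum (fun w => Q n w * Q' n w)%N by exact: mnumM.
have EF : Ex (F n) = (Ex (fun w => N B w * N B' w)%N + (Ex (fun w => Q n w * N B' w)%N +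
    (Ex (fun w => Q' n w * N B w)%N + Ex (fun w => Q n w * Q' n w)%N)))%E.
  have e3 := fe _ _ m2 m3; have e2 := fe _ _ m1 (mnumD m2 m3).
  apply: etrans (fe _ _ mNN (mnumD m1 (mnumD m2 m3))) _; congr (_ + _)%E.
  by apply: etrans e2 _; congr (_ + _)%E; exact: e3.
apply: (@le_trans _ _ (Ex (F n))); first exact: lexx.
rewrite EF (Ex2 dB) he.
have -> : e * (1 + a + a' + e) = e + (a * e + (a' * e + e * e)) by ring.
have fin : (moment [:: B; B'] < +oo)%E by rewrite he ltry.
have fin' : (moment [:: B'; B] < +oo)%E by rewrite he' ltry.
rewrite !EFinD; apply: leeD => //; apply: leeD; last apply: leeD.
- apply: le_trans (pair_times_le dB (pb n) fin) _.
  by rewrite he EFinM lee_wpmul2r.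
- apply: le_trans (pair_times_le dB' (pb' n) fin') _.
  by rewrite he' EFinM lee_wpmul2r.
- apply: le_trans (pair_pair_le dB (pb n) (pb' n) fin) _.
  by rewrite he EFinM.
Qed.

Lemma prob_ge2_le (m : {measure set C -> \bar R}) B (v k : R) : bounded_borel B ->
  m B = v%:E -> 0 <= k ->
  (forall b b' u u', disjoint_borel [:: b; b'] -> b `<=` B -> b' `<=` B ->
    m b = u%:E -> m b' = u'%:E -> (moment [:: b; b'] <= (k * u * u')%:E)%E) ->
  (P [set w | (1 < N B w)%N] <= (k * v ^+ 2)%:E)%E.
Proof.
move=> bB vB k0 hm; have [I [b [h1 h2 h3 h4]]] := fine_partition bB.
have pb n := partition_of_fine n h1 h2 h3.
have mE : measurable [set w | (1 < N B w)%N].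
  have := mN bB measurableT (measurable_itv `]1%R, +oo[); rewrite setTI.
  congr (measurable _); apply/seteqP; split => w /=; rewrite in_itv/= andbT;
    by rewrite -[1%R]/(1%:R) ltr_nat.
pose Q n w := pair_sum (fun i => N (b n i) w).
have -> : P [set w | (1 < N B w)%N] = (\int[P]_w (\1_[set w | (1 < N B w)%N] w)%:E)%E.
  by rewrite integral_indic// setIT.
apply: (@fatou_bound _ _ _ P (fun n w => ((Q n w)%:R : R)%:E)).
- by move=> n; apply/measurable_EFinP; exact: mpair.
- by move=> n w; rewrite lee_fin.
- by move=> w; rewrite lee_fin.
- move=> w; have [n1 hn1] := num_le1 dpp w bB (fun n i => (h1 n i).2) h4.
  exists n1 => n /hn1 u1; rewrite lee_fin indicE; have [/set_mem/= wB|_] := boolP (w \in _) => //.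
  rewrite ler1n -(ltn_add2l (N B w)) addn0 -{2}(sum_N w bB (pb n)) -sqr_sum_bits//.
  by rewrite (sum_N w bB (pb n)) -mulnn; move: wB; case: (N B w) => [|[|j]]// _; lia.
move=> n.
have mfin i : m (b n i) \is a fin_num.
  rewrite ge0_fin_numE//; apply: (@le_lt_trans _ _ (m B)); last by rewrite vB ltry.
  by apply: le_measure; rewrite ?inE; [exact: (h1 n i).1.1|exact: bB.1|exact: (h1 n i).2].
have mi i : m (b n i) = (fine (m (b n i)))%:E by rewrite fineK.
apply: (@le_trans _ _ (\sum_(p : I n * I n | p.1 != p.2) (k%:E * m (b n p.1)) * m (b n p.2))%E).
  have -> : (\int[P]_w ((Q n w)%:R : R)%:E =
      \sum_(p : I n * I n | p.1 != p.2) Ex (fun w => N (b n p.1) w * N (b n p.2) w)%N)%E.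
    apply: (Ex_sum (index_enum _) (fun p => p.1 != p.2)
      (f := fun p w => N (b n p.1) w * N (b n p.2) w)%N) => p.
    by apply: mnumM; apply: mN; exact: (h1 n _).1.
  apply: lee_sum => p pp.
  have d2 : disjoint_borel [:: b n p.1; b n p.2].
    by split; [exact: (h1 n _).1|split; [exact: h2|]|split; [exact: (h1 n _).1| |]].
  rewrite (Ex2 d2) (mi p.1) (mi p.2) -!EFinM.
  by apply: hm; rewrite -?mi//; exact: (h1 n _).2.
have u0 i : (0 <= k%:E * m (b n i))%E by rewrite mule_ge0.
have v0 i : (0 <= m (b n i))%E by [].
apply: le_trans (le_sum_pairs (fun p => p.1 != p.2) u0 v0) _.
have S : (\sum_i m (b n i) <= v%:E)%E.
  have -> : (\sum_i m (b n i) = \sum_i \int[m]_z (\1_(b n i) z)%:E)%E.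
    by apply: eq_bigr => i _; rewrite integral_indic ?setIT//; exact: (h1 n i).1.1.
  rewrite -(ge0_integral_sum m measurableT); last 2 first.
  - by move=> i; apply/measurable_EFinP; apply: measurable_indic; exact: (h1 n i).1.1.
  - by move=> i z _; rewrite lee_fin.
  have -> : v%:E = (\int[m]_z (\1_B z)%:E)%E by rewrite integral_indic ?setIT//; exact: bB.1.
  apply: ge0_le_integral_any => z _; first by apply: sume_ge0 => i _; rewrite lee_fin.
  rewrite sumEFin lee_fin !indicE.
  have [zB|zB] := boolP (z \in B); last first.
    rewrite big1// => i _; rewrite indicE; case: (boolP (z \in b n i)) => // /set_mem zi.
    by move: zB; rewrite mem_set//; exact: (h1 n i).2.
  have [i zi] := h3 n z (set_mem zB).
  rewrite (bigD1 i)//= indicE mem_set// big1 ?addr0// => j ji; rewrite indicE.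
  case: (boolP (z \in b n j)) => // /set_mem zj.
  by have : (b n j `&` b n i) z by []; rewrite h2.
rewrite -ge0_sume_distrr// expr2 !EFinM -muleA.
apply: lee_wpmul2l; first by rewrite lee_fin.
by apply: lee_pmul => //; exact: sume_ge0.
Qed.

(** Chebyshev's inequality for the number of points pairs, whose variance the
    negative correlation bounds by its mean. *)
Lemma prob_no_pair_le (I : finType) (B B' : I -> set C) (A : R) (e : I -> R) :
  0 <= A -> 0 < \sum_i e i ->
  (forall i, disjoint_borel [:: B i; B' i]) ->
  (forall i j, i != j -> disjoint_borel [:: B i; B' i; B j; B' j]) ->
  (forall i, moment [:: B i] <= A%:E)%E -> (forall i, moment [:: B' i] <= A%:E)%E ->
  (forall i, moment [:: B i; B' i] = (e i)%:E) ->
  forall F, measurable F -> F `<=` [set w | (\sum_i N (B i) w * N (B' i) w = 0)%N] ->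
  (P F * (\sum_i e i)%:E <= (1 + 2 * A)%:E)%E.
Proof.
move=> A0 mu0 d2 d4 hA hA' he F mF; set M := \sum_i e i in mu0 *.
have e0 i : 0 <= e i by rewrite -lee_fin -he moment_ge0.
pose X i w := (N (B i) w * N (B' i) w)%N; pose S w := (\sum_i X i w)%N.
have mX i : mnum (X i) by have [? _ [? _ _]] := d2 i; apply: mnumM; exact: mN.
have mS : mnum S by exact: mnum_sum.
have ES : (Ex S = M%:E)%E.
  rewrite /S (Ex_sum _ _ mX) -sumEFin; apply: eq_bigr => i _; rewrite -he; exact: Ex2.
have ES2 : (Ex (fun w => S w ^ 2)%N <= (M ^+ 2 + (1 + 2 * A) * M)%:E)%E.
  have -> : (Ex (fun w => S w ^ 2)%N = \sum_i \sum_j Ex (fun w => X i w * X j w)%N)%E.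
    transitivity (Ex (fun w => \sum_i \sum_j X i w * X j w)%N).
      by apply: eq_integral => w _; rewrite -mulnn big_distrlr.
    rewrite Ex_sum => [|i]; last by apply: mnum_sum => j; exact: mnumM.
    by apply: eq_bigr => i _; rewrite Ex_sum => // j; exact: mnumM.
  have -> : M ^+ 2 + (1 + 2 * A) * M = \sum_i \sum_j (e i * e j + (if j == i then (1 + 2 * A) * e i else 0)).
    rewrite expr2 big_distrlr/= mulr_sumr -big_split/=; apply: eq_bigr => i _.
    by rewrite big_split/= -big_mkcond big_pred1_eq.
  rewrite -sumEFin; apply: lee_sum => i _; rewrite -sumEFin; apply: lee_sum => j _.
  have [->|ij] := eqVneq j i.
    apply: le_trans (_ : (_ <= (e i * (1 + A + A + e i))%:E)%E) _; last by rewrite lee_fin; lra.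
    apply: le_trans (second_moment_le (d2 i) (hA i) (hA' i) (he i)).
    by rewrite le_eqVlt; apply/orP; left; apply/eqP; apply: eq_integral => w _; rewrite -mulnn.
  rewrite addr0 EFinM -!he eq_sym in ij *.
  rewrite (Ex4 (d4 i j ij)).
  apply: (@moment_cat_le _ mu _ pK [:: B i; B' i] [:: B j; B' j]) => //.
  by rewrite he ltry.
set E := [set w | _] => FE; have mE : measurable E.
  have := mS measurableT [set 0] (measurable_set1 0); rewrite setTI; congr (measurable _).
  apply/seteqP; split => w /= h; first by move/eqP: h; rewrite pnatr_eq0 => /eqP.
  by rewrite /S /X h.
have key : (\int[P]_w (M ^+ 2 * \1_E w + 2 * M * (S w)%:R)%:E <=
    \int[P]_w ((S w ^ 2)%N%:R + M ^+ 2)%:E)%E.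
  apply: ge0_le_integral_any => w _.
    by rewrite lee_fin addr_ge0 ?mulr_ge0 ?sqr_ge0// ltW.
  rewrite lee_fin natrX indicE; have [/set_mem wE|_] := boolP (w \in E).
    rewrite (_ : S w = 0%N) ?mulr0 ?addr0 ?mulr1 ?expr0n ?add0r//; exact: wE.
  rewrite mulr0 add0r -subr_ge0.
  by have := sqr_ge0 ((S w)%:R - M); rewrite sqrrB; congr (0 <= _); ring.
have L : (\int[P]_w (M ^+ 2 * \1_E w + 2 * M * (S w)%:R)%:E =
    (M ^+ 2)%:E * P E + (2 * M)%:E * M%:E)%E.
  transitivity (\int[P]_w ((M ^+ 2)%:E * (\1_E w)%:E + (2 * M)%:E * ((S w)%:R : R)%:E))%E.
    by apply: eq_integral => w _; rewrite EFinD !EFinM.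
  rewrite ge0_integralD//; last 4 first.
  - by move=> w _; rewrite -EFinM lee_fin mulr_ge0 ?sqr_ge0.
  - by apply/measurable_EFinP; apply: measurable_funM => //; exact: measurable_indic.
  - by move=> w _; rewrite -EFinM lee_fin !mulr_ge0// ltW.
  - by apply/measurable_EFinP; apply: measurable_funM.
  rewrite ge0_integralZl_any ?sqr_ge0//.
  rewrite ge0_integralZl_any ?mulr_ge0 ?(ltW mu0)//.
  by rewrite integral_indic// setIT -ES.
have U : (\int[P]_w ((S w ^ 2)%N%:R + M ^+ 2)%:E <= (M ^+ 2 + (1 + 2 * A) * M + M ^+ 2)%:E)%E.
  have -> : (\int[P]_w ((S w ^ 2)%N%:R + M ^+ 2)%:E = Ex (fun w => S w ^ 2)%N + (M ^+ 2)%:E)%E.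
    transitivity (\int[P]_w (((S w ^ 2)%N%:R : R)%:E + (M ^+ 2)%:E))%E.
      by apply: eq_integral => w _; rewrite EFinD.
    have mS2 : mnum (fun w => S w ^ 2)%N.
      by have := mnumM mS mS; congr measurable_fun; apply/funext => w; rewrite -mulnn.
    rewrite ge0_integralD//; last 2 first.
    - exact/measurable_EFinP.
    - by move=> w _; rewrite lee_fin sqr_ge0.
    by rewrite integral_cst// -[X in (_ * X)%E]/(P setT) probability_setT mule1.
  by rewrite EFinD; apply: leeD.
apply: (@le_trans _ _ (P E * M%:E)%E).
  by apply: lee_wpmul2r; [rewrite lee_fin ltW|apply: le_measure; rewrite ?inE].
have PE : P E \is a fin_num by rewrite fin_num_measure.
rewrite L in key; have := le_trans key U; rewrite -(fineK PE) -!EFinM -EFinD !lee_fin.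
move: (fine _) => p h; rewrite -(ler_pM2r mu0).
by move: h; rewrite expr2; lra.
Qed.

End second_moments.

(** * The separation event *)

Section separation_event.
Context d (Omega : measurableType d) (R : realType) (P : probability Omega R).
Local Notation C := R[i].
Variables (Lambda : Omega -> set C) (K : C -> C -> C) (mu : {measure set C -> \bar R}).
Hypothesis dpp : determinantal_process P K mu Lambda.
Local Notation N := (num Lambda).

Lemma num_le1P B w : bounded_borel B -> (N B w <= 1)%N <->
  forall x y, B x -> B y -> Lambda w x -> Lambda w y -> x = y.
Proof.
move=> bB; have fB := bounded_borel_finite dpp w bB.
have memE x : (x \in fset_set (B `&` Lambda w)) = (x \in B `&` Lambda w) by exact: in_fset_set.
have su := fset_uniq (fset_set (B `&` Lambda w)).
rewrite -[N B w]/(size (enum_fset (fset_set (B `&` Lambda w)))).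
have {}memE x : (x \in enum_fset (fset_set (B `&` Lambda w))) = (x \in B `&` Lambda w) := memE x.
move: su memE; case: (enum_fset _) => [|u [|v s]] su memE; split=> //.
- by move=> _ x y Bx _ Lx _; have := memE x; rewrite in_nil mem_set.
- move=> _ x y Bx By Lx Ly; have := memE x; have := memE y; rewrite !mem_seq1 !mem_set//.
  by move=> /eqP -> /eqP ->.
- move=> h; have /set_mem[Bu Lu] : u \in B `&` Lambda w by rewrite -memE mem_head.
  have /set_mem[Bv Lv] : v \in B `&` Lambda w by rewrite -memE !in_cons eqxx orbT.
  by move: su; rewrite (h u v)//= mem_head.
Qed.

Definition box (n : nat) (p : int * int) : set C :=
  [set z | (p.1%:~R <= complex.Re z * n.+1%:R < (p.1 + 2)%:~R) /\
           (p.2%:~R <= complex.Im z * n.+1%:R < (p.2 + 2)%:~R)].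

Let int2 (i : int) : (i + 2)%:~R = i%:~R + 2 :> R.
Proof. by rewrite intrD. Qed.

Let int1 (i : int) : (i + 1)%:~R = i%:~R + 1 :> R.
Proof. by rewrite intrD. Qed.

Lemma box_near n p z w : box n p z -> box n p w -> modulus (z - w) < 4 * n.+1%:R^-1.
Proof.
move=> [/= a1 b1] [/= a2 b2]; have n0 : 0 < n.+1%:R :> R by rewrite ltr0n.
have h (x y i : R) : i <= x * n.+1%:R < i + 2 -> i <= y * n.+1%:R < i + 2 ->
    `|x - y| * n.+1%:R < 2.
  move=> /andP[? ?] /andP[? ?].
  rewrite -{1}(gtr0_norm n0) -normrM mulrBl ltr_norml; apply/andP; split; lra.
rewrite ltr_pdivlMr//; apply: le_lt_trans (ler_wpM2r (ltW n0) (le_modulus_ReIm _)) _.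
rewrite ReB ImB mulrDl.
have -> : 4 = 2 + 2 :> R by ring.
by apply: ltrD; [apply: (h _ _ p.1%:~R)|apply: (h _ _ p.2%:~R)]; rewrite -int2.
Qed.

Lemma near_box n z w : modulus (z - w) < n.+1%:R^-1 -> exists p, box n p z /\ box n p w.
Proof.
move=> zw; have n0 : 0 < n.+1%:R :> R by rewrite ltr0n.
have h (x y : R) : `|x - y| <= modulus (z - w) -> exists i : int,
    (i%:~R <= x * n.+1%:R < (i + 2)%:~R) /\ (i%:~R <= y * n.+1%:R < (i + 2)%:~R).
  move=> xy; exists (Num.floor (Num.min (x * n.+1%:R) (y * n.+1%:R))).
  have : `|x * n.+1%:R - y * n.+1%:R| < 1.
    rewrite -mulrBl normrM (gtr0_norm n0) -ltr_pdivlMr// mul1r.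
    exact: le_lt_trans zw.
  have := floor_itv (Num.min (x * n.+1%:R) (y * n.+1%:R)); rewrite int1 !int2.
  move: ((Num.floor _)%:~R) => i; move: (x * _) (y * _) => a b /andP[].
  rewrite le_min gt_min ltr_norml => /andP[i1 i2] /orP[i3|i3] /andP[i4 i5];
    split; apply/andP; split; lra.
have [i [a1 a2]] : exists i : int, (i%:~R <= complex.Re z * n.+1%:R < (i + 2)%:~R) /\
    (i%:~R <= complex.Re w * n.+1%:R < (i + 2)%:~R).
  by apply: h; rewrite -ReB; exact: le_Re_modulus.
have [j [b1 b2]] : exists i : int, (i%:~R <= complex.Im z * n.+1%:R < (i + 2)%:~R) /\
    (i%:~R <= complex.Im w * n.+1%:R < (i + 2)%:~R).
  by apply: h; rewrite -ImB; exact: le_Im_modulus.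
by exists (i, j).
Qed.

Lemma bounded_box n p : bounded_borel (box n p).
Proof.
have mI (g : C -> R) (i : int) : measurable_fun [set: C] g ->
    measurable [set z | i%:~R <= g z * n.+1%:R < (i + 2)%:~R].
  move=> mg; have -> : [set z | i%:~R <= g z * n.+1%:R < (i + 2)%:~R] =
      [set: C] `&` (fun z => g z * n.+1%:R) @^-1` `[i%:~R, (i + 2)%:~R[.
    by rewrite setTI; apply/seteqP; split => z /=; rewrite in_itv.
  have : measurable_fun [set: C] (fun z => g z * n.+1%:R) by exact: measurable_funM.
  by apply; [exact: measurableT|exact: measurable_itv].
split; first by apply: measurableI; apply: mI; [exact: measurable_Re|exact: measurable_Im].
pose z0 : C := Complex (p.1%:~R / n.+1%:R) (p.2%:~R / n.+1%:R).
have n0 : n.+1%:R != 0 :> R by rewrite pnatr_eq0.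
have b0 : box n p z0.
  by split; rewrite /= divfK// lexx/= ltr_int ltrDl.
exists (modulus z0 + 4 * n.+1%:R^-1) => z bz; rewrite /disk/= subr0.
have := modulusD (z - z0) z0; rewrite subrK => h; apply: le_lt_trans h _.
by rewrite addrC ltrD2l; exact: box_near bz b0.
Qed.

Definition sparse (n : nat) : set Omega :=
  \bigcap_(p in [set: int * int]) [set w | (N (box n p) w <= 1)%N].

Lemma measurable_num_le1 B : bounded_borel B -> measurable [set w | (N B w <= 1)%N].
Proof.
move=> bB; have := measurable_num dpp bB measurableT (measurable_itv `]-oo, 1%R]).
rewrite setTI; congr (measurable _); apply/seteqP; split => w /=; rewrite in_itv/=;
  by rewrite -[1%R]/(1%:R) ler_nat.
Qed.

Lemma measurable_sparse n : measurable (sparse n).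
Proof.
rewrite -[sparse n]setCK; apply: measurableC; rewrite setC_bigcap.
apply: countable_bigcupT_measurable; first exact: countableP.
by move=> p; apply: measurableC; apply: measurable_num_le1; exact: bounded_box.
Qed.

Lemma sparse_dist n w x y : sparse n w -> Lambda w x -> Lambda w y -> x <> y ->
  n.+1%:R^-1 <= modulus (x - y).
Proof.
move=> sp Lx Ly xy; rewrite leNgt; apply/negP => /near_box[p [px py]].
by apply: xy; move/(num_le1P w (bounded_box n p)) : (sp p I); exact.
Qed.

Lemma separated_sparse : [set w | is_separated (Lambda w)] = \bigcup_n sparse n.
Proof.
apply/seteqP; split => w /=.
  rewrite /is_separated => h.
  have [r r0 hr] : exists2 r : R, 0 < r & forall x y, Lambda w x -> Lambda w y -> x <> y ->
      r <= modulus (x - y).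
    have lb x y : Lambda w x -> Lambda w y -> x <> y ->
        (ereal_inf [set (modulus (p.1 - p.2))%:E | p in [set p : C * C |
          [/\ Lambda w p.1, Lambda w p.2 & p.1 <> p.2]]] <= (modulus (x - y))%:E)%E.
      by move=> Lx Ly xy; apply: ereal_inf_lbound; exists (x, y).
    move: h lb; case: (ereal_inf _) => [r| |//] h lb.
      by exists r => // x y Lx Ly xy; have := lb x y Lx Ly xy; rewrite lee_fin.
    by exists 1 => // x y Lx Ly xy; have := lb x y Lx Ly xy; rewrite leye_eq.
  pose n := Num.truncn (4 / r); exists n => // p _.
  apply/(num_le1P w (bounded_box n p)) => x y bx by_ Lx Ly.
  apply: contrapT => xy; have := hr x y Lx Ly xy; rewrite leNgt => /negP; apply.
  apply: lt_le_trans (box_near bx by_) _.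
  have q0 : 0 <= 4 / r by rewrite divr_ge0// ltW.
  have /andP[_ h1] := truncn_itv q0.
  by rewrite ler_pdivrMr ?ltr0n// mulrC -ler_pdivrMr// ltW.
move=> [n _ sp]; rewrite /is_separated.
apply: (@lt_le_trans _ _ (n.+1%:R^-1)%:E); first by rewrite lte_fin invr_gt0 ltr0n.
apply: le_ereal_inf_tmp => _ [[x y] /= [Lx Ly xy] <-]; rewrite lee_fin.
exact: sparse_dist sp Lx Ly xy.
Qed.

Lemma measurable_separated : measurable [set w | is_separated (Lambda w)].
Proof. by rewrite separated_sparse; apply: bigcupT_measurable => n; exact: measurable_sparse. Qed.

End separation_event.

(** * Clustering for alpha at least 4/3 *)

Lemma scale_bounds (R : realType) (alpha r eps : R) : 4 / 3 <= alpha -> 1 <= r -> 0 < eps ->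
  let s := eps * Num.min 1 (r `^ (1 - alpha / 2)) in
  s ^+ 2 * r `^ (alpha - 2) <= eps ^+ 2 /\
  eps ^+ 6 / r ^+ 2 <= (s ^+ 2 * r `^ (alpha - 2)) ^+ 3.
Proof.
move=> a43 r1 e0; have r0 : 0 < r by lra.
have qT := @scale_sqr R alpha r r0; have T0 : 0 < r `^ (1 - alpha / 2) by exact: powR_gt0.
set q := r `^ (alpha - 2) in qT *; have q0 : 0 < q by exact: powR_gt0.
have e6 : eps ^+ 6 / r ^+ 2 <= eps ^+ 6.
  by rewrite ler_pdivrMr ?exprn_gt0// ler_peMr ?exprn_ge0 ?(ltW e0)// exprn_ege1.
have [T1|T1] := leP 1 (r `^ (1 - alpha / 2)); rewrite /= ?mulr1; last first.
  rewrite exprMn -mulrA [X in _ * X]mulrC qT mulr1; split=> //.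
  by rewrite -exprM.
have q1 : q <= 1.
  rewrite -qT ler_peMr ?(ltW q0)// exprn_ege1//.
split; first by rewrite ger_pMr ?exprn_gt0.
have qE : r ^- 2 <= q ^+ 3.
  have -> : q ^+ 3 = r `^ ((alpha - 2) * 3%:R) by rewrite powRrM powR_mulrn ?powR_ge0.
  rewrite -powR_invn ?(ltW r0)//.
  by apply: ler_powR => //; lra.
by rewrite exprMn -exprM ler_wpM2l ?exprn_ge0 ?(ltW e0).
Qed.

Lemma harmonic_unbounded (R : realType) (M : R) :
  exists k, M < \sum_(a < k) a.+1%:R^-1.
Proof.
apply: contrapT => h.
have ub k : \sum_(a < k) a.+1%:R^-1 <= M.
  by rewrite leNgt; apply/negP => hk; apply: h; exists k.
apply: (@dvg_harmonic R); apply: nondecreasing_is_cvgn.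
  apply/nondecreasing_seqP => k; rewrite /series/= big_nat_recr//= lerDl.
  by rewrite invr_ge0.
exists M => _ [k _ <-]; rewrite /series/= big_mkord; exact: ub.
Qed.

Section clustering.
Context d (Omega : measurableType d) (R : realType) (P : probability Omega R).
Local Notation C := R[i].
Variable alpha : R.
Hypothesis alpha0 : 0 < alpha.
Local Notation m := (@lebesgueC R).
Local Notation kap := (disk_area R).
Local Notation nu := (laplacian_phi_alpha alpha : {measure set C -> \bar R}).
Local Notation phi := (phi_alpha alpha).
Local Notation mu := (mu_phi phi nu : {measure set C -> \bar R}).
Variables (Lambda : Omega -> set C) (K : C -> C -> C).
Hypothesis kerK : fock_kernel phi nu K.
Hypothesis dpp : determinantal_process P K mu Lambda.
Local Notation moment Bs := (iterated_integral mu Bs (fun zs => (kernel_det K zs)%:E)).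
Local Notation N := (num Lambda).

Lemma num_gt0 B w : bounded_borel B -> (0 < N B w)%N -> exists x, B x /\ Lambda w x.
Proof.
move=> bB; rewrite /num cardfs_gt0 => /fset0Pn[x].
by rewrite (in_fset_set (bounded_borel_finite dpp w bB)) => /set_mem[]; exists x.
Qed.

Definition lattice_point (R0 a b : nat) : C := Complex (R0 + a)%:R b%:R.

Lemma lattice_point_apart R0 a b a' b' : (a, b) != (a', b') ->
  1 <= modulus (lattice_point R0 a b - lattice_point R0 a' b').
Proof.
have h (x y : nat) : x != y -> 1 <= `|x%:R - y%:R : R|.
  move=> xy; have [xy'|xy'] := ltnP x y.
    rewrite distrC ger0_norm ?subr_ge0 ?ler_nat 1?ltnW//.
    by rewrite -natrB 1?ltnW// ler1n subn_gt0.
  rewrite ger0_norm ?subr_ge0 ?ler_nat// -natrB// ler1n subn_gt0.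
  by rewrite ltn_neqAle xy' eq_sym xy.
rewrite xpair_eqE negb_and => /orP[ne|ne].
  by apply: le_trans (le_Re_modulus _); rewrite ReB/=; apply: h; rewrite eqn_add2l.
by apply: le_trans (le_Im_modulus _); rewrite ImB/=; exact: h.
Qed.

Lemma bounded_disk (z : C) r : bounded_borel (disk z r).
Proof.
split; first exact: measurable_disk.
exists (modulus z + r) => w; rewrite /disk/= subr0 => h.
by have := modulusD (w - z) z; rewrite subrK; move: h; lra.
Qed.

Lemma lattice_sum_ge (R0 k : nat) (c : R) : (0 < R0)%N -> 0 <= c ->
  c / (2 * R0%:R) ^+ 2 * \sum_(a < k) a.+1%:R^-1 <=
  \sum_(i : 'I_k * 'I_k) c / modulus (lattice_point R0 i.1 i.2) ^+ 2.
Proof.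
move=> R00 c0; have R0R : 1 <= R0%:R :> R by rewrite ler1n.
rewrite -(pair_big xpredT xpredT (fun a b : 'I_k => c / modulus (lattice_point R0 a b) ^+ 2))/=.
rewrite mulr_sumr; apply: ler_sum => a _.
have pos b : 0 < modulus (lattice_point R0 a b).
  apply: lt_le_trans (le_Re_modulus _); rewrite /= ger0_norm// ltr0n.
  by rewrite addn_gt0 R00.
apply: (@le_trans _ _ (\sum_(b < k | (b < a.+1)%N) c / (2 * R0%:R * a.+1%:R) ^+ 2)); last first.
  rewrite [leRHS](bigID (fun b : 'I_k => (b < a.+1)%N))/= -[leLHS]addr0 lerD//; last first.
    by apply: sumr_ge0 => b _; rewrite divr_ge0 ?sqr_ge0.
  apply: ler_sum => b ba; rewrite ler_wpM2l// lef_pV2 ?posrE ?exprn_gt0//; last first.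
    by rewrite !mulr_gt0// ?ltr0n.
  rewrite ler_pXn2r ?nnegrE ?(ltW (pos b)) ?mulr_ge0//.
  apply: le_trans (le_modulus_ReIm _) _; rewrite /= !ger0_norm//.
  have : b%:R <= a%:R :> R by rewrite ler_nat -ltnS.
  have -> : a.+1%:R = a%:R + 1 :> R by rewrite natr1.
  rewrite natrD mulrDr mulr1.
  have : a%:R <= R0%:R * a%:R :> R by rewrite ler_peMl.
  by rewrite -mulrA; move: R0R; move: (R0%:R * a%:R) => p; lra.
rewrite -(big_ord_widen_cond k xpredT (fun=> c / (2 * R0%:R * a.+1%:R) ^+ 2))//.
rewrite sumr_const card_ord -[leRHS]mulr_natr le_eqVlt; apply/orP; left; apply/eqP.
have : a.+1%:R != 0 :> R by rewrite pnatr_eq0.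
have : R0%:R != 0 :> R by rewrite pnatr_eq0 -lt0n.
by move: (a.+1%:R) (R0%:R) => x y y0 x0; field; rewrite y0 x0.
Qed.

Lemma sparse_null n : 4 / 3 <= alpha -> P (sparse Lambda n) = 0%E.
Proof.
move=> a43; have pK := psd_fock_kernel kerK; have K0 := disk_area_gt0 R.
have [c1 [r1 [c10 r11 h1]]] := moment1_le alpha0 kerK.
have [c2 [r2 [del [c20 r21 del0 h2]]]] := moment2_ge alpha0 kerK.
have [eps [eps0 [eps1 eps2 eps3]]] : exists eps : R, 0 < eps /\
    [/\ eps <= 1 / 2, eps <= del & eps <= n.+1%:R^-1].
  exists (Num.min (1 / 2) (Num.min del n.+1%:R^-1)); split.
    by rewrite !lt_min del0 invr_gt0 ltr0n divr_gt0.
  by split; rewrite !ge_min lexx ?orbT.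
pose R0 := (Num.truncn (r1 + r2)).+2.
have R0E : r1 + r2 + 1 <= R0%:R.
  have p0 : 0 <= r1 + r2 by move: r11 r21; lra.
  have /andP[_ h] := truncn_itv p0.
  by rewrite /R0 -natr1 lerD2r ltW.
pose z (i : nat * nat) := lattice_point R0 i.1 i.2; pose r i := modulus (z i).
have rR i : R0%:R <= r i.
  apply: le_trans (le_Re_modulus _); rewrite /= ger0_norm//.
  by rewrite ler_nat leq_addr.
have rge i : [/\ r1 <= r i, r2 <= r i & 1 <= r i].
  by have := rR i; move: R0E r11 r21; split; lra.
pose T i := r i `^ (1 - alpha / 2); pose s i := eps * Num.min 1 (T i).
have T0 i : 0 < T i by rewrite powR_gt0//; have [_ _] := rge i; lra.
have s0 i : 0 < s i by rewrite mulr_gt0// lt_min T0 ltr01.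
have seps i : s i <= eps by rewrite ger_pMr// ge_min lexx.
have sT i : s i <= del * T i.
  by rewrite ler_pM// ?(ltW eps0) ?le_min ?ler01 ?(ltW (T0 i))// ge_min lexx orbT.
pose z' i := z i + (s i / 2)%:C%C.
pose B i := disk (z i) (s i / 8); pose B' i := disk (z' i) (s i / 8).
have zz' i : modulus (z' i - z i) = s i / 2.
  by rewrite /z' addrC addKr modulus_real ger0_norm// divr_ge0// ltW.
have BD i x : B i x -> modulus (x - z i) < 3 / 4 * s i.
  by rewrite /B/disk/= => h; have := s0 i; move: h; lra.
have B'D i x : B' i x -> modulus (x - z i) < 3 / 4 * s i.
  rewrite /B'/disk/= => h; have := modulusD (x - z' i) (z' i - z i).
  by rewrite subrKA zz'; have := s0 i; move: h; lra.
have cross i x y : B i x -> B' i y -> s i / 4 <= modulus (y - x) <= s i * (3 / 4).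
  rewrite /B/B'/disk/= => hx hy.
  have e : y - x = (y - z' i) + (z' i - z i) + (z i - x) by ring.
  have u := modulusD ((y - z' i) + (z' i - z i)) (z i - x).
  have u' := modulusD (y - z' i) (z' i - z i).
  have e' : z' i - z i = (z' i - y) + (y - x) + (x - z i) by ring.
  have v := modulusD ((z' i - y) + (y - x)) (x - z i).
  have v' := modulusD (z' i - y) (y - x).
  rewrite -e in u; rewrite -e' in v; rewrite zz' in u' v; move: u u' v v' hx hy.
  rewrite (modulusB (z i) x) (modulusB (z' i) y).
  move: (modulus (y - x)) (modulus (x - z i)) (modulus (y - z' i)) (s i) => p q t S.
  move: (modulus _) (modulus _) => ? ? *; apply/andP; split; lra.
have far i j x y : i != j -> modulus (x - z i) < 3 / 4 * s i ->
    modulus (y - z j) < 3 / 4 * s j -> x <> y.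
  case: i => a b; case: j => a' b' ij hx hy xy.
  have := lattice_point_apart R0 ij; rewrite -/(z (a, b)) -/(z (a', b')) -xy in hy *.
  have -> : z (a, b) - z (a', b') = (z (a, b) - x) + (x - z (a', b')) by ring.
  have := modulusD (z (a, b) - x) (x - z (a', b')); rewrite (modulusB (z (a, b)) x).
  have := seps (a, b); have := seps (a', b'); move: hx hy eps1; lra.
have disj (A A' : set C) : (forall x y, A x -> A' y -> x <> y) -> A `&` A' = set0.
  by move=> hA; apply/seteqP; split => // x [Ax A'x]; case: (hA x x Ax A'x).
have BB' i : B i `&` B' i = set0.
  apply: disj => x y Bx By xy; have := cross i x y Bx By; rewrite xy subrr modulus0.
  by have := s0 i; move=> h /andP[]; move: h; lra.
have d2 i : disjoint_borel [:: B i; B' i].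
  by split; [exact: bounded_disk|split|split; [exact: bounded_disk| |]].
have d4 i j : i != j -> disjoint_borel [:: B i; B' i; B j; B' j].
  move=> ij; have D := far i j.
  split; [exact: bounded_disk| |split; [exact: bounded_disk| |exact: d2]].
    split=> //; split; first by apply: disj => x y /BD hx /BD hy; exact: D.
    by split=> //; apply: disj => x y /BD hx /B'D hy; exact: D.
  split; first by apply: disj => x y /B'D hx /BD hy; exact: D.
  by split=> //; apply: disj => x y /B'D hx /B'D hy; exact: D.
have ring i x : modulus (x - z i) < 3 / 4 * s i -> ring_region (r i) x.
  move=> hx; have [_ _ ri] := rge i; have := modulusD (x - z i) (z i); rewrite subrK -/(r i).
  have := modulusD (z i - x) x; rewrite subrK -/(r i) (modulusB (z i) x).
  have := seps i; move: hx ri eps1 => *; apply/andP; split; lra.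
have rB i : B i `<=` ring_region (r i) by move=> x /BD; exact: ring.
have rB' i : B' i `<=` ring_region (r i) by move=> x /B'D; exact: ring.
pose v i := kap * (s i / 8) ^+ 2.
have s8 i : 0 <= s i / 8 by rewrite divr_ge0// ltW.
have mB i : m (B i) = (v i)%:E by exact: lebesgueC_disk.
have mB' i : m (B' i) = (v i)%:E by exact: lebesgueC_disk.
pose q i := r i `^ (alpha - 2).
have sb i : s i ^+ 2 * q i <= eps ^+ 2 /\ eps ^+ 6 / r i ^+ 2 <= (s i ^+ 2 * q i) ^+ 3.
  by have [_ _ ri] := rge i; exact: (scale_bounds a43 ri eps0).
pose A := c1 * kap / 64 * eps ^+ 2.
have A0 : 0 <= A by rewrite mulr_ge0 ?sqr_ge0// divr_ge0// mulr_ge0// ltW.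
have cv i : c1 * q i * v i <= A.
  have -> : c1 * q i * v i = c1 * kap / 64 * (s i ^+ 2 * q i) by rewrite /v; field.
  by rewrite ler_wpM2l ?(sb i).1// divr_ge0// mulr_ge0// ltW.
have hA i : (moment [:: B i] <= A%:E)%E.
  have [ri _ _] := rge i.
  by apply: le_trans (h1 _ _ _ ri (measurable_disk _ _) (rB i) (mB i)) _; rewrite lee_fin; exact: cv.
have hA' i : (moment [:: B' i] <= A%:E)%E.
  have [ri _ _] := rge i.
  by apply: le_trans (h1 _ _ _ ri (measurable_disk _ _) (rB' i) (mB' i)) _; rewrite lee_fin; exact: cv.
pose e i := fine (moment [:: B i; B' i]).
have he i : moment [:: B i; B' i] = (e i)%:E.
  rewrite /e fineK// ge0_fin_numE ?moment_ge0//.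
  have fB' : (moment [:: B' i] < +oo)%E by apply: le_lt_trans (hA' i) (ltry _).
  apply: le_lt_trans (@moment_cat_le _ mu _ pK [:: B i] [:: B' i] isT fB') _.
  apply: (@le_lt_trans _ _ (A%:E * A%:E)%E); last by rewrite -EFinM ltry.
  by apply: lee_pmul => //; exact: moment_ge0.
pose c3 := c2 * kap ^+ 2 / (4 * 64) ^+ 2 * eps ^+ 6.
have c30 : 0 < c3 by rewrite mulr_gt0 ?exprn_gt0// divr_gt0 ?exprn_gt0// ?mulr_gt0 ?exprn_gt0.
have e_ge i : c3 / r i ^+ 2 <= e i.
  have [_ ri _] := rge i; have s4 : 0 <= s i / 4 by rewrite divr_ge0// ltW.
  have D x y : B i x -> B' i y -> s i / 4 <= modulus (y - x) <= del * T i.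
    move=> Bx By; have /andP[-> h] := cross i x y Bx By; apply: le_trans h _.
    by apply: le_trans (sT i); rewrite ger_pMr//; lra.
  have := h2 _ _ _ _ _ _ ri s4 (measurable_disk _ _) (measurable_disk _ _) (rB i) (rB' i)
    (mB i) (mB' i) D.
  rewrite he lee_fin; apply: le_trans.
  have -> : c2 * (s i / 4) ^+ 2 * (r i `^ (alpha - 2)) ^+ 3 * v i * v i =
     c2 * kap ^+ 2 / (4 * 64) ^+ 2 * (s i ^+ 2 * q i) ^+ 3 by rewrite /v /q; field.
  rewrite /c3 -mulrA ler_wpM2l ?(sb i).2//.
  by rewrite divr_ge0 ?sqr_ge0// mulr_ge0 ?sqr_ge0// ltW.
have R00 : (0 < R0)%N by [].
pose c4 := c3 / (2 * R0%:R) ^+ 2.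
have c40 : 0 < c4 by rewrite divr_gt0// exprn_gt0// mulr_gt0// ltr0n.
have E_sub k : sparse Lambda n `<=`
    [set w | (\sum_(i : 'I_k * 'I_k) N (B (i.1 : nat, i.2 : nat)) w * N (B' (i.1 : nat, i.2 : nat)) w = 0)%N].
  move=> w sp /=; apply: big1 => i _; apply/eqP; rewrite -leqn0 leqNgt muln_gt0.
  set ij := (_, _); apply/negP => /andP[b b'].
  have [x [Bx Lx]] := num_gt0 (bounded_disk _ _) b.
  have [y [By Ly]] := num_gt0 (bounded_disk _ _) b'.
  have /andP[xy1 xy2] := cross ij x y Bx By.
  have yx : y <> x.
    by move=> yx; move: xy1; rewrite yx subrr modulus0; have := s0 ij; lra.
  have := sparse_dist dpp sp Ly Lx yx; have := s0 ij; have := seps ij.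
  by move: xy2 eps3; move: (modulus _) (n.+1%:R^-1) (s ij) => *; lra.
have mS := measurable_sparse dpp n.
have PE : P (sparse Lambda n) \is a fin_num by rewrite fin_num_measure.
apply/eqP; rewrite -(fineK PE) eqe eq_le fine_ge0// andbT leNgt; apply/negP => p0.
set p := fine _ in p0.
have [k hk] := harmonic_unbounded ((1 + 2 * A) / (p * c4)).
set H := \sum_(a < k) _ in hk.
have Me : c4 * H <= \sum_(i : 'I_k * 'I_k) e (i.1 : nat, i.2 : nat).
  apply: le_trans (lattice_sum_ge k R00 (ltW c30)) _.
  by apply: ler_sum => i _; exact: (e_ge (i.1 : nat, i.2 : nat)).
have pc0 : 0 < p * c4 by rewrite mulr_gt0.
have A1 : 0 < 1 + 2 * A by move: A0; lra.
have H0 : 0 < H by apply: lt_trans hk; rewrite divr_gt0.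
have M0 : 0 < \sum_(i : 'I_k * 'I_k) e (i.1 : nat, i.2 : nat).
  by apply: lt_le_trans Me; rewrite mulr_gt0.
have := @prob_no_pair_le _ _ _ P Lambda K mu dpp pK ('I_k * 'I_k)%type
  (fun i => B (i.1 : nat, i.2 : nat)) (fun i => B' (i.1 : nat, i.2 : nat)) A
  (fun i => e (i.1 : nat, i.2 : nat)) A0 M0 (fun i => d2 _).
have d4k (i j : 'I_k * 'I_k) : i != j -> disjoint_borel [:: B (i.1 : nat, i.2 : nat);
    B' (i.1 : nat, i.2 : nat); B (j.1 : nat, j.2 : nat); B' (j.1 : nat, j.2 : nat)].
  case: i j => [i1 i2] [j1 j2] ij; apply: d4.
  by apply: contra_neq ij => -[/val_inj -> /val_inj ->].
move=> /(_ d4k (fun i => hA _) (fun i => hA' _) (fun i => he _) _ mS (E_sub k)) h.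
have : (p%:E * (c4 * H)%:E <= (1 + 2 * A)%:E)%E.
  rewrite fineK//; apply: le_trans h; apply: lee_wpmul2l => //; rewrite lee_fin//.
rewrite -EFinM lee_fin leNgt => /negP; apply.
by move: hk; rewrite ltr_pdivrMr// (mulrC H) -(mulrA p).
Qed.

Lemma almost_never_separated : 4 / 3 <= alpha ->
  P [set w | is_separated (Lambda w)] = 0%E.
Proof.
move=> a43; rewrite (separated_sparse dpp); apply/eqP; rewrite eq_le measure_ge0 andbT.
have mS n := measurable_sparse dpp n.
apply: le_trans (measure_sigma_subadditive P mS (bigcupT_measurable _ mS) (@subset_refl _ _)) _.
by rewrite eseries0// => n _ _; exact: sparse_null.
Qed.

End clustering.

(** * Separation for alpha below 4/3 *)

Lemma finite_min_distance (R : realType) (s : seq R[i]) : exists2 del : R, 0 < del &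
  forall x y, x \in s -> y \in s -> x != y -> del <= modulus (x - y).
Proof.
have one (x : R[i]) (t : seq R[i]) : exists2 del : R, 0 < del &
    forall y, y \in t -> x != y -> del <= modulus (x - y).
  elim: t => [|y t [e e0 he]]; first by exists 1.
  have [<-|xy] := eqVneq x y.
    by exists e => // z; rewrite in_cons => /orP[/eqP ->|/he//]; rewrite eqxx.
  exists (Num.min e (modulus (x - y))).
    by rewrite lt_min e0 modulus_gt0 subr_eq0.
  move=> z; rewrite in_cons => /orP[/eqP -> _|/he h /h h']; first by rewrite ge_min lexx orbT.
  by rewrite ge_min h'.
elim: s => [|x s [e e0 he]]; first by exists 1.
have [e' e'0 he'] := one x s; exists (Num.min e e'); first by rewrite lt_min e0.
move=> y z; rewrite !in_cons => /orP[/eqP ->|ys] /orP[/eqP ->|zs]; first by rewrite eqxx.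
- by move=> /(he' _ zs) h; rewrite ge_min h orbT.
- by rewrite eq_sym modulusB => /(he' _ ys) h; rewrite ge_min h orbT.
- by move=> /(he _ _ ys zs) h; rewrite ge_min h.
Qed.

Lemma union_bound d (T : measurableType d) (R : realType) (P : {measure set T -> \bar R})
    (I : finType) (A : I -> set T) : (forall i, measurable (A i)) ->
  (P (\bigcup_i A i) <= \sum_i P (A i))%E.
Proof.
move=> mA; have -> : \bigcup_i A i = \big[setU/set0]_(i <- index_enum I) A i.
  by rewrite -bigcup_seq; apply/seteqP; split => x [i _ Ai]; exists i => //=; rewrite mem_index_enum.
elim: (index_enum I) => [|i s ih]; first by rewrite !big_nil measure0.
rewrite !big_cons; apply: le_trans (leeD (lexx _) ih).
by apply: measureU2 => //; exact: bigsetU_measurable.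
Qed.

Lemma geometric_series_fin (R : realType) (u : nat -> \bar R) (c x : R) :
  0 <= c -> 0 <= x -> x < 1 -> (forall n, 0 <= u n)%E -> (forall n, u n <= (c * x ^+ n)%:E)%E ->
  (\sum_(0 <= n <oo) u n < +oo)%E.
Proof.
move=> c0 x0 x1 u0 ux; apply: (@le_lt_trans _ _ (c / (1 - x))%:E); last exact: ltry.
apply: lime_le; first exact: is_cvg_nneseries.
apply: nearW => k; apply: (@le_trans _ _ (\sum_(0 <= n < k) (c * x ^+ n)%:E)%E).
  by apply: lee_sum.
have y0 : 0 < 1 - x by lra.
rewrite sumEFin lee_fin -mulr_sumr ler_wpM2l// big_mkord -[leRHS]mul1r ler_pdivlMr//.
have := subrX1 x k; move: (\sum_(i < k) _) => S e.
have -> : S * (1 - x) = 1 - x ^+ k by move: e => /(congr1 (fun t => - t)); rewrite opprB => ->; ring.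
by rewrite gerBl exprn_ge0.
Qed.

Section separation.
Context d (Omega : measurableType d) (R : realType) (P : probability Omega R).
Local Notation C := R[i].
Variable alpha : R.
Hypothesis alpha0 : 0 < alpha.
Hypothesis alpha43 : alpha < 4 / 3.
Local Notation m := (@lebesgueC R).
Local Notation nu := (laplacian_phi_alpha alpha : {measure set C -> \bar R}).
Local Notation phi := (phi_alpha alpha).
Local Notation mu := (mu_phi phi nu : {measure set C -> \bar R}).
Variables (Lambda : Omega -> set C) (K : C -> C -> C).
Hypothesis kerK : fock_kernel phi nu K.
Hypothesis dpp : determinantal_process P K mu Lambda.
Local Notation N := (num Lambda).

Definition corner (p : int * int) : C := Complex p.1%:~R p.2%:~R.

Let box_corner p : box 0 p (corner p).
Proof. by split; rewrite /= mulr1 lexx/= ltr_int ltrDl. Qed.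

Let box_dist p x y : @box R 0 p x -> box 0 p y -> modulus (x - y) < 4.
Proof. by move=> bx by_; have := box_near bx by_; rewrite invr1 mulr1. Qed.

Let area_box p : exists2 v, 0 <= v <= 4 & m (box 0 p) = v%:E.
Proof.
have e : (m [set z : C | complex.Re z \in `[p.1%:~R, p.1%:~R + 2]%R /\
    complex.Im z \in `[p.2%:~R, p.2%:~R + 2]%R] = 4%:E)%E.
  by rewrite lebesgueC_rect ?lerDl//; congr EFin; ring.
have le : (m (box 0 p) <= 4%:E)%E.
  rewrite -e; apply: le_measure; rewrite ?inE; first exact: (bounded_box R 0 p).1.
    have mI (g : C -> R) (a b : R) : measurable_fun [set: C] g -> measurable [set z | g z \in `[a, b]].
      move=> mg; have -> : [set z | g z \in `[a, b]] = [set: C] `&` g @^-1` `[a, b] by rewrite setTI.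
      by apply: mg; [exact: measurableT|exact: measurable_itv].
    by apply: measurableI; apply: mI; [exact: measurable_Re|exact: measurable_Im].
  move=> z [/= /andP[a1 a2] /andP[b1 b2]]; move: a1 a2 b1 b2; rewrite !mulr1 !in_itv/= !intrD.
  by move=> -> /ltW -> -> /ltW ->.
exists (fine (m (box 0 p))).
  by rewrite fine_ge0//= -lee_fin fineK// ge0_fin_numE// (le_lt_trans le)// ltry.
by rewrite fineK// ge0_fin_numE// (le_lt_trans le)// ltry.
Qed.

Lemma box_crowded_le : exists D r0, [/\ 0 <= D, 1 <= r0 & forall p, r0 <= modulus (corner p) ->
  (P [set w | (1 < N (box 0 p) w)%N] <= (D * modulus (corner p) `^ (3 * alpha - 6))%:E)%E].
Proof.
have pK := psd_fock_kernel kerK.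
have [c [r1 [del [c0 r11 del0 h2]]]] := moment2_le alpha0 kerK.
pose e := 1 - alpha / 2; have e0 : 0 < e by rewrite /e; move: (alpha43); lra.
pose r2 := (4 / del) `^ e^-1; have r20 : 0 <= r2 by exact: powR_ge0.
exists (c * 16 ^+ 2), (8 + r1 + r2); split; first by rewrite mulr_ge0// ltW.
  by move: r11 r20; lra.
move=> p; set r := modulus _ => rr; have [v /andP[v0 v4] vE] := area_box p.
have r0 : 0 < r by move: r11 r20 rr; lra.
have bB := bounded_box R 0 p.
have t_le : 4 <= del * r `^ e.
  rewrite mulrC -ler_pdivrMr//.
  have -> : 4 / del = r2 `^ e.
    by rewrite /r2 -powRrM mulVf ?gt_eqF// powRr1// divr_ge0// ltW.
  by apply: ge0_ler_powR; rewrite ?nnegrE ?(ltW e0) ?(ltW r0)//; move: r11 rr; lra.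
have ring : box 0 p `<=` ring_region r.
  move=> z bz; have zc := box_dist bz (box_corner p).
  have := modulusD (z - corner p) (corner p); have := modulusD (corner p - z) z.
  rewrite !subrK -/r (modulusB (corner p)); move: zc rr r11 r20 => *.
  by apply/andP; split; lra.
pose k := c * 4 ^+ 2 * (r `^ (alpha - 2)) ^+ 3.
have k0 : 0 <= k by rewrite mulr_ge0 ?exprn_ge0 ?powR_ge0// mulr_ge0 ?sqr_ge0// ltW.
apply: (@le_trans _ _ (k * v ^+ 2)%:E).
  apply: (prob_ge2_le dpp bB vE k0) => b b' u u' [[mb _] _ [[mb' _] _ _]] sb sb' ub ub'.
  apply: h2 ub ub' _ => //; first by move: r20 rr; lra.
  - by move=> z /sb; exact: ring.
  - by move=> z /sb'; exact: ring.
  - by move=> x y /sb bx /sb' by_; apply: ltW; exact: box_dist by_ bx.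
rewrite lee_fin /k; have -> : r `^ (3 * alpha - 6) = (r `^ (alpha - 2)) ^+ 3.
  by rewrite -(powR_mulrn 3)// -?powRrM ?powR_ge0//; congr powR; ring.
have v16 : v ^+ 2 <= 16 by rewrite expr2; have := ler_pM v0 v0 v4 v4; lra.
have -> : c * 16 ^+ 2 * (r `^ (alpha - 2)) ^+ 3 = k * 16 by rewrite /k; ring.
by rewrite -/k ler_wpM2l.
Qed.

Let shift (M : nat) (i : 'I_(4 * M).+1 * 'I_(4 * M).+1) : int * int :=
  (i.1%:Z - (2 * M)%:Z, i.2%:Z - (2 * M)%:Z).

(** The event that some box at distance about M from the origin is crowded. *)
Definition crowded_ring (M : nat) : set Omega :=
  \bigcup_(i in [set: 'I_(4 * M).+1 * 'I_(4 * M).+1])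
    [set w | M%:R <= modulus (corner (shift i)) /\ (1 < N (box 0 (shift i)) w)%N].

Let measurable_crowded p : measurable [set w | (1 < N (box 0 p) w)%N].
Proof.
have := measurable_num_le1 dpp (bounded_box R 0 p) => /measurableC; congr (measurable _).
by apply/seteqP; split => w /=; rewrite ltnNge => /negP.
Qed.

Let measurable_crowded_far (M : nat) p :
  measurable [set w | M%:R <= modulus (corner p) /\ (1 < N (box 0 p) w)%N].
Proof.
have [h|h] := boolP (M%:R <= modulus (corner p)).
  by have := measurable_crowded p; congr (measurable _); apply/seteqP; split => w // [].
rewrite (_ : [set w | _] = set0)//; apply/seteqP; split => w // [].
by [].
Qed.

Lemma measurable_crowded_ring M : measurable (crowded_ring M).
Proof.
apply: countable_bigcupT_measurable; first exact: countableP.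
by move=> i; exact: measurable_crowded_far.
Qed.

Lemma crowded_ring_mem M p w : (0 < M)%N -> `|p.1| <= (2 * M)%:Z -> `|p.2| <= (2 * M)%:Z ->
  M%:R <= modulus (corner p) -> (1 < N (box 0 p) w)%N -> crowded_ring M w.
Proof.
case: p => a b M0 /= ha hb hM hN.
have idx (x : int) : `|x| <= (2 * M)%:Z -> exists i : 'I_(4 * M).+1, i%:Z - (2 * M)%:Z = x.
  rewrite ler_norml => /andP[x1 x2].
  have kb : (absz (x + (2 * M)%:Z)%R < (4 * M).+1)%N by lia.
  by exists (Ordinal kb); rewrite /= gez0_abs; lia.
have [i hi] := idx a ha; have [j hj] := idx b hb.
by exists (i, j) => //=; rewrite /shift/= hi hj.
Qed.

Lemma crowded_ring_le : exists c M0, [/\ 0 <= c, (0 < M0)%N & forall M, (M0 <= M)%N ->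
  (P (crowded_ring M) <= (c * M%:R `^ (3 * alpha - 4))%:E)%E].
Proof.
have [D [r0 [D0 r01 hD]]] := box_crowded_le.
exists (25 * D), (Num.truncn r0).+1; split=> //; first by rewrite mulr_ge0.
move=> M hM; have M1 : 1 <= M%:R :> R by rewrite ler1n (leq_trans _ hM).
have M0 : 0 < M%:R :> R by lra.
have rM : r0 <= M%:R.
  have r00 : 0 <= r0 by lra.
  have /andP[_ h] := truncn_itv r00.
  by apply: ltW; apply: lt_le_trans h _; rewrite ler_nat.
apply: le_trans (union_bound P (fun i => measurable_crowded_far M (shift i))) _.
apply: (@le_trans _ _ (\sum_(i : 'I_(4 * M).+1 * 'I_(4 * M).+1) (D * M%:R `^ (3 * alpha - 6))%:E)%E).
  apply: lee_sum => i _; have [h|h] := pselect (is_true (M%:R <= modulus (corner (shift i)))); last first.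
    rewrite (_ : [set w | _] = set0).
      by rewrite measure0 lee_fin mulr_ge0 ?powR_ge0.
    by apply/seteqP; split => w // [].
  apply: le_trans (_ : (_ <= P [set w | (1 < N (box 0 (shift i)) w)%N])%E) _.
    apply: le_measure; [apply/mem_set; exact: (measurable_crowded_far M (shift i))| |by move=> w []].
    by apply/mem_set; exact: measurable_crowded.
  apply: le_trans (hD _ _) _; first exact: le_trans h.
  rewrite lee_fin ler_wpM2l//.
  (* the exponent is negative *)
  have en : 0 <= 6 - 3 * alpha by move: (alpha43); lra.
  have rm : 0 < modulus (corner (shift i)) by apply: lt_le_trans h.
  have -> : 3 * alpha - 6 = - (6 - 3 * alpha) by ring.
  rewrite !powRN lef_pV2 ?posrE ?powR_gt0//.
  by apply: ge0_ler_powR; rewrite ?nnegrE// ltW.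
rewrite sumEFin sumr_const card_prod !card_ord lee_fin -[leLHS]mulr_natr natrM.
have -> : M%:R `^ (3 * alpha - 4) = M%:R `^ (3 * alpha - 6) * M%:R ^+ 2 :> R.
  have -> : 3 * alpha - 4 = (3 * alpha - 6) + 2%:R by ring.
  by rewrite powRD ?(gt_eqF M0) ?implybT// powR_mulrn// ltW.
have c5 : (4 * M).+1%:R <= 5 * M%:R :> R by rewrite -natr1 natrM; lra.
have -> : 25 * D * (M%:R `^ (3 * alpha - 6) * M%:R ^+ 2) =
  D * M%:R `^ (3 * alpha - 6) * ((5 * M%:R) * (5 * M%:R)) by ring.
by rewrite ler_wpM2l ?mulr_ge0 ?powR_ge0// ler_pM.
Qed.

(** Finitely many crowded rings and local finiteness leave a positive minimal
    distance. *)
Lemma not_separated_crowded j0 w : ~ is_separated (Lambda w) ->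
  lim_sup_set (fun j => crowded_ring (2 ^ (j + j0))) w.
Proof.
move=> nsep n _; apply: contrapT => nF; apply: nsep.
have nF' j : (n <= j)%N -> ~ crowded_ring (2 ^ (j + j0)) w.
  by move=> nj h; apply: nF; exists j.
pose M := (2 ^ (n + j0))%N; have M0 : (0 < M)%N by rewrite expn_gt0.
have near p : (1 < N (box 0 p) w)%N -> `|p.1| <= M%:Z /\ `|p.2| <= M%:Z.
  move=> hp; pose s := maxn (absz p.1) (absz p.2).
  have [sM|sM] := leqP s M.
    by move: sM; rewrite /s geq_max => /andP[h1 h2]; rewrite -!abszE !lez_nat.
  exfalso; pose k := trunc_log 2 s.
  have s0 : (0 < s)%N by apply: leq_ltn_trans sM.
  have /andP[k1 k2] := trunc_log_bounds (ltnSn 1) s0.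
  have nk : (n + j0 <= k)%N.
    by rewrite -ltnS -(ltn_exp2l _ _ (ltnSn 1)); apply: ltn_trans k2.
  have hk : (2 ^ (k - j0 + j0))%N = (2 ^ k)%N by rewrite subnK//; lia.
  apply: (nF' (k - j0)%N); first by lia.
  rewrite hk; apply: (@crowded_ring_mem _ p) => //; first by rewrite expn_gt0.
  - rewrite -abszE lez_nat -expnS; apply: ltnW; apply: leq_ltn_trans k2.
    exact: leq_maxl.
  - rewrite -abszE lez_nat -expnS; apply: ltnW; apply: leq_ltn_trans k2.
    exact: leq_maxr.
  apply: (@le_trans _ _ s%:R); first by rewrite ler_nat.
  have ab (x : int) : (absz x)%:R = `|x%:~R| :> R by rewrite natr_absz intr_norm.
  rewrite /s; case: (leqP (absz p.1) (absz p.2)) => _; rewrite ab.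
    exact: le_Im_modulus (corner p).
  exact: le_Re_modulus (corner p).
have [del del0 hdel] := finite_min_distance
  (enum_fset (fset_set (disk 0 (2 * M%:R + 4) `&` Lambda w))).
have in_disk p x : box 0 p x -> (1 < N (box 0 p) w)%N -> Lambda w x ->
    x \in enum_fset (fset_set (disk 0 (2 * M%:R + 4) `&` Lambda w)).
  move=> bx hp Lx; have fin := dpp.1.1 w (2 * M%:R + 4); rewrite setIC in fin.
  rewrite [_ \in _](in_fset_set fin); apply/mem_set; split=> //; rewrite /disk/= subr0.
  have [h1 h2] := near p hp; have := modulusD (x - corner p) (corner p); rewrite subrK.
  have cb : modulus (corner p) <= 2 * M%:R.
    apply: le_trans (le_modulus_ReIm _) _; rewrite /corner/= -!intr_norm.
    have e : (M%:Z)%:~R = M%:R :> R by [].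
    by rewrite mulr_natl mulr2n lerD// -e ler_int.
  have := box_dist bx (box_corner p); move: cb; lra.
apply: (@lt_le_trans _ _ (Num.min del 1)%:E); first by rewrite lte_fin lt_min del0 ltr01.
apply: le_ereal_inf_tmp => _ [[x y] /= [Lx Ly xy] <-]; rewrite lee_fin ge_min.
have [h|h] := leP 1 (modulus (x - y)); first by rewrite orbT.
have [|p [px py]] := @near_box R 0 x y; first by rewrite invr1.
have hp : (1 < N (box 0 p) w)%N.
  rewrite ltnNge; apply/negP => /(num_le1P dpp w (bounded_box R 0 p)) h1.
  by apply: xy; exact: h1.
rewrite hdel//; [exact: in_disk hp Lx|exact: in_disk hp Ly|exact/eqP].
Qed.

Lemma almost_surely_separated : P [set w | is_separated (Lambda w)] = 1%E.
Proof.
have [c [M0 [c0 M00 hM]]] := crowded_ring_le.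
pose F j := crowded_ring (2 ^ (j + M0)).
have mF j : measurable (F j) by exact: measurable_crowded_ring.
pose x : R := 2 `^ (3 * alpha - 4).
have x0 : 0 < x by exact: powR_gt0.
have x1 : x < 1.
  rewrite /x /powR gt_eqF// -[ltRHS]expR0 ltr_expR pmulr_llt0; first by move: (alpha43); lra.
  by rewrite ln_gt0// ltr1n.
have Fx j : (P (F j) <= (c * x ^+ j)%:E)%E.
  apply: le_trans (hM _ _) _.
    by apply: leq_trans (ltnW (ltn_expl M0 (ltnSn 1))) _; rewrite leq_exp2l// leq_addl.
  rewrite lee_fin ler_wpM2l//.
  have -> : (2 ^ (j + M0))%N%:R `^ (3 * alpha - 4) = x ^+ (j + M0) :> R.
    rewrite natrX -[2%:R ^+ _]powR_mulrn// -powRrM mulrC powRrM powR_mulrn// ltW//.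
  by rewrite exprD ler_piMr ?exprn_ge0 ?(ltW x0)// exprn_ile1// ltW.
have null : P (lim_sup_set F) = 0%E.
  apply: lim_sup_set_cvg0 => //.
  by apply: (geometric_series_fin c0 (ltW x0) x1) => //.
have mS := measurable_separated dpp.
have nS : P (~` [set w | is_separated (Lambda w)]) = 0%E.
  apply/eqP; rewrite eq_le measure_ge0 andbT -null; apply: le_measure; rewrite ?inE.
  - exact: measurableC.
  - apply: bigcapT_measurable => k; apply: bigcup_measurable => j _; exact: mF.
  - by move=> w /=; exact: not_separated_crowded.
by rewrite -[[set w | _]]setCK probability_setC ?nS ?sube0//; exact: measurableC.
Qed.

End separation.

(** * Probability of separation *)

Theorem corollary2p3 (R : realType) (d : measure_display)
    (Omega : measurableType d) (P : probability Omega R)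
    (alpha : R) (alpha_gt0 : 0 < alpha)
    (K : R[i] -> R[i] -> R[i]) (K_kernel : fock_kernel_alpha alpha K)
    (Lambda_alpha : Omega -> set R[i])
    (Lambda_dpp : determinantal_process P K (mu_alpha alpha) Lambda_alpha) :
  P [set w | is_separated (Lambda_alpha w)] =
    if alpha < 4 / 3 then 1%E else 0%E.
Proof.
case: ifPn => [alpha43|]; last rewrite -leNgt => alpha43.
  exact: (almost_surely_separated alpha_gt0 alpha43 K_kernel Lambda_dpp).
exact: (almost_never_separated alpha_gt0 K_kernel Lambda_dpp alpha43).
Qed.
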